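(* Let $f$, $X$, $\rho_0=\rho_s+\rho_r$, $s_k$, $\mathcal L_0$, $\mathcal L_1$ be as in the context, assume that $c$ is not preperiodic, and let $\varphi\in C^1([a_0,b])$. Let $$\Psi(z)=\sum_{n=0}^\infty\int_{a_0}^b z^n\mathcal L_0^n(\rho_0X)(x)\varphi'(x)\,dx .$$ For $|z|<1$ we have $$\Psi(z)=-\sum_{j=1}^\infty\varphi(c_j)\sum_{k=1}^jz^{j-k}s_kX(c_k)-\int_{a_0}^b(\mathrm{id}-z\mathcal L_1)^{-1}\bigl(X'\rho_s+(X\rho_r)'\bigr)(x)\,\varphi(x)\,dx .$$ The second term on the right-hand side extends to a meromorphic function in a disc of radius strictly larger than $1$, whose only singularity is an at most simple pole at $z=1$, with residue (understood as the coefficient of $\frac1{1-z}$) equal to $\mathcal J(f,X)\int_{a_0}^b\varphi\rho_0\,dx$. If $\mathcal J(f,X)=0$, then the following is a well-defined complex number: $$\Psi_1=-\sum_{j=1}^\infty\varphi(c_j)\sum_{k=1}^js_kX(c_k)-\int_{a_0}^b(\mathrm{id}-\mathcal L_1)^{-1}\bigl(X'\rho_s+(X\rho_r)'\bigr)(x)\,\varphi(x)\,dx .$$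
   Context: Setting. Let $a<c<b$, $I=[a,b]$, and let $f:I\to I$ be continuous such that: (i) $f$ is strictly increasing on $I_+=[a,c]$ and strictly decreasing on $I_-=[c,b]$; (ii) for $\sigma=\pm$, $f|_{I_\sigma}$ extends to a $C^3$ map on a neighbourhood of $I_\sigma$ and $\inf|f'|_{I_\sigma}|>1$; (iii) $c$ is not periodic under $f$; (iv) $f$ is topologically mixing on $[f^2(c),f(c)]$. Write $c_k=f^k(c)$. ''$c$ is not preperiodic'' means that for every $n\ge1$ the point $c_n$ is not periodic. $f$ has a unique absolutely continuous invariant probability measure; its density $\rho_0$ is of bounded variation, is extended by $0$ to $\mathbb R$ (it is supported in $[c_2,c_1]$), is continuous off $\{c_k: k\ge1\}$, and is taken with only regular discontinuities (at each $x$, $2\rho_0(x)$ is the sum of the left and right limits). Inverse branches. $J=(-\infty,f(c)]$; $\chi=1$ on the interior of $J$, $\chi(f(c))=1/2$, $\chi=0$ outside $J$. The two inverse branches of $f$ are extended to $C^3$ maps $\psi_+:J\to(-\infty,c]$ (strictly increasing, onto) and $\psi_-:J\to[c,\infty)$ (strictly decreasing, onto) with $\sup|\psi_\pm'|<1$. $a_0\le a$ denotes the unique fixed point of $\psi_+$. It is assumed moreover that $f(c)<b$ and $\min(f(a),f(b))>a>a_0$. Operators. $\mathcal L_0\varphi(x)=\chi(x)\varphi(\psi_+(x))-\chi(x)\varphi(\psi_-(x))$ and $\mathcal L_1\varphi(x)=\chi(x)\psi_+'(x)\varphi(\psi_+(x))+\chi(x)|\psi_-'(x)|\varphi(\psi_-(x))$.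 They act boundedly on the Banach space $BV$ of functions $\varphi:\mathbb R\to\mathbb C$ of bounded variation supported in $[a_0,b]$, modulo functions that differ on an at most countable set, with norm $\|\varphi\|_{BV}=\inf_{\phi\sim\varphi}\mathrm{var}(\phi)$. The resolvent $(\mathrm{id}-z\mathcal L_1)^{-1}$ is taken on $BV$; in the formula for $\Psi_1$, $(\mathrm{id}-\mathcal L_1)^{-1}(X'\rho_s+(X\rho_r)')$ denotes the value at $z=1$ of the extension of $(\mathrm{id}-z\mathcal L_1)^{-1}(X'\rho_s+(X\rho_r)')$. Decomposition. Let $H_u(x)=-1$ if $x<u$, $H_u(x)=0$ if $x>u$, $H_u(u)=-1/2$. Put $s_n=\lim_{y\downarrow c_n}\rho_0(y)-\lim_{x\uparrow c_n}\rho_0(x)$, $\rho_s=\sum_{n=1}^\infty s_nH_{c_n}$ (absolutely convergent) and $\rho_r=\rho_0-\rho_s$, which is continuous; it is known that $\rho_r'\in BV$. The weighted total jump is $\mathcal J(f,X)=\sum_{n=1}^\infty s_nX(c_n)$. Perturbation field. $X:\mathbb R\to\mathbb R$ satisfies $\sup|X|\le1$, $X|_{f(I)}$ extends to a $C^2$ function in a neighbourhood of $f(I)$, and $X'$ (derivative in the sense of distributions) is a function of bounded variation supported in $[a,b]$. It is assumed that for small $|t|$ (possibly one-sided) the map $f_t=f+tX\circ f$ sends $I$ into itself. $C^1([a_0,b])$ is the set of functions on $[a_0,b]$ which extend to $C^1$ functions in an open neighbourhood of $[a_0,b]$. *)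

(* Defs.v *)
From HB Require Import structures.
From mathcomp Require Import all_boot all_order all_algebra.
From mathcomp Require Import all_classical all_reals all_analysis.
From mathcomp Require Import complex.

Set Implicit Arguments.
Unset Strict Implicit.
Unset Printing Implicit Defensive.

Import Order.TTheory GRing.Theory Num.Theory.
Import numFieldNormedType.Exports.

Local Open Scope classical_set_scope.
Local Open Scope ring_scope.
Local Open Scope complex_scope.

Section real_functions.
Context {R : realType}.
Implicit Types (f F G eta : R -> R) (A U : set R).

Definition continuously_differentiable (k : nat) U F :=
  (forall j x, (j < k)%N -> U x -> derivable (derive1n j F) x 1) /\
  (forall x, U x -> {for x, continuous (derive1n k F)}).

(* [G] is a C^k function on an open neighbourhood of [A], equal to [F] on [A]. *)
Definition Ck_extension (k : nat) A F G :=
  (forall x, A x -> G x = F x) /\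
  exists U, [/\ open U, A `<=` U & continuously_differentiable k U G].

Definition periodic_point f (x : R) :=
  exists p : nat, (0 < p)%N /\ iter p f x = x.

Definition not_preperiodic f (c : R) :=
  forall n : nat, (0 < n)%N -> ~ periodic_point f (iter n f c).

Definition topologically_mixing f A :=
  forall U V : set R, open U -> open V ->
    U `&` A !=set0 -> V `&` A !=set0 ->
  exists N : nat, forall n, (N <= n)%N ->
    (iter n f @` (U `&` A)) `&` (V `&` A) !=set0.

Definition test_function eta :=
  (forall n x, derivable (derive1n n eta) x 1) /\
  (exists M : R, forall x, M < `|x| -> eta x = 0).

Definition is_distributional_derivative F G :=
  forall eta, test_function eta ->
    (\int[lebesgue_measure]_(x in setT) (F x * derive1 eta x) =
     - \int[lebesgue_measure]_(x in setT) (G x * eta x))%R.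

(* [g] is the density on [A] of an absolutely continuous probability measure on
   [A] that is invariant under [f : A -> A]. *)
Definition invariant_density f A (g : R -> R) :=
  [/\ measurable_fun A g,
      forall x, A x -> 0 <= g x,
      (\int[lebesgue_measure]_(x in A) (g x)%:E = 1)%E &
      forall B, measurable B ->
        (\int[lebesgue_measure]_(x in A `&` f @^-1` B) (g x)%:E =
         \int[lebesgue_measure]_(x in A `&` B) (g x)%:E)%E].

End real_functions.

Section complex_valued_functions.
Context {R : realType}.
Implicit Types (phi psi u g : R -> R[i]).

Definition cplx (F : R -> R) : R -> R[i] := fun x => (F x)%:C.

Definition cderive phi : R -> R[i] := fun x =>
  derive1 (fun t => complex.Re (phi t)) x +i* derive1 (fun t => complex.Im (phi t)) x.

Definition cintegral (a b : R) phi : R[i] :=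
  (\int[lebesgue_measure]_(x in `[a, b]) complex.Re (phi x))%R +i*
  (\int[lebesgue_measure]_(x in `[a, b]) complex.Im (phi x))%R.

Definition C1_on (a b : R) phi :=
  (exists G, Ck_extension 1 `[a, b] (fun t => complex.Re (phi t)) G) /\
  (exists G, Ck_extension 1 `[a, b] (fun t => complex.Im (phi t)) G).

(* Total variation over the real line. *)
Definition var phi : \bar R :=
  ereal_sup [set v | exists (n : nat) (s : nat -> R),
    {homo s : i j / (i <= j)%N >-> i <= j} /\
    v = (\sum_(i < n) complex.Re `|phi (s i.+1) - phi (s i)|)%:E].

Definition finite_var phi := (var phi < +oo)%E.

(* The space BV: genuine functions represent classes modulo [eq_cbl]. *)
Definition in_BV (a b : R) phi :=
  finite_var phi /\ (forall x, phi x != 0 -> x \in `[a, b]).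

Definition eq_cbl phi psi := countable [set x | phi x <> psi x].

Definition BV_norm phi : \bar R :=
  ereal_inf [set var psi | psi in [set psi | eq_cbl psi phi]].

(* For [T] acting on BV (supported in [[a, b]]), [u] represents the preimage of
   [g] under [id - z T]. *)
Definition resolvent_eq (a b : R) (T : (R -> R[i]) -> R -> R[i]) (z : R[i]) g u :=
  in_BV a b u /\ eq_cbl (fun x => u x - z * T u x) g.

Definition invertible_on_BV (a b : R) (T : (R -> R[i]) -> R -> R[i]) (z : R[i]) :=
  [/\ forall g, in_BV a b g -> exists u, resolvent_eq a b T z g u,
      forall g u v, in_BV a b g ->
        resolvent_eq a b T z g u -> resolvent_eq a b T z g v -> eq_cbl u v &
      exists M : R, forall g u, in_BV a b g -> resolvent_eq a b T z g u ->
        (BV_norm u <= M%:E * BV_norm g)%E].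

(* A representative of (id - z T)^-1 g; meaningful when [invertible_on_BV]. *)
Definition resolvent (a b : R) (T : (R -> R[i]) -> R -> R[i]) (z : R[i]) g :
  R -> R[i] := xget (fun=> 0) [set u | resolvent_eq a b T z g u].

(* Complex differentiability on the disc |z| < r, for the norm of BV. *)
Definition BV_holomorphic (a b r : R) (U : R[i] -> R -> R[i]) :=
  forall z : R[i], `|z| < r%:C ->
    in_BV a b (U z) /\
    exists D : R -> R[i], in_BV a b D /\
      BV_norm (fun x => h^-1 * (U (z + h) x - U z x) - D x)
        @[h --> (0 : R[i]^o)^'] --> 0%E.

(* [u] represents the value at z = 1 of the BV-valued holomorphic extension of
   z |-> (id - z T)^-1 g to a disc of radius larger than 1. *)
Definition resolvent_value_at_1 (a b : R) (T : (R -> R[i]) -> R -> R[i]) g u :=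
  exists (r : R) (U : R[i] -> R -> R[i]),
    [/\ 1 < r, BV_holomorphic a b r U,
        forall z : R[i], `|z| < 1 -> eq_cbl (U z) (resolvent a b T z g) &
        in_BV a b u /\ eq_cbl u (U 1)].

(* A representative, unique up to a countable set, of the derivative in the
   sense of distributions when the latter is a function of bounded variation. *)
Definition distr_derive (F : R -> R) : R -> R :=
  xget (fun=> 0)
    [set G | finite_var (cplx G) /\ is_distributional_derivative F G].

End complex_valued_functions.

Section complex_analysis.
Context {R : realType}.
Implicit Types (F : R[i] -> R[i]) (w kappa : R[i]).

(* [R[i]^o] is [R[i]] with its topology as a normed module over itself, so that
   [derivable] in direction 1 is complex differentiability. *)
Definition holomorphic_at F w := derivable (F : R[i]^o -> R[i]^o) w 1.

(* The principal part of [F] at [w] is kappa / (w - z), with kappa possibly 0. *)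
Definition at_most_simple_pole F w kappa :=
  exists H : R[i] -> R[i],
    (\forall z \near (w : R[i]^o), holomorphic_at H z) /\
    (\forall z \near (w : R[i]^o)^', F z = kappa / (w - z) + H z).

Definition cvg_series1 (u : nat -> R[i]) :=
  cvgn ((fun n => \sum_(1 <= j < n.+1) u j) : nat -> R[i]^o).

Definition sum_series1 (u : nat -> R[i]) : R[i] :=
  limn ((fun n => \sum_(1 <= j < n.+1) u j) : nat -> R[i]^o).

Definition cvg_series0 (u : nat -> R[i]) :=
  cvgn ((fun n => \sum_(0 <= j < n) u j) : nat -> R[i]^o).

Definition sum_series0 (u : nat -> R[i]) : R[i] :=
  limn ((fun n => \sum_(0 <= j < n) u j) : nat -> R[i]^o).

End complex_analysis.

Section map.
Context {R : realType}.
Variables (a b c : R) (f : R -> R).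

(* Only the values of [f] on [[a, b]] matter. *)
Record unimodal_expanding_mixing : Prop := {
  uem_a_lt_c : a < c;
  uem_c_lt_b : c < b;
  uem_stable : forall x, x \in `[a, b] -> f x \in `[a, b];
  uem_continuous : {within `[a, b], continuous f};
  uem_increasing : {in `[a, c] &, {homo f : x y / x < y}};
  uem_decreasing : {in `[c, b] &, {homo f : x y /~ x < y}};
  uem_expanding_left : exists g, Ck_extension 3 `[a, c] f g /\
    (1 < ereal_inf [set `|derive1 g x|%:E | x in `[a, c]])%E;
  uem_expanding_right : exists g, Ck_extension 3 `[c, b] f g /\
    (1 < ereal_inf [set `|derive1 g x|%:E | x in `[c, b]])%E;
  uem_not_periodic : ~ periodic_point f c;
  uem_mixing : topologically_mixing f `[f (f c), f c]
}.

(* Only the values of [psip] and [psim] on ]-oo, f c] matter; they are taken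
   C^3 on a neighbourhood of that half-line so that the derivatives make sense
   at [f c]. *)
Record inverse_branches (a0 : R) (psip psim : R -> R) : Prop := {
  ib_smooth_plus : exists2 e : R, 0 < e &
    continuously_differentiable 3 `]-oo, f c + e[ psip;
  ib_smooth_minus : exists2 e : R, 0 < e &
    continuously_differentiable 3 `]-oo, f c + e[ psim;
  ib_plus_f : forall x, x \in `[a, c] -> psip (f x) = x;
  ib_minus_f : forall x, x \in `[c, b] -> psim (f x) = x;
  ib_increasing : {in `]-oo, f c] &, {homo psip : x y / x < y}};
  ib_decreasing : {in `]-oo, f c] &, {homo psim : x y /~ x < y}};
  ib_onto_plus : psip @` `]-oo, f c] = `]-oo, c]%classic;
  ib_onto_minus : psim @` `]-oo, f c] = `[c, +oo[%classic;
  ib_contracting_plus :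
    (ereal_sup [set `|derive1 psip x|%:E | x in `]-oo, f c]] < 1)%E;
  ib_contracting_minus :
    (ereal_sup [set `|derive1 psim x|%:E | x in `]-oo, f c]] < 1)%E;
  ib_fixed : a0 \in `]-oo, f c] /\ psip a0 = a0;
  ib_fixed_unique : forall x, x \in `]-oo, f c] -> psip x = x -> x = a0;
  ib_a0_le_a : a0 <= a;
  ib_fc_lt_b : f c < b;
  ib_a_lt_min : a < Num.min (f a) (f b);
  ib_a0_lt_a : a0 < a
}.

Definition chi (x : R) : R :=
  if x < f c then 1 else if x == f c then 2^-1 else 0.

Definition L0 (psip psim : R -> R) (phi : R -> R[i]) : R -> R[i] := fun x =>
  (chi x)%:C * phi (psip x) - (chi x)%:C * phi (psim x).

Definition L1 (psip psim : R -> R) (phi : R -> R[i]) : R -> R[i] := fun x =>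
  (chi x * derive1 psip x)%:C * phi (psip x) +
  (chi x * `|derive1 psim x|)%:C * phi (psim x).

Definition heaviside (u x : R) : R :=
  if x < u then -1 else if x == u then - 2^-1 else 0.

Definition jump (rho0 : R -> R) (n : nat) : R :=
  lim (rho0 y @[y --> (iter n f c)^'+]) - lim (rho0 x @[x --> (iter n f c)^'-]).

Definition rho_s (rho0 : R -> R) (x : R) : R :=
  limn (fun N => \sum_(1 <= n < N.+1) jump rho0 n * heaviside (iter n f c) x).

Definition rho_r (rho0 : R -> R) (x : R) : R := rho0 x - rho_s rho0 x.

Definition total_jump (rho0 X : R -> R) : R :=
  limn (fun N => \sum_(1 <= n < N.+1) jump rho0 n * X (iter n f c)).

(* [rho0] is the regularised density, extended by 0, of the unique absolutely
   continuous invariant probability measure of [f], with its known regularity. *)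
Record acip_density (rho0 : R -> R) : Prop := {
  acip_invariant : invariant_density f `[a, b] rho0;
  acip_unique : forall g, invariant_density f `[a, b] g ->
    {ae lebesgue_measure, forall x, x \in `[a, b] -> g x = rho0 x};
  acip_bv : finite_var (cplx rho0);
  acip_support : forall x, rho0 x != 0 -> x \in `[f (f c), f c];
  acip_continuous : forall x,
    (forall k : nat, (0 < k)%N -> x <> iter k f c) ->
    {for x, continuous rho0};
  acip_regular : forall x,
    2 * rho0 x = lim (rho0 y @[y --> x^'-]) + lim (rho0 y @[y --> x^'+]);
  acip_rho_r_derivative : exists G,
    [/\ finite_var (cplx G), forall x, G x != 0 -> x \in `[a, b] &
        is_distributional_derivative (rho_r rho0) G]
}.

Record perturbation_field (X : R -> R) : Prop := {
  pf_measurable : measurable_fun setT X;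
  pf_bounded : forall x, `|X x| <= 1;
  pf_smooth : exists G, Ck_extension 2 (f @` `[a, b]) X G;
  pf_derivative : exists G,
    [/\ finite_var (cplx G), forall x, G x != 0 -> x \in `[a, b] &
        is_distributional_derivative X G];
  (* [sgn = 1] or [sgn = -1]: t ranges over a possibly one-sided neighbourhood
     of 0. *)
  pf_stable : exists (sgn e : R), [/\ sgn = 1 \/ sgn = -1, 0 < e &
    forall t, 0 <= t <= e -> forall x, x \in `[a, b] ->
      f x + (sgn * t) * X (f x) \in `[a, b]]
}.

(* X' rho_s + (X rho_r)' *)
Definition source (rho0 X : R -> R) : R -> R := fun x =>
  distr_derive X x * rho_s rho0 x +
  distr_derive (fun y => X y * rho_r rho0 y) x.

(* The n-th term of the susceptibility function Psi. *)
Definition Psi_term (a0 : R) (psip psim rho0 X : R -> R) (phi : R -> R[i])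
    (z : R[i]) (n : nat) : R[i] :=
  cintegral a0 b (fun x =>
    z ^+ n * iter n (L0 psip psim) (cplx (fun y => rho0 y * X y)) x *
    cderive phi x).

Definition jump_term (rho0 X : R -> R) (phi : R -> R[i]) (z : R[i]) (j : nat) :
    R[i] :=
  phi (iter j f c) *
  \sum_(1 <= k < j.+1) z ^+ (j - k) * (jump rho0 k * X (iter k f c))%:C.

Definition resolvent_term (a0 : R) (psip psim rho0 X : R -> R)
    (phi : R -> R[i]) (z : R[i]) : R[i] :=
  - cintegral a0 b (fun x =>
      resolvent a0 b (L1 psip psim) z (cplx (source rho0 X)) x * phi x).

(* [w] is a value of the expression defining Psi_1. *)
Definition is_Psi1 (a0 : R) (psip psim rho0 X : R -> R) (phi : R -> R[i])
    (w : R[i]) :=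
  cvg_series1 (jump_term rho0 X phi 1) /\
  exists u : R -> R[i],
    resolvent_value_at_1 a0 b (L1 psip psim) (cplx (source rho0 X)) u /\
    w = - sum_series1 (jump_term rho0 X phi 1)
        - cintegral a0 b (fun x => u x * phi x).

End map.

(* Main.v *)
Require Import Defs.
From HB Require Import structures.
From mathcomp Require Import all_boot all_order all_algebra.
From mathcomp Require Import all_classical all_reals all_analysis.
From mathcomp Require Import complex.
From mathcomp Require Import measurable_realfun ring lra.

(* Let g = X' rho_s + (X rho_r)' and F = f. For a primitive Theta of a bounded
   function theta, integrating by parts on each step of rho_s gives
     int rho_0 X theta = - sum_k s_k X(c_k) Theta(c_k) - int g Theta,
   and L_0, L_1 are dual to Theta -> Theta o F in the sense that
     int L_0 h Theta' = int h (Theta o F)',  int L_1 g Theta = int g (Theta o F).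
   Taking Theta = phi o F^n expresses the n-th coefficient of Psi through the
   sums sum_k s_k X(c_k) phi(c_{k+n}) and the numbers int (L_1^n g) phi; summing
   over n gives the identity, and Theta = 1 shows that int g = - J(f, X).
   The jumps satisfy s_{n+1} = psi'(c_{n+1}) s_n, for the inverse branch psi
   through c_n, because the other preimage of c_{n+1} is not in the orbit of c;
   hence they decay geometrically.
   The analytic statements rest on the spectral gap of L_1 on the functions of
   bounded variation of integral 0. Since the weights |psi'| may vanish outside
   f(I), the Lasota-Yorke inequality is obtained by treating the jumps along the
   orbit of c separately from the rest of the variation; the gap then follows by
   a Doeblin argument from the mixing of f on [c_2, c_1]. Writing
   g = - J(f, X) rho_0 + g_0 with int g_0 = 0, the rho_0 part contributes the
   pole and the g_0 part a power series of radius larger than 1. *)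

Set Implicit Arguments.
Unset Strict Implicit.
Unset Printing Implicit Defensive.

Import Order.TTheory GRing.Theory Num.Theory.
Import numFieldNormedType.Exports.

Local Open Scope classical_set_scope.
Local Open Scope ring_scope.
Local Open Scope complex_scope.

(** * Derivatives and integrals off a countable set *)

(** The obstacle is the cut at c_1: it creates a jump of size up to 2 |p(c)|, and bounding |p(c)| by
    the variation of p destroys any contraction in one step. Two facts repair this. The images of
    the two inverse branches meet only at c, so the pulled-back variations add up to a single
    variation, not to two. And a jump at c_n is carried to c_(n+1) without affecting the bound on
    p(c) as long as the orbit stays out of some [c, c + d]; then p(c) is controlled by the regular
    part and the L^1 norm. Elements of BV are classes modulo countable sets, while values at c and
    at the c_n matter. Hence the work is done with real functions that are bounded and continuous
    off a countable set, and integration by parts uses primitives that are differentiable off a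
    countable set; complex functions are split into real and imaginary parts. At z = 1 the condition
    J = 0 acts twice: it gives the source integral 0, so that its Neumann series converges beyond
    the unit disc, and it makes the partial sums of s_k X(c_k) decay geometrically, so that the
    series over j converges although phi(c_j) need not tend to 0. *)

Section real_tools.
Context {R : realType}.
Implicit Types (p P : R -> R) (x y u v M : R) (E : set R).
Notation mu := (@lebesgue_measure R).

Lemma continuous_epsP p x : {for x, continuous p} <->
  forall e : R, 0 < e -> exists2 d : R, 0 < d & forall y, `|y - x| < d -> `|p y - p x| < e.
Proof.
split=> [/cvgrPdist_lt H e e0|H].
  have /nbhs_ballP[d /= d0 Hd] := H e e0.
  by exists d => // y yd; rewrite distrC; apply: Hd; rewrite /ball/= distrC.
apply/cvgrPdist_lt => e e0; have [d d0 Hd] := H e e0.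
apply/nbhs_ballP; exists d => //= y; rewrite /ball/= distrC => /Hd.
by rewrite distrC.
Qed.

(** The multiplied form has no division by y - x, so it can be tested at any increment, y = x
    included. *)
Lemma is_derive_epsP P x (d : R) : is_derive x (1 : R) P d <->
  forall e : R, 0 < e -> exists2 r : R, 0 < r & forall y, `|y - x| < r ->
    `|P y - P x - d * (y - x)| <= e * `|y - x|.
Proof.
have E1 h : h *: (1 : R) = h by rewrite /GRing.scale/= mulr1.
split=> [[dP <-] e e0|H].
  move: dP => /cvg_ex[l Hl].
  have -> : 'D_1 P x = l by apply/cvg_lim => //.
  move/cvgrPdist_le: Hl => /(_ e e0); rewrite /=.
  move=> /nbhs_ballP[r /= r0 Hr]; exists r => // y yr.
  have [->|yx] := eqVneq y x; first by rewrite !subrr mulr0 subr0 normr0 mulr0.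
  have h0 : y - x != 0 by rewrite subr_eq0.
  have := Hr (y - x); rewrite /ball/= sub0r normrN => /(_ yr h0).
  rewrite E1 subrK => Hle.
  have -> : P y - P x - l * (y - x) = - (l - (y - x)^-1 * (P y - P x)) * (y - x).
    by field.
  by rewrite normrM normrN ler_wpM2r.
have Hl : (fun h => h^-1 *: ((P \o shift x) (h *: (1 : R)) - P x)) @ 0^' --> d.
  apply/cvgrPdist_le => e e0; rewrite /=.
  have [r r0 Hr] := H e e0; apply/nbhs_ballP; exists r => //= h.
  rewrite /ball/= sub0r normrN => hr h0; rewrite E1.
  have := Hr (h + x); rewrite addrK => /(_ hr).
  have -> : P (h + x) - P x - d * h = - (d - h^-1 * (P (h + x) - P x)) * h.
    by field.
  by rewrite normrM normrN ler_pM2r ?normr_gt0.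
apply: DeriveDef; first by apply/cvg_ex; exists d.
exact/cvg_lim.
Qed.

Lemma is_derive_continuous P x d : is_derive x (1 : R) P d ->
  {for x, continuous P}.
Proof. by case=> /derivable1_diffP/differentiable_continuous. Qed.

Lemma exists_notin_countable E u v : countable E -> u < v ->
  exists2 x, x \in `]u, v[ & ~ E x.
Proof.
move=> cE uv; apply: contrapT => H.
have : (mu `]u, v[%classic <= mu E)%E.
  apply: le_measure; rewrite ?inE//; first exact: countable_measurable.
  by move=> x /= xuv; apply: contrapT => nE; apply: H; exists x.
rewrite (countable_lebesgue_measure0 cE) lebesgue_measure_itv/= lte_fin uv.
by rewrite -EFinB lee_fin leNgt subr_gt0 uv.
Qed.

(* Zygmund's argument: pick a level y missed by P on E; at the last time the
   level y is attained, the derivative cannot be negative. *)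
Lemma neg_derive_le P (d : R -> R) E u v : u <= v -> countable E ->
  (forall x, x \in `[u, v] -> {for x, continuous P}) ->
  (forall x, x \in `]u, v[ -> ~ E x -> is_derive x (1 : R) P (d x) /\ d x < 0) ->
  P v <= P u.
Proof.
move=> uv cE cP dP; rewrite leNgt; apply/negP => PuPv.
have cPE : countable (P @` E) by apply: sub_countable cE; exact: card_image_le.
have [y] := exists_notin_countable cPE PuPv; rewrite in_itv/= => /andP[Puy yPv] yE.
pose S := [set t | u <= t <= v /\ P t <= y].
have Su : S u by split; [rewrite lexx uv|exact: ltW].
have hsS : has_sup S by split; [exists u|exists v => t [/andP[]]].
pose s := sup S.
have us : u <= s by apply: ub_le_sup => //; exact: hsS.2.
have sv : s <= v by apply: ge_sup; [exists u|move=> t [/andP[]]].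
have sS : s \in `[u, v] by rewrite in_itv/= us sv.
have Psy : P s <= y.
  rewrite leNgt; apply/negP => yPs.
  have [r r0 Hr] := (continuous_epsP P s).1 (cP _ sS) (P s - y) ltac:(lra).
  have [t St sr] := sup_adherent r0 hsS.
  have ts : t <= s by apply: ub_le_sup => //; exact: hsS.2.
  have := Hr t; rewrite ltr_distl => /(_ _); case: St => _ Pty.
  have H1 : `|t - s| < r by rewrite ltr_distl; apply/andP; split; rewrite -/s in sr; lra.
  move=> /(_ _) ; rewrite -ltr_distl => /(_ H1).
  by rewrite ltr_distl => /andP[]; lra.
have yPs : y <= P s.
  rewrite leNgt; apply/negP => Psy'.
  have sv' : s < v by rewrite lt_neqAle sv andbT; apply/eqP => sv'; move: yPv; rewrite -sv'; lra.
  have [r r0 Hr] := (continuous_epsP P s).1 (cP _ sS) (y - P s) ltac:(lra).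
  pose t := s + Num.min (r / 2) (v - s).
  have m1 : Num.min (r / 2) (v - s) <= r / 2 by rewrite ge_min lexx.
  have m2 : Num.min (r / 2) (v - s) <= v - s by rewrite ge_min lexx orbT.
  have m0 : 0 < Num.min (r / 2) (v - s) by rewrite lt_min subr_gt0 sv' divr_gt0.
  have St : S t.
    split; first by rewrite /t; apply/andP; split; lra.
    have := Hr t; rewrite /t addrAC subrr add0r gtr0_norm// => /(_ _).
    by move=> /(_ ltac:(lra)); rewrite ltr_distl => /andP[]; lra.
  have : t <= s by apply: ub_le_sup => //; exact: hsS.2.
  by rewrite /t; lra.
have {Psy yPs} Ps : P s = y by apply/le_anti; rewrite Psy yPs.
have sE : ~ E s by move=> Es; apply: yE; exists s.
have us' : u < s by rewrite lt_neqAle us andbT; apply/eqP => h; move: Puy; rewrite h Ps ltxx.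
have sv' : s < v by rewrite lt_neqAle sv andbT; apply/eqP => h; move: yPv; rewrite -h Ps ltxx.
have [|/is_derive_epsP dPs ds] := dP s _ sE; first by rewrite in_itv/= us' sv'.
have [r r0 Hr] := dPs (- d s / 2) ltac:(lra).
pose h := Num.min (r / 2) (v - s).
have m1 : h <= r / 2 by rewrite ge_min lexx.
have m2 : h <= v - s by rewrite ge_min lexx orbT.
have m0 : 0 < h by rewrite lt_min subr_gt0 sv' divr_gt0.
have := Hr (s + h); rewrite addrAC subrr add0r gtr0_norm// => /(_ ltac:(lra)).
rewrite ler_norml => /andP[_]; rewrite Ps => H1.
have St : S (s + h).
  split; first by apply/andP; split; lra.
  have dh : d s * h < 0 by rewrite nmulr_rlt0.
  by lra.
have : s + h <= s by apply: ub_le_sup => //; exact: hsS.2.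
by lra.
Qed.

(** Subtracting k x with k > 0 makes the derivative negative, so [neg_derive_le] applies to Q - k x;
    k is then arbitrarily small, and Q is P or - P. *)
Lemma countable_derive0_const P E u v : u <= v -> countable E ->
  (forall x, x \in `[u, v] -> {for x, continuous P}) ->
  (forall x, x \in `]u, v[ -> ~ E x -> is_derive x (1 : R) P 0) ->
  P v = P u.
Proof.
move=> uv cE.
have key (Q : R -> R) : (forall x, x \in `[u, v] -> {for x, continuous Q}) ->
  (forall x, x \in `]u, v[ -> ~ E x -> is_derive x (1 : R) Q 0) -> Q v <= Q u.
  move=> cQ dQ; apply/ler_addgt0Pr => e e0.
  (* The + 1 covers the case u = v and still gives k (v - u) <= e. *)
  pose k := e / (v - u + 1).
  have k0 : 0 < k by rewrite divr_gt0//; lra.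
  have : Q v - k * v <= Q u - k * u.
    apply: (@neg_derive_le (fun x => Q x - k * x) (fun=> - k) E) => //.
      move=> x xuv; apply: continuousB; first exact: cQ.
      exact: mulrl_continuous.
    move=> x xuv xE; split; last by lra.
    have := dQ x xuv xE => dQx.
    apply: is_derive_eq.
    by rewrite /GRing.scale/=; lra.
  have : k * (v - u) <= e.
    rewrite /k mulrAC ler_pdivrMr; last lra.
    by rewrite ler_pM2l//; lra.
  by lra.
move=> cP dP; apply/le_anti; rewrite key//=.
rewrite -lerN2; apply: (key (fun x => - P x)) => x xuv; first exact/continuousN/cP.
by move=> xE; have := dP x xuv xE => dQx; apply: is_derive_eq; rewrite oppr0.
Qed.


(** The working class of integrands: it is an algebra, it contains the functions of bounded
    variation, its members are integrable on segments, and they satisfy the fundamental theorem of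
    calculus off a countable set. *)
Definition bcc p := (exists M, forall x, `|p x| <= M) /\
  countable [set x | ~ {for x, continuous p}].

Lemma bcc_intro p M E : (forall x, `|p x| <= M) -> countable E ->
  (forall x, ~ E x -> {for x, continuous p}) -> bcc p.
Proof.
move=> pM cE cp; split; first by exists M.
apply: sub_countable cE; apply: subset_card_le => x /= npx.
by apply: contrapT => /cp.
Qed.

Lemma countableU E1 E2 : countable E1 -> countable E2 -> countable (E1 `|` E2).
Proof.
move=> c1 c2; rewrite -bigcup2E; apply: bigcup_countable => // i _.
by rewrite /bigcup2; case: ifP => // _; case: ifP.
Qed.

Lemma bcc_bound p : bcc p -> exists2 M, 0 <= M & forall x, `|p x| <= M.
Proof. by case=> -[M pM] _; exists M => //; exact: le_trans (pM 0). Qed.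

Lemma bcc_cst k : bcc (cst k).
Proof. by apply: (@bcc_intro _ `|k| set0) => // x _; exact: cst_continuous. Qed.

Lemma bccN p : bcc p -> bcc (fun x => - p x).
Proof.
move=> [[M pM] cp]; apply: (@bcc_intro _ M _ _ cp) => x; first by rewrite normrN.
by move=> /contrapT; exact: continuousN.
Qed.

Lemma bccD p q : bcc p -> bcc q -> bcc (fun x => p x + q x).
Proof.
move=> [[M pM] cp] [[N qN] cq].
apply: (@bcc_intro _ (M + N) _ _ (countableU cp cq)) => x.
  by rewrite (le_trans (ler_normD _ _))// lerD.
by move=> /not_orP[/contrapT h1 /contrapT h2]; exact: continuousD.
Qed.

Lemma bccB p q : bcc p -> bcc q -> bcc (fun x => p x - q x).
Proof. by move=> hp hq; exact/bccD/bccN. Qed.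

Lemma bccM p q : bcc p -> bcc q -> bcc (fun x => p x * q x).
Proof.
move=> [[M pM] cp] [[N qN] cq].
apply: (@bcc_intro _ (M * N) _ _ (countableU cp cq)) => x.
  by rewrite normrM ler_pM.
by move=> /not_orP[/contrapT h1 /contrapT h2]; exact: continuousM.
Qed.

Lemma bccZ k p : bcc p -> bcc (fun x => k * p x).
Proof. by move=> hp; exact: bccM (bcc_cst k) hp. Qed.

Lemma bcc_norm p : bcc p -> bcc (fun x => `|p x|).
Proof.
move=> [[M pM] cp]; apply: (@bcc_intro _ M _ _ cp) => x; first by rewrite normr_id.
move=> /contrapT h; apply: (@continuous_comp _ _ _ p) => //.
exact: norm_continuous.
Qed.

Lemma bcc_measurable p : bcc p -> measurable_fun setT p.
Proof.
move=> [_ cp]; set E := [set x | _] in cp.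
have mE : measurable E by exact: countable_measurable.
rewrite -(setvU E); apply/measurable_funU => //; first exact: measurableC.
split.
  apply: subspace_continuous_measurable_fun; first exact: measurableC.
  by apply: continuous_in_subspaceT => x; rewrite inE => /= /contrapT.
move=> _ B mB; apply: countable_measurable => //.
exact: sub_countable (subset_card_le (@subIsetl _ _ _)) cp.
Qed.

Lemma bcc_integrable p u v : bcc p -> mu.-integrable `[u, v] (EFin \o p).
Proof.
move=> hp; apply: measurable_bounded_integrable => //.
- by rewrite /= lebesgue_measure_itv/=; case: ifP => // _; rewrite -EFinB ltry.
- exact: measurable_funS (bcc_measurable hp).
- have [M M0 pM] := bcc_bound hp.
  by exists M; split; rewrite ?num_real// => y My x _; exact: le_trans (pM x) (ltW My).
Qed.

Notation I := (fun u v p => \int[mu]_(x in `[u, v]) p x).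

Lemma intD p q u v : bcc p -> bcc q ->
  \int[mu]_(x in `[u, v]) (p x + q x) = I u v p + I u v q.
Proof. by move=> hp hq; rewrite RintegralD//; exact: bcc_integrable. Qed.

Lemma intB p q u v : bcc p -> bcc q ->
  \int[mu]_(x in `[u, v]) (p x - q x) = I u v p - I u v q.
Proof. by move=> hp hq; rewrite RintegralB//; exact: bcc_integrable. Qed.

Lemma intZ k p u v : bcc p -> \int[mu]_(x in `[u, v]) (k * p x) = k * I u v p.
Proof. by move=> hp; rewrite RintegralZl//; exact: bcc_integrable. Qed.

Lemma int_eq p q u v : (forall x, u <= x <= v -> p x = q x) -> I u v p = I u v q.
Proof. by move=> pq; apply: eq_Rintegral => x; rewrite inE/= in_itv/= => /pq. Qed.

Lemma int_le p q u v : bcc p -> bcc q -> (forall x, u <= x <= v -> p x <= q x) ->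
  I u v p <= I u v q.
Proof.
move=> hp hq pq; apply: le_Rintegral.
- exact: measurable_itv.
- exact: bcc_integrable.
- exact: bcc_integrable.
- by move=> x; rewrite /= in_itv/= => /pq.
Qed.

Lemma int_cst k u v : u <= v -> \int[mu]_(x in `[u, v]) k = k * (v - u).
Proof.
move=> uv; rewrite Rintegral_cst//= lebesgue_measure_itv/= lte_fin.
by case: ltP => [|vu]; [rewrite -EFinB|rewrite (@le_anti _ _ u v) ?uv ?vu// subrr].
Qed.

Lemma int_ge0 p u v : (forall x, u <= x <= v -> 0 <= p x) -> 0 <= I u v p.
Proof. by move=> h; apply: Rintegral_ge0 => x; rewrite /= in_itv/= => /h. Qed.

(** Reversed bounds give 0 and not the opposite integral: a primitive based at u is therefore
    constant to the left of u and Lipschitz on the whole line. *)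
Lemma int_empty p u v : v <= u -> I u v p = 0.
Proof.
rewrite le_eqVlt => /orP[/eqP->|vu]; first by rewrite set_itv1 Rintegral_set1.
by rewrite set_itv_ge ?Rintegral_set0// bnd_simp -ltNge.
Qed.

Lemma int_normr p u v : bcc p -> `|I u v p| <= \int[mu]_(x in `[u, v]) `|p x|.
Proof. by move=> hp; apply: le_normr_Rintegral => //; exact: bcc_integrable. Qed.

Lemma int_norm_le p M u v : u <= v -> bcc p -> (forall x, u <= x <= v -> `|p x| <= M) ->
  `|I u v p| <= M * (v - u).
Proof.
move=> uv hp pM; apply: le_trans (int_normr u v hp) _; rewrite -(int_cst M uv).
exact: (int_le (bcc_norm hp) (bcc_cst M) pM).
Qed.

Lemma int_split p u w v : u <= w -> w <= v -> bcc p ->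
  I u v p = I u w p + I w v p.
Proof.
move=> uw wv hp.
have h1 : (BLeft u <= BRight w :> itv_bound R)%O by rewrite bnd_simp.
have h2 : (BRight w <= BRight v :> itv_bound R)%O by rewrite bnd_simp.
have ip := bcc_integrable u v hp.
have := @Rintegral_itvB _ p (BLeft u) (BRight v) w ip h1 h2.
rewrite Rintegral_itv_obnd_cbnd; last first.
  apply: integrableS (bcc_integrable w v hp) => //; exact: subset_itv_oc_cc.
by move=> <-; rewrite addrC subrK.
Qed.

Lemma prim_lipschitz p M u s t : bcc p -> (forall x, `|p x| <= M) ->
  `|I u t p - I u s p| <= M * `|t - s|.
Proof.
move=> hp pM; have M0 : 0 <= M by exact: le_trans (pM 0).
wlog st : s t / s <= t => [hw|].
  have [|/ltW] := leP s t; first exact: hw.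
  by rewrite distrC (distrC t); exact: hw.
rewrite (ger0_norm (_ : 0 <= t - s)) ?subr_ge0//.
have [us|su] := leP u s.
  rewrite (int_split us st hp) addrAC subrr add0r.
  exact: int_norm_le.
rewrite (int_empty _ (ltW su)) subr0; have [ut|tu] := leP u t.
  apply: le_trans (int_norm_le ut hp (fun x _ => pM x)) _.
  by rewrite ler_wpM2l//; lra.
by rewrite (int_empty _ (ltW tu)) normr0 mulr_ge0// subr_ge0.
Qed.

Lemma prim_continuous p u t : bcc p -> {for t, continuous (fun s => I u s p)}.
Proof.
move=> hp; have [M M0 pM] := bcc_bound hp; apply/continuous_epsP => e e0.
exists (e / (M + 1)) => [|y]; first by rewrite divr_gt0//; lra.
rewrite ltr_pdivlMr; last lra; move=> ye.
apply: le_lt_trans (prim_lipschitz u t y hp pM) _; apply: le_lt_trans ye.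
by rewrite mulrC ler_wpM2l//; lra.
Qed.

Lemma prim_derive p u t : bcc p -> u < t -> {for t, continuous p} ->
  is_derive t (1 : R) (fun s => I u s p) (p t).
Proof.
move=> hp ut cp.
have [] := @continuous_FTC1_closed _ p u t (t + 1) _ (bcc_integrable u (t + 1) hp) ut cp.
  by rewrite ltrDl.
by move=> d1; rewrite derive1E => d2; exact: (DeriveDef d1 d2).
Qed.

(** The difference of P and the indefinite integral of p has derivative 0 off the union of two
    countable sets, so it is constant; P need not be differentiable everywhere. *)
Lemma FTC_countable p P E u v : u <= v -> bcc p -> countable E ->
  (forall x, x \in `[u, v] -> {for x, continuous P}) ->
  (forall x, x \in `]u, v[ -> ~ E x -> is_derive x (1 : R) P (p x)) ->
  I u v p = P v - P u.
Proof.
move=> uv hp cE cP dP.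
pose Q s := P s - I u s p; pose D : set R := [set x | ~ {for x, continuous p}].
have cED : countable (E `|` D) by exact: countableU cE hp.2.
have : Q v = Q u.
  have H := @countable_derive0_const Q _ _ _ uv cED; apply: H.
    by move=> x xuv; apply: continuousB; [exact: cP|exact: prim_continuous].
  move=> x xuv /not_orP[Ex /contrapT px].
  have d1 := dP _ xuv Ex.
  have ux : u < x by move: xuv; rewrite in_itv/= => /andP[].
  have d2 := prim_derive hp ux px.
  by apply: is_derive_eq; rewrite subrr.
by rewrite /Q (int_empty _ (lexx u)) subr0 => <-; rewrite subKr.
Qed.

(** The zero function is a primitive of p - q off E, so this is an instance of [FTC_countable]. *)
Lemma int_eq_countable p q E u v : bcc p -> bcc q -> countable E ->
  (forall x, u < x < v -> ~ E x -> p x = q x) -> I u v p = I u v q.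
Proof.
move=> hp hq cE pq; have [uv|/ltW vu] := leP u v; last by rewrite !int_empty.
apply/eqP; rewrite -subr_eq0 -intB//; apply/eqP.
have -> : 0 = cst 0 v - cst 0 u :> R by rewrite subrr.
have H := @FTC_countable (fun x => p x - q x) (cst 0) E u v uv (bccB hp hq) cE.
apply: H => [x _|x]; first exact: cst_continuous.
rewrite in_itv/= => xuv Ex; rewrite pq// subrr; exact: is_derive_cst.
Qed.

End real_tools.

(** * Functions of bounded variation *)

Section bounded_variation.
Context {R : realType}.
Implicit Types (p q V W : R -> R) (x y u v w : R).

(** A witness V replaces suprema over partitions: it can be composed with monotone maps, added and
    passed to the limit, which is how variation bounds are transported through the operators. *)
Definition dominated p V := forall x y, x <= y -> `|p y - p x| <= V y - V x.

(* V plays the role of the variation function of p. *)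
Definition bvb p v := exists V, (forall x, 0 <= V x <= v) /\ dominated p V.

Lemma dominated_ge p V : dominated p V -> {homo V : x y / x <= y}.
Proof. by move=> h x y /h /(le_trans (normr_ge0 _)); rewrite subr_ge0. Qed.

Lemma bvb_ge0 p v : bvb p v -> 0 <= v.
Proof. by move=> [V [/(_ 0)/andP[h1 h2] _]]; exact: le_trans h2. Qed.

Lemma bvb_le p v w : v <= w -> bvb p v -> bvb p w.
Proof.
move=> vw [V [V01 dV]]; exists V; split=> // x; have /andP[-> h] := V01 x.
exact: le_trans vw.
Qed.

Lemma bvb_osc p v x y : bvb p v -> `|p y - p x| <= v.
Proof.
wlog xy : x y / x <= y => [hw|].
  have [|/ltW] := leP x y; first exact: hw.
  by rewrite distrC; exact: hw.
move=> [V [V01 dV]]; apply: le_trans (dV _ _ xy) _.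
by have /andP[_ h1] := V01 y; have /andP[h2 _] := V01 x; lra.
Qed.

Lemma bvb_sup p v x0 x : p x0 = 0 -> bvb p v -> `|p x| <= v.
Proof. by move=> p0 /(bvb_osc x0 x); rewrite p0 subr0. Qed.

Lemma bvb_eq p q v : (forall x, p x = q x) -> bvb p v -> bvb q v.
Proof. by move=> /funext->. Qed.

Lemma bvb_cst k : bvb (cst k) 0.
Proof.
exists (cst 0); split; first by move=> x; rewrite lexx.
by move=> x y _; rewrite /cst !subrr normr0.
Qed.

Lemma bvbD p q v w : bvb p v -> bvb q w -> bvb (fun x => p x + q x) (v + w).
Proof.
move=> [V [V01 dV]] [W [W01 dW]]; exists (fun x => V x + W x); split=> [x|x y xy].
  by have /andP[h1 h2] := V01 x; have /andP[h3 h4] := W01 x; apply/andP; split; lra.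
rewrite (_ : _ - _ = (p y - p x) + (q y - q x)); last by ring.
apply: le_trans (ler_normD _ _) _.
by have := dV _ _ xy; have := dW _ _ xy; lra.
Qed.

Lemma bvb_lipschitz p q v k : 0 <= k ->
  (forall x y, `|q y - q x| <= k * `|p y - p x|) -> bvb p v -> bvb q (k * v).
Proof.
move=> k0 qp [V [V01 dV]]; exists (fun x => k * V x); split=> [x|x y xy].
  by have /andP[h1 h2] := V01 x; rewrite mulr_ge0//= ler_wpM2l.
by apply: le_trans (qp x y) _; rewrite -mulrBr ler_wpM2l// dV.
Qed.

Lemma bvbZ k p v : bvb p v -> bvb (fun x => k * p x) (`|k| * v).
Proof. by apply: bvb_lipschitz => // x y; rewrite -mulrBr normrM. Qed.

Lemma bvbN p v : bvb p v -> bvb (fun x => - p x) v.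
Proof.
move=> h; rewrite -(mul1r v); apply: bvb_lipschitz h => // x y.
by rewrite mul1r -opprD normrN.
Qed.

Lemma bvbB p q v w : bvb p v -> bvb q w -> bvb (fun x => p x - q x) (v + w).
Proof. by move=> hp hq; exact/bvbD/bvbN. Qed.

Lemma bvb_norm p v : bvb p v -> bvb (fun x => `|p x|) v.
Proof.
move=> h; rewrite -(mul1r v); apply: bvb_lipschitz h => // x y.
by rewrite mul1r; exact: ler_dist_dist.
Qed.

Lemma bvbM p q v w M N : 0 <= M -> 0 <= N -> (forall x, `|p x| <= M) -> (forall x, `|q x| <= N) ->
  bvb p v -> bvb q w -> bvb (fun x => p x * q x) (M * w + N * v).
Proof.
move=> M0 N0 pM qN [V [V01 dV]] [W [W01 dW]].
exists (fun x => M * W x + N * V x); split=> [x|x y xy].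
  have /andP[h1 h2] := V01 x; have /andP[h3 h4] := W01 x.
  by rewrite addr_ge0 ?mulr_ge0//= lerD// ler_wpM2l.
rewrite (_ : _ - _ = p y * (q y - q x) + q x * (p y - p x)); last by ring.
apply: le_trans (ler_normD _ _) _; rewrite !normrM.
have h1 : `|p y| * `|q y - q x| <= M * (W y - W x) by rewrite ler_pM// dW.
have h2 : `|q x| * `|p y - p x| <= N * (V y - V x) by rewrite ler_pM// dV.
by lra.
Qed.

Lemma bvb_homo V v : {homo V : x y / x <= y} -> (forall x, 0 <= V x <= v) -> bvb V v.
Proof.
by move=> hV V01; exists V; split=> // x y xy; rewrite ger0_norm// subr_ge0 hV.
Qed.

Definition ind u v : R -> R := fun x => if (u <= x <= v) then 1 else 0.

Lemma bvb_ge u : bvb (fun x => if u <= x then 1 else 0) 1.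
Proof.
apply: bvb_homo => [x y xy|x].
  by case: ifP => // ux; rewrite ?(le_trans ux xy)//; case: ifP.
by case: ifP => _; rewrite ?lexx ler01.
Qed.

Lemma bvb_gt u : bvb (fun x => if u < x then 1 else 0) 1.
Proof.
apply: bvb_homo => [x y xy|x].
  by case: ifP => // ux; rewrite ?(lt_le_trans ux xy)//; case: ifP.
by case: ifP => _; rewrite ?lexx ler01.
Qed.

Lemma indE u v : u <= v ->
  ind u v = (fun x => (if u <= x then 1 else 0) - (if v < x then 1 else 0)).
Proof.
move=> uv; apply/funext => x; rewrite /ind; have [ux|xu] := leP u x => /=.
  by case: leP => _; rewrite ?subr0 ?subrr.
by rewrite ltNge (le_trans (ltW xu) uv)/= subrr.
Qed.

Lemma bvb_ind u v : u <= v -> bvb (ind u v) 2.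
Proof. by move=> uv; rewrite indE//; apply: bvbB; [exact: bvb_ge|exact: bvb_gt]. Qed.

Lemma ind_norm u v x : `|ind u v x| <= 1.
Proof. by rewrite /ind; case: ifP => _; rewrite ?normr1 ?normr0. Qed.

(** Discontinuities of a monotone function are countable on each ]-n, n[; off them the one-sided
    limits coincide and squeeze V x. *)
Lemma homo_bcc V v : {homo V : x y / x <= y} -> (forall x, 0 <= V x <= v) -> bcc V.
Proof.
move=> hV V01; pose F n := [set x | x \in (`]- n%:R, n%:R[ : interval R) /\ discontinuity V x].
apply: (@bcc_intro _ V v (\bigcup_n F n)).
- by move=> x; have /andP[h1 h2] := V01 x; rewrite ger0_norm.
- apply: bigcup_countable => // n _; apply: discontinuity_countable.
  by move=> x y _ _; exact: hV.
move=> x nFx; pose n := (Num.truncn `|x|).+1.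
have xn : x \in (`]- n%:R, n%:R[ : interval R).
  by rewrite in_itv/= -ltr_norml truncnS_gt.
have cr : cvg (V y @[y --> x^'+]).
  apply: nondecreasing_at_right_is_cvgr; near=> z; first by move=> ? ? _ _ ; exact: hV.
  by exists 0 => _ [t _ <-]; have /andP[] := V01 t.
have cl : cvg (V y @[y --> x^'-]).
  apply: nondecreasing_at_left_is_cvgr; near=> z; first by move=> ? ? _ _ ; exact: hV.
  by exists v => _ [t _ <-]; have /andP[] := V01 t.
have E : lim (V y @[y --> x^'-]) = lim (V y @[y --> x^'+]).
  by apply: contrapT => E; apply: nFx; exists n => //; split => //; split=> //; exact/eqP.
have h1 : lim (V y @[y --> x^'-]) <= V x.
  by apply: limr_le => //; near=> z; apply: hV; exact/ltW.
have h2 : V x <= lim (V y @[y --> x^'+]).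
  by apply: limr_ge => //; near=> z; apply: hV; exact/ltW.
apply/left_right_continuousP; split.
  by rewrite (_ : V x = lim (V y @[y --> x^'-]))//; apply/le_anti; rewrite h1 E h2.
by rewrite (_ : V x = lim (V y @[y --> x^'+]))//; apply/le_anti; rewrite -E h1 E h2.
Unshelve. all: by end_near. Qed.

(** Jordan decomposition: p = V - (V - p) with both terms nondecreasing. Continuity off a countable
    set and one-sided limits of p follow from the monotone case. *)
Lemma dominated_homoB p V : dominated p V -> {homo (fun x => V x - p x) : x y / x <= y}.
Proof.
by move=> dV x y /dV; rewrite ler_norml => /andP[h1 h2]; lra.
Qed.

Lemma bvb_bound p v x : bvb p v -> `|p x| <= `|p 0| + v.
Proof.
move=> h; have := bvb_osc 0 x h; have := ler_normD (p x - p 0) (p 0).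
by rewrite subrK; lra.
Qed.

Lemma bvb_bcc p v : bvb p v -> bcc p.
Proof.
move=> hp; have [V [V01 dV]] := hp.
have cV := homo_bcc (dominated_ge dV) V01.
(* The constant shifts V - p to nonnegative values, as [homo_bcc] requires. *)
pose W x := V x - p x + (`|p 0| + v).
have cW : bcc W.
  apply: (@homo_bcc _ (v + (`|p 0| + v + (`|p 0| + v)))) => [x y xy|x].
    by rewrite lerD2r; exact: (dominated_homoB dV).
  have := bvb_bound x hp; rewrite ler_norml => /andP[h1 h2].
  by have /andP[h3 h4] := V01 x; rewrite /W; apply/andP; split; lra.
have -> : p = (fun x => V x - (W x - (`|p 0| + v))).
  by apply/funext => x; rewrite /W; ring.
by apply: bccB cV _; apply: bccB cW _; exact: bcc_cst.
Qed.

Lemma bvb_right_cvg p v x : bvb p v -> cvg (p y @[y --> x^'+]).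
Proof.
move=> hp; have [V [V01 dV]] := hp.
have -> : p = (fun x => V x - (V x - p x)) by apply/funext => y; ring.
apply: is_cvgB; apply: nondecreasing_at_right_is_cvgr; near=> z.
- by move=> ? ? _ _; exact: dominated_ge dV _ _.
- by exists 0 => _ [t _ <-]; have /andP[] := V01 t.
- by move=> ? ? _ _; exact: dominated_homoB dV _ _.
exists (- (`|p 0| + v)) => _ [t _ <-].
have := bvb_bound t hp; rewrite ler_norml => /andP[h1 h2].
by have /andP[h3 h4] := V01 t; lra.
Unshelve. all: by end_near. Qed.

Lemma bvb_left_cvg p v x : bvb p v -> cvg (p y @[y --> x^'-]).
Proof.
move=> hp; have [V [V01 dV]] := hp.
have -> : p = (fun x => V x - (V x - p x)) by apply/funext => y; ring.
apply: is_cvgB; apply: nondecreasing_at_left_is_cvgr; near=> z.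
- by move=> ? ? _ _; exact: dominated_ge dV _ _.
- by exists v => _ [t _ <-]; have /andP[] := V01 t.
- by move=> ? ? _ _; exact: dominated_homoB dV _ _.
exists (v + (`|p 0| + v)) => _ [t _ <-].
have := bvb_bound t hp; rewrite ler_norml => /andP[h1 h2].
by have /andP[h3 h4] := V01 t; lra.
Unshelve. all: by end_near. Qed.

(** The sums of the witnesses are nondecreasing in n and bounded by S; their pointwise limit
    dominates p, because inequalities between increments pass to the limit. *)
Lemma bvb_series (p_ : nat -> R -> R) (v_ : nat -> R) p S :
  (forall n, bvb (p_ n) (v_ n)) -> (forall n, \sum_(0 <= i < n) v_ i <= S) ->
  (forall x, (fun n => \sum_(0 <= i < n) p_ i x) @ \oo --> p x) -> bvb p S.
Proof.
move=> /choice[V HV] vS cp.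
pose W n x := \sum_(0 <= i < n) V i x.
have W01 n x : 0 <= W n x <= S.
  rewrite sumr_ge0 => [|i _]; last by have /andP[] := (HV i).1 x.
  by apply: le_trans (vS n); apply: ler_sum => i _; have /andP[] := (HV i).1 x.
have ndW x : nondecreasing_seq (W ^~ x).
  apply/nondecreasing_seqP => n; rewrite /W big_nat_recr//= lerDl.
  by have /andP[] := (HV n).1 x.
have cW x : cvgn (W ^~ x).
  apply: nondecreasing_is_cvgn => //; exists S => _ [n _ <-].
  by have /andP[] := W01 n x.
exists (fun x => limn (W ^~ x)); split=> [x|x y xy].
  apply/andP; split.
    by apply: limr_ge => //; near=> n; have /andP[] := W01 n x.
  by apply: limr_le => //; near=> n; have /andP[] := W01 n x.
have h1 : (fun n => `|\sum_(0 <= i < n) p_ i y - \sum_(0 <= i < n) p_ i x|) @ \oo --> `|p y - p x|.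
  by apply: cvg_norm; exact: cvgB.
have h2 : (fun n => W n y - W n x) @ \oo --> limn (W ^~ y) - limn (W ^~ x).
  by apply: cvgB; exact: cW.
apply: (ler_cvg_to h1 h2).
near=> n; rewrite /W -!sumrB; apply: le_trans (ler_norm_sum _ _ _) _.
by apply: ler_sum => i _; exact: (HV i).2.
Unshelve. all: by end_near. Qed.

End bounded_variation.

(** * Transfer operators of two inverse branches *)

(** The data seen by the operator: two contracting branches glued at [c] over [c1], with [w1] and
    [w2] the absolute values of their derivatives. [A, B] stands for [a_0, b]; A is fixed by [psi1],
    and [psi2] sends A beyond B, so the support is preserved. *)
Record branches {R : realType} (A B c c1 k : R) (psi1 psi2 w1 w2 : R -> R) : Prop := {
  br_Ac : A < c;
  br_cc1 : c < c1;
  br_c1B : c1 < B;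
  br_k0 : 0 <= k;
  br_k1 : k < 1;
  br_w1 : forall x, x <= c1 -> 0 <= w1 x <= k;
  br_w2 : forall x, x <= c1 -> 0 <= w2 x <= k;
  br_d1 : forall x, x <= c1 -> is_derive x (1 : R) psi1 (w1 x);
  br_d2 : forall x, x <= c1 -> is_derive x (1 : R) psi2 (- w2 x);
  br_cw1 : forall x, x <= c1 -> {for x, continuous w1};
  br_cw2 : forall x, x <= c1 -> {for x, continuous w2};
  br_inc : forall x y, x < y -> y <= c1 -> psi1 x < psi1 y;
  br_dec : forall x y, x < y -> y <= c1 -> psi2 y < psi2 x;
  br_lip1 : forall x y, x <= y -> y <= c1 -> `|psi1 y - psi1 x| <= k * (y - x);
  br_lip2 : forall x y, x <= y -> y <= c1 -> `|psi2 y - psi2 x| <= k * (y - x);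
  br_1c1 : psi1 c1 = c;
  br_2c1 : psi2 c1 = c;
  br_A : psi1 A = A;
  br_B : B < psi2 A;
  (* The quotient w' / w may be unbounded since w1 may vanish outside the
     image of the original interval, whence the extra term e * (y - x). *)
  br_dist1 : forall e : R, 0 < e -> exists2 C, 0 <= C & forall x y,
    A - 1 <= x -> x <= y -> y <= c1 ->
    `|w1 y - w1 x| <= e * (y - x) + C * `|psi1 y - psi1 x|;
  br_dist2 : forall e : R, 0 < e -> exists2 C, 0 <= C & forall x y,
    A - 1 <= x -> x <= y -> y <= c1 ->
    `|w2 y - w2 x| <= e * (y - x) + C * `|psi2 y - psi2 x|
}.

(** This is [chi], with [c1] as a parameter in place of [f c]. *)
Definition cut {R : realType} (c1 x : R) : R :=
  if x < c1 then 1 else if x == c1 then 2^-1 else 0.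

Definition transfer {R : realType} (c1 : R) (psi1 psi2 w1 w2 : R -> R) (p : R -> R) : R -> R :=
  fun x => cut c1 x * w1 x * p (psi1 x) + cut c1 x * w2 x * p (psi2 x).

Definition supp {R : realType} (A B : R) (p : R -> R) :=
  forall x, ~~ (A <= x <= B) -> p x = 0.

(** * Integrals of functions with support in a segment *)

Section supported.
Context {R : realType}.
Implicit Types (p : R -> R) (A B u v t : R).
Notation mu := (@lebesgue_measure R).

Lemma suppD A B p q : supp A B p -> supp A B q -> supp A B (fun x => p x + q x).
Proof. by move=> hp hq x hx; rewrite hp// hq// addr0. Qed.

Lemma suppZ A B p k : supp A B p -> supp A B (fun x => k * p x).
Proof. by move=> hp x hx; rewrite hp// mulr0. Qed.

Lemma suppB A B p q : supp A B p -> supp A B q -> supp A B (fun x => p x - q x).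
Proof. by move=> hp hq x hx; rewrite hp// hq// subr0. Qed.

Lemma supp_norm A B p : supp A B p -> supp A B (fun x => `|p x|).
Proof. by move=> hp x hx; rewrite hp// normr0. Qed.

Lemma suppS A B A' B' p : A' <= A -> B <= B' -> supp A B p -> supp A' B' p.
Proof.
move=> h1 h2 hp x hx; apply: hp; apply: contra hx => /andP[h3 h4].
by rewrite (le_trans h1)// (le_trans h4).
Qed.

Lemma supp_bvb_sup A B p v x : supp A B p -> bvb p v -> `|p x| <= v.
Proof.
move=> sp; apply: (@bvb_sup _ _ _ (A - 1)); apply: sp; rewrite negb_and.
by rewrite -ltNge; apply/orP; left; lra.
Qed.

Lemma int_zero p u v : (forall x, u < x < v -> p x = 0) -> bcc p ->
  \int[mu]_(x in `[u, v]) p x = 0.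
Proof.
move=> p0 hp; rewrite (int_eq_countable hp (bcc_cst 0) (countable0 R)).
  by rewrite /Rintegral integral0.
by move=> x xuv _; rewrite p0.
Qed.

Lemma int_supp A B p u v : A <= B -> u <= A -> B <= v -> bcc p -> supp A B p ->
  \int[mu]_(x in `[u, v]) p x = \int[mu]_(x in `[A, B]) p x.
Proof.
move=> AB uA Bv hp sp; rewrite (@int_split _ p u A v)//; last exact: le_trans Bv.
rewrite (@int_split _ p A B v)// (@int_zero p u A)// ?(@int_zero p B v)//.
- by rewrite add0r addr0.
- move=> x /andP[h1 h2]; apply: sp; rewrite negb_and -!ltNge.
  by rewrite h1 orbT.
move=> x /andP[h1 h2]; apply: sp; rewrite negb_and -!ltNge.
by rewrite h2.
Qed.

Lemma int_ge0_supp A B p u v : A <= B -> bcc p -> supp A B p -> (forall x, 0 <= p x) ->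
  \int[mu]_(x in `[u, v]) p x <= \int[mu]_(x in `[A, B]) p x.
Proof.
move=> AB hp sp p0; have [uv|/ltW vu] := leP u v; last first.
  by rewrite int_empty//; apply: int_ge0.
pose U := Num.min u A; pose W := Num.max v B.
have UA : U <= A by rewrite ge_min lexx orbT.
have Uu : U <= u by rewrite ge_min lexx.
have BW : B <= W by rewrite le_max lexx orbT.
have vW : v <= W by rewrite le_max lexx.
rewrite -(int_supp AB UA BW hp sp).
rewrite (@int_split _ p U u W)//; last exact: le_trans vW.
rewrite (@int_split _ p u v W)//.
have h1 : 0 <= \int[mu]_(x in `[U, u]) p x by exact: int_ge0.
have h2 : 0 <= \int[mu]_(x in `[v, W]) p x by exact: int_ge0.
by lra.
Qed.

Lemma countable_preimage (S D : set R) (g : R -> R) : countable D ->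
  {in S &, injective g} -> countable (S `&` g @^-1` D).
Proof.
move=> cD ig; pose S' := S `&` g @^-1` D.
have : countable (g @` S').
  apply: sub_countable cD; apply: subset_card_le => _ [x [_ ? <-]] //.
have ig' : {in S' &, injective g}.
  by move=> x y /[!inE] -[Sx _] [Sy _]; apply: ig; rewrite inE.
by rewrite (eq_countable (inj_card_eq ig')).
Qed.

End supported.

(** * Change of variables and conservation of mass *)

Section transfer_operator.
Context {R : realType}.
Variables (A B c c1 k : R) (psi1 psi2 w1 w2 : R -> R).
Hypothesis HB : branches A B c c1 k psi1 psi2 w1 w2.
Implicit Types (p q m V : R -> R) (x y u v : R).
Notation mu := (@lebesgue_measure R).
Notation TL := (transfer c1 psi1 psi2 w1 w2).
Let hAc : A < c. Proof. exact: br_Ac HB. Qed.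
Let hcc1 : c < c1. Proof. exact: br_cc1 HB. Qed.
Let hc1B : c1 < B. Proof. exact: br_c1B HB. Qed.
Let hk0 : 0 <= k. Proof. exact: br_k0 HB. Qed.
Let hk1 : k < 1. Proof. exact: br_k1 HB. Qed.
Local Hint Resolve hAc hcc1 hc1B hk0 hk1 : core.

Lemma br_Ac1 : A < c1. Proof. exact: lt_trans hcc1. Qed.
Lemma br_cB : c < B. Proof. exact: lt_trans hc1B. Qed.
Lemma br_AB : A < B. Proof. exact: lt_trans br_Ac1 hc1B. Qed.
Local Hint Extern 0 (is_true (_ <= _)) => (apply: ltW; (exact: br_Ac1 || exact: br_cB || exact: br_AB || exact: hAc || exact: hcc1 || exact: hc1B)) : core.
Local Hint Resolve br_Ac1 br_cB br_AB : core.

Lemma psi1_homo x y : x <= y -> y <= c1 -> psi1 x <= psi1 y.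
Proof.
rewrite le_eqVlt => /predU1P[->//|xy yc]; exact/ltW/(br_inc HB).
Qed.

Lemma psi2_homo x y : x <= y -> y <= c1 -> psi2 y <= psi2 x.
Proof.
rewrite le_eqVlt => /predU1P[->//|xy yc]; exact/ltW/(br_dec HB).
Qed.

Lemma psi1_le x : x <= c1 -> psi1 x <= c.
Proof. by move=> xc; rewrite -(br_1c1 HB) psi1_homo. Qed.

Lemma psi2_ge x : x <= c1 -> c <= psi2 x.
Proof. by move=> xc; rewrite -(br_2c1 HB) psi2_homo. Qed.

Lemma psi1_lt x : x < A -> psi1 x < A.
Proof. by move=> xA; rewrite -[ltRHS](br_A HB); apply: (br_inc HB). Qed.

Lemma psi2_gt x : x <= A -> B < psi2 x.
Proof. by move=> xA; apply: lt_le_trans (br_B HB) _; exact: psi2_homo. Qed.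

Lemma psi1_gtA x : A < x -> x <= c1 -> A < psi1 x.
Proof. by move=> xA xc; rewrite -[ltLHS](br_A HB); apply: (br_inc HB). Qed.

Lemma psi1_inj : {in `]-oo, c1]%classic &, injective psi1}.
Proof.
move=> x y; rewrite !inE/= !in_itv/= => xc yc.
have [xy|yx|->//] := ltgtP x y => E.
- by have := br_inc HB xy yc; rewrite E ltxx.
- by have := br_inc HB yx xc; rewrite E ltxx.
Qed.

Lemma psi2_inj : {in `]-oo, c1]%classic &, injective psi2}.
Proof.
move=> x y; rewrite !inE/= !in_itv/= => xc yc.
have [xy|yx|->//] := ltgtP x y => E.
- by have := br_dec HB xy yc; rewrite E ltxx.
- by have := br_dec HB yx xc; rewrite E ltxx.
Qed.

Lemma cut01 x : 0 <= cut c1 x <= 1.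
Proof. by rewrite /cut; case: ifP => _; [lra|case: ifP => _; lra]. Qed.

Lemma cut_lt x : x < c1 -> cut c1 x = 1.
Proof. by rewrite /cut => ->. Qed.

Lemma cut_gt x : c1 < x -> cut c1 x = 0.
Proof. by move=> h; rewrite /cut ltNge (ltW h)/= gt_eqF. Qed.

Lemma cut_continuous x : x != c1 -> {for x, continuous (cut c1)}.
Proof.
rewrite neq_lt => /orP[xc|cx]; apply/continuous_epsP => e e0.
  exists (c1 - x) => [|y yx]; first by rewrite subr_gt0.
  move: yx; rewrite ltr_distl => /andP[_ h].
  by rewrite !cut_lt ?subrr ?normr0//; lra.
exists (x - c1) => [|y yx]; first by rewrite subr_gt0.
move: yx; rewrite ltr_distl => /andP[h _].
by rewrite !cut_gt ?subrr ?normr0//; lra.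
Qed.

(** Injectivity of the branch makes the preimage of the discontinuity set of m countable; the cut
    adds only the point [c1]. *)
Lemma bcc_pull (psi w m : R -> R) K : bcc m ->
  {in `]-oo, c1]%classic &, injective psi} ->
  (forall x, x <= c1 -> {for x, continuous psi}) ->
  (forall x, x <= c1 -> {for x, continuous w}) -> 0 <= K ->
  (forall x, x <= c1 -> `|w x| <= K) ->
  bcc (fun x => cut c1 x * w x * m (psi x)).
Proof.
move=> hm ipsi cpsi cw K0 wK; have [M M0 mM] := bcc_bound hm.
pose D := [set x | ~ {for x, continuous m}].
have cD : countable D by case: hm.
pose E := [set c1] `|` (`]-oo, c1] `&` psi @^-1` D).
apply: (@bcc_intro _ _ (K * M) E).
- move=> x; have [xc|cx] := leP x c1; last first.
    by rewrite cut_gt// !mul0r normr0 mulr_ge0.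
  rewrite normrM ler_pM// normrM.
  have /andP[h1 h2] := cut01 x; rewrite (ger0_norm h1).
  by apply: le_trans (wK _ xc); rewrite ler_piMl.
- apply: countableU; first exact: countable1.
  exact: countable_preimage.
move=> x /not_orP[/= /eqP xc1 nE].
have cutx := cut_continuous xc1.
move: xc1; rewrite neq_lt => /orP[xc|cx]; last first.
  apply/continuous_epsP => e e0; exists (x - c1) => [|y]; first by rewrite subr_gt0.
  rewrite ltr_distl => /andP[h _].
  by rewrite !cut_gt ?mul0r ?subrr ?normr0//; lra.
apply: continuousM; first by apply: continuousM => //; apply: cw; exact: ltW.
apply: continuous_comp; first by apply: cpsi; exact: ltW.
apply: contrapT => nm; apply: nE; split => //=.
by rewrite in_itv/= ltW.
Qed.

Lemma psi1_cont x : x <= c1 -> {for x, continuous psi1}.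
Proof. by move=> /(br_d1 HB); exact: is_derive_continuous. Qed.

Lemma psi2_cont x : x <= c1 -> {for x, continuous psi2}.
Proof. by move=> /(br_d2 HB); exact: is_derive_continuous. Qed.

Lemma w1_norm x : x <= c1 -> `|w1 x| <= k.
Proof. by move=> /(br_w1 HB)/andP[h1 h2]; rewrite ger0_norm. Qed.

Lemma w2_norm x : x <= c1 -> `|w2 x| <= k.
Proof. by move=> /(br_w2 HB)/andP[h1 h2]; rewrite ger0_norm. Qed.

Lemma bcc_pull1 m : bcc m -> bcc (fun x => cut c1 x * w1 x * m (psi1 x)).
Proof.
move=> hm; apply: (@bcc_pull psi1 w1 m k) => //.
- exact: psi1_inj.
- exact: psi1_cont.
- exact: (br_cw1 HB).
- exact: w1_norm.
Qed.

Lemma bcc_pull2 m : bcc m -> bcc (fun x => cut c1 x * w2 x * m (psi2 x)).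
Proof.
move=> hm; apply: (@bcc_pull psi2 w2 m k) => //.
- exact: psi2_inj.
- exact: psi2_cont.
- exact: (br_cw2 HB).
- exact: w2_norm.
Qed.

Lemma transfer_bcc p : bcc p -> bcc (TL p).
Proof. by move=> hp; apply: bccD; [exact: bcc_pull1|exact: bcc_pull2]. Qed.

(** The substitution y = psi1 x, obtained from [FTC_countable]: the integral of m from A to psi1 x
    is a primitive of the integrand, off the preimages of the discontinuities of m. *)
Lemma int_pull1 m : bcc m ->
  \int[mu]_(x in `[A, B]) (cut c1 x * w1 x * m (psi1 x)) = \int[mu]_(x in `[A, c]) m x.
Proof.
move=> hm; have bm := bcc_pull1 hm.
rewrite (int_split (ltW br_Ac1) (ltW hc1B) bm).
rewrite [X in _ + X]int_zero//; last first.
  by move=> x /andP[h _]; rewrite cut_gt// !mul0r.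
pose D := [set x | ~ {for x, continuous m}].
have cE : countable (`]-oo, c1] `&` psi1 @^-1` D).
  by apply: countable_preimage psi1_inj; case: hm.
pose P x := \int[mu]_(t in `[A, psi1 x]) m t.
suff -> : \int[mu]_(x in `[A, c1]) (cut c1 x * w1 x * m (psi1 x)) = P c1 - P A.
  by rewrite /P (br_1c1 HB) (br_A HB) (int_empty _ (lexx A)) subr0 addr0.
apply: (FTC_countable (ltW br_Ac1) bm cE) => x; rewrite in_itv/= => /andP[Ax xc].
  apply: (@continuous_comp _ _ _ psi1 (fun s => \int[mu]_(t in `[A, s]) m t)).
    exact: psi1_cont.
  exact: prim_continuous.
move=> nE; have cm : {for psi1 x, continuous m}.
  apply: contrapT => nm; apply: nE; split => //=.
  by rewrite in_itv/= ltW.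
have d1 := prim_derive hm (psi1_gtA Ax (ltW xc)) cm.
have d2 := br_d1 HB (ltW xc).
rewrite cut_lt// mul1r mulrC.
exact: (@is_derive1_comp _ (fun s => \int[mu]_(t in `[A, s]) m t) psi1 x (m (psi1 x)) (w1 x) d1 d2).
Qed.

Lemma int_pull2 m : bcc m ->
  \int[mu]_(x in `[A, B]) (cut c1 x * w2 x * m (psi2 x)) = \int[mu]_(x in `[c, psi2 A]) m x.
Proof.
move=> hm; have bm := bcc_pull2 hm.
rewrite (int_split (ltW br_Ac1) (ltW hc1B) bm).
rewrite [X in _ + X]int_zero//; last first.
  by move=> x /andP[h _]; rewrite cut_gt// !mul0r.
pose D := [set x | ~ {for x, continuous m}].
have cE : countable (`]-oo, c1] `&` psi2 @^-1` D).
  by apply: countable_preimage psi2_inj; case: hm.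
(* The sign compensates for [psi2] being decreasing. *)
pose P x := - \int[mu]_(t in `[c, psi2 x]) m t.
suff -> : \int[mu]_(x in `[A, c1]) (cut c1 x * w2 x * m (psi2 x)) = P c1 - P A.
  by rewrite /P (br_2c1 HB) (int_empty _ (lexx c)) oppr0 opprK add0r addr0.
apply: (FTC_countable (ltW br_Ac1) bm cE) => x; rewrite in_itv/= => /andP[Ax xc].
  apply: continuousN.
  apply: (@continuous_comp _ _ _ psi2 (fun s => \int[mu]_(t in `[c, s]) m t)).
    exact: psi2_cont.
  exact: prim_continuous.
move=> nE; have cm : {for psi2 x, continuous m}.
  apply: contrapT => nm; apply: nE; split => //=.
  by rewrite in_itv/= ltW.
have cx : c < psi2 x by rewrite -(br_2c1 HB); exact: (br_dec HB).
have d1 := prim_derive hm cx cm.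
have d2 := br_d2 HB (ltW xc).
have := @is_derive1_comp _ (fun s => \int[mu]_(t in `[c, s]) m t) psi2 x (m (psi2 x)) (- w2 x) d1 d2.
move=> d3; rewrite cut_lt// mul1r.
have -> : w2 x * m (psi2 x) = - (m (psi2 x) * - w2 x) by ring.
exact: is_deriveN.
Qed.

Lemma transfer_supp p : supp A B p -> supp A c1 (TL p).
Proof.
move=> sp x; rewrite negb_and -!ltNge => /orP[xA|cx]; last first.
  by rewrite /transfer cut_gt// !mul0r addr0.
rewrite /transfer !sp ?mulr0 ?addr0// negb_and -!ltNge.
  by rewrite (psi2_gt (ltW xA)) orbT.
by rewrite psi1_lt.
Qed.

Lemma transfer_suppAB p : supp A B p -> supp A B (TL p).
Proof. by move=> /transfer_supp; exact: suppS. Qed.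

(** The branches integrate p over [A, c] and over [c, psi2 A]; the second segment contains [c, B]
    because [psi2 A] lies beyond B. *)
Lemma transfer_int p : bcc p -> supp A B p ->
  \int[mu]_(x in `[A, B]) TL p x = \int[mu]_(x in `[A, B]) p x.
Proof.
move=> hp sp; rewrite (intD _ _ (bcc_pull1 hp) (bcc_pull2 hp)) int_pull1// int_pull2//.
rewrite (@int_split _ p A c B)//.
congr (_ + _); rewrite (@int_split _ p c B (psi2 A))//; last exact: ltW (br_B HB).
rewrite [X in _ + X]int_zero ?addr0//.
by move=> x /andP[h _]; rewrite sp// negb_and -!ltNge h orbT.
Qed.

Lemma transferD p q : TL (fun x => p x + q x) = (fun x => TL p x + TL q x).
Proof. by apply/funext => x; rewrite /transfer; ring. Qed.

Lemma transferB p q : TL (fun x => p x - q x) = (fun x => TL p x - TL q x).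
Proof. by apply/funext => x; rewrite /transfer; ring. Qed.

Lemma transferZ r p : TL (fun x => r * p x) = (fun x => r * TL p x).
Proof. by apply/funext => x; rewrite /transfer; ring. Qed.

Lemma cutw_ge0 x : 0 <= cut c1 x * w1 x /\ 0 <= cut c1 x * w2 x.
Proof.
have [xc|cx] := leP x c1; last by rewrite cut_gt// !mul0r.
have /andP[h1 _] := cut01 x; have /andP[h2 _] := br_w1 HB xc.
by have /andP[h3 _] := br_w2 HB xc; rewrite !mulr_ge0.
Qed.

Lemma transfer_ge0 p : (forall x, 0 <= p x) -> forall x, 0 <= TL p x.
Proof. by move=> p0 x; have [h1 h2] := cutw_ge0 x; rewrite addr_ge0// mulr_ge0. Qed.

Lemma transfer_norm p x : `|TL p x| <= TL (fun y => `|p y|) x.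
Proof.
have [h1 h2] := cutw_ge0 x; apply: le_trans (ler_normD _ _) _.
by rewrite (normrM (_ * w1 _)) (normrM (_ * w2 _)) (ger0_norm h1) (ger0_norm h2).
Qed.

Lemma transfer_int_norm p : bcc p -> supp A B p ->
  \int[mu]_(x in `[A, B]) `|TL p x| <= \int[mu]_(x in `[A, B]) `|p x|.
Proof.
move=> hp sp; rewrite -(transfer_int (bcc_norm hp) (supp_norm sp)).
apply: int_le; first exact/bcc_norm/transfer_bcc.
- exact/transfer_bcc/bcc_norm.
- by move=> x _; exact: transfer_norm.
Qed.

End transfer_operator.

(** * Lasota-Yorke inequality *)

Section lasota_yorke.
Context {R : realType}.
Variables (A B c c1 k : R) (psi1 psi2 w1 w2 : R -> R) (o : nat -> R).
Hypothesis HB : branches A B c c1 k psi1 psi2 w1 w2.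
(* o is the orbit of c1: the forward map is only known through its inverse branches. *)
Hypothesis o0 : o 0 = c1.
Hypothesis o_le : forall n, o n <= c1.
Hypothesis o_A : forall n, A <= o n.
Hypothesis o_c : forall n, o n != c.
Hypothesis o_lt : forall n, o n < c -> psi1 (o n.+1) = o n.
Hypothesis o_gt : forall n, c < o n -> psi2 (o n.+1) = o n.
Implicit Types (p q V : R -> R) (x y u v : R).
Notation mu := (@lebesgue_measure R).
Notation TL := (transfer c1 psi1 psi2 w1 w2).
Let hAc : A < c. Proof. exact: br_Ac HB. Qed.
Let hcc1 : c < c1. Proof. exact: br_cc1 HB. Qed.
Let hc1B : c1 < B. Proof. exact: br_c1B HB. Qed.
Let hk0 : 0 <= k. Proof. exact: br_k0 HB. Qed.
Let hk1 : k < 1. Proof. exact: br_k1 HB. Qed.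
Let hAB : A < B. Proof. exact: br_AB HB. Qed.
Let hAc1 : A < c1. Proof. exact: br_Ac1 HB. Qed.
Local Hint Resolve hAc hcc1 hc1B hk0 hk1 hAB hAc1 : core.

(** Both sides are controlled by adding up consecutive increments, so a bound for steps of length at
    most eta is enough. It serves to use a branch estimate that holds on short intervals only. *)
Lemma local_to_global (g G : R -> R) u v eta : 0 < eta ->
  (forall x y, u <= x -> x <= y -> y <= v -> y - x <= eta -> `|g y - g x| <= G y - G x) ->
  forall x y, u <= x -> x <= y -> y <= v -> `|g y - g x| <= G y - G x.
Proof.
move=> e0 H x y ux xy yv.
have [n] : exists n : nat, y - x <= n%:R * eta.
  exists (Num.truncn ((y - x) / eta)).+1.
  by rewrite -ler_pdivrMr// ltW// truncnS_gt.
elim: n x ux xy => [|n IH] x ux xy.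
  rewrite mul0r subr_le0 => yx; have -> : x = y by apply/le_anti; rewrite xy yx.
  by rewrite !subrr normr0.
move=> yxn; have [h|h] := leP (y - x) eta; first exact: H.
rewrite (_ : g y - g x = (g y - g (x + eta)) + (g (x + eta) - g x)); last by ring.
apply: le_trans (ler_normD _ _) _.
have h1 : `|g (x + eta) - g x| <= G (x + eta) - G x.
  by apply: H => //; [rewrite lerDl ltW|lra|rewrite addrAC subrr add0r].
have h2 : `|g y - g (x + eta)| <= G y - G (x + eta).
  apply: IH; [lra|lra|].
  by move: yxn; rewrite -natr1 mulrDl mul1r; lra.
lra.
Qed.

(** A point strictly to the left of the support: images vanish at [A1], so increments from [A1] also
    see a jump at A. *)
Let A1 := A - 1.
Let I p t := \int[mu]_(s in `[A1, t]) `|p s|.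

Let I_ge p s t r : A1 <= s -> s <= t -> bcc p ->
  (forall u, s <= u <= t -> r <= `|p u|) -> r * (t - s) <= I p t - I p s.
Proof.
move=> As st hp rp; rewrite /I (int_split As st (bcc_norm hp)) addrAC subrr add0r.
rewrite -(int_cst r st); apply: int_le rp; first exact: bcc_cst.
exact: bcc_norm.
Qed.

(* The Leibniz rule d(w p(psi)) = w dp(psi) + p(psi) dw for increments. *)
Let branch_dom (psi w : R -> R) k' e :
  (forall x y, x <= y -> y <= c1 -> `|psi y - psi x| <= k * (y - x)) ->
  (forall x, x <= c1 -> `|w x| <= k) ->
  (forall x, A1 <= x -> x <= c1 -> A1 <= psi x) ->
  (forall e : R, 0 < e -> exists2 C, 0 <= C & forall x y,
    A1 <= x -> x <= y -> y <= c1 ->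
    `|w y - w x| <= e * (y - x) + C * `|psi y - psi x|) ->
  k < k' -> 0 < e -> exists C eta, [/\ 0 <= C, 0 < eta &
  forall p V M, bcc p -> (forall x, `|p x| <= M) -> dominated p V ->
    forall x y, A1 <= x -> x <= y -> y <= c1 -> y - x <= eta ->
    `|w y * p (psi y) - w x * p (psi x)| <=
    k' * `|V (psi y) - V (psi x)| + e * M * (y - x) + C * `|I p (psi y) - I p (psi x)|].
Proof.
move=> lip wk psiA dist kk' e0; have [C C0 HC] := dist e e0.
(* For images of length h <= eta, the error C h D made by comparing p(psi x) with the values of p on
   the image is absorbed in (k' - k) D. *)
pose eta := (k' - k) / (C + 1).
have eta0 : 0 < eta by rewrite divr_gt0//; lra.
have Ceta : C * eta <= k' - k.
  rewrite /eta mulrCA ler_piMr//; first by lra.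
  by rewrite ler_pdivrMr; lra.
exists C, eta; split => // p V M hp pM dV x y Ax xy yc yx.
pose h := `|psi y - psi x|; pose D := `|V (psi y) - V (psi x)|.
have h_eta : h <= eta.
  apply: le_trans (lip _ _ xy yc) _; apply: le_trans yx.
  by rewrite ler_piMl ?subr_ge0// ltW.
have h0 : 0 <= h by exact: normr_ge0.
have pD : `|p (psi y) - p (psi x)| <= D.
  rewrite /D; have [/dV h1|/ltW/dV h1] := leP (psi x) (psi y).
    by apply: le_trans h1 (ler_norm _).
  by rewrite distrC; apply: le_trans h1 _; rewrite distrC; exact: ler_norm.
(* On the image interval |p| is at least |p(psi x)| - D; integrating over it replaces a pointwise
   value by an L^1 norm. *)
have Ip : (`|p (psi x)| - D) * h <= `|I p (psi y) - I p (psi x)|.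
  have Apx : A1 <= psi x by apply: psiA => //; exact: le_trans yc.
  have Apy : A1 <= psi y by apply: psiA => //; exact: le_trans xy.
  have aux s t : `|p s| - `|p t| <= `|p t - p s|.
    by rewrite distrC; exact: lerB_dist.
  rewrite /h /D; have [st|/ltW st] := leP (psi x) (psi y).
    rewrite (ger0_norm (_ : 0 <= psi y - psi x)) ?subr_ge0//.
    apply: le_trans (ler_norm _); apply: I_ge => // u /andP[h1 h2].
    have := aux (psi x) u; have := dV _ _ h1; have := dominated_ge dV h2.
    by have := ler_norm (V (psi y) - V (psi x)); lra.
  rewrite distrC (distrC (psi y)) (distrC (I _ _)).
  rewrite (ger0_norm (_ : 0 <= psi x - psi y)) ?subr_ge0//.
  apply: le_trans (ler_norm _); apply: I_ge => // u /andP[h1 h2].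
  have := aux (psi x) u; rewrite (distrC (p u)).
  have := dV _ _ h2; have := dominated_ge dV h1.
  by have := ler_norm (V (psi x) - V (psi y)); lra.
rewrite (_ : _ - _ = w y * (p (psi y) - p (psi x)) + (w y - w x) * p (psi x)); last by ring.
apply: le_trans (ler_normD _ _) _; rewrite !normrM.
have h1 : `|w y| * `|p (psi y) - p (psi x)| <= k * D by rewrite ler_pM// wk.
have D0 : 0 <= D by exact: normr_ge0.
have h2 : `|w y - w x| * `|p (psi x)| <= e * (y - x) * M + C * (h * `|p (psi x)|).
  apply: le_trans (ler_wpM2r (normr_ge0 _) (HC _ _ Ax xy yc)) _.
  rewrite mulrDl -mulrA -[C * _ * _]mulrA lerD2r -mulrA ler_wpM2l ?(ltW e0)//.
  by rewrite ler_wpM2l ?subr_ge0.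
have h3 : C * (h * `|p (psi x)|) <= C * `|I p (psi y) - I p (psi x)| + (k' - k) * D.
  have : h * `|p (psi x)| <= `|I p (psi y) - I p (psi x)| + h * D by lra.
  move=> /(ler_wpM2l C0) h4; apply: le_trans h4 _; rewrite mulrDr lerD2l mulrA ler_wpM2r//.
  by apply: le_trans Ceta; rewrite ler_wpM2l.
rewrite -/D; lra.
Qed.

(** The branches are controlled on [A1, c1] only; clamping turns bounds there into witnesses on the
    whole line. *)
Let clampc x := Num.min c1 (Num.max A1 x).

Let clampc_homo : {homo clampc : x y / x <= y}.
Proof.
move=> x y xy; rewrite /clampc le_min ge_min lexx/= ge_min; apply/orP; right.
by rewrite ge_max le_max lexx/= le_max xy orbT.
Qed.

Let A1c1 : A1 <= c1. Proof. by rewrite /A1; have := hAc1; lra. Qed.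

Let clampc_itv x : A1 <= clampc x <= c1.
Proof. by rewrite /clampc le_min A1c1 le_max lexx/= ge_min lexx. Qed.

Let clampc_id x : A1 <= x <= c1 -> clampc x = x.
Proof. by move=> /andP[h1 h2]; rewrite /clampc max_r// min_r. Qed.

Let clampc_ge x : c1 <= x -> clampc x = c1.
Proof. by move=> h; rewrite /clampc min_l// le_max h orbT. Qed.

(** This is 1 - [cut u], that is H_u + 1. The value 1/2 makes the identities below hold at every
    point. *)
Definition step u x : R := if x < u then 0 else if x == u then 2^-1 else 1.

Lemma step01 u x : 0 <= step u x <= 1.
Proof. by rewrite /step; case: ifP => _; [lra|case: ifP => _; lra]. Qed.

Lemma step_homo u : {homo step u : x y / x <= y}.
Proof.
move=> x y; rewrite /step => xy.
case: (ltgtP x u) => xu; case: (ltgtP y u) => yu; lra.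
Qed.

Let psi1A1 x : A1 <= x -> x <= c1 -> A1 <= psi1 x.
Proof.
move=> Ax xc; have [xA|Ax'] := leP x A; last first.
  by have := psi1_gtA HB Ax' xc; rewrite /A1; lra.
have := br_lip1 HB xA (ltW hAc1); rewrite (br_A HB) ler_norml => /andP[_ h].
have h1 : k * (A - x) <= A - x by rewrite ler_piMl ?subr_ge0// ltW.
by move: Ax; rewrite /A1; lra.
Qed.

Let psi2A1 x : A1 <= x -> x <= c1 -> A1 <= psi2 x.
Proof. by move=> _ /(psi2_ge HB); rewrite /A1; have := hAc; lra. Qed.

Let N1 p := \int[mu]_(x in `[A, B]) `|p x|.

Let I_bound p t : bcc p -> supp A B p -> 0 <= I p t <= N1 p.
Proof.
move=> hp sp; rewrite int_ge0//=.
exact: (int_ge0_supp _ t (ltW hAB) (bcc_norm hp) (supp_norm sp) (fun x => normr_ge0 (p x))).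
Qed.

Let I_homo p : bcc p -> {homo I p : x y / x <= y}.
Proof.
move=> hp x y xy; have [Ax|/ltW xA] := leP A1 x.
  by have := @I_ge p x y 0 Ax xy hp (fun _ _ => normr_ge0 _); rewrite mul0r subr_ge0.
by rewrite {1}/I int_empty//; apply: int_ge0.
Qed.

(** The witness is pulled back by both branches, with a minus sign for the decreasing one. As psi1
    <= c <= psi2, V(psi1) - V(psi2) varies by no more than V does, so the factor is k' and not 2 k'.
    The cut removes the value (w1 + w2)(c1) p(c), whence the last term; [E] collects the distortion
    and L^1 errors. *)
Lemma transfer_dominated k' e : k < k' -> 0 < e -> exists2 C, 0 <= C &
  forall p V M, bcc p -> supp A B p -> (forall x, `|p x| <= M) -> dominated p V ->
  exists E, [/\ {homo E : x y / x <= y},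
    forall x, 0 <= E x <= 2 * e * M * (c1 - A + 1) + C * N1 p &
    dominated (TL p) (fun x => k' * (V (psi1 (clampc x)) - V (psi2 (clampc x))) + E x +
                        2 * `|p c| * step c1 x)].
Proof.
move=> kk' e0.
have [C1 [eta1 [C10 eta10 H1]]] :=
  branch_dom (br_lip1 HB) (w1_norm HB) psi1A1 (br_dist1 HB) kk' e0.
have [C2 [eta2 [C20 eta20 H2]]] :=
  branch_dom (br_lip2 HB) (w2_norm HB) psi2A1 (br_dist2 HB) kk' e0.
pose C := C1 + C2; exists C; first exact: addr_ge0.
move=> p V M hp sp pM dV.
have M0 : 0 <= M by exact: le_trans (pM 0).
pose E0 x := 2 * e * M * (x - A1) + C * (I p (psi1 x) - I p (psi2 x) + N1 p).
pose E x := E0 (clampc x); exists E.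
have hE0 x y : x <= y -> y <= c1 -> E0 x <= E0 y.
  move=> xy yc; rewrite /E0 lerD//.
    by rewrite ler_wpM2l ?lerD2r// !mulr_ge0// ltW.
  rewrite ler_wpM2l ?addr_ge0// lerD2r lerD//; first exact/I_homo/(psi1_homo HB).
  by rewrite lerN2; exact/I_homo/(psi2_homo HB).
have hE x y : x <= y -> E x <= E y.
  by move=> xy; apply: hE0; [exact: clampc_homo|have /andP[] := clampc_itv y].
split; [exact: hE| |].
- move=> x; have /andP[h1 h2] := clampc_itv x; rewrite /E /E0.
  have /andP[h3 h4] := I_bound (psi1 (clampc x)) hp sp.
  have /andP[h5 h6] := I_bound (psi2 (clampc x)) hp sp.
  have h7 : I p (psi1 (clampc x)) <= I p (psi2 (clampc x)).
    by apply: I_homo => //; exact: le_trans (psi1_le HB h2) (psi2_ge HB h2).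
  have n0 : 0 <= 2 * e * M by rewrite !mulr_ge0// ltW.
  have a1 : 0 <= clampc x - A1 by rewrite subr_ge0.
  have a2 : clampc x - A1 <= c1 - A + 1 by rewrite /A1; lra.
  have a3 : 0 <= I p (psi1 (clampc x)) - I p (psi2 (clampc x)) + N1 p by lra.
  apply/andP; split; first by rewrite addr_ge0// mulr_ge0// addr_ge0.
  apply: lerD; first exact: ler_wpM2l.
  by apply: ler_wpM2l; [rewrite addr_ge0|lra].
pose F x := w1 x * p (psi1 x) + w2 x * p (psi2 x).
pose G x := k' * (V (psi1 x) - V (psi2 x)) + E0 x.
have FG x y : A1 <= x -> x <= y -> y <= c1 -> `|F y - F x| <= G y - G x.
  apply: (@local_to_global F G A1 c1 (Num.min eta1 eta2)).
    by rewrite lt_min eta10.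
  move=> {}x {}y Ax xy yc; rewrite le_min => /andP[y1 y2].
  have := H1 p V M hp pM dV x y Ax xy yc y1.
  have := H2 p V M hp pM dV x y Ax xy yc y2.
  have p1 := psi1_homo HB xy yc; have p2 := psi2_homo HB xy yc.
  rewrite (ger0_norm (_ : 0 <= V (psi1 y) - V (psi1 x))) ?subr_ge0 ?(dominated_ge dV)//.
  rewrite (ler0_norm (_ : V (psi2 y) - V (psi2 x) <= 0)) ?subr_le0 ?(dominated_ge dV)//.
  have i1 := I_homo hp p1; have i2 := I_homo hp p2.
  rewrite (ger0_norm (_ : 0 <= I p (psi1 y) - I p (psi1 x))) ?subr_ge0//.
  rewrite (ler0_norm (_ : I p (psi2 y) - I p (psi2 x) <= 0)) ?subr_le0//.
  have -> : F y - F x = (w1 y * p (psi1 y) - w1 x * p (psi1 x)) + (w2 y * p (psi2 y) - w2 x * p (psi2 x)).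
    by rewrite /F; ring.
  move=> h2 h1; apply: le_trans (ler_normD _ _) _.
  have j1 : C1 * (I p (psi1 y) - I p (psi1 x)) <= C * (I p (psi1 y) - I p (psi1 x)).
    by rewrite ler_wpM2r ?subr_ge0// lerDl.
  have j2 : C2 * - (I p (psi2 y) - I p (psi2 x)) <= C * - (I p (psi2 y) - I p (psi2 x)).
    by rewrite ler_wpM2r ?oppr_ge0 ?subr_le0// lerDr.
  by rewrite /G /E0; lra.
(* Left of [A1] both preimages are off the support, and from [c1] on the value at [c1] is used, so
   clamping does not change the result. *)
have TLE x : TL p x = (1 - step c1 x) * F (clampc x).
  rewrite /transfer /cut /step /F; case: (ltgtP x c1) => xc.
  - rewrite subr0 !mul1r; have [Ax|xA] := leP A1 x.
      by rewrite clampc_id// Ax ltW.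
    have s0 t : t < A -> p (psi1 t) = 0 /\ (t <= c1 -> p (psi2 t) = 0).
      move=> tA; rewrite !sp// negb_and -!ltNge ?(psi1_lt HB)//.
      by rewrite (psi2_gt HB (ltW tA)) orbT.
    have -> : clampc x = A1 by rewrite /clampc max_l ?min_r// ltW.
    have a1 : A1 < A by rewrite /A1; lra.
    have [-> h1] := s0 _ a1; have [-> h2] := s0 _ (lt_trans xA a1).
    by rewrite h1// h2 ?(ltW xc)//; ring.
  - by rewrite subrr !mul0r addr0.
  - rewrite xc clampc_ge//; have -> : 1 - 2^-1 = 2^-1 :> R by lra.
    by ring.
have Fc1 : `|F c1| <= 2 * `|p c|.
  rewrite /F (br_1c1 HB) (br_2c1 HB) -mulrDl normrM ler_wpM2r//.
  apply: le_trans (ler_normD _ _) _.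
  by have := w1_norm HB (lexx c1); have := w2_norm HB (lexx c1); have := hk1; lra.
move=> x y xy; rewrite !TLE.
have /andP[sx0 sx1] := step01 c1 x; have /andP[sy0 sy1] := step01 c1 y.
have sxy := step_homo c1 xy.
rewrite (_ : _ - (1 - step c1 x) * _ = (1 - step c1 x) * (F (clampc y) - F (clampc x))
  - (step c1 y - step c1 x) * F (clampc y)); last by ring.
apply: le_trans (ler_normB _ _) _; rewrite !normrM.
have /andP[ax xc] := clampc_itv x; have /andP[ay yc] := clampc_itv y.
have g1 : `|1 - step c1 x| * `|F (clampc y) - F (clampc x)| <= G (clampc y) - G (clampc x).
  have := FG _ _ ax (clampc_homo xy) yc; apply: le_trans.
  by rewrite ler_piMl// ger0_norm; lra.
have g2 : `|step c1 y - step c1 x| * `|F (clampc y)| <= (step c1 y - step c1 x) * (2 * `|p c|).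
  rewrite ger0_norm ?subr_ge0//; have [yc1|c1y] := ltP y c1.
    have -> : step c1 y = step c1 x by rewrite /step yc1 (le_lt_trans xy yc1).
    by rewrite subrr !mul0r.
  by rewrite clampc_ge// ler_wpM2l// subr_ge0.
rewrite /E; move: g1; rewrite /G; lra.
Qed.


Let step_clampc u x : A <= u -> u < c1 -> step u (clampc x) = step u x.
Proof.
move=> Au uc; have [xc|cx] := ltP x c1; last first.
  rewrite clampc_ge// /step ltNge (ltW uc)/= gt_eqF// ltNge (le_trans (ltW uc) cx)/=.
  by rewrite gt_eqF// (lt_le_trans uc).
have [Ax|xA] := leP A1 x; first by rewrite clampc_id// Ax ltW.
have A1u : A1 < u by rewrite /A1; lra.
have -> : clampc x = A1 by rewrite /clampc max_l ?min_r// ltW.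
by rewrite /step A1u (lt_trans xA A1u).
Qed.

Let step_psi1 u z : u <= c1 -> z <= c1 -> step (psi1 u) (psi1 z) = step u z.
Proof.
move=> uc zc; rewrite /step; case: (ltgtP z u) => [zu|uz|->].
- by rewrite (br_inc HB zu uc).
- by rewrite ltNge (ltW (br_inc HB uz zc))/= gt_eqF// (br_inc HB uz zc).
- by rewrite ltxx eqxx.
Qed.

Let step_psi2 u z : u <= c1 -> z <= c1 -> step (psi2 u) (psi2 z) = 1 - step u z.
Proof.
move=> uc zc; rewrite /step; case: (ltgtP z u) => [zu|uz|->].
- by rewrite ltNge (ltW (br_dec HB zu uc))/= gt_eqF ?(br_dec HB zu uc)// subr0.
- by rewrite (br_dec HB uz zc) subrr.
- by rewrite ltxx eqxx; lra.
Qed.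

Let o_lt_c1 n : o n.+1 < c1.
Proof.
rewrite lt_neqAle o_le andbT; apply/eqP => E; have := o_c n.
rewrite neq_lt => /orP[h|h].
  by have := o_lt h; rewrite E (br_1c1 HB) => H; move: h; rewrite -H ltxx.
by have := o_gt h; rewrite E (br_2c1 HB) => H; move: h; rewrite -H ltxx.
Qed.

(** One branch sends o n.+1 to o n; the other stays across c, where the step at o n is constant. A
    jump therefore has a single image, and the constant -1 disappears in increments. *)
Let step_pull n x :
  step (o n) (psi1 (clampc x)) - step (o n) (psi2 (clampc x)) = step (o n.+1) x - 1.
Proof.
rewrite -(step_clampc x (o_A _) (o_lt_c1 n)); have /andP[_ zc] := clampc_itv x.
have := o_c n; rewrite neq_lt => /orP[h|h].
  rewrite -{1}(o_lt h) step_psi1// {2}/step.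
  have h1 := lt_le_trans h (psi2_ge HB zc).
  by rewrite ltNge (ltW h1)/= gt_eqF.
rewrite -{2}(o_gt h) step_psi2// {1}/step (le_lt_trans (psi1_le HB zc) h).
by ring.
Qed.

(** The variation is split into a regular part, at most [P0], and masses [m i] at the first n points
    of the orbit. Keeping the masses apart shows that they do not reach p(c). *)
Definition orbdom p P0 n (m : nat -> R) := exists P, (forall x, 0 <= P x <= P0) /\
  {homo P : x y / x <= y} /\ dominated p (fun x => P x + \sum_(i < n) m i * step (o i) x).

Lemma orbdom_bvb p P0 n m : (forall i, 0 <= m i) -> orbdom p P0 n m ->
  bvb p (P0 + \sum_(i < n) m i).
Proof.
move=> m0 [P [P01 [_ dP]]]; exists (fun x => P x + \sum_(i < n) m i * step (o i) x).
split=> // x; have /andP[h1 h2] := P01 x.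
rewrite addr_ge0 ?sumr_ge0//= => [|i _]; last by rewrite mulr_ge0//; case/andP: (step01 (o i) x).
rewrite lerD// ler_sum// => i _; have /andP[h3 h4] := step01 (o i) x.
by rewrite ler_piMr.
Qed.

(** Old masses move one step along the orbit with the factor k', and a mass 2 |p(c)| appears at o 0
    = c1. No orbit point in [c, c + d] means that only the regular part varies there, so averaging
    |p| over this interval gives |p(c)| <= P0 + N1 p / d. *)
Lemma orbdom_step k' e : k < k' -> 0 < e -> exists2 C, 0 <= C &
  forall p n m P0 d, 0 < d -> supp A B p -> orbdom p P0 n m -> (forall i, 0 <= m i) ->
  (forall i, (i < n)%N -> ~~ (c <= o i <= c + d)) ->
  orbdom (TL p) (k' * P0 + 2 * e * (P0 + \sum_(i < n) m i) * (c1 - A + 1) + C * N1 p)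
    n.+1 (fun i => if i is j.+1 then k' * m j else 2 * (P0 + N1 p / d)).
Proof.
move=> kk' e0; have [C C0 HC] := transfer_dominated kk' e0; exists C => //.
move=> p n m P0 d d0 sp op m0 od.
have k'0 : 0 <= k' by exact: le_trans hk0 (ltW kk').
have bp := orbdom_bvb m0 op; have hp := bvb_bcc bp.
have pM x : `|p x| <= P0 + \sum_(i < n) m i by exact: (supp_bvb_sup x sp bp).
have [P [P01 [hP dP]]] := op.
have [E [hE E01 dE]] := HC p _ _ hp sp pM dP.
(* P(psi1) - P(psi2) takes its values in [- P0, 0]; adding P0 restores nonnegativity without
   increasing the bound k' P0. *)
pose P' x := k' * (P (psi1 (clampc x)) - P (psi2 (clampc x)) + P0) + E x.
have pc : `|p c| <= P0 + N1 p / d.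
  have : (`|p c| - P0) * d <= N1 p.
    have cd : c <= c + d by rewrite lerDl ltW.
    apply: (@le_trans _ _ (\int[mu]_(x in `[c, c + d]) `|p x|)); last first.
      by apply: int_ge0_supp; [exact: ltW|exact: bcc_norm|exact: supp_norm|].
    have -> : (`|p c| - P0) * d = \int[mu]_(x in `[c, c + d]) (`|p c| - P0).
      by rewrite int_cst// addrAC subrr add0r.
    apply: int_le; [exact: bcc_cst|exact: bcc_norm|move=> x /andP[cx xc]].
    have := dP _ _ cx; rewrite opprD addrACA.
    rewrite (_ : \sum_(i < n) _ - \sum_(i < n) _ = 0); last first.
      rewrite -sumrB big1// => i _; rewrite -mulrBr.
      have /negP := od i (ltn_ord i); rewrite /step => oi.
      rewrite (_ : _ - _ = 0) ?mulr0//.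
      case: (ltgtP x (o i)) => [xo|ox|xo].
      - by rewrite (le_lt_trans cx xo) subrr.
      - have : o i < c by rewrite ltNge; apply/negP => co; apply: oi; rewrite co (le_trans (ltW ox) xc).
        by move=> oc; rewrite ltNge (ltW oc)/= gt_eqF// subrr.
      - by exfalso; apply: oi; rewrite -xo cx xc.
    have := lerB_dist (p c) (p x); rewrite distrC.
    by have /andP[h1 h2] := P01 x; have /andP[h3 h4] := P01 c; lra.
  by rewrite -ler_pdivlMr//; lra.
exists P'; split; [|split].
- move=> x; have /andP[e1 e2] := E01 x; rewrite /P'.
  have /andP[h1 h2] := P01 (psi1 (clampc x)); have /andP[h3 h4] := P01 (psi2 (clampc x)).
  have /andP[_ zc] := clampc_itv x.
  have h5 := hP _ _ (le_trans (psi1_le HB zc) (psi2_ge HB zc)).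
  have h6 : 0 <= P (psi1 (clampc x)) - P (psi2 (clampc x)) + P0 by lra.
  apply/andP; split; first by rewrite addr_ge0// mulr_ge0.
  have h7 : P (psi1 (clampc x)) - P (psi2 (clampc x)) + P0 <= P0 by lra.
  by rewrite -[leRHS]addrA; apply: lerD e2; exact: ler_wpM2l.
- move=> x y xy; rewrite /P' lerD ?hE// ler_wpM2l// lerD2r.
  have zz := clampc_homo xy; have /andP[_ zc] := clampc_itv y.
  by rewrite lerD ?lerN2; [|exact/hP/(psi1_homo HB)|exact/hP/(psi2_homo HB)].
move=> x y xy; apply: le_trans (dE x y xy) _.
rewrite !big_ord_recl/= o0.
pose S z := \sum_(i < n) m i * step (o i) z.
have Sp z : S (psi1 (clampc z)) - S (psi2 (clampc z)) =
    \sum_(i < n) m i * step (o i.+1) z - \sum_(i < n) m i.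
  rewrite /S -!sumrB; apply: eq_bigr => i _.
  by rewrite -mulrBr step_pull mulrBr mulr1.
have Sk z : \sum_(i < n) k' * m i * step (o (bump 0 i)) z = k' * \sum_(i < n) m i * step (o i.+1) z.
  by rewrite mulr_sumr; apply: eq_bigr => i _; rewrite mulrA.
rewrite !Sk /P'.
have Z z : k' * (P (psi1 (clampc z)) + S (psi1 (clampc z)) - (P (psi2 (clampc z)) + S (psi2 (clampc z)))) =
   k' * (P (psi1 (clampc z)) - P (psi2 (clampc z))) + k' * (S (psi1 (clampc z)) - S (psi2 (clampc z))).
  by ring.
rewrite !Z !Sp.
have : 2 * `|p c| * (step c1 y - step c1 x) <= 2 * (P0 + N1 p / d) * (step c1 y - step c1 x).
  by rewrite ler_wpM2r ?subr_ge0 ?step_homo// ler_wpM2l.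
lra.
Qed.

(** The orbit avoids c, so finitely many of its points leave a right neighbourhood of c free. As d
    depends on N, so does the constant [K] below. *)
Let o_far N : exists2 d, 0 < d & forall i, (i < N)%N -> ~~ (c <= o i <= c + d).
Proof.
elim: N => [|N [d d0 Hd]]; first by exists 1.
have [oc|co] := leP c (o N); last first.
  exists d => // i; rewrite ltnS leq_eqVlt => /orP[/eqP->|/Hd//].
  by rewrite negb_and -ltNge co.
have oc' : 0 < o N - c by rewrite subr_gt0 lt_neqAle oc eq_sym o_c.
exists (Num.min d ((o N - c) / 2)); first by rewrite lt_min d0 divr_gt0.
move=> i; rewrite ltnS leq_eqVlt => /orP[/eqP->|/Hd h].
  rewrite negb_and -!ltNge; apply/orP; right.
  have : Num.min d ((o N - c) / 2) <= (o N - c) / 2 by rewrite ge_min lexx orbT.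
  by lra.
apply: contra h => /andP[-> h]/=; apply: le_trans h _.
by rewrite lerD2l ge_min lexx.
Qed.

Lemma iter_transfer_supp p n : supp A B p -> supp A B (iter n TL p).
Proof.
move=> sp; elim: n => [|n IH]; first exact: sp.
exact: (transfer_suppAB HB IH).
Qed.

Lemma iter_transfer_bcc p n : bcc p -> bcc (iter n TL p).
Proof.
move=> hp; elim: n => [|n IH]; first exact: hp.
exact: (transfer_bcc HB IH).
Qed.

Lemma iter_transfer_int p n : bcc p -> supp A B p ->
  \int[mu]_(x in `[A, B]) iter n TL p x = \int[mu]_(x in `[A, B]) p x.
Proof.
move=> hp sp; elim: n => [|n <-]; first by [].
exact: (transfer_int HB (iter_transfer_bcc n hp) (iter_transfer_supp n sp)).
Qed.

Lemma iter_transfer_int_norm p n : bcc p -> supp A B p ->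
  \int[mu]_(x in `[A, B]) `|iter n TL p x| <= \int[mu]_(x in `[A, B]) `|p x|.
Proof.
move=> hp sp; elim: n => [|n IH]; first exact: lexx.
apply: le_trans IH.
exact: (transfer_int_norm HB (iter_transfer_bcc n hp) (iter_transfer_supp n sp)).
Qed.

(* Jumps are created at c1 only, with a size controlled by the value at c, and
   the orbit of c1 takes long to come back near c: weighting them by a small
   factor mu0 makes the pair (regular part, jumps) contract. *)
Lemma lasota_yorke_aux : exists mu0 theta, [/\ 0 < mu0, mu0 <= 1, 0 < theta, theta < 1 &
  forall N, exists2 K, 0 <= K & forall p v, supp A B p -> bvb p v ->
  forall n, (n <= N)%N -> exists P0 m, [/\ orbdom (iter n TL p) P0 n m, 0 <= P0,
    forall i, 0 <= m i &
    P0 + mu0 * \sum_(i < n) m i <= theta ^+ n * v + K * n%:R * N1 p]].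
Proof.
(* The regular part receives k' P0, at most mu0 P0 from the distortion and 2 mu0 P0 from the new
   jump; k' + 3 mu0 <= th. *)
pose k' := (1 + k) / 2; pose th := (1 + k') / 2; pose mu0 := (th - k') / 4.
have kk' : k < k' by rewrite /k'; have := hk1; lra.
have k'1 : k' < 1 by rewrite /k'; have := hk1; lra.
have k'0 : 0 < k' by rewrite /k'; have := hk0; lra.
have th1 : th < 1 by rewrite /th; lra.
have th0 : 0 < th by rewrite /th; lra.
have kth : k' < th by rewrite /th; lra.
have mu00 : 0 < mu0 by rewrite /mu0; lra.
pose L := c1 - A + 1.
have L0 : 0 < L by rewrite /L; have := hAc1; lra.
(* The distortion error is then mu0 (th - k') (P0 + S); with the contracted masses mu0 k' S, the
   part in S is exactly th mu0 S. *)
pose e := mu0 * (th - k') / (2 * L).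
have e0 : 0 < e by rewrite /e !mulr_gt0 ?invr_gt0 ?mulr_gt0//; lra.
have eL : 2 * e * L = mu0 * (th - k') by rewrite /e; field; rewrite gt_eqF.
have [C C0 HC] := orbdom_step kk' e0.
exists mu0, th; split => //; first by rewrite /mu0; lra.
move=> N; have [d d0 Hd] := o_far N.
have K0 : 0 <= C + 2 * mu0 / d.
  apply: addr_ge0 => //; apply: divr_ge0; last exact: ltW.
  by apply: mulr_ge0 => //; exact: ltW.
exists (C + 2 * mu0 / d) => // p v sp bp; have hp := bvb_bcc bp.
have N10 : 0 <= N1 p by apply: int_ge0.
have v0 := bvb_ge0 bp.
elim=> [_|n IH nN].
  have [V [V01 dV]] := bp; exists v, (fun=> 0); split => //.
    exists V; split => //; split; first exact: dominated_ge dV.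
    by move=> x y xy; rewrite !big_ord0 !addr0; exact: dV.
  by rewrite big_ord0; lra.
have [P0 [m [op P00 m0 Hle]]] := IH (ltnW nN).
have spn := iter_transfer_supp n sp.
have N1n : N1 (iter n TL p) <= N1 p by exact: iter_transfer_int_norm.
have oi i : (i < n)%N -> ~~ (c <= o i <= c + d) by move=> /leq_trans h; apply/Hd/h/ltnW.
have := HC _ n m P0 d d0 spn op m0 oi.
set P' := (X in orbdom _ X _ _); set m' := (X in orbdom _ _ _ X) => op'.
exists P', m'; split => //.
- have S0 : 0 <= \sum_(i < n) m i by apply: sumr_ge0.
  have a1 : 0 <= 2 * e * (P0 + \sum_(i < n) m i) * L.
    apply: mulr_ge0 (ltW L0); apply: mulr_ge0; last exact: addr_ge0.
    by apply: mulr_ge0 (ltW e0).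
  have a2 : 0 <= C * N1 (iter n TL p) by apply: mulr_ge0 => //; apply: int_ge0.
  have a3 : 0 <= k' * P0 by apply: mulr_ge0 => //; exact: ltW.
  by apply: addr_ge0 a2; apply: addr_ge0 a1.
- move=> [|i] /=; last by rewrite mulr_ge0// ltW.
  by rewrite mulr_ge0// addr_ge0// divr_ge0 ?(ltW d0)//; apply: int_ge0.
rewrite big_ord_recl/=.
have -> : \sum_(i < n) k' * m i = k' * \sum_(i < n) m i by rewrite mulr_sumr.
rewrite /P' -/L; set S := \sum_(i < n) m i in Hle *; set n1 := N1 (iter n TL p) in N1n *.
have S0 : 0 <= S by apply: sumr_ge0.
have t1 : 2 * e * (P0 + S) * L = mu0 * (th - k') * (P0 + S) by rewrite -eL; ring.
have t2 : mu0 * (2 * (P0 + n1 / d) + k' * S) = 2 * mu0 * P0 + 2 * mu0 / d * n1 + mu0 * k' * S.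
  by field; rewrite gt_eqF.
rewrite t1 t2.
have t3 : (C + 2 * mu0 / d) * n1 <= (C + 2 * mu0 / d) * N1 p by rewrite ler_wpM2l.
have t4 : th * (P0 + mu0 * S) <= th * (th ^+ n * v + (C + 2 * mu0 / d) * n%:R * N1 p).
  by rewrite ler_wpM2l// ltW.
have t5 : th * ((C + 2 * mu0 / d) * n%:R * N1 p) <= (C + 2 * mu0 / d) * n%:R * N1 p.
  by rewrite ler_piMl ?(ltW th1)// !mulr_ge0.
have t6 : mu0 * (th - k') * P0 <= mu0 * P0 by rewrite ler_wpM2r// ler_piMr ?(ltW mu00)//; lra.
have t7 : k' * P0 + mu0 * P0 + 2 * mu0 * P0 <= th * P0.
  by rewrite -!mulrDl ler_wpM2r// /mu0; lra.
rewrite exprS -natr1; lra.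
Qed.

(** Returning from the weighted sum P0 + mu0 S to the variation P0 + S costs a factor 1 / mu0, which
    a large number of iterates compensates. *)
Lemma lasota_yorke : exists N D, [/\ (0 < N)%N, 0 <= D & forall p v, supp A B p -> bvb p v ->
  bvb (iter N TL p) (v / 2 + D * \int[mu]_(x in `[A, B]) `|p x|)].
Proof.
have [mu0 [th [m0 m1 th0 th1 H]]] := lasota_yorke_aux.
have : (fun n => th ^+ n) @ \oo --> (0 : R).
  by apply: cvg_expr; rewrite ger0_norm// ltW.
(* N is such that th ^+ N.+1 <= mu0 / 2; the successor makes the number of iterates positive. *)
move=> /cvgrPdist_le/(_ (mu0 / 2)) [|N _ HN]; first by rewrite divr_gt0.
have {HN} := HN N.+1 (leqnSn _); rewrite /= sub0r normrN ger0_norm ?exprn_ge0 ?(ltW th0)// => HN.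
have [K K0 HK] := H N.+1; exists N.+1, (K * N.+1%:R / mu0); split => //.
  by rewrite divr_ge0 ?mulr_ge0// ltW.
move=> p v sp bp; have [P0 [m [op P00 mm0 Hle]]] := HK p v sp bp N.+1 (leqnn _).
apply: bvb_le (orbdom_bvb mm0 op); have v0 := bvb_ge0 bp.
set S := \sum_(i < N.+1) m i in Hle *; set n1 := \int[mu]_(x in _) _.
have S0 : 0 <= S by apply: sumr_ge0.
rewrite -(ler_pM2l m0) mulrDr.
have -> : mu0 * (v / 2 + K * N.+1%:R / mu0 * n1) = mu0 / 2 * v + K * N.+1%:R * n1.
  by field; rewrite gt_eqF.
have t1 : th ^+ N.+1 * v <= mu0 / 2 * v by rewrite ler_wpM2r.
have t2 : mu0 * P0 <= P0 by rewrite ler_piMl.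
by move: Hle; rewrite -[N1 p]/n1; lra.
Qed.

Lemma int_norm_bvb p v : supp A B p -> bvb p v ->
  \int[mu]_(x in `[A, B]) `|p x| <= (B - A) * v.
Proof.
move=> sp bp; rewrite mulrC; have hp := bvb_bcc bp.
apply: le_trans (ler_norm _) _; apply: int_norm_le; [exact: ltW|exact: bcc_norm|].
by move=> x _; rewrite normr_id; exact: (supp_bvb_sup x sp bp).
Qed.

(** A crude bound for one step, for the iterates left over after division by the N of
    [lasota_yorke]. *)
Lemma transfer_bvb : exists2 K, 1 <= K & forall p v, supp A B p -> bvb p v -> bvb (TL p) (K * v).
Proof.
have [mu0 [th [m0 m1 th0 th1 H]]] := lasota_yorke_aux.
have [K K0 HK] := H 1%N; exists ((1 + K * (B - A)) / mu0).
  have : 0 <= K * (B - A) by rewrite mulr_ge0// subr_ge0 ltW.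
  by move=> ?; rewrite ler_pdivlMr//; lra.
move=> p v sp bp; have [P0 [m [op P00 mm0 Hle]]] := HK p v sp bp 1%N (leqnn _).
apply: bvb_le (orbdom_bvb mm0 op); have v0 := bvb_ge0 bp.
have h := int_norm_bvb sp bp.
set S := \sum_(i < 1) m i in Hle *; set n1 := N1 p in Hle.
have S0 : 0 <= S by apply: sumr_ge0.
rewrite -(ler_pM2l m0) mulrDr.
have -> : mu0 * ((1 + K * (B - A)) / mu0 * v) = v + K * ((B - A) * v).
  by field; rewrite gt_eqF.
have t1 : th ^+ 1 * v <= v by rewrite expr1 ler_piMl// ltW.
have t2 : mu0 * P0 <= P0 by rewrite ler_piMl.
have t3 : K * n1 <= K * ((B - A) * v) by rewrite ler_wpM2l.
by move: Hle; rewrite mulr1; lra.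
Qed.

Lemma iter_transfer_bvb_le : exists2 K, 1 <= K & forall n p v, supp A B p -> bvb p v ->
  bvb (iter n TL p) (K ^+ n * v).
Proof.
have [K K1 HK] := transfer_bvb; exists K => // n p v sp bp.
elim: n => [|n IH] /=; first by rewrite mul1r.
by rewrite exprS -mulrA; apply: HK => //; exact: iter_transfer_supp.
Qed.

Lemma lasota_yorke_iter : exists N D, [/\ (0 < N)%N, 0 <= D & forall p v j, supp A B p -> bvb p v ->
  bvb (iter (j * N) TL p) (v / 2 ^+ j + D * \int[mu]_(x in `[A, B]) `|p x|)].
Proof.
(* The L^1 terms D, D / 2, D / 4, ... add up to at most 2 D, because the L^1 norm does not grow. *)
have [N [D [N0 D0 H]]] := lasota_yorke; exists N, (2 * D); split=> //; first exact: mulr_ge0.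
move=> p v j sp bp; have hp := bvb_bcc bp.
have n0 : 0 <= \int[mu]_(x in `[A, B]) `|p x| by apply: int_ge0.
elim: j => [|j IH].
  by rewrite mul0n/= expr0 divr1; apply: bvb_le bp; rewrite lerDl !mulr_ge0.
rewrite mulSn iterD; apply: bvb_le (H _ _ (iter_transfer_supp _ sp) IH).
have : D * \int[mu]_(x in `[A, B]) `|iter (j * N) TL p x| <= D * \int[mu]_(x in `[A, B]) `|p x|.
  by rewrite ler_wpM2l// iter_transfer_int_norm.
have -> : v / 2 ^+ j.+1 = v / 2 ^+ j / 2 by rewrite exprSr invfM mulrA.
lra.
Qed.

Lemma transfer_power_bounded : exists2 K, 1 <= K & forall n p v, supp A B p -> bvb p v ->
  bvb (iter n TL p) (K * v).
Proof.
have [N [D [N0 D0 H]]] := lasota_yorke_iter; have [K K1 HK] := iter_transfer_bvb_le.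
pose G := 1 + D * (B - A); have G1 : 1 <= G by rewrite lerDl mulr_ge0// subr_ge0 ltW.
have KN1 : 1 <= K ^+ N by rewrite exprn_ege1.
exists (K ^+ N * G); first by rewrite -[1]mulr1 ler_pM.
move=> n p v sp bp; have v0 := bvb_ge0 bp.
have aux j : bvb (iter (j * N) TL p) (G * v).
  apply: bvb_le (H p v j sp bp); rewrite mulrDl mul1r lerD//.
    by rewrite ler_pdivrMr ?exprn_gt0// ler_peMr// exprn_ege1// ler1n.
  by rewrite -mulrA ler_wpM2l// int_norm_bvb.
rewrite (divn_eq n N) addnC iterD -mulrA.
apply: bvb_le (HK (n %% N)%N _ _ (iter_transfer_supp _ sp) (aux _)).
rewrite ler_wpM2r ?mulr_ge0//; first by rewrite (le_trans _ G1).
by apply: ler_weXn2l => //; rewrite ltnW// ltn_mod.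
Qed.

End lasota_yorke.

(** * Spectral gap *)

Section spectral_gap.
Context {R : realType}.
Variables (A B c c1 k : R) (psi1 psi2 w1 w2 : R -> R) (o : nat -> R).
Hypothesis HB : branches A B c c1 k psi1 psi2 w1 w2.
Hypothesis o0 : o 0 = c1.
Hypothesis o_le : forall n, o n <= c1.
Hypothesis o_A : forall n, A <= o n.
Hypothesis o_c : forall n, o n != c.
Hypothesis o_lt : forall n, o n < c -> psi1 (o n.+1) = o n.
Hypothesis o_gt : forall n, c < o n -> psi2 (o n.+1) = o n.
(** [F] is the forward map on the core [c2, c1], where the weights are at least [lam]. The window
    [q1, q2] will be taken inside the open core, since mixing covers only such windows in finite
    time. *)
Variables (c2 q1 q2 lam : R) (F : R -> R).
Hypothesis Ac2 : A < c2.
Hypothesis c2c : c2 < c.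
Hypothesis psi2c2 : psi2 c2 = c1.
Hypothesis F_core : forall y, c2 <= y <= c1 -> c2 <= F y <= c1.
Hypothesis lam0 : 0 < lam.
Hypothesis F_left : forall y, c2 <= y <= c -> psi1 (F y) = y /\ lam <= w1 (F y).
Hypothesis F_right : forall y, c <= y <= c1 -> psi2 (F y) = y /\ lam <= w2 (F y).
Hypothesis q12 : q1 < q2.
Hypothesis Aq1 : A <= q1.
Hypothesis q2B : q2 <= B.
Hypothesis F_mix : forall u v, c2 <= u -> u < v -> v <= c1 -> exists N, forall n, (N <= n)%N ->
  forall x, q1 <= x <= q2 -> exists2 y, u <= y <= v & iter n F y = x.
Implicit Types (p q V : R -> R) (x y u v : R).
Notation mu := (@lebesgue_measure R).
Notation TL := (transfer c1 psi1 psi2 w1 w2).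
Notation N1 p := (\int[mu]_(x in `[A, B]) `|p x|).
Let hAc : A < c. Proof. exact: br_Ac HB. Qed.
Let hcc1 : c < c1. Proof. exact: br_cc1 HB. Qed.
Let hc1B : c1 < B. Proof. exact: br_c1B HB. Qed.
Let hk0 : 0 <= k. Proof. exact: br_k0 HB. Qed.
Let hk1 : k < 1. Proof. exact: br_k1 HB. Qed.
Let hAB : A < B. Proof. exact: br_AB HB. Qed.
Let hAc1 : A < c1. Proof. exact: br_Ac1 HB. Qed.
Let hc2c1 : c2 < c1. Proof. exact: lt_trans c2c hcc1. Qed.
Local Hint Resolve hAc hcc1 hc1B hk0 hk1 hAB hAc1 hc2c1 lam0 : core.

Lemma iter_transfer_ge0 n p : (forall x, 0 <= p x) -> forall x, 0 <= iter n TL p x.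
Proof.
move=> p0; elim: n => [|n IH]; first exact: p0.
exact: (transfer_ge0 HB IH).
Qed.

Lemma iter_transferB n p q :
  iter n TL (fun x => p x - q x) = (fun x => iter n TL p x - iter n TL q x).
Proof. by elim: n => // n IH; rewrite !iterS IH transferB. Qed.

Lemma iter_transferD n p q :
  iter n TL (fun x => p x + q x) = (fun x => iter n TL p x + iter n TL q x).
Proof. by elim: n => // n IH; rewrite !iterS IH transferD. Qed.

Lemma iter_transferZ n r p : iter n TL (fun x => r * p x) = (fun x => r * iter n TL p x).
Proof. by elim: n => // n IH; rewrite !iterS IH transferZ. Qed.

(* Points to the left of the core have no preimage beyond c1: there the
   operator is a mere contraction. *)
Lemma outside_decay p M n x : supp A B p -> (forall x, `|TL p x| <= M) -> x < c2 ->
  `|iter n.+1 TL p x| <= k ^+ n * M.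
Proof.
move=> sp pM; elim: n x => [|n IH] x xc2.
  by rewrite expr0 mul1r; exact: pM.
rewrite iterS; set q := iter n.+1 TL p in IH *.
have sq : supp A c1 q by exact: (transfer_supp HB (iter_transfer_supp HB n sp)).
have xc1 : x < c1 by exact: lt_trans hc2c1.
have M0 : 0 <= M by exact: le_trans (pM 0).
have h2 : q (psi2 x) = 0.
  apply: sq; rewrite negb_and -!ltNge; apply/orP; right.
  by rewrite -psi2c2; apply: (br_dec HB) => //; exact: ltW.
rewrite /transfer h2 mulr0 addr0 cut_lt// mul1r normrM exprS -mulrA.
apply: ler_pM => //; first exact: (w1_norm HB (ltW xc1)).
apply: IH; have [xA|Ax] := leP x A.
  apply: le_lt_trans Ac2; rewrite -(br_A HB).
  exact: (psi1_homo HB xA (ltW hAc1)).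
have := br_lip1 HB (ltW Ax) (ltW xc1); rewrite (br_A HB) ler_norml => /andP[_ h].
have : k * (x - A) <= x - A by rewrite ler_piMl ?subr_ge0// ltW.
by lra.
Qed.

(** All terms are nonnegative, so only the preimage on the orbit of y is kept; the factor 1/2 is the
    value of the cut at [c1]. *)
Lemma iter_transfer_lower n p y : (forall x, 0 <= p x) -> c2 <= y <= c1 ->
  (lam / 2) ^+ n * p y <= iter n TL p (iter n F y).
Proof.
move=> p0 yc; elim: n => [|n IH]; first by rewrite mul1r.
have zc : c2 <= iter n F y <= c1 by elim: n {IH} => //= n; exact: F_core.
rewrite !iterS; set z := iter n F y in IH zc *; set q := iter n TL p in IH *.
have q0 x : 0 <= q x by exact: iter_transfer_ge0.
have /andP[_ Fz1] := F_core zc.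
have cutF : 2^-1 <= cut c1 (F z).
  rewrite /cut; case: ltP => h; first by lra.
  by rewrite (_ : F z == c1) ?lexx//; apply/eqP/le_anti; rewrite Fz1 h.
have [g1 g2] := cutw_ge0 HB (F z).
rewrite exprS -mulrA.
apply: (@le_trans _ _ (lam / 2 * q z)).
  by apply: ler_wpM2l IH; apply: divr_ge0 => //; exact: ltW.
case/andP: zc => z1 z2; have [zc|cz] := leP z c.
  have [E lw] := F_left (introT andP (conj z1 zc)).
  rewrite /transfer E; apply: (@le_trans _ _ (cut c1 (F z) * w1 (F z) * q z)).
    by apply: ler_wpM2r => //; rewrite mulrC ler_pM// ltW.
  by rewrite lerDl mulr_ge0.
have [E lw] := F_right (introT andP (conj (ltW cz) z2)).
rewrite /transfer E; apply: (@le_trans _ _ (cut c1 (F z) * w2 (F z) * q z)).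
  by apply: ler_wpM2r => //; rewrite mulrC ler_pM// ltW.
by rewrite lerDr mulr_ge0.
Qed.

(** On each piece p is below eta somewhere, hence below eta plus the variation on the piece; in the
    sum the variation carries only the factor h. By contraposition, a large mass forces p >= eta on
    a whole piece. *)
Lemma pigeonhole p V (h eta : R) n : dominated p V -> bcc p -> 0 <= h ->
  (forall i, (i < n)%N -> exists2 t, c2 + i%:R * h <= t <= c2 + i.+1%:R * h & p t < eta) ->
  \int[mu]_(x in `[c2, c2 + n%:R * h]) p x <=
    n%:R * h * eta + h * (V (c2 + n%:R * h) - V c2).
Proof.
move=> dV hp h0; elim: n => [|n IH] Hi.
  by rewrite mul0r addr0 (int_empty _ (lexx _)) subrr !mul0r mulr0 addr0.
have [t /andP[t1 t2] tp] := Hi n (ltnSn n).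
have a1 : c2 <= c2 + n%:R * h by rewrite lerDl mulr_ge0.
have a2 : c2 + n%:R * h <= c2 + n.+1%:R * h by exact: le_trans t2.
rewrite (int_split a1 a2 hp).
have := IH (fun i h => Hi i (ltnW h)).
set u := c2 + n%:R * h in t1 a1 a2 *; set v := c2 + n.+1%:R * h in t2 a2 *.
have vu : v - u = h by rewrite /v /u -natr1; ring.
have : \int[mu]_(x in `[u, v]) p x <= (eta + (V v - V u)) * h.
  rewrite -[X in _ * X]vu -(int_cst _ a2).
  apply: (int_le hp (bcc_cst (eta + (V v - V u)))) => x /andP[ux xv].
  have : p x - p t <= V v - V u.
    have [tx|/ltW xt] := leP t x.
      have := dV _ _ tx; have := dominated_ge dV xv; have := dominated_ge dV t1.
      by rewrite ler_norml => ? ? /andP[_ ?]; lra.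
    have := dV _ _ xt; have := dominated_ge dV t2; have := dominated_ge dV ux.
    by rewrite ler_norml => ? ? /andP[? _]; lra.
  by rewrite /cst; lra.
rewrite -natr1; lra.
Qed.

(** After m0 + 1 steps at least half of the mass is in the core; [pigeonhole] yields a piece where
    the density is at least m / (4 L), and mixing spreads this piece over [q1, q2]. Pieces and times
    depend on D' but not on p, so d is uniform. *)
Lemma doeblin D' : 0 <= D' -> exists n1, forall n, (n1 <= n)%N -> exists2 d, 0 < d &
  forall p m, 0 <= m -> (forall x, 0 <= p x) -> supp A B p -> bvb p (D' * m) ->
  \int[mu]_(x in `[A, B]) p x = m -> forall x, q1 <= x <= q2 -> d * m <= iter n TL p x.
Proof.
move=> D'0.
have [K K1 HK] := transfer_power_bounded HB o0 o_le o_A o_c o_lt o_gt.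
have K0 : 0 <= K by exact: le_trans K1.
pose L := c1 - c2; have L0 : 0 < L by rewrite subr_gt0.
(* After [m0] further steps the mass to the left of the core is at most m / 2; one initial step
   brings the support into [A, c1]. *)
have [m0 Hm0] : exists m0 : nat, k ^+ m0 * (K * D' * (c2 - A)) <= 2^-1.
  have : (fun n => k ^+ n * (K * D' * (c2 - A))) @ \oo --> (0 : R).
    rewrite -[X in _ --> X](mul0r (K * D' * (c2 - A))); apply: cvgM; last exact: cvg_cst.
    by apply: cvg_expr; rewrite ger0_norm.
  move=> /cvgrPdist_le/(_ 2^-1) [|N _ HN]; first by rewrite invr_gt0.
  exists N; have := HN N (leqnn _); rewrite /= sub0r normrN; apply: le_trans.
  exact: ler_norm.
(* With this many pieces the variation contributes at most m / 8 in [pigeonhole]. *)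
have [N1' HN1] : exists n : nat, L * (K * D') <= n.+1%:R / 8.
  exists (Num.truncn (L * (K * D') * 8)).
  by rewrite ler_pdivlMr// ltW// truncnS_gt.
pose n2 := N1'.+1; pose h := L / n2%:R.
have h0 : 0 < h by rewrite divr_gt0.
have n2h : n2%:R * h = L by rewrite /h mulrC divfK// pnatr_eq0.
have hKD : h * (K * D') <= 8^-1.
  have -> : h * (K * D') = L * (K * D') / n2%:R by rewrite /h mulrAC.
  by rewrite ler_pdivrMr ?ltr0n// [leRHS]mulrC.
(* The pieces being finite in number, a single time serves all of them. *)
have pieces j : (j <= n2)%N -> exists Nm, forall n, (Nm <= n)%N -> forall i, (i < j)%N ->
    forall x, q1 <= x <= q2 -> exists2 y, c2 + i%:R * h <= y <= c2 + i.+1%:R * h & iter n F y = x.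
  elim: j => [_|j IH jn]; first by exists 0%N.
  have [Nm Hm] := IH (ltnW jn).
  have b1 : c2 <= c2 + j%:R * h by rewrite lerDl mulr_ge0// ltW.
  have b2 : c2 + j%:R * h < c2 + j.+1%:R * h by rewrite ltrD2l ltr_pM2r// ltr_nat.
  have b3 : c2 + j.+1%:R * h <= c1.
    have : j.+1%:R * h <= L by rewrite -n2h ler_wpM2r ?(ltW h0)// ler_nat.
    by rewrite /L; lra.
  have [Nj Hj] := F_mix b1 b2 b3.
  exists (maxn Nm Nj) => n; rewrite geq_max => /andP[n1 n3] i.
  rewrite ltnS leq_eqVlt => /orP[/eqP->|ij]; first exact: Hj.
  exact: Hm.
have [Nm Hm] := pieces n2 (leqnn _).
(* If every piece had a point below eta m, the core would carry at most m / 4 + m / 8, less than m /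
   2. *)
pose eta := (4 * L)^-1.
have eta0 : 0 < eta by rewrite invr_gt0 mulr_gt0.
have etaL : L * eta = 4^-1 by rewrite /eta; field; rewrite gt_eqF.
exists (Nm + m0.+1)%N => n nn.
pose s := (n - m0.+1)%N.
have ns : n = (s + m0.+1)%N by rewrite /s subnK// (leq_trans _ nn)// leq_addl.
have Nms : (Nm <= s)%N by rewrite /s leq_subRL ?(leq_trans _ nn) ?leq_addl// addnC.
exists ((lam / 2) ^+ s * eta).
  by rewrite mulr_gt0// exprn_gt0// divr_gt0.
move=> p m mge p0 sp bp intp x xq.
have [m_0|mgt] := leP m 0.
  have -> : m = 0 by apply/le_anti; rewrite m_0 mge.
  by rewrite mulr0; exact: iter_transfer_ge0.
rewrite ns iterD; set r := iter m0.+1 TL p.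
have r0 y : 0 <= r y by exact: iter_transfer_ge0.
have br : bvb r (K * (D' * m)) by exact: HK.
have hr := bvb_bcc br; have hp := bvb_bcc bp.
have sr : supp A c1 r by exact: (transfer_supp HB (iter_transfer_supp HB m0 sp)).
have intr : \int[mu]_(x in `[A, B]) r x = m by rewrite -intp; exact: (iter_transfer_int HB).
have i1 : \int[mu]_(x in `[A, c2]) r x <= m / 2.
  have b1 : bvb (TL p) (K * (D' * m)) by exact: (HK 1%N).
  have M1 y : `|TL p y| <= K * (D' * m).
    exact: (supp_bvb_sup y (transfer_suppAB HB sp) b1).
  (* The factor 1 - g discards the end point [c2], which the estimate for x < c2 does not cover. *)
  pose g y : R := if c2 <= y then 1 else 0.
  have hg : bcc g := bvb_bcc (bvb_ge c2).
  have hrg : bcc (fun y => r y * (1 - g y)) := bccM hr (bccB (bcc_cst 1) hg).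
  have : \int[mu]_(x in `[A, c2]) r x <= k ^+ m0 * (K * (D' * m)) * (c2 - A).
    have -> : \int[mu]_(x in `[A, c2]) r x = \int[mu]_(x in `[A, c2]) (r x * (1 - g x)).
      apply: (int_eq_countable hr hrg (countable0 _)).
      by move=> y /andP[_ yc] _; rewrite /g leNgt yc/= subr0 mulr1.
    rewrite -(int_cst _ (ltW Ac2)).
    apply: (int_le hrg (bcc_cst _)).
    move=> y _; have b0 : 0 <= k ^+ m0 * (K * (D' * m)).
      by apply: mulr_ge0; [exact: exprn_ge0|exact: le_trans (normr_ge0 _) (M1 0)].
    rewrite /g; case: ifPn => [_|]; first by rewrite subrr mulr0.
    rewrite -ltNge => yc; rewrite subr0 mulr1; apply: le_trans (ler_norm _) _.
    exact: outside_decay.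
  have : k ^+ m0 * (K * (D' * m)) * (c2 - A) <= m / 2.
    have -> : k ^+ m0 * (K * (D' * m)) * (c2 - A) = k ^+ m0 * (K * D' * (c2 - A)) * m by ring.
    by rewrite mulrC ler_wpM2l.
  by lra.
have i2 : m / 2 <= \int[mu]_(x in `[c2, c1]) r x.
  move: intr; rewrite (@int_split _ r A c2 B)//; [|exact: ltW|exact: ltW (lt_trans hc2c1 hc1B)].
  rewrite (@int_split _ r c2 c1 B)//; [|exact: ltW|exact: ltW].
  rewrite [X in _ + (_ + X)]int_zero//; first by lra.
  by move=> y /andP[y1 _]; apply: sr; rewrite negb_and -!ltNge y1 orbT.
have [V [V01 dV]] := br.
have [i [iN Hi]] : exists i, (i < n2)%N /\ forall t, c2 + i%:R * h <= t <= c2 + i.+1%:R * h -> eta * m <= r t.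
  apply: contrapT => H.
  have H' i : (i < n2)%N -> exists2 t, c2 + i%:R * h <= t <= c2 + i.+1%:R * h & r t < eta * m.
    move=> iN; apply: contrapT => H'; apply: H; exists i; split => // t tt.
    by rewrite leNgt; apply/negP => rt; apply: H'; exists t.
  have := pigeonhole dV hr (ltW h0) H'; rewrite n2h.
  have -> : c2 + L = c1 by rewrite /L; ring.
  have -> : L * (eta * m) = m / 4 by rewrite mulrA etaL; ring.
  have /andP[v1 v2] := V01 c1; have /andP[v3 v4] := V01 c2.
  have : h * (V c1 - V c2) <= h * (K * (D' * m)) by rewrite ler_wpM2l ?(ltW h0)//; lra.
  have -> : h * (K * (D' * m)) = h * (K * D') * m by ring.
  have : h * (K * D') * m <= 8^-1 * m by rewrite ler_wpM2r.
  by move: i2; lra.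
have [y yi Fy] := Hm s Nms i iN x xq.
have yc : c2 <= y <= c1.
  case/andP: yi => y1 y2; apply/andP; split.
    by apply: le_trans y1; rewrite lerDl mulr_ge0// ltW.
  apply: le_trans y2 _; have : i.+1%:R * h <= L by rewrite -n2h ler_wpM2r ?(ltW h0)// ler_nat.
  by rewrite /L; lra.
rewrite -Fy; apply: le_trans (iter_transfer_lower s r0 yc).
by rewrite -mulrA ler_wpM2l ?Hi// exprn_ge0// divr_ge0// ltW.
Qed.

Lemma int_ind : \int[mu]_(x in `[A, B]) ind q1 q2 x = q2 - q1.
Proof.
have hi := bvb_bcc (bvb_ind (ltW q12)).
have si : supp q1 q2 (ind q1 q2) by move=> x h; rewrite /ind (negbTE h).
rewrite (int_supp (ltW q12) Aq1 q2B hi si).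
rewrite (@int_eq _ _ (cst 1)) => [|x h]; last by rewrite /ind h.
by rewrite /cst int_cst ?mul1r// ltW.
Qed.

(** If v is large compared with the L^1 norm a, the Lasota-Yorke inequality decreases e v. Otherwise
    the positive and negative parts of p both have mass a / 2 and controlled variation; [doeblin]
    bounds both images below by the same constant on [q1, q2], and this common part cancels in
    L^1. *)
Lemma contraction : exists n g e, [/\ (0 < n)%N, 0 < g, g < 1 & 0 < e <= 1] /\ (
  forall p v, supp A B p -> bvb p v -> \int[mu]_(x in `[A, B]) p x = 0 ->
  exists v', bvb (iter n TL p) v' /\ N1 (iter n TL p) + e * v' <= g * (N1 p + e * v)).
Proof.
have [N [D [N0 D0 H]]] := lasota_yorke_iter HB o0 o_le o_A o_c o_lt o_gt.
(* v > D1 a gives both D a <= v / 4 and a <= v. *)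
pose D1 := 4 * D + 1.
have D10 : 0 <= 2 * D1 by rewrite /D1; lra.
have [n1 Hn1] := doeblin D10.
(* The + 2 gives at least two halvings, hence v / 4; as N > 0, also n >= n1. *)
pose j := n1.+2; pose n := (j * N)%N.
have n1n : (n1 <= n)%N by rewrite /n (leq_trans (leq_pmulr _ N0))// leq_mul2r /j (leq_trans (leqnSn _))// orbT.
have [d d0 Hd] := Hn1 n n1n.
pose del := Num.min 1 (d * (q2 - q1)).
have del0 : 0 < del by rewrite lt_min ltr01/= mulr_gt0// subr_gt0.
have del1 : del <= 1 by rewrite ge_min lexx.
have deld : del <= d * (q2 - q1) by rewrite ge_min lexx orbT.
(* The L^1 norm loses del a; this e makes the term e D a of the new variation cost at most half of
   that. *)
pose e := del / (2 * (D + 1)).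
have D1pos : 0 < 2 * (D + 1) by lra.
have e0 : 0 < e by rewrite divr_gt0.
have eD : e * (D + 1) = del / 2 by rewrite /e; field; rewrite gt_eqF//; lra.
have e1 : e <= del / 2 by rewrite -eD ler_peMr ?(ltW e0)//; lra.
exists n, (1 - e / 4), e; split.
  by split; [rewrite muln_gt0|lra|lra|apply/andP; split; lra].
move=> p v sp bp intp; have hp := bvb_bcc bp; have v0 := bvb_ge0 bp.
have ev : 0 <= e * v by exact: mulr_ge0 (ltW e0) v0.
have bn := H p v j sp bp; set a := N1 p in bn *.
have a0 : 0 <= a by apply: int_ge0.
have v4 : v / 2 ^+ j <= v / 4.
  rewrite ler_wpM2l// lef_pV2 ?posrE ?exprn_gt0// /j 2!exprS mulrA.
  by rewrite (_ : 2 * 2 = 4 :> R) ?ler_peMr ?exprn_ege1//; lra.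
exists (v / 4 + D * a); split; first by apply: bvb_le bn; rewrite lerD2r.
have na : N1 (iter n TL p) <= a by exact: (iter_transfer_int_norm HB).
have [vD|Dv] := leP v (D1 * a); last first.
  have Da : 4 * (D * a) + a <= v by move: Dv; rewrite /D1; lra.
  have t1 : e * (v / 4 + D * a) <= e * (v / 2) by rewrite ler_wpM2l ?(ltW e0)//; lra.
  have t2 : e / 4 * a <= e / 4 * v by rewrite ler_wpM2l//; [lra|nra].
  have t3 : e / 4 * (e * v) <= 1 / 4 * (e * v) by apply: (ler_wpM2r ev); lra.
  by lra.
have key : N1 (iter n TL p) <= (1 - del) * a.
  pose pp x := 2^-1 * (`|p x| + p x); pose pm x := 2^-1 * (`|p x| - p x).
  have pp0 x : 0 <= pp x.
    by rewrite mulr_ge0// -lerBlDr sub0r; have := ler_norm (- p x); rewrite normrN.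
  have pm0 x : 0 <= pm x by rewrite mulr_ge0// subr_ge0 ler_norm.
  have bpp : bvb pp (2 * D1 * (a / 2)).
    apply: bvb_le (bvbZ 2^-1 (bvbD (bvb_norm bp) bp)).
    by rewrite ger0_norm//; lra.
  have bpm : bvb pm (2 * D1 * (a / 2)).
    apply: bvb_le (bvbZ 2^-1 (bvbB (bvb_norm bp) bp)).
    by rewrite ger0_norm//; lra.
  have spp : supp A B pp by apply/suppZ/suppD => //; exact: supp_norm.
  have spm : supp A B pm by apply/suppZ/suppB => //; exact: supp_norm.
  have hn := bcc_norm hp.
  have ip : \int[mu]_(x in `[A, B]) pp x = a / 2.
    by rewrite (intZ _ _ _ (bccD hn hp)) (intD _ _ hn hp) intp -/a; lra.
  have im : \int[mu]_(x in `[A, B]) pm x = a / 2.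
    by rewrite (intZ _ _ _ (bccB hn hp)) (intB _ _ hn hp) intp -/a; lra.
  have a20 : 0 <= a / 2 by lra.
  have Hp := Hd pp (a / 2) a20 pp0 spp bpp ip.
  have Hm := Hd pm (a / 2) a20 pm0 spm bpm im.
  have Ep : p = (fun x => pp x - pm x).
    by apply/funext => x; rewrite /pp /pm; lra.
  pose I x := d * (a / 2) * ind q1 q2 x.
  have bi : bcc I by apply: bccZ; exact: bvb_bcc (bvb_ind (ltW q12)).
  have Ip x : I x <= iter n TL pp x.
    rewrite /I /ind; case: ifP => [/Hp|_]; first by rewrite mulr1.
    by rewrite mulr0; exact: iter_transfer_ge0.
  have Im x : I x <= iter n TL pm x.
    rewrite /I /ind; case: ifP => [/Hm|_]; first by rewrite mulr1.
    by rewrite mulr0; exact: iter_transfer_ge0.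
  have hpp := bvb_bcc bpp; have hpm := bvb_bcc bpm.
  have hnp := iter_transfer_bcc HB n hpp; have hnm := iter_transfer_bcc HB n hpm.
  apply: (@le_trans _ _ (\int[mu]_(x in `[A, B]) (iter n TL pp x + iter n TL pm x - 2 * I x))).
    apply: int_le.
    - by apply: bcc_norm; exact: (iter_transfer_bcc HB).
    - by apply: bccB; [exact: bccD|exact: bccZ].
    move=> x _; rewrite Ep iter_transferB ler_norml.
    by have := Ip x; have := Im x => ? ?; apply/andP; split; lra.
  rewrite (intB _ _ (bccD hnp hnm) (bccZ 2 bi)) (intD _ _ hnp hnm) (intZ _ _ _ bi).
  rewrite !(iter_transfer_int HB)// ip im.
  rewrite (intZ _ _ _ (bvb_bcc (bvb_ind (ltW q12)))).
  have -> : \int[mu]_(x in `[A, B]) ind q1 q2 x = q2 - q1.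
    exact: int_ind.
  have : del * a <= d * (q2 - q1) * a by rewrite ler_wpM2r.
  by lra.
have t1 : e * (D * a) <= del / 2 * a.
  by rewrite -eD -mulrA ler_wpM2l ?(ltW e0)// ler_wpM2r//; lra.
have t2 : e / 4 * a <= del / 2 * a by rewrite ler_wpM2r//; lra.
have t3 : e / 4 * (e * v) <= 1 / 4 * (e * v) by apply: (ler_wpM2r ev); lra.
by have := mulr_ge0 (ltW e0) v0; lra.
Qed.

Theorem spectral_gap : exists C th, [/\ 0 <= C, 0 < th, th < 1 &
  forall p v n, supp A B p -> bvb p v -> \int[mu]_(x in `[A, B]) p x = 0 ->
  bvb (iter n TL p) (C * th ^+ n * v)].
Proof.
have [n [g [e [[n0 g0 g1 /andP[e0 e1]] H]]]] := contraction.
have [K K1 HK] := transfer_power_bounded HB o0 o_le o_A o_c o_lt o_gt.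
have K0 : 0 <= K by exact: le_trans K1.
have nR : 0 < n%:R :> R by rewrite ltr0n.
(* By Bernoulli's inequality th ^+ n >= g, so no n-th root is taken. *)
pose th := 1 - (1 - g) / n%:R.
have u0 : 0 < (1 - g) / n%:R by rewrite divr_gt0// subr_gt0.
have u1 : (1 - g) / n%:R < 1.
  by rewrite ltr_pdivrMr// mul1r (@lt_le_trans _ _ 1) ?ler1n//; lra.
have th0 : 0 < th by rewrite /th; lra.
have th1 : th < 1 by rewrite /th; lra.
have bern (x : R) j : 0 <= x -> x <= 1 -> 1 - j%:R * x <= (1 - x) ^+ j.
  move=> x0 x1; elim: j => [|j IH]; first by rewrite mul0r subr0.
  rewrite exprS -natr1.
  have : (1 - x) * (1 - j%:R * x) <= (1 - x) * (1 - x) ^+ j by rewrite ler_wpM2l//; lra.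
  have : 0 <= j%:R * x * x by rewrite !mulr_ge0.
  by lra.
have gth : g <= th ^+ n.
  apply: le_trans (bern _ _ (ltW u0) (ltW u1)).
  by rewrite mulrC divfK ?gt_eqF//; lra.
have it j p v : supp A B p -> bvb p v -> \int[mu]_(x in `[A, B]) p x = 0 ->
    exists v', bvb (iter (j * n) TL p) v' /\ N1 (iter (j * n) TL p) + e * v' <= g ^+ j * (N1 p + e * v).
  move=> sp bp ip; elim: j => [|j [v' [b' h']]].
    by exists v; rewrite mul0n mul1r; split.
  have hp := bvb_bcc bp.
  have sj := iter_transfer_supp HB (j * n) sp.
  have ij : \int[mu]_(x in `[A, B]) iter (j * n) TL p x = 0.
    by rewrite (iter_transfer_int HB).
  have [v'' [b'' h'']] := H _ _ sj b' ij.
  exists v''; rewrite mulSn iterD; split => //.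
  apply: le_trans h'' _; rewrite exprS -mulrA ler_wpM2l//; exact: ltW.
(* The division by th ^+ n pays for the fewer than n iterates left over, and (B - A + e) / e for
   passing from N1 p + e v to v. *)
pose C := K * ((B - A + e) / e) / th ^+ n.
have BA : 0 < B - A by rewrite subr_gt0.
have BAe : 0 < B - A + e by rewrite addr_gt0.
have C0 : 0 <= C.
  by rewrite /C divr_ge0 ?exprn_ge0 ?(ltW th0)// mulr_ge0// divr_ge0 ?(ltW BAe)// ltW.
exists C, th; split => // p v m sp bp ip; have v0 := bvb_ge0 bp.
have [v' [b' h']] := it (m %/ n)%N p v sp bp ip.
have Np := int_norm_bvb HB sp bp.
have N0' : 0 <= N1 (iter (m %/ n * n) TL p) by apply: int_ge0.
have v'le : v' <= g ^+ (m %/ n) * ((B - A + e) / e * v).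
  rewrite -(ler_pM2l e0).
  have -> : e * (g ^+ (m %/ n) * ((B - A + e) / e * v)) = g ^+ (m %/ n) * ((B - A + e) * v).
    by field; rewrite gt_eqF.
  apply: (@le_trans _ _ (g ^+ (m %/ n) * (N1 p + e * v))); first by lra.
  by rewrite ler_wpM2l ?exprn_ge0 ?(ltW g0)//; lra.
have := HK (m %% n)%N _ _ (iter_transfer_supp HB (m %/ n * n) sp) b'.
rewrite -iterD addnC -divn_eq; apply: bvb_le.
apply: le_trans (ler_wpM2l K0 v'le) _.
have gm : g ^+ (m %/ n) <= th ^+ m / th ^+ n.
  rewrite ler_pdivlMr ?exprn_gt0//.
  apply: (@le_trans _ _ (th ^+ (n * (m %/ n)) * th ^+ n)).
    rewrite ler_wpM2r ?exprn_ge0 ?(ltW th0)// exprM lerXn2r// ?nnegrE ?(ltW g0)//.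
    by rewrite exprn_ge0 ?(ltW th0).
  rewrite -exprD ler_wiXn2l ?(ltW th0) ?(ltW th1)//.
  rewrite {1}(divn_eq m n) mulnC leq_add2l; exact/ltnW/ltn_pmod.
have w0 : 0 <= (B - A + e) / e * v by rewrite mulr_ge0// divr_ge0 ?(ltW BAe) ?(ltW e0).
apply: le_trans (ler_wpM2l K0 (ler_wpM2r w0 gm)) _.
by rewrite /C le_eqVlt; apply/orP; left; apply/eqP; ring.
Qed.

End spectral_gap.

(** * Distributional derivatives *)

Section bump.
Context {R : realType}.
Implicit Types (g h : R -> R) (P : {poly R}) (x y : R).
Notation mu := (@lebesgue_measure R).

Lemma is_derive_near g h x (d r : R) : 0 < r ->
  (forall y, `|y - x| < r -> g y = h y) -> is_derive x (1 : R) h d -> is_derive x (1 : R) g d.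
Proof.
move=> r0 gh /is_derive_epsP H; apply/is_derive_epsP => e e0.
have [s s0 Hs] := H e e0; exists (Num.min r s); first by rewrite lt_min r0.
move=> y; rewrite lt_min => /andP[yr ys].
by rewrite !gh ?subrr ?normr0//; exact: Hs.
Qed.

Lemma is_derive_affine (a b x : R) : is_derive x (1 : R) (fun y => a * y + b) a.
Proof.
apply/is_derive_epsP => e e0; exists 1 => // y _.
have -> : a * y + b - (a * x + b) - a * (y - x) = 0 by ring.
by rewrite normr0 mulr_ge0// ltW.
Qed.

(** The polynomial parameter makes the family closed under derivation: P becomes X^2 (P - P'). *)
Definition flat P x := if 0 < x then P.[x^-1] * expR (- x^-1) else 0.

Lemma poly_le_expR P : exists2 C, 0 <= C & forall y, 0 <= y -> `|P.[y]| <= C * expR y.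
Proof.
exists (\sum_(i < size P) `|P`_i| * (i`!%:R + 1)).
  by apply: sumr_ge0 => i _; rewrite mulr_ge0// addr_ge0.
move=> y y0; rewrite horner_coef; apply: le_trans (ler_norm_sum _ _ _) _.
rewrite mulr_suml ler_sum// => i _; rewrite normrM -mulrA ler_wpM2l//.
rewrite ger0_norm ?exprn_ge0//; have E := expR_ge1Dx y.
case: (nat_of_ord i) => [|n]; first by rewrite expr0 fact0; lra.
have := expR_ge1Dxn n y0.
have F0 : 0 < n.+1`!%:R :> R by rewrite ltr0n fact_gt0.
move=> H; have : y ^+ n.+1 / n.+1`!%:R <= expR y by lra.
by rewrite ler_pdivrMr// mulrDl mul1r mulrC => ?; lra.
Qed.

(** The quadratic bound is what gives the derivative 0 at 0. *)
Lemma flat_le P : exists2 C, 0 <= C & forall x, `|flat P x| <= C * x ^+ 2.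
Proof.
have [C C0 HC] := poly_le_expR ('X^2 * P); exists C => // x.
rewrite /flat; case: ifP => [x0|_]; last by rewrite normr0 mulr_ge0// sqr_ge0.
have y0 : 0 <= x^-1 by rewrite invr_ge0 ltW.
have := HC _ y0; rewrite hornerM hornerXn normrM ger0_norm ?exprn_ge0// => H.
rewrite normrM (ger0_norm (expR_ge0 _)) expRN.
rewrite -(ler_pM2l (_ : 0 < x^-1 ^+ 2 * expR x^-1)); last first.
  by rewrite mulr_gt0 ?expR_gt0// exprn_gt0// invr_gt0.
have -> : x^-1 ^+ 2 * expR x^-1 * (`|P.[x^-1]| / expR x^-1) = x^-1 ^+ 2 * `|P.[x^-1]|.
  by field; rewrite (gt_eqF (expR_gt0 _)) (gt_eqF x0).
have -> // : x^-1 ^+ 2 * expR x^-1 * (C * x ^+ 2) = C * expR x^-1.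
by field; rewrite (gt_eqF x0).
Qed.

Lemma is_derive_flat P x :
  is_derive x (1 : R) (flat P) (flat ('X^2 * (P - P^`())) x).
Proof.
have [x0|x0|->] := ltgtP x 0; first 1 last.
- rewrite {2}/flat x0.
  apply: (@is_derive_near _ (fun y => P.[y^-1] * expR (- y^-1)) _ _ x) => //.
    move=> y; rewrite ltr_distl => /andP[y1 _]; rewrite /flat ifT//; lra.
  have xn : x != 0 by rewrite gt_eqF.
  have d1 : is_derive x (1 : R) (fun y : R => y^-1) (- x ^- 2).
    by have := @is_deriveV R id x 1 1 xn (is_derive_id _ _); rewrite /GRing.scale/= mulr1.
  have d2 : is_derive x (1 : R) (fun y : R => P.[y^-1]) (P^`().[x^-1] * - x ^- 2).
    exact: (@is_derive1_comp R (horner P) (fun y : R => y^-1) x _ _ (is_derive_poly _ _) d1).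
  have d3 : is_derive x (1 : R) (fun y : R => expR (- y^-1)) (expR (- x^-1) * - - x ^- 2).
    exact: (@is_derive1_comp R expR (fun y : R => - y^-1) x _ _ (is_derive_expR _) (is_deriveN d1)).
  apply: (is_derive_eq (is_deriveM d2 d3)).
  rewrite hornerM hornerXn hornerD hornerN /GRing.scale/=.
  by set u := P.[_]; set v := P^`().[_]; set w := expR _; field.
- rewrite {2}/flat ltxx.
  have [C C0 HC] := flat_le P; apply/is_derive_epsP => e e0.
  have C1 : 0 < C + 1 by lra.
  exists (e / (C + 1)) => [|y]; first exact: divr_gt0.
  have f0 : flat P 0 = 0 by rewrite /flat ltxx.
  rewrite f0 mul0r !subr0 ltr_pdivlMr// => ye.
  apply: le_trans (HC y) _; rewrite -real_normK ?num_real//.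
  rewrite expr2 mulrA ler_wpM2r//; apply: le_trans (ltW ye).
  by rewrite mulrC ler_wpM2l//; lra.
rewrite {2}/flat ltNge (ltW x0)/=.
apply: (@is_derive_near _ (cst 0) _ _ (- x)); first by rewrite oppr_gt0.
  move=> y; rewrite ltr_distl => /andP[_ y1]; rewrite /flat ifF//; lra.
Qed.

(** Every member has its derivative in the class, so derivatives of all orders exist by induction on
    the order alone. *)
Inductive smooth : (R -> R) -> Prop :=
| smooth_flat P : smooth (flat P)
| smooth_cst k : smooth (cst k)
| smoothD g h : smooth g -> smooth h -> smooth (fun x => g x + h x)
| smoothM g h : smooth g -> smooth h -> smooth (fun x => g x * h x)
| smooth_affine g a b : smooth g -> smooth (fun x => g (a * x + b))
| smooth_prim g h : smooth g -> (forall x, is_derive x (1 : R) h (g x)) -> smooth h.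

Lemma smooth_derive g : smooth g ->
  exists2 g', smooth g' & forall x, is_derive x (1 : R) g (g' x).
Proof.
elim=> {g} [P|k|g h sg [g' sg' dg] sh [h' sh' dh]|g h sg [g' sg' dg] sh [h' sh' dh]
  |g a b sg [g' sg' dg]|g h sg _ dh].
- exists (flat ('X^2 * (P - P^`()))); [exact: smooth_flat|exact: is_derive_flat].
- exists (cst 0); [exact: smooth_cst|by move=> x; exact: (is_derive_cst k x (1 : R))].
- exists (fun x => g' x + h' x); [exact: smoothD|by move=> x; exact: is_deriveD].
- exists (fun x => g x * h' x + h x * g' x).
    by apply: smoothD; exact: smoothM.
  by move=> x; exact: is_deriveM.
- exists (fun x => g' (a * x + b) * cst a x).
    by apply: smoothM; [exact: (smooth_affine a b)|exact: smooth_cst].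
  move=> x; apply: (@is_derive1_comp R g (fun x => a * x + b)).
  exact: is_derive_affine.
- by exists g.
Qed.

Lemma smooth_test g : smooth g -> forall n x, derivable (derive1n n g) x 1.
Proof.
move=> sg; have H n : smooth (derive1n n g).
  elim: n => // n IH; have [g' sg' dg] := smooth_derive IH.
  rewrite derive1nS (_ : derive1 _ = g')//; apply/funext => x.
  by rewrite derive1E; have := dg x => -[].
by move=> n x; have [g' _ dg] := smooth_derive (H n); case: (dg x).
Qed.

(** exp(-1/x) exp(-1/(1-x)) on ]0, 1[. It is not normalised: its mass [bump_prim 1] appears as a
    factor below. *)
Definition bump x := flat 1 x * flat 1 (-1 * x + 1).

Lemma bump_smooth : smooth bump.
Proof.
by apply: smoothM; [exact: smooth_flat|apply: smooth_affine; exact: smooth_flat].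
Qed.

Lemma flat1_ge0 x : 0 <= flat 1 x <= 1.
Proof.
rewrite /flat; case: ifP => [x0|_]; last by rewrite lexx ler01.
by rewrite hornerC mul1r expR_ge0/= -expR0 ler_expR oppr_le0 invr_ge0 ltW.
Qed.

Lemma bump01 x : 0 <= bump x <= 1.
Proof.
have /andP[h1 h2] := flat1_ge0 x; have /andP[h3 h4] := flat1_ge0 (-1 * x + 1).
by rewrite /bump mulr_ge0//= -[leRHS]mul1r ler_pM.
Qed.

Lemma bump_out x : ~~ (0 < x < 1) -> bump x = 0.
Proof.
rewrite negb_and -!leNgt => /orP[x0|x1]; rewrite /bump /flat.
  by rewrite ltNge x0 mul0r.
by rewrite [X in _ * X]ifF ?mulr0//; apply/negbTE; rewrite -leNgt; lra.
Qed.

Lemma bump_gt0 x : 0 < x < 1 -> 0 < bump x.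
Proof.
move=> /andP[x0 x1]; rewrite /bump /flat x0 ifT; last lra.
by rewrite !hornerC !mul1r mulr_gt0// expR_gt0.
Qed.

Lemma smooth_continuous g : smooth g -> forall x, {for x, continuous g}.
Proof. by move=> /smooth_derive[g' _ dg] x; exact: is_derive_continuous (dg x). Qed.

Lemma bcc_bump : bcc bump.
Proof.
apply: (@bcc_intro _ _ 1 set0) => //.
- by move=> x; have /andP[h1 h2] := bump01 x; rewrite ger0_norm.
- by move=> x _; exact: (smooth_continuous bump_smooth).
Qed.

(** The base point -1 lies to the left of the support, so the derivative is also available at 0. *)
Definition bump_prim x := \int[mu]_(t in `[-1, x]) bump t.

Lemma bump_prim_derive x : is_derive x (1 : R) bump_prim (bump x).
Proof.
have [x1|x1] := ltP (-1) x.
  by apply: prim_derive => //; [exact: bcc_bump|exact: (smooth_continuous bump_smooth)].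
rewrite bump_out; last by rewrite negb_and -!leNgt; apply/orP; left; lra.
apply: (@is_derive_near _ (cst 0) _ _ 1) => //.
move=> y; rewrite ltr_distl => /andP[_ h]; rewrite /bump_prim.
apply: int_zero; last exact: bcc_bump.
move=> z /andP[_ z1]; apply: bump_out; rewrite negb_and -!leNgt; apply/orP; left; lra.
Qed.

Lemma bump_prim_le0 x : x <= 0 -> bump_prim x = 0.
Proof.
move=> x0; apply: int_zero; last exact: bcc_bump.
move=> z /andP[_ z1]; apply: bump_out; rewrite negb_and -!leNgt; apply/orP; left; lra.
Qed.

Lemma bump_prim_ge1 x : 1 <= x -> bump_prim x = bump_prim 1.
Proof.
move=> x1; rewrite /bump_prim (@int_split _ _ _ 1 x)//; last exact: bcc_bump.
  rewrite [X in _ + X]int_zero ?addr0//; last exact: bcc_bump.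
  move=> z /andP[z1 _]; apply: bump_out; rewrite negb_and -!leNgt; apply/orP; right; lra.
Qed.

Lemma bump_mass_gt0 : 0 < bump_prim 1.
Proof.
have m : 0 < bump 2^-1 by apply: bump_gt0; apply/andP; split; lra.
have [r r0 Hr] := (continuous_epsP _ _).1 (smooth_continuous bump_smooth (x := 2^-1)) (bump 2^-1 / 2) ltac:(lra).
pose s := Num.min (r / 2) 4^-1.
have s0 : 0 < s by rewrite lt_min; apply/andP; split; [exact: divr_gt0|rewrite invr_gt0].
have s1 : s <= r / 2 by rewrite ge_min lexx.
have s2 : s <= 4^-1 by rewrite ge_min lexx orbT.
have b0 x : 0 <= bump x by have /andP[] := bump01 x.
rewrite /bump_prim (@int_split _ _ _ 2^-1 1)//; [|lra|lra|exact: bcc_bump].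
rewrite (@int_split _ _ 2^-1 (2^-1 + s) 1)//; [|lra|lra|exact: bcc_bump].
have h1 : 0 <= \int[mu]_(x in `[-1, 2^-1]) bump x by apply: int_ge0.
have h2 : 0 <= \int[mu]_(x in `[2^-1 + s, 1]) bump x by apply: int_ge0.
have h3 : bump 2^-1 / 2 * s <= \int[mu]_(x in `[2^-1, 2^-1 + s]) bump x.
  have {1}-> : s = 2^-1 + s - 2^-1 by ring.
  rewrite -int_cst; last lra.
  apply: int_le; [exact: bcc_cst|exact: bcc_bump|].
  move=> x /andP[x1 x2]; have := Hr x; rewrite !ltr_distl => /(_ ltac:(apply/andP; split; lra)).
  by move=> /andP[h _]; lra.
have : 0 < bump 2^-1 / 2 * s by rewrite mulr_gt0// divr_gt0.
lra.
Qed.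

Definition mollifier (u e x : R) := e^-1 * bump (e^-1 * x + (- u / e)).
Definition mollifier_prim (u e x : R) := bump_prim (e^-1 * x + (- u / e)).

Lemma mollifier_prim_derive u e x :
  is_derive x (1 : R) (mollifier_prim u e) (mollifier u e x).
Proof.
have d1 : is_derive x (1 : R) (fun x => e^-1 * x + (- u / e)) (e^-1).
  exact: is_derive_affine.
have -> : mollifier u e x = bump (e^-1 * x + (- u / e)) * e^-1 by rewrite /mollifier mulrC.
exact: (@is_derive1_comp R bump_prim (fun x => e^-1 * x + (- u / e)) x _ _ (bump_prim_derive _) d1).
Qed.

Lemma mollifier_smooth u e : smooth (mollifier u e).
Proof. by apply: (smoothM (smooth_cst e^-1)); apply: smooth_affine; exact: bump_smooth. Qed.

Lemma mollifier_prim_smooth u e : smooth (mollifier_prim u e).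
Proof. exact: smooth_prim (mollifier_smooth u e) (mollifier_prim_derive u e). Qed.

Lemma mollifier_bound u e x : 0 < e -> 0 <= mollifier u e x <= e^-1.
Proof.
move=> e0; have /andP[h1 h2] := bump01 (e^-1 * x + (- u / e)).
have i0 : 0 <= e^-1 by rewrite invr_ge0 ltW.
by rewrite /mollifier mulr_ge0//= ler_piMr.
Qed.

Let affE (u e x : R) : 0 < e -> e^-1 * x + (- u / e) = (x - u) / e.
Proof. by move=> e0; field; rewrite gt_eqF. Qed.

Lemma mollifier_out u e x : 0 < e -> ~~ (u < x < u + e) -> mollifier u e x = 0.
Proof.
move=> e0 H; rewrite /mollifier affE// bump_out ?mulr0//; apply: contra H.
move=> /andP[h1 h2]; move: h1 h2; rewrite ltr_pdivrMr// pmulr_lgt0 ?invr_gt0// mul1r.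
by move=> h1 h2; apply/andP; split; lra.
Qed.

Lemma mollifier_prim_left u e x : 0 < e -> x <= u -> mollifier_prim u e x = 0.
Proof.
move=> e0 xu; rewrite /mollifier_prim affE// bump_prim_le0//.
by rewrite pmulr_lle0 ?invr_gt0// subr_le0.
Qed.

Lemma mollifier_prim_right u e x : 0 < e -> u + e <= x -> mollifier_prim u e x = bump_prim 1.
Proof.
move=> e0 xu; rewrite /mollifier_prim affE// bump_prim_ge1//.
by rewrite ler_pdivlMr//; lra.
Qed.

Lemma bcc_mollifier u e : 0 < e -> bcc (mollifier u e).
Proof.
move=> e0; apply: (@bcc_intro _ _ e^-1 set0) => //.
- by move=> x; have /andP[h1 h2] := mollifier_bound u x e0; rewrite ger0_norm.
- by move=> x _; exact: (smooth_continuous (mollifier_smooth u e)).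
Qed.

End bump.

(** * Uniqueness of distributional derivatives and recovery of a primitive *)

Section distributional_derivatives.
Context {R : realType}.
Implicit Types (F G H D P eta : R -> R) (x u e K M : R).
Notation mu := (@lebesgue_measure R).

Lemma int_setT F M : (forall x, M < `|x| -> F x = 0) ->
  \int[mu]_(x in setT) F x = \int[mu]_(x in `[- M, M]) F x.
Proof.
move=> F0; rewrite [RHS]Rintegral_mkcond; congr (Rintegral _ _ _).
apply/funext => x; rewrite patchE; case: ifPn => // /negP xM.
rewrite F0// ltNge; apply/negP => h; apply: xM.
by rewrite inE/= in_itv/= -ler_norml.
Qed.

Lemma mollifier_test u e : 0 < e -> test_function (mollifier u e).
Proof.
move=> e0; split; first exact: smooth_test (mollifier_smooth u e).
exists (`|u| + e) => x h; apply: mollifier_out => //; apply/negP => /andP[h1 h2].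
move: h; have := ler_norm u; have := ler_norm (- u); rewrite normrN => ? ?.
by rewrite ltNge => /negP; apply; rewrite ler_norml; apply/andP; split; lra.
Qed.

Lemma continuous_bcc F M : (forall x, {for x, continuous F}) ->
  (forall x, M < `|x| -> F x = 0) -> bcc F.
Proof.
move=> cF F0; have [M0|M0] := leP 0 M; last first.
  rewrite (_ : F = cst 0); first exact: bcc_cst.
  by apply/funext => x; rewrite F0// (lt_le_trans M0).
have cN : {within `[- M, M], continuous (fun x => `|F x|)}.
  apply: continuous_subspaceT => x.
  by apply: (@continuous_comp _ _ _ F) => //; exact: norm_continuous.
have MM : - M <= M by lra.
have [x0 _ Hx0] := EVT_max MM cN.
apply: (@bcc_intro _ F `|F x0| set0) => // x.
have [xM|Mx] := leP `|x| M; last by rewrite F0// normr0.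
by apply: Hx0; rewrite in_itv/= -ler_norml.
Qed.

Lemma derive1_is_derive F x : derivable F x 1 -> is_derive x (1 : R) F (derive1 F x).
Proof. by move=> dF; apply: DeriveDef => //; rewrite derive1E. Qed.

Lemma test_function_bcc eta : test_function eta ->
  [/\ bcc eta, bcc (derive1 eta), forall x, is_derive x (1 : R) eta (derive1 eta x) &
   exists M, (forall x, M < `|x| -> eta x = 0) /\ (forall x, M < `|x| -> derive1 eta x = 0)].
Proof.
move=> [de [M eM]].
have d0 x : is_derive x (1 : R) eta (derive1 eta x).
  by apply: derive1_is_derive; exact: (de 0%N).
have d1 x : is_derive x (1 : R) (derive1 eta) (derive1 (derive1 eta) x).
  by apply: derive1_is_derive; exact: (de 1%N).
have dM x : M < `|x| -> derive1 eta x = 0.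
  move=> xM; have := d0 x; set d := derive1 eta x => dx.
  have : is_derive x (1 : R) eta 0.
    apply: (@is_derive_near _ eta (cst 0) _ _ (`|x| - M)); first by rewrite subr_gt0.
    by move=> y yx; rewrite eM//; have := lerB_dist x y; rewrite distrC; lra.
  by case=> _ h0; case: dx => _ <-; rewrite h0.
split => //.
- by apply: (@continuous_bcc _ M) => // x; exact: is_derive_continuous (d0 x).
- by apply: (@continuous_bcc _ M) => // x; exact: is_derive_continuous (d1 x).
- by exists M.
Qed.

Lemma int_mollifier u e M : 0 < e -> - M <= u -> u + e <= M ->
  \int[mu]_(x in `[- M, M]) mollifier u e x = bump_prim 1.
Proof.
move=> e0 Mu uM; have MM : - M <= M by lra.
have -> : bump_prim 1 = mollifier_prim u e M - mollifier_prim u e (- M).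
  by rewrite mollifier_prim_right// mollifier_prim_left// subr0.
apply: (FTC_countable MM (bcc_mollifier u e0) (countable0 _)).
- by move=> x _; exact: (smooth_continuous (mollifier_prim_smooth u e)).
- by move=> x _ _; exact: mollifier_prim_derive.
Qed.

(** At a point of continuity with H u <> 0 the sign of H is constant on the support of a narrow
    mollifier, so the pairing cannot vanish; the other points are countable. *)
Lemma bcc_test_zero H : bcc H ->
  (forall eta, test_function eta -> \int[mu]_(x in setT) (H x * eta x) = 0) ->
  countable [set x | H x <> 0].
Proof.
move=> hH tH; have [_ cH] := hH.
apply: sub_countable cH; apply: subset_card_le => u /= Hu cu.
have p0 : 0 < `|H u| by rewrite normr_gt0; exact/eqP.
have [r r0 Hr] := (continuous_epsP H u).1 cu (`|H u| / 2) ltac:(lra).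
pose e := r / 2; have e0 : 0 < e by rewrite divr_gt0.
pose s := Num.sg (H u); pose M := `|u| + e.
have sH : s * H u = `|H u| by rewrite /s -normrEsg.
have hm := bcc_mollifier u e0.
have [Mu uM] : - M <= u /\ u + e <= M.
  by have := ler_norm u; have := ler_norm (- u); rewrite normrN /M; split; lra.
have E : \int[mu]_(x in `[- M, M]) (s * (H x * mollifier u e x)) = 0.
  rewrite (intZ _ _ _ (bccM hH hm)) -int_setT ?tH ?mulr0//; first exact: mollifier_test.
  move=> x h; rewrite mollifier_out ?mulr0//; apply/negP => /andP[h1 h2].
  by move: h; rewrite ltNge => /negP; apply; rewrite ler_norml; apply/andP; split; lra.
have : `|H u| / 2 * bump_prim 1 <= \int[mu]_(x in `[- M, M]) (s * (H x * mollifier u e x)).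
  rewrite -(int_mollifier e0 Mu uM) -(intZ _ _ _ hm).
  apply: int_le; [exact: bccZ|exact: (bccZ _ (bccM hH hm))|move=> x _].
  have /andP[m0 _] := mollifier_bound u x e0.
  have [/andP[ux xu]|nx] := boolP (u < x < u + e); last by rewrite mollifier_out// !mulr0.
  rewrite [leRHS]mulrA; apply: ler_wpM2r => //.
  have := Hr x; rewrite ger0_norm ?subr_ge0 ?(ltW ux)// => /(_ ltac:(rewrite /e in xu; lra)) h.
  have : `|s * (H x - H u)| < `|H u| / 2.
    by rewrite normrM /s normr_sg (_ : H u != 0) ?mul1r//; exact/eqP.
  by rewrite mulrBr sH ltr_norml => /andP[h1 _]; lra.
rewrite E; apply/negP; rewrite -ltNge mulr_gt0//; first by rewrite divr_gt0.
exact: bump_mass_gt0.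
Qed.

Lemma distributional_derivative_unique F G H : bcc G -> bcc H ->
  is_distributional_derivative F G -> is_distributional_derivative F H ->
  countable [set x | G x <> H x].
Proof.
move=> hG hH dG dH; have := @bcc_test_zero (fun x => G x - H x) (bccB hG hH).
have -> : [set x | G x - H x <> 0] = [set x | G x <> H x].
  apply/seteqP; split => x /= h; first by move=> E; apply: h; rewrite E subrr.
  by move=> /eqP; rewrite subr_eq0 => /eqP.
apply=> eta te; have [he _ _ [M [eM _]]] := test_function_bcc te.
have Gz x : M < `|x| -> G x * eta x = 0 by move=> /eM ->; rewrite mulr0.
have Hz x : M < `|x| -> H x * eta x = 0 by move=> /eM ->; rewrite mulr0.
rewrite (int_setT (M := M)); last by move=> x /eM ->; rewrite mulr0.
have -> : \int[mu]_(x in `[- M, M]) ((G x - H x) * eta x) =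
    \int[mu]_(x in `[- M, M]) (G x * eta x - H x * eta x).
  by apply: int_eq => x _; ring.
rewrite (intB _ _ (bccM hG he) (bccM hH he)) -(int_setT Gz) -(int_setT Hz).
by have := dG eta te; rewrite dH// => /oppr_inj ->; rewrite subrr.
Qed.

Lemma int_by_parts P p eta : bcc P -> (forall x, {for x, continuous P}) -> bcc p ->
  countable [set x | ~ is_derive x (1 : R) P (p x)] -> test_function eta ->
  \int[mu]_(x in setT) (P x * derive1 eta x) = - \int[mu]_(x in setT) (p x * eta x).
Proof.
move=> hP cP hp dP te; have [he hde de [M [eM deM]]] := test_function_bcc te.
(* eta vanishes for |x| > M strictly; at the larger bounds M1 and - M1 it is 0 and the boundary
   terms disappear. *)
pose M1 := `|M| + 1.
have M1e x : M1 < `|x| -> eta x = 0.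
  by move=> h; apply: eM; have := ler_norm M; rewrite /M1 in h; lra.
have M1de x : M1 < `|x| -> derive1 eta x = 0.
  by move=> h; apply: deM; have := ler_norm M; rewrite /M1 in h; lra.
rewrite !(int_setT (M := M1)); first last.
- by move=> x /M1de ->; rewrite mulr0.
- by move=> x /M1e ->; rewrite mulr0.
apply/eqP; rewrite -addr_eq0 -(intD _ _ (bccM hP hde) (bccM hp he)); apply/eqP.
have M10 : 0 < M1 by rewrite /M1; have := normr_ge0 M; lra.
have eM1 : eta M1 = 0.
  by apply: eM; rewrite /M1 ger0_norm; [have := ler_norm M; lra|have := normr_ge0 M; lra].
have eM1' : eta (- M1) = 0.
  by apply: eM; rewrite normrN /M1 ger0_norm; [have := ler_norm M; lra|have := normr_ge0 M; lra].
have -> : 0 = P M1 * eta M1 - P (- M1) * eta (- M1) by rewrite eM1 eM1' !mulr0 subrr.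
have MM : - M1 <= M1 by lra.
apply: (@FTC_countable _ (fun x => P x * derive1 eta x + p x * eta x) (fun x => P x * eta x) _ _ _ MM _ dP).
- by apply: bccD; exact: bccM.
- move=> x _; apply: continuousM => //; exact: is_derive_continuous (de x).
move=> x _ /contrapT dx; have := is_deriveM dx (de x).
by rewrite /GRing.scale/= (mulrC (eta x)).
Qed.

Lemma distributional_derivative_prim F P p : measurable_fun setT F ->
  (\forall x \ae mu, F x = P x) -> bcc P ->
  (forall x, {for x, continuous P}) -> bcc p ->
  countable [set x | ~ is_derive x (1 : R) P (p x)] ->
  is_distributional_derivative F p.
Proof.
move=> mF FP hP cP hp dP eta te; rewrite -(int_by_parts hP cP hp dP te).
have [he hde _ _] := test_function_bcc te.
congr fine; apply: ae_eq_integral => //.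
- by apply/measurable_EFinP; apply: measurable_funM => //; exact: bcc_measurable.
- by apply/measurable_EFinP; apply: bcc_measurable; exact: bccM.
apply: filterS FP; first exact: (ae_filter_ringOfSetsType mu).
by move=> x -> _.
Qed.

Lemma lebesgue_pt_epsP D u : lebesgue_pt D u -> forall eps : R, 0 < eps ->
  exists2 r, 0 < r & forall e, 0 < e -> e < r ->
  (\int[mu]_(x in ball u e) `|D x - D u|%:E <= (eps * e)%:E)%E.
Proof.
move=> /fine_cvgP[] H1 /cvgrPdist_le H2 eps eps0.
have H3 := H2 (eps / 2) ltac:(lra).
have : \forall e \near (0 : R)^'+, davg D u e \is a fin_num /\ `|0 - fine (davg D u e)| <= eps / 2.
  by near=> e; split; near: e.
move=> /nbhs_ballP[r /= r0 Hr]; exists r => // e e0 er.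
have be : ball 0 r e by rewrite /ball/= sub0r normrN gtr0_norm.
have [ffin] := Hr e be e0; rewrite sub0r normrN => /(le_trans (ler_norm _)); rewrite -lee_fin fineK//.
rewrite /davg /iavg lebesgue_measure_ball ?(ltW e0)// inver.
rewrite ifF; last by apply/negbTE; rewrite mulrn_eq0/= gt_eqF.
rewrite lee_pdivrMl; last by rewrite mulrn_wgt0.
rewrite -EFinM; have -> : e *+ 2 * (eps / 2) = eps * e by rewrite -mulr_natr; field.
by [].
Unshelve. all: by end_near. Qed.

Lemma bounded_integrable (h : R -> R) K (u v : R) : measurable_fun setT h ->
  (forall x, `|h x| <= K) -> mu.-integrable `[u, v] (EFin \o h).
Proof.
move=> mh hK; apply: measurable_bounded_integrable => //.
- by rewrite /= lebesgue_measure_itv/=; case: ifP => // _; rewrite -EFinB ltry.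
- exact: measurable_funTS.
- by exists K; split; rewrite ?num_real// => y My x _; exact: le_trans (hK x) (ltW My).
Qed.

Lemma bounded_int_norm_le (h g : R -> R) (M K : R) (S : set R) : measurable_fun setT h ->
  (forall x, `|h x| <= K) -> (forall x, ~ S x -> h x = 0) -> measurable S ->
  (`|\int[mu]_(x in `[- M, M]) h x|%:E <= \int[mu]_(x in S) `|h x|%:E)%E.
Proof.
move=> mh hK hS mS.
have ih := bounded_integrable (- M) M mh hK.
rewrite EFin_normr_Rintegral//; apply: le_trans (le_abse_integral _ _ _) _ => //.
  by apply: (measurable_int mu).
have mn : measurable_fun setT (fun x => `|h x|%:E).
  by apply/measurable_EFinP; apply: measurableT_comp.
rewrite [leRHS]integral_mkcond.
apply: le_trans (_ : \int[mu]_(x in setT) `|h x|%:E <= _)%E.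
  by apply: ge0_subset_integral => //.
rewrite le_eqVlt; apply/orP; left; apply/eqP; apply: eq_integral => x _.
rewrite patchE; case: ifPn => // /negP nS; rewrite hS ?normr0//.
by move=> Sx; apply: nS; rewrite inE.
Qed.

(* The differences of mollifiers are derivatives of test functions, hence the
   mollified values of F - P at two Lebesgue points coincide. *)
Lemma distributional_derivative_inv F P p K : measurable_fun setT F ->
  (forall x, `|F x| <= K) -> is_distributional_derivative F p ->
  bcc P -> (forall x, {for x, continuous P}) -> bcc p ->
  countable [set x | ~ is_derive x (1 : R) P (p x)] ->
  exists C, \forall x \ae mu, F x = P x + C.
Proof.
move=> mF FK dF hP cP hp dP.
have [L L0 PL] := bcc_bound hP.
pose D x := F x - P x; have mP := bcc_measurable hP.
have mD : measurable_fun setT D by exact: measurable_funB.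
have DK x : `|D x| <= K + L by rewrite (le_trans (ler_normB _ _))// lerD.
have K0 : 0 <= K by exact: le_trans (FK 0).
have iD (g : R -> R) M : bcc g -> mu.-integrable `[- M, M] (EFin \o (fun x => D x * g x)).
  move=> hg; have [N N0 gN] := bcc_bound hg.
  apply: (@bounded_integrable _ ((K + L) * N)).
    by apply: measurable_funM => //; exact: bcc_measurable.
  by move=> x; rewrite normrM ler_pM.
have lD : locally_integrable setT D.
  split => //; first exact: openT.
  move=> Q _ cQ; apply: (@le_lt_trans _ _ (\int[mu]_(x in Q) (K + L)%:E)%E).
    apply: ge0_le_integral => //; first exact: compact_measurable.
    - by apply/measurable_EFinP; apply: measurableT_comp => //; exact: measurable_funTS.
    - by move=> x _; rewrite lee_fin.
  rewrite integral_cst//; last exact: compact_measurable.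
  by rewrite lte_mul_pinfty ?lee_fin ?addr_ge0// compact_finite_measure.
(* The mollifier is at most 1 / e and supported in the ball of radius e, so the error is at most 1 /
   e times the integral of |D - D u| over that ball. *)
have moll u : lebesgue_pt D u -> forall eps, 0 < eps -> exists2 r, 0 < r &
    forall e M, 0 < e -> e < r -> - M <= u -> u + e <= M ->
    `|\int[mu]_(x in `[- M, M]) (D x * mollifier u e x) - bump_prim 1 * D u| <= eps.
  move=> /lebesgue_pt_epsP H eps eps0; have [r r0 Hr] := H eps eps0.
  exists r => // e M e0 er Mu uM.
  have hm := bcc_mollifier u e0.
  pose h x := (D x - D u) * mollifier u e x.
  have Eh : \int[mu]_(x in `[- M, M]) (D x * mollifier u e x) - bump_prim 1 * D u =
      \int[mu]_(x in `[- M, M]) h x.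
    rewrite -(int_mollifier e0 Mu uM) mulrC -(intZ _ _ _ hm) -RintegralB//.
    - by apply: eq_Rintegral => x _; rewrite /h; ring.
    - exact: iD.
    - exact: bcc_integrable (bccZ _ hm).
  rewrite Eh -lee_fin.
  have e10 : 0 <= e^-1 by rewrite invr_ge0 ltW.
  have mol x : 0 <= mollifier u e x <= e^-1 by exact: mollifier_bound.
  have mh : measurable_fun setT h.
    by apply: measurable_funM; [exact: measurable_funB|exact: bcc_measurable].
  apply: le_trans (@bounded_int_norm_le h h M ((K + L + (K + L)) * e^-1) (ball u e) mh _ _ _) _.
  - move=> x; have /andP[m1 m2] := mol x; rewrite normrM (ger0_norm m1) ler_pM//.
    by rewrite (le_trans (ler_normB _ _))// lerD.
  - move=> x nb; rewrite /h mollifier_out ?mulr0//; apply/negP => /andP[h1 h2].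
    by apply: nb; rewrite /ball/= ltr_distl; apply/andP; split; lra.
  - exact: measurable_ball.
  apply: (@le_trans _ _ (\int[mu]_(x in ball u e) (e^-1%:E * `|D x - D u|%:E))%E).
    apply: ge0_le_integral => //; first exact: measurable_ball.
    - by apply/measurable_EFinP; apply: measurableT_comp => //; exact: measurable_funTS.
    - apply: measurable_funTS; apply/measurable_EFinP; apply: measurable_funM => //.
      by apply: measurableT_comp => //; exact: measurable_funB.
    move=> x _; rewrite -EFinM lee_fin /h normrM mulrC ler_wpM2r//.
    by have /andP[m1 m2] := mol x; rewrite ger0_norm.
  rewrite ge0_integralZl_EFin//; last 2 first.
  - exact: measurable_ball.
  - apply: measurable_funTS; apply/measurable_EFinP.
    by apply: measurableT_comp => //; exact: measurable_funB.
  apply: le_trans (lee_wpmul2l _ (Hr e e0 er)) _; first by rewrite lee_fin.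
  by rewrite -EFinM lee_fin; rewrite mulrCA mulVf ?mulr1// gt_eqF.
(* The two primitives reach the same value [bump_prim 1] on the right, so their difference has
   compact support and is a test function. *)
have test u v e : 0 < e -> exists M0, forall M, M0 <= M ->
    \int[mu]_(x in `[- M, M]) (D x * mollifier u e x) =
    \int[mu]_(x in `[- M, M]) (D x * mollifier v e x).
  move=> e0; pose M0 := `|u| + `|v| + e; exists M0 => M M0M.
  have hu := bcc_mollifier u e0; have hv := bcc_mollifier v e0.
  have [u1 u2] : - M0 <= u /\ u + e <= M0.
    have := ler_norm u; have := ler_norm (- u); rewrite normrN /M0; have := normr_ge0 v.
    by split; lra.
  have [v1 v2] : - M0 <= v /\ v + e <= M0.
    have := ler_norm v; have := ler_norm (- v); rewrite normrN /M0; have := normr_ge0 u.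
    by split; lra.
  pose eta x := mollifier_prim u e x - mollifier_prim v e x.
  pose eta' x := mollifier u e x - mollifier v e x.
  have seta : smooth eta.
    have -> : eta = (fun x => mollifier_prim u e x + (-1) * mollifier_prim v e (1 * x + 0)).
      by apply/funext => x; rewrite /eta mul1r addr0; ring.
    apply: smoothD; first exact: mollifier_prim_smooth.
    apply: smoothM; first exact: smooth_cst.
    by apply: smooth_affine; exact: mollifier_prim_smooth.
  have deta x : is_derive x (1 : R) eta (eta' x).
    by apply: is_deriveB; exact: mollifier_prim_derive.
  have eta'E : derive1 eta = eta'.
    by apply/funext => x; rewrite derive1E; case: (deta x).
  have teta : test_function eta.
    split; first exact: smooth_test.
    exists M0 => x; rewrite ltr_normr => /orP[h|h]; rewrite /eta.
      by rewrite !mollifier_prim_right ?subrr//; lra.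
    by rewrite !mollifier_prim_left ?subrr//; lra.
  have [he hde de _] := test_function_bcc teta.
  have zero x : M < `|x| -> eta' x = 0.
    move=> h; rewrite /eta' !mollifier_out ?subrr//; apply/negP => /andP[h1 h2]; move: h.
      by rewrite ltNge => /negP; apply; rewrite ler_norml; apply/andP; split; lra.
    by rewrite ltNge => /negP; apply; rewrite ler_norml; apply/andP; split; lra.
  have E1 := dF eta teta; rewrite -(int_by_parts hP cP hp dP teta) eta'E in E1.
  have he' : bcc eta' by rewrite -eta'E.
  move: E1; rewrite (int_setT (M := M)); last by move=> x /zero ->; rewrite mulr0.
  rewrite (int_setT (M := M)); last by move=> x /zero ->; rewrite mulr0.
  move=> E1.
  have E2 : \int[mu]_(x in `[- M, M]) (D x * eta' x) = 0.
    have iF : mu.-integrable `[- M, M] (EFin \o (fun x => F x * eta' x)).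
      have [N N0 eN] := bcc_bound he'.
      apply: (@bounded_integrable _ (K * N)).
        by apply: measurable_funM => //; exact: bcc_measurable.
      by move=> x; rewrite normrM ler_pM.
    have iP := bcc_integrable (- M) M (bccM hP he').
    apply/eqP; move/eqP: E1; rewrite -subr_eq0 -RintegralB//.
    by under eq_Rintegral do rewrite -mulrBl.
  apply/eqP; rewrite -subr_eq0 -RintegralB//; [|exact: iD|exact: iD].
  apply/eqP; rewrite -[RHS]E2; apply: eq_Rintegral => x _.
  by rewrite /eta' mulrBr.
have cst_D u v : lebesgue_pt D u -> lebesgue_pt D v -> D u = D v.
  move=> lu lv; have B0 := @bump_mass_gt0 R.
  suff : bump_prim 1 * (D u - D v) = 0.
    by move/eqP; rewrite mulf_eq0 gt_eqF//= subr_eq0 => /eqP.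
  apply/eqP; rewrite -normr_le0; apply/ler_addgt0Pr => eps eps0; rewrite add0r.
  have [r1 r10 H1] := moll u lu (eps / 2) ltac:(lra).
  have [r2 r20 H2] := moll v lv (eps / 2) ltac:(lra).
  pose e := Num.min r1 r2 / 2.
  have m0 : 0 < Num.min r1 r2 by rewrite lt_min r10.
  have m1 : Num.min r1 r2 <= r1 by rewrite ge_min lexx.
  have m2 : Num.min r1 r2 <= r2 by rewrite ge_min lexx orbT.
  have e0 : 0 < e by rewrite divr_gt0.
  have [M0 HM] := test u v e e0.
  pose M := `|M0| + `|u| + `|v| + e.
  have win w : `|w| <= `|u| + `|v| -> - M <= w /\ w + e <= M.
    rewrite ler_norml => /andP[w1 w2]; have := normr_ge0 M0; rewrite /M.
    by move: w1 w2 e0; clear; lra.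
  have [u1 u2] : - M <= u /\ u + e <= M by apply: win; rewrite lerDl.
  have [v1 v2] : - M <= v /\ v + e <= M by apply: win; rewrite lerDr.
  have MM : M0 <= M.
    by apply: le_trans (ler_norm M0) _; rewrite /M -!addrA lerDl !addr_ge0// ltW.
  have [er1 er2] : e < r1 /\ e < r2 by rewrite /e; move: m0 m1 m2; clear; lra.
  have := H1 e M e0 er1 u1 u2; have := H2 e M e0 er2 v1 v2.
  rewrite (HM M MM) !ler_norml => /andP[g1 g2] /andP[g3 g4].
  by apply/andP; move: g1 g2 g3 g4; clear; split; lra.
have ae := lebesgue_differentiation lD.
have [u lu] : exists u, lebesgue_pt D u.
  apply: contrapT => H; have [N [mN N0 HN]] := ae.
  have : (mu setT <= mu N)%E.
    by apply: le_measure; rewrite ?inE//; move=> x _; apply: HN => /= lx; apply: H; exists x.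
  by rewrite N0 -set_itvNyy lebesgue_measure_itv.
exists (D u); apply: filterS ae; first exact: (ae_filter_ringOfSetsType mu).
by move=> x lx; rewrite (cst_D u x lu lx) /D; ring.
Qed.

End distributional_derivatives.

(** * The unimodal map and its inverse branches *)

Section calculus.
Context {R : realType}.
Implicit Types (g h p q psi : R -> R) (x y u v d e : R).

(** At an end point one side suffices: this gives the derivative of psi o f at a, b and the turning
    point. *)
Lemma is_derive_identity_on h a c x d : a < c -> a <= x <= c ->
  (forall y, a <= y <= c -> h y = y) -> is_derive x (1 : R) h d -> d = 1.
Proof.
move=> ac /andP[ax xc] hy /is_derive_epsP H.
apply/eqP; rewrite eq_sym -subr_eq0 -normr_le0; apply/ler_addgt0Pr => e e0; rewrite add0r.
have [r r0 Hr] := H e e0.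
have [y [yac yx yr]] : exists y, [/\ a <= y <= c, y != x & `|y - x| < r].
  have [xc'|cx] := ltP x c.
    exists (x + Num.min (r / 2) (c - x)).
    have m1 : Num.min (r / 2) (c - x) <= r / 2 by rewrite ge_min lexx.
    have m2 : Num.min (r / 2) (c - x) <= c - x by rewrite ge_min lexx orbT.
    have m0 : 0 < Num.min (r / 2) (c - x) by rewrite lt_min subr_gt0 xc' divr_gt0.
    split; first by apply/andP; split; lra.
      by rewrite gt_eqF// ltrDl.
    by rewrite addrAC subrr add0r gtr0_norm//; lra.
  exists (x - Num.min (r / 2) (x - a)).
  have m1 : Num.min (r / 2) (x - a) <= r / 2 by rewrite ge_min lexx.
  have m2 : Num.min (r / 2) (x - a) <= x - a by rewrite ge_min lexx orbT.
  have m0 : 0 < Num.min (r / 2) (x - a).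
    by rewrite lt_min subr_gt0 (lt_le_trans ac cx) divr_gt0.
  split; first by apply/andP; split; lra.
    by rewrite lt_eqF// gtrDl oppr_lt0.
  by rewrite addrAC subrr add0r normrN gtr0_norm//; lra.
have := Hr y yr; rewrite !hy//; last by rewrite ax xc.
have -> : y - x - d * (y - x) = (1 - d) * (y - x) by ring.
by rewrite normrM ler_pM2r// normr_gt0 subr_eq0.
Qed.

Lemma derive_ge0_of_incr g x d v : x <= v -> (forall y, y < x -> g y < g x) ->
  is_derive x (1 : R) g d -> 0 <= d.
Proof.
move=> xv gx /is_derive_epsP H; rewrite leNgt; apply/negP => d0.
have [r r0 Hr] := H (- d / 2) ltac:(lra).
have := Hr (x - r / 2); rewrite addrAC subrr add0r normrN gtr0_norm ?divr_gt0//.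
move=> /(_ ltac:(lra)); rewrite ler_norml => /andP[h1 _].
have := gx (x - r / 2) ltac:(lra).
have : d * (r / 2) < 0 by rewrite nmulr_rlt0// divr_gt0.
lra.
Qed.

Lemma MVT_lipschitz g (g' : R -> R) K u v : 0 <= K -> u <= v ->
  (forall x, u <= x <= v -> is_derive x (1 : R) g (g' x)) ->
  (forall x, u <= x <= v -> `|g' x| <= K) -> `|g v - g u| <= K * (v - u).
Proof.
move=> K0 uv dg gK.
have [||x xuv ->] := @MVT_segment R g g' u v uv.
- by move=> x /subset_itv_oo_cc; rewrite in_itv/=; exact: dg.
- apply: derivable_within_continuous => x; rewrite in_itv/= => xuv.
  by case: (dg x xuv).
rewrite normrM (ger0_norm (_ : 0 <= v - u)) ?subr_ge0// ler_wpM2r ?subr_ge0// gK//.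
Qed.

(* A nonnegative C^1 function p has p' = 0 wherever p = 0, so |p'| is bounded by
   any e > 0 plus a multiple of p on a compact interval. *)
Lemma derivative_le_function p q u v e : u <= v -> 0 < e ->
  (forall x, x <= v -> 0 <= p x) -> 0 < p v ->
  (forall x, x <= v -> is_derive x (1 : R) p (q x)) ->
  (forall x, x <= v -> {for x, continuous q}) ->
  exists2 C, 0 <= C & forall x, u <= x <= v -> `|q x| <= e + C * p x.
Proof.
move=> uv e0 p0 pv dp cq.
have q0 x : x <= v -> p x = 0 -> q x = 0.
  (* p v > 0 keeps the zero x away from v, so increments on both sides of x are available. *)
  move=> xv px; have xv' : x < v.
    by rewrite lt_neqAle xv andbT; apply/eqP => E; move: pv; rewrite -E px ltxx.
  have /is_derive_epsP H := dp x xv.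
  apply/le_anti/andP; split; rewrite leNgt; apply/negP => qx.
    have [r r0 Hr] := H (q x / 2) ltac:(lra).
    have := Hr (x - r / 2); rewrite addrAC subrr add0r normrN gtr0_norm ?divr_gt0//.
    move=> /(_ ltac:(lra)); rewrite px ler_norml => /andP[_ h1].
    have := p0 (x - r / 2) ltac:(lra).
    have : 0 < q x * (r / 2) by rewrite mulr_gt0// divr_gt0.
    lra.
  have [r r0 Hr] := H (- q x / 2) ltac:(lra).
  pose h := Num.min (r / 2) (v - x).
  have m1 : h <= r / 2 by rewrite ge_min lexx.
  have m2 : h <= v - x by rewrite ge_min lexx orbT.
  have m0 : 0 < h by rewrite lt_min subr_gt0 xv' divr_gt0.
  have := Hr (x + h); rewrite addrAC subrr add0r gtr0_norm//.
  move=> /(_ ltac:(lra)); rewrite px ler_norml => /andP[_ h1].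
  have := p0 (x + h) ltac:(lra).
  have : q x * h < 0 by rewrite nmulr_rlt0.
  lra.
have cabs x : x <= v -> {for x, continuous (fun x => `|q x|)}.
  by move=> xv; apply: (@continuous_comp _ _ _ q); [exact: cq|exact: norm_continuous].
(* G is positive, since q = 0 wherever p = 0, and it equals p where |q| >= e: its minimum bounds p
   from below there. *)
pose G x := p x + Num.max (e - `|q x|) 0.
have cGx x : x <= v -> {for x, continuous G}.
  move=> xv; have cp := is_derive_continuous (dp x xv).
  apply: (continuousD cp).
  have hc : {for x, continuous (fun x => e - `|q x|)}.
    by apply: continuousB; [exact: cst_continuous|exact: cabs].
  apply/continuous_epsP => r r0; have [s s0 Hs] := (continuous_epsP _ x).1 hc r r0.
  exists s => // y /Hs; apply: le_lt_trans.
  rewrite -!/(Num.max _ _); set A := e - _; set B := e - _.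
  by case: (leP A 0); case: (leP B 0) => ? ?; rewrite ?subrr ?subr0 ?sub0r ?normrN//;
    rewrite ler_norml; have := ler_norm (A - B); have := ler_norm (B - A); rewrite (distrC B); move=> ? ?;
    apply/andP; split; lra.
have cG : {within `[u, v], continuous G}.
  by apply: continuous_in_subspaceT => x; rewrite inE/= in_itv/= => /andP[_ /cGx].
have [x0 x0uv Hmin] := EVT_min uv cG.
move: x0uv; rewrite in_itv/= => /andP[ux0 x0v].
have G0 : 0 < G x0.
  rewrite /G; have := p0 x0 x0v; rewrite le_eqVlt => /orP[/eqP/esym E|h].
    by rewrite E (q0 _ x0v E) normr0 subr0 add0r lt_max e0.
  by rewrite ltr_pwDl// le_max lexx orbT.
have cqw : {within `[u, v], continuous (fun x => `|q x|)}.
  by apply: continuous_in_subspaceT => x; rewrite inE/= in_itv/= => /andP[_ /cabs].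
have [x1 _ Hmax] := EVT_max uv cqw.
exists (`|q x1| / G x0); first by rewrite divr_ge0// ltW.
move=> x /andP[ux xv].
have xin : x \in `[u, v] by rewrite in_itv/= ux xv.
have [h|h] := leP `|q x| e.
  by rewrite -[leLHS]addr0 lerD// mulr_ge0 ?p0// divr_ge0// ltW.
have := Hmin x xin; rewrite {2}/G max_r ?addr0; last lra.
move=> hp; have : `|q x1| / G x0 * G x0 <= `|q x1| / G x0 * p x.
  by rewrite ler_wpM2l// divr_ge0// ltW.
rewrite divfK ?gt_eqF//; have := Hmax x xin; lra.
Qed.

(** Both e t + C psi t + p t and e t + C psi t - p t have nonnegative derivative, by
    [derivative_le_function], hence are nondecreasing. *)
Lemma distortion psi p q u v e : u <= v -> 0 < e ->
  (forall x, x <= v -> is_derive x (1 : R) psi (p x)) ->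
  (forall x, x <= v -> 0 <= p x) -> 0 < p v ->
  (forall x, x <= v -> is_derive x (1 : R) p (q x)) ->
  (forall x, x <= v -> {for x, continuous q}) ->
  exists2 C, 0 <= C & forall x y, u <= x -> x <= y -> y <= v ->
    `|p y - p x| <= e * (y - x) + C * `|psi y - psi x|.
Proof.
move=> uv e0 dpsi p0 pv dp cq.
have [C C0 HC] := derivative_le_function uv e0 p0 pv dp cq.
exists C => // x y ux xy yv.
have mono (s : R) : `|s| <= 1 -> 0 <= (e * y + C * psi y + s * p y) - (e * x + C * psi x + s * p x).
  move=> s1.
  have d t : x <= t <= y ->
     is_derive t (1 : R) (fun t => e * t + C * psi t + s * p t) (e + C * p t + s * q t).
    move=> /andP[xt ty]; have tv := le_trans ty yv.
    have d1 := dpsi t tv; have d2 := dp t tv.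
    apply: is_derive_eq.
    by rewrite /GRing.scale/= mulr1.
  have [||t tin /= ->] := @MVT_segment R (fun t => e * t + C * psi t + s * p t) (fun t => e + C * p t + s * q t) x y xy.
  - by move=> t /subset_itv_oo_cc; rewrite in_itv/=; exact: d.
  - apply: derivable_within_continuous => t; rewrite in_itv/= => tin.
    by case: (d t tin).
  rewrite mulr_ge0 ?subr_ge0//.
  move: tin; rewrite in_itv/= => /andP[xt ty].
  have := HC t; rewrite (le_trans ux xt) (le_trans ty yv) => /(_ isT) h.
  have : `|s * q t| <= `|q t| by rewrite normrM ler_piMl.
  by rewrite ler_norml => /andP[h1 _]; lra.
have m1 := mono 1; have m2 := mono (-1).
rewrite normrN normr1 lexx in m2; rewrite normr1 lexx in m1.
have {}m1 := m1 isT; have {}m2 := m2 isT.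
have psixy : 0 <= psi y - psi x.
  have d t : x <= t <= y -> is_derive t (1 : R) psi (p t).
    by move=> /andP[_ ty]; apply: dpsi; exact: le_trans yv.
  have [||t tin ->] := @MVT_segment R psi p x y xy.
  - by move=> t /subset_itv_oo_cc; rewrite in_itv/=; exact: d.
  - apply: derivable_within_continuous => t; rewrite in_itv/= => tin.
    by case: (d t tin).
  rewrite mulr_ge0 ?subr_ge0// p0//.
  by move: tin; rewrite in_itv/= => /andP[_ ty]; exact: le_trans yv.
by rewrite (ger0_norm psixy) ler_norml; apply/andP; split; lra.
Qed.

Lemma cdiff3_is_derive U g j x : continuously_differentiable 3 U g -> (j < 3)%N -> U x ->
  is_derive x (1 : R) (derive1n j g) (derive1n j.+1 g x).
Proof.
by move=> [H _] j3 Ux; apply: DeriveDef; [exact: H|rewrite derive1nS derive1E].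
Qed.

Lemma within_continuous_eps (f : R -> R) a b x : {within `[a, b], continuous f} -> a <= x <= b ->
  forall e : R, 0 < e -> exists2 d : R, 0 < d & forall y, a <= y <= b -> `|y - x| < d -> `|f y - f x| < e.
Proof.
move=> cf xab e e0; have xin : `[a, b]%classic x by rewrite /= in_itv.
have H : within `[a, b] (nbhs x) (fun t => `|f x - f t| < e).
  by rewrite (nbhs_subspace_in xin); move/cvgrPdist_lt : (cf x) => /(_ e e0).
move: H => /nbhs_ballP[d /= d0 Hd]; exists d => // y yab yx.
rewrite distrC; apply: Hd; last by rewrite /= in_itv.
by rewrite /ball/= distrC.
Qed.

Definition clamp a b x : R := Num.min b (Num.max a x).

Lemma clamp_itv a b x : a <= b -> a <= clamp a b x <= b.
Proof. by move=> ab; rewrite /clamp le_min ab le_max lexx/= ge_min lexx. Qed.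

Lemma clamp_id a b x : a <= x <= b -> clamp a b x = x.
Proof. by move=> /andP[h1 h2]; rewrite /clamp max_r// min_r. Qed.

Lemma clamp_lipschitz a b x y : `|clamp a b y - clamp a b x| <= `|y - x|.
Proof.
have mx s t : `|Num.max a t - Num.max a s| <= `|t - s|.
  have := ler_norm (t - s); have := ler_norm (s - t); rewrite (distrC s) => h1 h2.
  by case: (leP a s) => ?; case: (leP a t) => ?; rewrite ler_norml; apply/andP; split; lra.
have mn s t : `|Num.min b t - Num.min b s| <= `|t - s|.
  have := ler_norm (t - s); have := ler_norm (s - t); rewrite (distrC s) => h1 h2.
  by case: (leP b s) => ?; case: (leP b t) => ?; rewrite ler_norml; apply/andP; split; lra.
exact: le_trans (mn _ _) (mx _ _).
Qed.

Lemma clamp_continuous (f : R -> R) a b x : a <= b -> {within `[a, b], continuous f} ->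
  {for x, continuous (fun y => f (clamp a b y))}.
Proof.
move=> ab cf; apply/continuous_epsP => e e0.
have [d d0 Hd] := within_continuous_eps cf (clamp_itv x ab) e0.
exists d => // y yx; apply: Hd; first exact: clamp_itv.
exact: le_lt_trans (clamp_lipschitz _ _ _ _) yx.
Qed.

End calculus.

(** * The core [c_2, c_1] and the hypotheses of the spectral gap *)

Section unimodal_map.
Context {R : realType}.
Variables (a b c a0 : R) (f psip psim : R -> R).
Hypothesis Hf : unimodal_expanding_mixing a b c f.
Hypothesis Hpsi : inverse_branches a b c f a0 psip psim.
Implicit Types (x y u v : R).
Notation c1 := (f c).
Notation c2 := (f (f c)).

Let ac : a < c. Proof. exact: uem_a_lt_c Hf. Qed.
Let cb : c < b. Proof. exact: uem_c_lt_b Hf. Qed.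
Let ab : a < b. Proof. exact: lt_trans cb. Qed.
Let a0a : a0 < a. Proof. exact: ib_a0_lt_a Hpsi. Qed.

Lemma f_stable x : a <= x <= b -> a <= f x <= b.
Proof. by have := @uem_stable _ _ _ _ _ Hf x; rewrite !in_itv. Qed.

Let cab : a <= c <= b. Proof. by rewrite !ltW. Qed.
Let c1ab : a <= c1 <= b. Proof. exact: f_stable. Qed.

Lemma f_increasing x y : a <= x -> x < y -> y <= c -> f x < f y.
Proof.
move=> ax xy yc; apply: (uem_increasing Hf) => //.
  by rewrite in_itv/= ax (le_trans (ltW xy) yc).
by rewrite in_itv/= yc (le_trans ax (ltW xy)).
Qed.

Lemma f_decreasing x y : c <= x -> x < y -> y <= b -> f y < f x.
Proof.
move=> cx xy yb; apply: (uem_decreasing Hf) => //.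
  by rewrite in_itv/= yb (le_trans cx (ltW xy)).
by rewrite in_itv/= cx (le_trans (ltW xy) yb).
Qed.

Lemma f_le_c1 x : a <= x <= b -> f x <= c1.
Proof.
move=> /andP[ax xb]; have [xc|cx|->//] := ltgtP x c.
  by apply/ltW/f_increasing.
by apply/ltW/f_decreasing.
Qed.

Lemma psip_f x : a <= x <= c -> psip (f x) = x.
Proof. by move=> h; apply: (ib_plus_f Hpsi); rewrite in_itv. Qed.

Lemma psim_f x : c <= x <= b -> psim (f x) = x.
Proof. by move=> h; apply: (ib_minus_f Hpsi); rewrite in_itv. Qed.

Lemma psip_c1 : psip c1 = c. Proof. by rewrite psip_f// lexx ltW. Qed.
Lemma psim_c1 : psim c1 = c. Proof. by rewrite psim_f// lexx ltW. Qed.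

Lemma psip_increasing x y : x < y -> y <= c1 -> psip x < psip y.
Proof.
move=> xy yc; apply: (ib_increasing Hpsi) => //; rewrite in_itv//=.
exact: le_trans (ltW xy) yc.
Qed.

Lemma psim_decreasing x y : x < y -> y <= c1 -> psim y < psim x.
Proof.
move=> xy yc; apply: (ib_decreasing Hpsi) => //; rewrite in_itv//=.
exact: le_trans (ltW xy) yc.
Qed.

Lemma psip_derive j x : (j < 3)%N -> x <= c1 ->
  is_derive x (1 : R) (derive1n j psip) (derive1n j.+1 psip x).
Proof.
have [e e0 H] := ib_smooth_plus Hpsi; move=> j3 xc.
by apply: (cdiff3_is_derive H) => //=; rewrite in_itv/=; lra.
Qed.

Lemma psim_derive j x : (j < 3)%N -> x <= c1 ->
  is_derive x (1 : R) (derive1n j psim) (derive1n j.+1 psim x).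
Proof.
have [e e0 H] := ib_smooth_minus Hpsi; move=> j3 xc.
by apply: (cdiff3_is_derive H) => //=; rewrite in_itv/=; lra.
Qed.

Lemma psip_derive_ge0 x : x <= c1 -> 0 <= derive1 psip x.
Proof.
move=> xc; apply: (derive_ge0_of_incr xc _ (@psip_derive 0 x isT xc)).
by move=> y yx; exact: psip_increasing.
Qed.

Lemma psim_derive_le0 x : x <= c1 -> derive1 psim x <= 0.
Proof.
move=> xc; rewrite -oppr_ge0.
apply: (@derive_ge0_of_incr _ (fun t => - psim t) x _ c1 xc).
  by move=> y yx; rewrite ltrN2; exact: psim_decreasing.
exact: is_deriveN (@psim_derive 0 x isT xc).
Qed.

Let sup_lt1 (g : R -> R) :
  (ereal_sup [set `|g x|%:E | x in `]-oo, c1]] < 1)%E ->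
  exists k, [/\ 0 <= k, k < 1 & forall x, x <= c1 -> `|g x| <= k].
Proof.
set S := ereal_sup _ => S1.
have gS x : x <= c1 -> (`|g x|%:E <= S)%E.
  by move=> xc; apply: ereal_sup_ubound; exists x => //=; rewrite in_itv.
have S0 : (0 <= S)%E by apply: le_trans (gS c1 (lexx _)); rewrite lee_fin.
have Sfin : S \is a fin_num by rewrite ge0_fin_numE// (lt_trans S1)// ltry.
exists (fine S); split.
- by rewrite fine_ge0.
- by rewrite -lte_fin fineK.
- by move=> x /gS; rewrite -{1}(fineK Sfin) lee_fin.
Qed.

Let kp_ex := sup_lt1 (ib_contracting_plus Hpsi).
Let km_ex := sup_lt1 (ib_contracting_minus Hpsi).

Lemma contraction_rate : exists k, [/\ 0 <= k, k < 1,
  forall x, x <= c1 -> `|derive1 psip x| <= k &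
  forall x, x <= c1 -> `|derive1 psim x| <= k].
Proof.
have [kp [kp0 kp1 Hp]] := kp_ex; have [km [km0 km1 Hm]] := km_ex.
exists (Num.max kp km); split.
- by rewrite le_max kp0.
- by rewrite gt_max kp1.
- by move=> x /Hp h; rewrite le_max h.
- by move=> x /Hm h; rewrite le_max h orbT.
Qed.

Let lip_p k : (forall x, x <= c1 -> `|derive1 psip x| <= k) -> 0 <= k ->
  forall x y, x <= y -> y <= c1 -> `|psip y - psip x| <= k * (y - x).
Proof.
move=> hk k0 x y xy yc; apply: (@MVT_lipschitz _ psip (derive1 psip)) => // t /andP[_ ty].
  by apply: (@psip_derive 0) => //; exact: le_trans yc.
by apply: hk; exact: le_trans yc.
Qed.

Let lip_m k : (forall x, x <= c1 -> `|derive1 psim x| <= k) -> 0 <= k ->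
  forall x y, x <= y -> y <= c1 -> `|psim y - psim x| <= k * (y - x).
Proof.
move=> hk k0 x y xy yc; apply: (@MVT_lipschitz _ psim (derive1 psim)) => // t /andP[_ ty].
  by apply: (@psim_derive 0) => //; exact: le_trans yc.
by apply: hk; exact: le_trans yc.
Qed.

(** Contraction of [psip] gives c - a <= k (c_1 - f a) < c_1 - f a <= c_1 - a. *)
Lemma c_lt_c1 : c < c1.
Proof.
have [k [k0 k1 Hp _]] := contraction_rate.
have fac : f a < c1 by apply: f_increasing => //; exact: lexx.
have pa : psip (f a) = a by apply: psip_f; rewrite lexx ltW.
have := lip_p Hp k0 (ltW fac) (lexx _).
rewrite psip_c1 pa gtr0_norm ?subr_gt0// => h.
have fa : a <= f a by have /andP[] : a <= f a <= b by apply: f_stable; rewrite lexx ltW.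
have : k * (c1 - f a) < c1 - f a by rewrite gtr_pMl// subr_gt0.
lra.
Qed.

Lemma c2_lt_c1 : c2 < c1.
Proof. by apply: f_decreasing; [exact: lexx|exact: c_lt_c1|case/andP: c1ab]. Qed.

(** If c <= c_2, contraction of [psim] gives c_1 - c_2 <= k (c_3 - c_2) < c_3 - c_2 <= c_1 - c_2, a
    contradiction. *)
Lemma c2_lt_c : c2 < c.
Proof.
rewrite ltNge; apply/negP => cc2.
have [k [k0 k1 _ Hm]] := contraction_rate.
have c2b : c2 <= b by apply: le_trans (ltW c2_lt_c1) _; case/andP: c1ab.
have c23 : c2 < f c2.
  by apply: f_decreasing => //; [exact: c2_lt_c1|case/andP: c1ab].
have c31 : f c2 <= c1 by apply: f_le_c1; rewrite c2b andbT (le_trans (ltW ac)).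
have := lip_m Hm k0 (ltW c23) c31.
rewrite psim_f ?cc2// psim_f; last by rewrite (ltW c_lt_c1); case/andP: c1ab.
rewrite ler0_norm; last by rewrite subr_le0 ltW// c2_lt_c1.
have : k * (f c2 - c2) < f c2 - c2 by rewrite gtr_pMl// subr_gt0.
have := c2_lt_c1; lra.
Qed.

Lemma c2_ge_a : a <= c2.
Proof. by have /andP[] := f_stable c1ab. Qed.

Lemma core_ab y : c2 <= y <= c1 -> a <= y <= b.
Proof.
move=> /andP[h1 h2]; rewrite (le_trans c2_ge_a h1) (le_trans h2)//.
by case/andP: c1ab.
Qed.

(** [psip] contracts towards its fixed point: x - a_0 <= k (f x - a_0) < f x - a_0. This keeps the
    core invariant. *)
Lemma f_gt x : a <= x <= c -> x < f x.
Proof.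
move=> /andP[ax xc]; have [k [k0 k1 Hp _]] := contraction_rate.
have [_ fa0] := ib_fixed Hpsi.
have /andP[afx fxb] : a <= f x <= b by apply: f_stable; rewrite ax (le_trans xc)// ltW.
have a0fx : a0 < f x by exact: lt_le_trans afx.
have fxc : f x <= c1 by apply: f_le_c1; rewrite ax (le_trans xc)// ltW.
have := lip_p Hp k0 (ltW a0fx) fxc; rewrite fa0 psip_f ?ax//.
rewrite ger0_norm; last by rewrite subr_ge0; exact: le_trans (ltW a0a) ax.
have : k * (f x - a0) < f x - a0 by rewrite gtr_pMl// subr_gt0.
lra.
Qed.

Lemma core_stable y : c2 <= y <= c1 -> c2 <= f y <= c1.
Proof.
move=> /andP[h1 h2]; have /andP[ay yb] := core_ab (introT andP (conj h1 h2)).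
rewrite f_le_c1 ?ay// andbT; have [cy|yc] := leP c y.
  move: h2; rewrite le_eqVlt => /orP[/eqP->//|h2]; apply/ltW/f_decreasing => //.
  by case/andP: c1ab.
by apply: le_trans h1 _; apply/ltW/f_gt; rewrite ay ltW.
Qed.

Let ext_bound (g : R -> R) u v : u < v -> Ck_extension 3 `[u, v] f g ->
  exists2 K, 0 < K & forall x, u <= x <= v -> [/\ g x = f x,
    is_derive x (1 : R) g (derive1 g x), `|derive1 g x| <= K &
    {for x, continuous (derive1 g)}].
Proof.
move=> uv [gf [U [oU AU cd]]].
have d j x : (j < 3)%N -> u <= x <= v -> is_derive x (1 : R) (derive1n j g) (derive1n j.+1 g x).
  by move=> j3 h; apply: (cdiff3_is_derive cd) => //; apply: AU; rewrite /= in_itv.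
have cN : {within `[u, v], continuous (fun x => `|derive1 g x|)}.
  apply: continuous_in_subspaceT => x; rewrite inE/= in_itv/= => xuv.
  apply: (@continuous_comp _ _ _ (derive1 g)); last exact: norm_continuous.
  exact: is_derive_continuous (d 1%N x isT xuv).
have [x0 _ Hx0] := EVT_max (ltW uv) cN.
exists (`|derive1 g x0| + 1); first by have := normr_ge0 (derive1 g x0); lra.
move=> x xuv; split.
- by apply: gf; rewrite /= in_itv.
- exact: (d 0%N).
- by have := Hx0 x; rewrite in_itv/= => /(_ xuv); lra.
- exact: is_derive_continuous (d 1%N x isT xuv).
Qed.

(** At a and at c only the C^3 extension g has a two-sided derivative, so the chain rule with the
    inverse branch is written for g. The bound K on g' becomes the lower bound 1 / K on the
    weight. *)
Lemma left_extension : exists g K, 0 < K /\ forall x, a <= x <= c ->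
  [/\ g x = f x /\ derive1 psip (f x) * derive1 g x = 1,
    is_derive x (1 : R) g (derive1 g x), `|derive1 g x| <= K &
    {for x, continuous (derive1 g)}].
Proof.
have [g [eg _]] := uem_expanding_left Hf; have [K K0 H] := ext_bound ac eg.
exists g, K; split=> // x xin; have [gf dg gK cg] := H x xin; split=> //; split=> //.
have fx : f x <= c1.
  by apply: f_le_c1; case/andP: xin => h1 h2; rewrite h1 (le_trans h2)// ltW.
have d1 : is_derive (g x) (1 : R) psip (derive1 psip (g x)).
  by rewrite gf; exact: (@psip_derive 0).
have d2 := @is_derive1_comp R psip g x _ _ d1 dg.
rewrite -gf; apply: (is_derive_identity_on ac xin _ d2) => y yin.
by have [gy _ _ _] := H y yin; rewrite /= gy psip_f.
Qed.

Lemma right_extension : exists g K, 0 < K /\ forall x, c <= x <= b ->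
  [/\ g x = f x /\ derive1 psim (f x) * derive1 g x = 1,
    is_derive x (1 : R) g (derive1 g x), `|derive1 g x| <= K &
    {for x, continuous (derive1 g)}].
Proof.
have [g [eg _]] := uem_expanding_right Hf; have [K K0 H] := ext_bound cb eg.
exists g, K; split=> // x xin; have [gf dg gK cg] := H x xin; split=> //; split=> //.
have fx : f x <= c1.
  by apply: f_le_c1; case/andP: xin => h1 h2; rewrite h2 (le_trans (ltW ac) h1).
have d1 : is_derive (g x) (1 : R) psim (derive1 psim (g x)).
  by rewrite gf; exact: (@psim_derive 0).
have d2 := @is_derive1_comp R psim g x _ _ d1 dg.
rewrite -gf; apply: (is_derive_identity_on cb xin _ d2) => y yin.
by have [gy _ _ _] := H y yin; rewrite /= gy psim_f.
Qed.

Lemma branch_lower_bound : exists2 lam, 0 < lam &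
  (forall x, a <= x <= c -> lam <= derive1 psip (f x)) /\
  (forall x, c <= x <= b -> lam <= `|derive1 psim (f x)|).
Proof.
have [gp [Kp [Kp0 Hp]]] := left_extension; have [gm [Km [Km0 Hm]]] := right_extension.
pose K := Kp + Km; have K0 : 0 < K by exact: addr_gt0.
have inv (s t K' : R) : 0 < K' -> K' <= K -> s * t = 1 -> `|t| <= K' -> K^-1 <= `|s|.
  move=> K'0 K'K st tK; have t0 : 0 < `|t|.
    by rewrite normr_gt0; apply/eqP => E; move: st; rewrite E mulr0 => /eqP; rewrite eq_sym oner_eq0.
  have sE : `|s| = `|t|^-1.
    have tn : `|t| != 0 by rewrite gt_eqF.
    by apply: (mulIf tn); rewrite -normrM st normr1 mulVf.
  by rewrite sE lef_pV2 ?posrE// (le_trans tK).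
exists K^-1; first by rewrite invr_gt0.
split=> x xin.
  have [[gf E] _ tK _] := Hp x xin.
  have fx : f x <= c1.
    by apply: f_le_c1; case/andP: xin => h1 h2; rewrite h1 (le_trans h2)// ltW.
  have := inv _ _ Kp Kp0 _ E tK; rewrite ger0_norm ?psip_derive_ge0//.
  by apply; rewrite /K lerDl ltW.
have [[gf E] _ tK _] := Hm x xin.
by have := inv _ _ Km Km0 _ E tK; apply; rewrite /K lerDr ltW.
Qed.

Let wm x := `|derive1 psim x|.

Lemma wmE x : x <= c1 -> wm x = - derive1 psim x.
Proof. by move=> xc; rewrite /wm ler0_norm// psim_derive_le0. Qed.

Lemma psim_a0 : b < psim a0.
Proof.
have : a < Num.min (f a) (f b) := ib_a_lt_min Hpsi.
rewrite lt_min => /andP[_ afb].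
rewrite -[ltLHS](@psim_f b); last by rewrite lexx ltW.
apply: psim_decreasing; first exact: lt_trans afb.
by apply: f_le_c1; rewrite lexx ltW.
Qed.

(* psim is decreasing, so |psim'| = - psim' is smooth up to c1. *)
Theorem unimodal_branches : exists k, branches a0 b c c1 k psip psim (derive1 psip) wm.
Proof.
have [k [k0 k1 Hp Hm]] := contraction_rate.
have [lam lam0 [lamp lamm]] := branch_lower_bound.
have a0c : a0 < c by exact: lt_trans ac.
have a0c1 : a0 - 1 <= c1 by have := c_lt_c1; lra.
exists k; split => //.
- exact: c_lt_c1.
- exact: ib_fc_lt_b Hpsi.
- by move=> x xc; rewrite psip_derive_ge0//= (le_trans (ler_norm _))// Hp.
- by move=> x xc; rewrite normr_ge0/= Hm.
- by move=> x xc; exact: (@psip_derive 0).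
- by move=> x xc; rewrite wmE// opprK; exact: (@psim_derive 0).
- by move=> x xc; exact: is_derive_continuous (@psip_derive 1 x isT xc).
- move=> x xc; apply: (@continuous_comp _ _ _ (derive1 psim)); last exact: norm_continuous.
  exact: is_derive_continuous (@psim_derive 1 x isT xc).
- exact: psip_increasing.
- exact: psim_decreasing.
- exact: lip_p.
- exact: lip_m.
- exact: psip_c1.
- exact: psim_c1.
- by have [] := ib_fixed Hpsi.
- exact: psim_a0.
- move=> e e0.
  have d0 x (xc : x <= c1) := @psip_derive 0 x isT xc.
  have d1 x (xc : x <= c1) := @psip_derive 1 x isT xc.
  have g1 : 0 < derive1 psip c1 by apply: lt_le_trans lam0 (lamp c _); rewrite lexx ltW.
  have cc x (xc : x <= c1) := is_derive_continuous (@psip_derive 2 x isT xc).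
  exact: (@distortion _ psip (derive1 psip) (derive1n 2 psip) (a0 - 1) c1 e a0c1 e0
    d0 psip_derive_ge0 g1 d1 cc).
move=> e e0.
have [|||||C C0 HC] := @distortion _ (fun x => - psim x) (fun x => - derive1 psim x)
    (fun x => - derive1n 2 psim x) (a0 - 1) c1 e a0c1 e0.
- by move=> x xc; exact: is_deriveN (@psim_derive 0 x isT xc).
- by move=> x xc; rewrite oppr_ge0 psim_derive_le0.
- by rewrite -wmE//; apply: lt_le_trans lam0 (lamm c _); rewrite lexx ltW.
- by move=> x xc; exact: is_deriveN (@psim_derive 1 x isT xc).
- by move=> x xc; apply: continuousN; exact: is_derive_continuous (@psim_derive 2 x isT xc).
exists C => // x y ux xy yc; rewrite !wmE//; last exact: le_trans yc.
have -> : `|psim y - psim x| = `|- psim y - - psim x| by rewrite -opprD normrN.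
exact: HC.
Qed.

(** The index is shifted: orbit n is c_(n+1), so that orbit 0 is the point of the cut. *)
Definition orbit n := iter n.+1 f c.

Lemma iter_ab n x : a <= x <= b -> a <= iter n f x <= b.
Proof. by move=> xab; elim: n => //= n; exact: f_stable. Qed.

Lemma orbit_core n : c2 <= orbit n <= c1.
Proof.
elim: n => [|n IH]; first by rewrite /orbit/= lexx ltW ?c2_lt_c1.
exact: core_stable.
Qed.

Lemma orbit_le n : orbit n <= c1. Proof. by case/andP: (orbit_core n). Qed.

Lemma orbit_ge n : a0 <= orbit n.
Proof.
apply: le_trans (ltW a0a) _; apply: le_trans c2_ge_a _.
by case/andP: (orbit_core n).
Qed.

Lemma orbit_neq n : orbit n != c.
Proof. by apply/eqP => E; apply: (uem_not_periodic Hf); exists n.+1. Qed.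

Lemma orbit_lt n : orbit n < c -> psip (orbit n.+1) = orbit n.
Proof.
move=> h; rewrite /orbit iterS; apply: psip_f.
by have /andP[-> _] := core_ab (orbit_core n); rewrite ltW.
Qed.

Lemma orbit_gt n : c < orbit n -> psim (orbit n.+1) = orbit n.
Proof.
move=> h; rewrite /orbit iterS; apply: psim_f.
by have /andP[_ ->] := core_ab (orbit_core n); rewrite andbT ltW.
Qed.

Lemma core_left lam : (forall x, a <= x <= c -> lam <= derive1 psip (f x)) ->
  forall y, c2 <= y <= c -> psip (f y) = y /\ lam <= derive1 psip (f y).
Proof.
move=> h y /andP[h1 h2]; have yac : a <= y <= c by rewrite (le_trans c2_ge_a h1).
by rewrite psip_f// h.
Qed.

Lemma core_right lam : (forall x, c <= x <= b -> lam <= wm (f x)) ->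
  forall y, c <= y <= c1 -> psim (f y) = y /\ lam <= wm (f y).
Proof.
move=> h y /andP[h1 h2]; have ycb : c <= y <= b by rewrite h1 (le_trans h2)//; case/andP: c1ab.
by rewrite psim_f// h.
Qed.

Lemma iter_continuous n : {within `[a, b], continuous (iter n f)}.
Proof.
have ab' := ltW ab.
(* Precomposition with [clamp] makes every factor continuous on the whole line, so the iterates
   compose. *)
have key m : forall x, {for x, continuous (fun y => iter m f (clamp a b y))}.
  elim: m => [|m IH] x.
    apply/continuous_epsP => e e0; exists e => // y; apply: le_lt_trans.
    exact: clamp_lipschitz.
  have -> : (fun y => iter m.+1 f (clamp a b y)) =
      (fun y => f (clamp a b y)) \o (fun y => iter m f (clamp a b y)).
    by apply/funext => y /=; rewrite [in RHS]clamp_id// iter_ab// clamp_itv.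
  apply: continuous_comp; first exact: IH.
  exact: clamp_continuous (uem_continuous Hf).
have : {within `[a, b], continuous (fun y => iter n f (clamp a b y))}.
  by apply: continuous_subspaceT => x; exact: key.
apply: subspace_eq_continuous => x; rewrite inE/= in_itv/= => xab.
by rewrite /from_subspace/= clamp_id.
Qed.

(** Mixing sends points of ]u, v[ both to the left of q1 and to the right of q2 at all large times;
    the intermediate value theorem covers what lies between. *)
Lemma core_mixing q1 q2 : c2 < q1 -> q1 < q2 -> q2 < c1 ->
  forall u v, c2 <= u -> u < v -> v <= c1 -> exists N, forall n, (N <= n)%N ->
  forall x, q1 <= x <= q2 -> exists2 y, u <= y <= v & iter n f y = x.
Proof.
move=> cq1 q12 q2c u v cu uv vc.
pose U := `]u, v[%classic; pose V1 := `]-oo, q1[%classic; pose V2 := `]q2, +oo[%classic.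
have cc := c2_lt_c1.
have oU : open U by exact: interval_open.
have oV1 : open V1 by exact: interval_open.
have oV2 : open V2 by exact: interval_open.
have UI : U `&` `[c2, c1] !=set0.
  exists ((u + v) / 2); rewrite /U /=; split; rewrite in_itv/=; apply/andP; split; lra.
have V1I : V1 `&` `[c2, c1] !=set0.
  by exists c2; rewrite /V1/=; split; rewrite in_itv//= lexx ltW.
have V2I : V2 `&` `[c2, c1] !=set0.
  by exists c1; rewrite /V2/=; split; rewrite in_itv/= ?andbT// lexx ltW.
have [n1 H1] := uem_mixing Hf oU oV1 UI V1I.
have [n2 H2] := uem_mixing Hf oU oV2 UI V2I.
exists (maxn n1 n2) => n; rewrite geq_max => /andP[nn1 nn2] x /andP[q1x xq2].
have [_ [[y1 [U1 _] <-] [W1 _]]] := H1 n nn1.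
have [_ [[y2 [U2 _] <-] [W2 _]]] := H2 n nn2.
move: U1 U2 W1 W2; rewrite /U /V1 /V2 /= !in_itv/= andbT => /andP[uy1 y1v] /andP[uy2 y2v] h1 h2.
have ua : a <= u by exact: le_trans c2_ge_a cu.
have vb : v <= b by apply: le_trans vc _; case/andP: c1ab.
have sub s t : u <= s -> t <= v -> {within `[s, t], continuous (iter n f)}.
  move=> us tv; apply: (continuous_subspaceW _ (@iter_continuous n)).
  move=> z /=; rewrite !in_itv/= => /andP[sz zt].
  by rewrite (le_trans ua (le_trans us sz)) (le_trans zt (le_trans tv vb)).
have [y12|y21] := leP y1 y2.
  have [||y] := @IVT R (iter n f) y1 y2 x y12.
  - by apply: sub; exact: ltW.
  - by rewrite ge_min le_max (ltW (lt_le_trans h1 q1x)) (ltW (le_lt_trans xq2 h2)) orbT.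
  rewrite in_itv/= => /andP[g1 g2] <-; exists y => //.
  by rewrite (le_trans (ltW uy1) g1) (le_trans g2 (ltW y2v)).
have [||y] := @IVT R (iter n f) y2 y1 x (ltW y21).
- by apply: sub; exact: ltW.
- by rewrite ge_min le_max (ltW (lt_le_trans h1 q1x)) (ltW (le_lt_trans xq2 h2)) orbT.
rewrite in_itv/= => /andP[g1 g2] <-; exists y => //.
by rewrite (le_trans (ltW uy2) g1) (le_trans g2 (ltW y1v)).
Qed.

Lemma psim_c2 : psim c2 = c1.
Proof. by rewrite psim_f// (ltW c_lt_c1); case/andP: c1ab. Qed.

Lemma a0_lt_c2 : a0 < c2. Proof. exact: lt_le_trans a0a c2_ge_a. Qed.

Notation TL := (transfer c1 psip psim (derive1 psip) wm).

Theorem unimodal_power_bounded : exists2 K, 1 <= K & forall n p v,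
  supp a0 b p -> bvb p v -> bvb (iter n TL p) (K * v).
Proof.
have [k HB] := unimodal_branches.
exact: (transfer_power_bounded HB (erefl _) orbit_le orbit_ge orbit_neq orbit_lt orbit_gt).
Qed.

Theorem unimodal_spectral_gap : exists C th, [/\ 0 <= C, 0 < th, th < 1 &
  forall p v n, supp a0 b p -> bvb p v ->
  \int[lebesgue_measure]_(x in `[a0, b]) p x = 0 ->
  bvb (iter n TL p) (C * th ^+ n * v)].
Proof.
have [k HB] := unimodal_branches.
have [lam lam0 [lamp lamm]] := branch_lower_bound.
have cc := c2_lt_c1; have cb1 : c1 <= b by case/andP: c1ab.
have a0c2 := a0_lt_c2.
pose q1 := c2 + (c1 - c2) / 3; pose q2 := c2 + (c1 - c2) / 3 * 2.
apply: (@spectral_gap _ a0 b c c1 k psip psim (derive1 psip) wm orbit HB (erefl _)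
  orbit_le orbit_ge orbit_neq orbit_lt orbit_gt c2 q1 q2 lam f).
- exact: a0_lt_c2.
- exact: c2_lt_c.
- exact: psim_c2.
- exact: core_stable.
- by [].
- exact: core_left.
- exact: core_right.
- rewrite /q1 /q2; lra.
- rewrite /q1; lra.
- rewrite /q2; lra.
- by apply: core_mixing; rewrite /q1 /q2; lra.
Qed.

End unimodal_map.

(** * Total variation of complex functions *)

Section complex_modulus.
Context {R : realType}.
Implicit Types z w : R[i].

(** The modulus as a real number: the norm of R[i] takes its values in R[i]. *)
Definition cabs z : R := complex.Re `|z|.

Lemma cabsE z : cabs z = Num.sqrt (complex.Re z ^+ 2 + complex.Im z ^+ 2).
Proof. by rewrite /cabs normc_def. Qed.

Lemma normC_cabs z : `|z| = (cabs z)%:C.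
Proof. by rewrite /cabs !normc_def. Qed.

Lemma Re_le_cabs z : `|complex.Re z| <= cabs z.
Proof. by rewrite cabsE -sqrtr_sqr ler_wsqrtr// lerDl sqr_ge0. Qed.

Lemma Im_le_cabs z : `|complex.Im z| <= cabs z.
Proof. by rewrite cabsE -sqrtr_sqr ler_wsqrtr// lerDr sqr_ge0. Qed.

Lemma cabs_le z : cabs z <= `|complex.Re z| + `|complex.Im z|.
Proof.
rewrite cabsE -[leRHS]ger0_norm ?addr_ge0// -sqrtr_sqr ler_wsqrtr//.
rewrite sqrrD !real_normK ?num_real//.
have := mulr_ge0 (normr_ge0 (complex.Re z)) (normr_ge0 (complex.Im z)); lra.
Qed.

Lemma cabs_ge0 z : 0 <= cabs z.
Proof. by rewrite cabsE sqrtr_ge0. Qed.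

Lemma cabsM z w : cabs (z * w) = cabs z * cabs w.
Proof.
apply: (@complexI R); rewrite -normC_cabs normrM !normC_cabs.
by rewrite -rmorphM.
Qed.

Lemma cabs_real (x : R) : cabs x%:C = `|x|.
Proof. by rewrite cabsE/= expr0n addr0 sqrtr_sqr. Qed.

Lemma cabsX z n : cabs (z ^+ n) = cabs z ^+ n.
Proof.
elim: n => [|n IH]; last by rewrite !exprS cabsM IH.
by rewrite !expr0 -[1]/(1%:C) cabs_real normr1.
Qed.

Lemma cabsD z w : cabs (z + w) <= cabs z + cabs w.
Proof. by rewrite -lecR rmorphD -!normC_cabs ler_normD. Qed.

Lemma cabsN z : cabs (- z) = cabs z.
Proof. by rewrite /cabs normrN. Qed.

Lemma cabs_sum (I : Type) (r : seq I) (P : pred I) (F : I -> R[i]) :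
  cabs (\sum_(i <- r | P i) F i) <= \sum_(i <- r | P i) cabs (F i).
Proof.
elim/big_ind2: _ => [|x u y v xu yv|//]; first by rewrite -[0]/(0%:C) cabs_real normr0.
by apply: le_trans (cabsD _ _) _; exact: lerD.
Qed.

End complex_modulus.

Section total_variation.
Context {R : realType}.
Implicit Types (phi psi : R -> R[i]) (p q V : R -> R).

Let vsum phi n (s : nat -> R) := \sum_(i < n) cabs (phi (s i.+1) - phi (s i)).

(** V x is the variation on ]-oo, x], as a supremum over chains ending at or before x. *)
Lemma finite_var_dominated phi : finite_var phi -> exists V,
  (forall x, 0 <= V x <= fine (var phi)) /\
  (forall x y, x <= y -> cabs (phi y - phi x) <= V y - V x).
Proof.
rewrite /finite_var => fv; set K := fine _.
have H n s : {homo s : i j / (i <= j)%N >-> i <= j} -> vsum phi n s <= K.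
  move=> hs; have h : ((vsum phi n s)%:E <= var phi)%E.
    by apply: ereal_sup_ubound; exists n, s.
  rewrite -lee_fin fineK// ge0_fin_numE// (le_trans _ h)// lee_fin.
  by apply: sumr_ge0 => i _; exact: cabs_ge0.
pose S x := [set v | exists n (s : nat -> R), [/\ {homo s : i j / (i <= j)%N >-> i <= j},
  s n <= x & v = vsum phi n s]].
have S0 x : S x 0.
  by exists 0%N, (fun=> x); split => //; rewrite /vsum big_ord0.
have SK x : ubound (S x) K by move=> _ [n [s [hs _ ->]]]; exact: H.
exists (fun x => sup (S x)); split=> [x|x y xy].
  by rewrite ub_le_sup//=; [apply: ge_sup => //; exists 0|exists K].
rewrite lerBrDr addrC -lerBrDr; apply: ge_sup; first by exists 0.
move=> _ [n [s [hs snx ->]]]; rewrite lerBrDr.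
(* A chain ending before x is prolonged by x and then by y, which adds the increment from x to y. *)
pose s' i := if (i <= n)%N then s i else if i == n.+1 then x else y.
have E : vsum phi n.+2 s' = vsum phi n s + cabs (phi x - phi (s n)) + cabs (phi y - phi x).
  rewrite /vsum !big_ord_recr/=; congr (_ + _ + _).
  - by apply: eq_bigr => i _; rewrite /s' ltn_ord (ltnW (ltn_ord i)).
  - by rewrite /s' ltnn leqnn eqxx.
  - by rewrite /s' ltnn eqxx leqNgt ltnS leqnSn/= gtn_eqF.
apply: (@le_trans _ _ (vsum phi n.+2 s')).
  by rewrite E lerD2r lerDl cabs_ge0.
apply: ub_le_sup; first by exists K.
exists n.+2, s'; split => //.
- move=> i j ij; rewrite /s'; case: (leqP j n) => [jn|nj].
    by rewrite (leq_trans ij jn); exact: hs.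
  case: (leqP i n) => [iln|ni].
    by have six : s i <= x := le_trans (hs _ _ iln) snx; case: eqP => // _; exact: le_trans xy.
  case: eqP => [i1|ni1]; case: eqP => [j1|nj1] //.
  by exfalso; apply: ni1; apply/eqP; rewrite eqn_leq ni andbT -j1.
- by rewrite /s' ltnNge leqnSn/= gtn_eqF.
Qed.

Lemma finite_var_bvb phi : finite_var phi ->
  bvb (fun x => complex.Re (phi x)) (fine (var phi)) /\
  bvb (fun x => complex.Im (phi x)) (fine (var phi)).
Proof.
move=> /finite_var_dominated[V [V01 dV]]; split; exists V; split=> // x y /dV.
  by apply: le_trans; rewrite -raddfB Re_le_cabs.
by apply: le_trans; rewrite -raddfB Im_le_cabs.
Qed.

Lemma finite_var_cplx p : finite_var (cplx p) -> exists v, bvb p v.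
Proof. by move=> /finite_var_bvb[h _]; exists (fine (var (cplx p))). Qed.

Lemma var_le phi v w : bvb (fun x => complex.Re (phi x)) v ->
  bvb (fun x => complex.Im (phi x)) w -> (var phi <= (v + w)%:E)%E.
Proof.
move=> [V [V01 dV]] [W [W01 dW]]; apply: ge_ereal_sup => _ [n [s [hs ->]]].
rewrite lee_fin; apply: (@le_trans _ _ (\sum_(i < n) ((V (s i.+1) + W (s i.+1)) - (V (s i) + W (s i))))).
  apply: ler_sum => i _; apply: le_trans (cabs_le _) _; rewrite !raddfB.
  have si : s i <= s i.+1 by exact: hs.
  by have := dV _ _ si; have := dW _ _ si; lra.
rewrite -(big_mkord xpredT (fun i => (V (s i.+1) + W (s i.+1)) - (V (s i) + W (s i)))).
rewrite (telescope_sumr_eq (fun i => V (s i) + W (s i)))//.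
by have := V01 (s n); have := V01 (s 0%N); have := W01 (s n); have := W01 (s 0%N); lra.
Qed.

Lemma finite_var_intro phi v w : bvb (fun x => complex.Re (phi x)) v ->
  bvb (fun x => complex.Im (phi x)) w -> finite_var phi.
Proof. by move=> hv hw; apply: le_lt_trans (var_le hv hw) _; rewrite ltry. Qed.

Lemma bvb_cplx p v : bvb p v -> finite_var (cplx p).
Proof. by move=> h; exact: (@finite_var_intro (cplx p) v 0 h (bvb_cst 0)). Qed.

Lemma var_ge0 phi : (0 <= var phi)%E.
Proof.
apply: ereal_sup_ubound; exists 0%N, (fun=> 0); split => //.
by rewrite big_ord0.
Qed.

End total_variation.

(** * The invariant density and its jumps *)

Section one_sided_limits.
Context {R : realType}.
Implicit Types (p q psi w : R -> R) (D : set R) (x l : R).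

Lemma right_cvg_eq_countable p q (E : set R) x l l' : countable E ->
  (\forall y \near x, ~ E y -> p y = q y) ->
  p y @[y --> x^'+] --> l -> q y @[y --> x^'+] --> l' -> l = l'.
Proof.
move=> cE pq pl ql'; apply/eqP; rewrite -subr_eq0; apply/negPn/negP => n0.
have : (fun y => p y - q y) @ x^'+ --> l - l' by exact: cvgB.
move=> /cvgrPdist_lt /(_ `|l - l'|); rewrite normr_gt0 => /(_ n0) H.
have [d /= d0 Hd] := filterI pq H.
have xd : x < x + d by rewrite ltrDl.
have [y] := exists_notin_countable cE xd; rewrite in_itv/= => /andP[xy yd] Ey.
have [|h1 h2] := Hd y; first by rewrite /ball/= ltr_distl; apply/andP; split; lra.
by have := h2 xy; rewrite /= h1// subrr subr0 ltxx.
Qed.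

Lemma left_cvg_eq_countable p q (E : set R) x l l' : countable E ->
  (\forall y \near x, ~ E y -> p y = q y) ->
  p y @[y --> x^'-] --> l -> q y @[y --> x^'-] --> l' -> l = l'.
Proof.
move=> cE pq pl ql'; apply/eqP; rewrite -subr_eq0; apply/negPn/negP => n0.
have : (fun y => p y - q y) @ x^'- --> l - l' by exact: cvgB.
move=> /cvgrPdist_lt /(_ `|l - l'|); rewrite normr_gt0 => /(_ n0) H.
have [d /= d0 Hd] := filterI pq H.
have xd : x - d < x by rewrite ltrBlDr ltrDl.
have [y] := exists_notin_countable cE xd; rewrite in_itv/= => /andP[xy yd] Ey.
have [|h1 h2] := Hd y; first by rewrite /ball/= ltr_distl; apply/andP; split; lra.
by have := h2 yd; rewrite /= h1// subrr subr0 ltxx.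
Qed.

Lemma within_comp psi x D D' : {for x, continuous psi} ->
  (\forall y \near x, D y -> D' (psi y)) ->
  psi y @[y --> within D (nbhs x)] --> within D' (nbhs (psi x)).
Proof.
move=> cpsi DD' A HA; have /= H := cpsi _ HA.
by apply: filterS2 DD' H => y h1 h2 /h1.
Qed.

(** Here [psi1] is whichever branch leads to the point where p may jump. D and D' are sides of x and
    of its image: the same side for the increasing branch, opposite sides for the decreasing one. *)
Lemma within_cvg_pull p psi1 psi2 w1 w2 x D D' l :
  {for x, continuous psi1} -> {for x, continuous psi2} ->
  {for x, continuous w1} -> {for x, continuous w2} ->
  {for psi2 x, continuous p} ->
  (\forall y \near x, D y -> D' (psi1 y)) ->
  p y @[y --> within D' (nbhs (psi1 x))] --> l ->
  w1 y * p (psi1 y) + w2 y * p (psi2 y) @[y --> within D (nbhs x)] -->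
    w1 x * l + w2 x * p (psi2 x).
Proof.
move=> c1 c2 cw1 cw2 cp DD' pl; apply: cvgD.
  apply: cvgM; first exact: cvg_within_filter cw1.
  exact: cvg_comp (within_comp c1 DD') pl.
apply: cvg_within_filter; apply: continuousM => //.
exact: (@continuous_comp _ _ _ psi2 p).
Qed.

End one_sided_limits.

(** * The fixed point equation of rho_0 and the decay of its jumps *)

Section invariant_density.
Context {R : realType}.
Variables (a b c a0 : R) (f psip psim rho0 : R -> R).
Hypothesis Hf : unimodal_expanding_mixing a b c f.
Hypothesis Hpsi : inverse_branches a b c f a0 psip psim.
Hypothesis Hrho : acip_density a b c f rho0.
Implicit Types (x y t : R).
Notation c1 := (f c).
Notation c2 := (f (f c)).
Notation mu := (@lebesgue_measure R).
Notation wm := (fun x => `|derive1 psim x|).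
Notation TL := (transfer c1 psip psim (derive1 psip) wm).
Notation orbit := (orbit c f).

Let ac : a < c. Proof. exact: uem_a_lt_c Hf. Qed.
Let cb : c < b. Proof. exact: uem_c_lt_b Hf. Qed.
Let a0a : a0 < a. Proof. exact: ib_a0_lt_a Hpsi. Qed.
Let c1b : c1 < b. Proof. exact: ib_fc_lt_b Hpsi. Qed.
Let a0c2 : a0 < c2. Proof. exact: a0_lt_c2 Hf Hpsi. Qed.
Let ac2 : a <= c2. Proof. exact: c2_ge_a Hf. Qed.

Lemma rho_bvb : exists v, bvb rho0 v.
Proof. exact: finite_var_cplx (acip_bv Hrho). Qed.

Lemma rho_bcc : bcc rho0.
Proof. by have [v /bvb_bcc] := rho_bvb. Qed.

Lemma rho_supp_core : supp c2 c1 rho0.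
Proof.
move=> x; apply: contraNeq => /(acip_support Hrho); by rewrite in_itv.
Qed.

Lemma rho_supp : supp a0 b rho0.
Proof. by apply: suppS rho_supp_core; exact: ltW. Qed.

Lemma rho_int1 : \int[mu]_(x in `[a0, b]) rho0 x = 1.
Proof.
have [_ _ H _] := acip_invariant Hrho.
rewrite (@int_supp _ c2 c1)//; [|exact/ltW/(c2_lt_c1 Hf Hpsi)|exact: ltW|exact: ltW|exact: rho_bcc|exact: rho_supp_core].
rewrite -(@int_supp _ c2 c1 _ a b) //; [|exact/ltW/(c2_lt_c1 Hf Hpsi)|exact: ltW|exact: rho_bcc|exact: rho_supp_core].
by rewrite /Rintegral H.
Qed.

Let preimage_itv t x : a <= x <= b -> t < c1 ->
  (f x <= t) = (x <= psip t) || (psim t <= x).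
Proof.
move=> /andP[ax xb] tc.
have pt : psip t < c by rewrite -(psip_c1 Hf Hpsi); exact: psip_increasing Hpsi _ _ tc (lexx _).
have mt : c < psim t by rewrite -(psim_c1 Hf Hpsi); exact: psim_decreasing Hpsi _ _ tc (lexx _).
have fx : f x <= c1 by apply: (f_le_c1 Hf); rewrite ax.
have [xc|cx] := leP x c.
  rewrite [psim t <= x]leNgt (le_lt_trans xc mt) orbF.
  have xE : psip (f x) = x by apply: (psip_f Hpsi); rewrite ax.
  have [|tf] := leP (f x) t.
    rewrite le_eqVlt => /predU1P[<-|ft]; first by rewrite xE lexx.
    by rewrite -[X in X <= _]xE ltW//; exact: psip_increasing Hpsi _ _ ft (ltW tc).
  by apply/esym/negbTE; rewrite -ltNge -[ltRHS]xE; exact: psip_increasing Hpsi _ _ tf fx.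
rewrite [x <= psip t]leNgt (lt_trans pt cx)/=.
have xE : psim (f x) = x by apply: (psim_f Hpsi); rewrite (ltW cx).
have [|tf] := leP (f x) t.
  rewrite le_eqVlt => /predU1P[<-|ft]; first by rewrite xE lexx.
  by rewrite -[X in _ <= X]xE ltW//; exact: psim_decreasing Hpsi _ _ ft (ltW tc).
by apply/esym/negbTE; rewrite -ltNge -[ltLHS]xE; exact: psim_decreasing Hpsi _ _ tf fx.
Qed.

Notation Rint s := (\int[mu]_(x in `[a0, s]) rho0 x).

(** A right end beyond b, hence beyond the mass, that dominates [psim t] for every t >= a_0. *)
Let B' := psim a0.
Let bB' : b < B'. Proof. exact: psim_a0 Hf Hpsi. Qed.

Let Rint_S (P : R -> bool) : bcc (fun x => if P x then rho0 x else 0) ->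
  fine (\int[mu]_(x in `[a, b]%classic `&` [set x | P x]) (rho0 x)%:E) =
  \int[mu]_(x in `[a0, B']) (if P x then rho0 x else 0).
Proof.
move=> bP.
have sP : supp a b (fun x => if P x then rho0 x else 0).
  by move=> x hx; case: ifP => // _; apply: (suppS ac2 (ltW c1b) rho_supp_core).
rewrite (@int_supp _ a b _ a0 B')//; [|exact/ltW/(lt_trans ac)|exact: ltW|exact: ltW].
rewrite /Rintegral; congr fine.
rewrite integral_mkcondr; apply: eq_integral => x _.
rewrite patchE; case: ifPn; first by rewrite inE/= => ->.
by move=> /negP; rewrite inE/= => /negP/negbTE->.
Qed.

Let rho_le_bcc (t : R) : bcc (fun x => if x <= t then rho0 x else 0).
Proof.
have -> : (fun x => if x <= t then rho0 x else 0) =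
    (fun x => rho0 x - rho0 x * (if t < x then 1 else 0)).
  by apply/funext => x; case: leP => _; rewrite ?mulr0 ?mulr1 ?subr0 ?subrr.
apply: bccB; first exact: rho_bcc.
apply: bccM; [exact: rho_bcc|exact: bvb_bcc (bvb_gt t)].
Qed.

(** Invariance is tested on ]-oo, t], whose preimage is what lies to the left of [psip t] and to the
    right of [psim t]. *)
Lemma rho_int_invariance t : a0 <= t -> t < c1 ->
  Rint (psip t) + (Rint B' - Rint (psim t)) = Rint t.
Proof.
move=> at0 tc; have [_ _ _ inv] := acip_invariant Hrho.
have rb := rho_bcc.
have pt : psip t < c by rewrite -(psip_c1 Hf Hpsi); exact: psip_increasing Hpsi _ _ tc (lexx _).
have mt : c < psim t by rewrite -(psim_c1 Hf Hpsi); exact: psim_decreasing Hpsi _ _ tc (lexx _).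
have pa0 : psip a0 = a0 by have [] := ib_fixed Hpsi.
have a0p : a0 <= psip t.
  move: at0; rewrite le_eqVlt => /predU1P[<-|at0]; first by rewrite pa0.
  by rewrite -[leLHS]pa0; apply/ltW/(psip_increasing Hpsi) => //; exact: ltW.
have mB : psim t <= B'.
  move: at0; rewrite le_eqVlt => /predU1P[<-|at0]//.
  by apply/ltW/(psim_decreasing Hpsi) => //; exact: ltW.
have /(congr1 fine) := inv `]-oo, t]%classic (measurable_itv _).
pose P1 x := (x <= psip t) || (psim t <= x).
have -> : `[a, b]%classic `&` f @^-1` `]-oo, t]%classic = `[a, b]%classic `&` [set x | P1 x].
  apply/seteqP; split=> x /=; rewrite !in_itv/= => -[xab]; rewrite /P1.
    by rewrite preimage_itv.
  by rewrite preimage_itv.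
have -> : `[a, b]%classic `&` `]-oo, t]%classic = `[a, b]%classic `&` [set x | x <= t].
  by apply/seteqP; split=> x /=; rewrite !in_itv/=.
have b1 : bcc (fun x => if P1 x then rho0 x else 0).
  have -> : (fun x => if P1 x then rho0 x else 0) =
      (fun x => (if x <= psip t then rho0 x else 0) + rho0 x * (if psim t <= x then 1 else 0)).
    apply/funext => x; rewrite /P1; case: leP => /= xp.
      by rewrite leNgt (le_lt_trans xp (lt_trans pt mt)) mulr0 addr0.
    by case: ifP; rewrite ?mulr1 ?mulr0 ?addr0 ?add0r.
  apply: bccD; first exact: rho_le_bcc.
  apply: bccM; [exact: rho_bcc|exact: bvb_bcc (bvb_ge _)].
rewrite (Rint_S b1) (Rint_S (rho_le_bcc t)).
have tB : t <= B' by apply: le_trans (ltW bB'); apply: ltW (lt_trans tc c1b).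
have -> : \int[mu]_(x in `[a0, B']) (if x <= t then rho0 x else 0) = Rint t.
  have z0 x : t < x < B' -> (if x <= t then rho0 x else 0) = 0.
    by move=> /andP[tx _]; rewrite leNgt tx.
  rewrite (int_split at0 tB (rho_le_bcc t)) (int_zero z0 (rho_le_bcc t)) addr0.
  by apply: int_eq => x /andP[_ ->].
move=> <-; pose p1 x := if P1 x then rho0 x else 0.
rewrite -[X in _ = Rintegral _ _ X]/p1.
have pm := ltW (lt_trans pt mt).
rewrite (@int_split _ p1 a0 (psip t) B' a0p (le_trans pm mB) b1).
rewrite (@int_split _ p1 (psip t) (psim t) B' pm mB b1).
rewrite (@int_split _ rho0 a0 (psim t) B' (le_trans a0p pm) mB rb).
congr (_ + _); first by apply: int_eq => x /andP[_ xp]; rewrite /p1 /P1 xp.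
rewrite [X in _ = X + _]int_zero//; last first.
  by move=> x /andP[h1 h2]; rewrite /p1 /P1 !leNgt h1 h2.
rewrite add0r addrC addKr; apply: int_eq => x /andP[xp _].
by rewrite /p1 /P1 xp orbT.
Qed.

(* The derivative of the invariance of the distribution function of rho_0. *)
Lemma transfer_rho : countable [set x | TL rho0 x <> rho0 x].
Proof.
have [k HB] := unimodal_branches Hf Hpsi; have rb := rho_bcc; have [_ cd] := rb.
pose D := [set x | ~ {for x, continuous rho0}].
have cE1 := countable_preimage cd (psi1_inj HB).
have cE2 := countable_preimage cd (psi2_inj HB).
have cE := countableU (countableU cd (countable1 c1)) (countableU cE1 cE2).
apply: sub_countable (countableU cE (countable1 a0)); apply: subset_card_le => x /= TLx.
apply: contrapT => /not_orP[/not_orP[/not_orP[/contrapT cx xc1] /not_orP[h1 h2]] xa0]; apply: TLx.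
have [xc|cx1] := ltP x c1; last first.
  have {}cx1 : c1 < x by rewrite lt_neqAle cx1 andbT; apply/eqP => E; apply: xc1.
  by rewrite /transfer cut_gt// !mul0r addr0 rho_supp_core// negb_and -!ltNge cx1 orbT.
have [xa|ax] := ltP x a0.
  rewrite (transfer_suppAB HB rho_supp) ?rho_supp// negb_and -!ltNge xa//.
have {}ax : a0 < x by rewrite lt_neqAle ax andbT; apply/eqP => E; apply: xa0.
have {h1}cp : {for psip x, continuous rho0}.
  by apply: contrapT => h; apply: h1; split => //=; rewrite in_itv/= ltW.
have {h2}cm : {for psim x, continuous rho0}.
  by apply: contrapT => h; apply: h2; split => //=; rewrite in_itv/= ltW.
have ap : a0 < psip x by exact: (psi1_gtA HB) (ltW xc).
have am : a0 < psim x by apply: lt_le_trans (psi2_ge HB (ltW xc)); exact: br_Ac HB.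
have d0 := prim_derive rb ax cx.
have d1 := @is_derive1_comp R (fun s => Rint s) psip x _ _ (prim_derive rb ap cp) (br_d1 HB (ltW xc)).
have d2 := @is_derive1_comp R (fun s => Rint s) psim x _ _ (prim_derive rb am cm) (br_d2 HB (ltW xc)).
have d3 := is_deriveD d1 (is_deriveB (is_derive_cst (Rint B') x (1:R)) d2).
pose r := Num.min (x - a0) (c1 - x).
have r0 : 0 < r by rewrite lt_min !subr_gt0 ax.
have d4 := @is_derive_near _ (fun s => Rint s) _ x _ r r0 _ d3.
have E : rho0 x = rho0 (psip x) * derive1 psip x + (0 - rho0 (psim x) * - wm x).
  have [_ <-] := d0; have [|_ <-//] := d4.
  move=> y; rewrite ltr_distl => /andP[y1 y2] /=.
  have h1 : r <= x - a0 by rewrite ge_min lexx.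
  have h2 : r <= c1 - x by rewrite ge_min lexx orbT.
  by rewrite /= -rho_int_invariance//; lra.
by rewrite E /transfer cut_lt//; ring.
Qed.

Hypothesis Hc : not_preperiodic f c.

Lemma orbit_inj : injective orbit.
Proof.
move=> m n; wlog mn : m n / (m <= n)%N => [hw E|E].
  by have [|/ltnW] := leqP m n => h; [exact: hw|apply/esym/hw].
apply/eqP; rewrite eqn_leq mn/= leqNgt; apply/negP => mltn.
apply: (Hc (n := m.+1)) => //; exists (n - m)%N; split; first by rewrite subn_gt0.
by rewrite -iterD addnS subnK// -[LHS]/(orbit n) -E.
Qed.

Lemma orbit_ltc1 n : orbit n.+1 < c1.
Proof.
rewrite lt_neqAle (orbit_le Hf Hpsi) andbT; apply/eqP => E.
by have := @orbit_inj n.+1 0%N E.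
Qed.

Notation s := (jump c f rho0).

Let rlim x := lim (rho0 y @[y --> x^'+]).
Let llim x := lim (rho0 y @[y --> x^'-]).

Let rlimP x : rho0 y @[y --> x^'+] --> rlim x.
Proof. by have [v hv] := rho_bvb; exact: bvb_right_cvg hv. Qed.

Let llimP x : rho0 y @[y --> x^'-] --> llim x.
Proof. by have [v hv] := rho_bvb; exact: bvb_left_cvg hv. Qed.

Let jumpE n : s n.+1 = rlim (orbit n) - llim (orbit n). Proof. by []. Qed.

(* Among the preimages of c_{n+1} only c_n is in the orbit, so that only one of
   the two terms of L_1 rho_0 jumps at c_{n+1}. *)
Lemma jump_decay k : branches a0 b c c1 k psip psim (derive1 psip) wm ->
  forall n, `|s n.+2| <= k * `|s n.+1|.
Proof.
move=> HB n; rewrite !jumpE; set x := orbit n.+1.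
have xc : x < c1 := orbit_ltc1 n; have xc' := ltW xc.
pose q y := derive1 psip y * rho0 (psip y) + wm y * rho0 (psim y).
have qE : \forall y \near x, ~ [set y | TL rho0 y <> rho0 y] y -> q y = rho0 y.
  have nx : \forall y \near x, y < c1 by exact: (@open_lt R c1).
  apply: filterS nx => y yc /= /contrapT yE.
  by rewrite -[RHS]yE /transfer cut_lt// !mul1r.
have cE := transfer_rho.
have cp1 := psi1_cont HB xc'; have cp2 := psi2_cont HB xc'.
have cw1 := br_cw1 HB xc'; have cw2 := br_cw2 HB xc'.
have nx : \forall y \near x, y < c1 by exact: (@open_lt R c1).
have [nc|cn] := ltP (orbit n) c.
  have xn : psip x = orbit n by exact: (orbit_lt Hf Hpsi).
  have cy : {for psim x, continuous rho0}.
    apply: (acip_continuous Hrho) => -[//|m] _; rewrite -/(orbit m) => mE.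
    have cm : c < orbit m.
      rewrite lt_neqAle eq_sym (orbit_neq Hf) -mE; exact: (psi2_ge HB).
    have E : psim (orbit m.+1) = psim x by rewrite (orbit_gt Hf Hpsi cm).
    have /orbit_inj[mn] : orbit m.+1 = orbit n.+1.
      by apply: (psi2_inj HB) E; rewrite inE/= in_itv/=; exact: (orbit_le Hf Hpsi).
    by move: cm; rewrite mn ltNge (ltW nc).
  have hr : rlim x = derive1 psip x * rlim (orbit n) + wm x * rho0 (psim x).
    apply/esym/(right_cvg_eq_countable cE qE _ (@rlimP x)).
    have rP : rho0 y @[y --> (psip x)^'+] --> rlim (orbit n) by rewrite xn; exact: rlimP.
    apply: (within_cvg_pull cp1 cp2 cw1 cw2 cy _ rP).
    by apply: filterS nx => y yc xy; exact: (br_inc HB) (ltW yc).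
  have hl : llim x = derive1 psip x * llim (orbit n) + wm x * rho0 (psim x).
    apply/esym/(left_cvg_eq_countable cE qE _ (@llimP x)).
    have lP : rho0 y @[y --> (psip x)^'-] --> llim (orbit n) by rewrite xn; exact: llimP.
    apply: (within_cvg_pull cp1 cp2 cw1 cw2 cy _ lP).
    by apply: filterS nx => y _ xy; exact: (br_inc HB) xc'.
  rewrite hr hl (_ : _ - _ = derive1 psip x * (rlim (orbit n) - llim (orbit n))); last by ring.
  by rewrite normrM ler_wpM2r// (w1_norm HB).
have {}cn : c < orbit n by rewrite lt_neqAle eq_sym (orbit_neq Hf).
have xn : psim x = orbit n by exact: (orbit_gt Hf Hpsi).
have cy : {for psip x, continuous rho0}.
  apply: (acip_continuous Hrho) => -[//|m] _; rewrite -/(orbit m) => mE.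
  have cm : orbit m < c.
    rewrite lt_neqAle (orbit_neq Hf) -mE; exact: (psi1_le HB).
  have E : psip (orbit m.+1) = psip x by rewrite (orbit_lt Hf Hpsi cm).
  have /orbit_inj[mn] : orbit m.+1 = orbit n.+1.
    by apply: (psi1_inj HB) E; rewrite inE/= in_itv/=; exact: (orbit_le Hf Hpsi).
  by move: cm; rewrite mn ltNge (ltW cn).
have qE' : \forall y \near x, ~ [set y | TL rho0 y <> rho0 y] y ->
    wm y * rho0 (psim y) + derive1 psip y * rho0 (psip y) = rho0 y.
  by apply: filterS qE => y h /h <-; rewrite addrC.
(* [psim] reverses the order: right limits at x come from left limits at c_(n+1), so the jump
   changes sign. *)
have hr : rlim x = wm x * llim (orbit n) + derive1 psip x * rho0 (psip x).
  apply/esym/(right_cvg_eq_countable cE qE' _ (@rlimP x)).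
  have lP : rho0 y @[y --> (psim x)^'-] --> llim (orbit n) by rewrite xn; exact: llimP.
  apply: (within_cvg_pull cp2 cp1 cw2 cw1 cy _ lP).
  by apply: filterS nx => y yc xy; exact: (br_dec HB) (ltW yc).
have hl : llim x = wm x * rlim (orbit n) + derive1 psip x * rho0 (psip x).
  apply/esym/(left_cvg_eq_countable cE qE' _ (@llimP x)).
  have rP : rho0 y @[y --> (psim x)^'+] --> rlim (orbit n) by rewrite xn; exact: rlimP.
  apply: (within_cvg_pull cp2 cp1 cw2 cw1 cy _ rP).
  by apply: filterS nx => y _ xy; exact: (br_dec HB) xc'.
rewrite hr hl (_ : _ - _ = - wm x * (rlim (orbit n) - llim (orbit n))); last by ring.
by rewrite normrM normrN ler_wpM2r// (w2_norm HB).
Qed.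

Lemma jump_exp : exists C k, [/\ 0 <= C, 0 <= k, k < 1 & forall n, `|s n.+1| <= C * k ^+ n].
Proof.
have [k HB] := unimodal_branches Hf Hpsi; have k0 := br_k0 HB.
exists `|s 1|, k; split => //; first exact: br_k1 HB.
elim=> [|n IH]; first by rewrite mulr1.
apply: le_trans (jump_decay HB n) _; rewrite exprS mulrCA.
exact: ler_wpM2l.
Qed.

End invariant_density.

(** * Geometrically convergent series *)

Section geometric_series.
Context {R : realType}.
Implicit Types (u : nat -> R) (C k : R).

Lemma geometric_partial_le k N M : 0 <= k -> k < 1 -> (N <= M)%N ->
  \sum_(N <= i < M) k ^+ i <= k ^+ N / (1 - k).
Proof.
move=> k0 k1 NM; rewrite -(subnKC NM); move: (M - N)%N => n {NM}; elim: n N => [|n IH] N.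
  by rewrite addn0 big_geq// divr_ge0 ?exprn_ge0// subr_ge0 ltW.
rewrite big_ltn ?addnS ?ltnS ?leq_addr// -addSn; apply: le_trans (lerD (lexx _) (IH _)) _.
have k1' : 1 - k != 0 by rewrite subr_eq0 gt_eqF.
by rewrite exprS le_eqVlt; apply/orP; left; apply/eqP; field.
Qed.

Lemma dominated_partial_le u C k N M : 0 <= k -> k < 1 -> (forall n, `|u n| <= C * k ^+ n) ->
  (N <= M)%N -> \sum_(N <= i < M) `|u i| <= C * k ^+ N / (1 - k).
Proof.
move=> k0 k1 uC NM; have C0 : 0 <= C by have := uC 0%N; rewrite expr0 mulr1; exact: le_trans.
apply: (@le_trans _ _ (\sum_(N <= i < M) C * k ^+ i)); first by apply: ler_sum => i _.
by rewrite -mulr_sumr -mulrA ler_wpM2l// geometric_partial_le.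
Qed.

Lemma dominated_series u C k : 0 <= k -> k < 1 -> (forall n, `|u n| <= C * k ^+ n) ->
  exists l, (fun N => \sum_(0 <= i < N) u i) @ \oo --> l /\
    forall N, `|l - \sum_(0 <= i < N) u i| <= C * k ^+ N / (1 - k).
Proof.
move=> k0 k1 uC.
have cu : cvgn (series u).
  apply: normed_cvg; apply: (@series_le_cvg _ _ (geometric C k)) => [n|n|n|].
  - exact: normr_ge0.
  - by have := uC n; exact: le_trans.
  - exact: uC.
  - by apply: is_cvg_geometric_series; rewrite ger0_norm.
exists (limn (series u)); split=> [|N]; first exact: cu.
have H : \forall M \near \oo, `|series u M - series u N| <= C * k ^+ N / (1 - k).
  exists N => // M /= NM; rewrite /series/= (@big_cat_nat _ _ _ N 0 M)//= addrAC subrr add0r.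
  by apply: le_trans (ler_norm_sum _ _ _) _; exact: dominated_partial_le uC NM.
have cN : `|series u M - series u N| @[M --> \oo] --> `|limn (series u) - series u N|.
  by apply: cvg_norm; apply: cvgB; [exact: cu|exact: cvg_cst].
rewrite -[X in _ - X]/(series u N) -(cvg_lim (@Rhausdorff R) cN).
by apply: limr_le => //; apply/cvg_ex; eexists; exact: cN.
Qed.

Lemma geometric_small C k e : 0 <= k -> k < 1 -> 0 < e ->
  exists N, forall n, (N <= n)%N -> C * k ^+ n < e.
Proof.
move=> k0 k1 e0; have h : geometric C k @ \oo --> (0 : R).
  by apply: cvg_geometric; rewrite ger0_norm.
have [N _ HN] := (cvgrPdist_lt _ _).1 h e e0; exists N => n Nn.
by have := HN n Nn; rewrite /= sub0r normrN; exact: le_lt_trans (ler_norm _).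
Qed.

Lemma cvg_dominated_diff u l C k : 0 <= k -> k < 1 ->
  (forall n, `|l - u n| <= C * k ^+ n) -> u @ \oo --> l.
Proof.
move=> k0 k1 H; apply/cvgrPdist_lt => e e0; have [N HN] := geometric_small C k0 k1 e0.
by exists N => // n /= /HN; exact: le_lt_trans.
Qed.

End geometric_series.

Section function_series.
Context {R : realType}.
Notation mu := (@lebesgue_measure R).
Implicit Types (p q : R -> R) (C k u v : R).

(** The geometric bound is uniform in x, so the tail of the series is estimated directly under the
    integral. *)
Lemma series_int (p_ : nat -> R -> R) p q C k u v : u <= v -> 0 <= k -> k < 1 ->
  (forall n, bcc (p_ n)) -> (forall n x, `|p_ n x| <= C * k ^+ n) -> bcc p ->
  (forall x, (fun N => \sum_(0 <= i < N) p_ i x) @ \oo --> p x) -> bcc q ->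
  (fun N => \sum_(0 <= i < N) \int[mu]_(x in `[u, v]) (p_ i x * q x)) @ \oo -->
    \int[mu]_(x in `[u, v]) (p x * q x).
Proof.
move=> uv k0 k1 bp_ pC bp cp bq; have [M M0 qM] := bcc_bound bq.
have bs N : bcc (fun x => \sum_(0 <= i < N) p_ i x).
  elim: N => [|N IH]; first by under [X in bcc X]funext do rewrite big_nil; exact: bcc_cst.
  by under [X in bcc X]funext do rewrite big_nat_recr//=; exact: (bccD IH (bp_ N)).
have sE N : \sum_(0 <= i < N) \int[mu]_(x in `[u, v]) (p_ i x * q x) =
    \int[mu]_(x in `[u, v]) ((\sum_(0 <= i < N) p_ i x) * q x).
  elim: N => [|N IH].
    rewrite big_nil; under eq_Rintegral do rewrite big_nil mul0r.
    by rewrite (@int_cst _ 0)// mul0r.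
  rewrite big_nat_recr//= IH -(intD u v (bccM (bs N) bq) (bccM (bp_ N) bq)).
  by apply: int_eq => x _; rewrite big_nat_recr//= mulrDl.
apply: (@cvg_dominated_diff _ _ _ (C / (1 - k) * M * (v - u)) k) => // N.
have b1 := bccM bp bq; have b2 := bccM (bs N) bq.
rewrite sE -(intB u v b1 b2).
rewrite [leRHS](_ : _ = C * k ^+ N / (1 - k) * M * (v - u)); last by ring.
apply: (int_norm_le uv (bccB b1 b2)) => x _.
rewrite -mulrBl normrM ler_pM//.
have [l [cl Hl]] := dominated_series k0 k1 (fun n => pC n x).
by have -> : p x = l by exact: cvg_unique (cp x) cl.
Qed.

End function_series.

(** * Primitives off a countable set and continuous representatives *)

Section primitives.
Context {R : realType}.
Notation mu := (@lebesgue_measure R).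
Implicit Types (p q P Q : R -> R) (x y u v A B : R).

Lemma continuous_dense_eq P Q u v x : u < v -> u <= x <= v ->
  {for x, continuous P} -> {for x, continuous Q} ->
  (forall s t, u <= s -> s < t -> t <= v -> exists2 y, s < y < t & P y = Q y) -> P x = Q x.
Proof.
move=> uv /andP[ux xv] cP cQ dns; apply/eqP; rewrite -subr_eq0; apply/negPn/negP => n0.
have cPQ : {for x, continuous (fun y => P y - Q y)} by exact: continuousB.
have := (continuous_epsP _ _).1 cPQ `|P x - Q x|; rewrite normr_gt0 => /(_ n0)[d d0 Hd].
pose s := Num.max u (x - d / 2); pose t := Num.min v (x + d / 2).
have st : s < t by rewrite lt_min !gt_max uv; apply/and3P; split; lra.
have us : u <= s by rewrite le_max lexx.
have tv : t <= v by rewrite ge_min lexx.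
have [y /andP[sy yt] E] := dns s t us st tv.
have := Hd y; rewrite E subrr sub0r normrN ltxx => h; apply: notF; apply: h.
move: sy yt; rewrite gt_max lt_min => /andP[_ h1] /andP[_ h2].
by rewrite ltr_distl; apply/andP; split; lra.
Qed.

Lemma exists_ae (Q : R -> Prop) u v : u < v -> (\forall x \ae mu, Q x) ->
  exists2 y, u < y < v & Q y.
Proof.
move=> uv [A [mA A0 QA]]; apply: contrapT => H.
have : (mu `]u, v[%classic <= mu A)%E.
  apply: le_measure; rewrite ?inE//.
  move=> y /=; rewrite in_itv/= => yuv; apply: QA => /= Qy.
  by apply: H; exists y.
by rewrite A0 lebesgue_measure_itv/= lte_fin uv -EFinB lee_fin subr_le0 leNgt uv.
Qed.

(** This class of test functions is stable under products and under composition with the folded map,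
    which destroys differentiability at the turning point. *)
Definition prim_of P p := [/\ bcc P, forall x, {for x, continuous P}, bcc p &
  countable [set x | ~ is_derive x (1 : R) P (p x)]].

Lemma prim_of_cst k : prim_of (cst k) (cst 0).
Proof.
split; [exact: bcc_cst|by move=> x; exact: cst_continuous|exact: bcc_cst|].
rewrite (_ : mkset _ = set0) ?countable0//; apply/seteqP; split=> // x /= h.
by apply: h; exact: is_derive_cst.
Qed.

Lemma prim_ofM P p Q q : prim_of P p -> prim_of Q q ->
  prim_of (fun x => P x * Q x) (fun x => p x * Q x + P x * q x).
Proof.
move=> [bP cP bp dP] [bQ cQ bq dQ]; split.
- exact: bccM.
- by move=> x; exact: continuousM.
- by apply: bccD; exact: bccM.
- apply: sub_countable (countableU dP dQ); apply: subset_card_le => x /= h.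
  apply: contrapT => /not_orP[/contrapT h1 /contrapT h2]; apply: h.
  have := is_deriveM h1 h2; rewrite /GRing.scale/= [Q x * _]mulrC addrC.
  by [].
Qed.

Lemma prim_of_int P p u v : prim_of P p -> u <= v ->
  \int[mu]_(x in `[u, v]) p x = P v - P u.
Proof.
move=> [bP cP bp dP] uv; apply: (FTC_countable uv bp dP).
  by move=> x _; exact: cP.
by move=> x _ /contrapT.
Qed.

Lemma prim_bvb A B p v : A <= B -> supp A B p -> bvb p v ->
  bvb (fun x => \int[mu]_(y in `[A, x]) p y) (v * (B - A)).
Proof.
move=> AB sp hp; have bp := bvb_bcc hp; have np := bcc_norm bp.
exists (fun x => \int[mu]_(y in `[A, x]) `|p y|); split=> [x|x y xy].
  apply/andP; split; first by apply: int_ge0 => y _; exact: normr_ge0.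
  apply: le_trans (int_ge0_supp A x AB np (supp_norm sp) (fun x => normr_ge0 _)) _.
  rewrite -(int_cst v AB); apply: (int_le np (bcc_cst v)) => y _.
  exact: supp_bvb_sup sp hp.
have [Ax|xA] := leP A x.
  rewrite !(@int_split _ _ A x y)// ![_ + _ - _]addrAC !subrr !add0r.
  exact: int_normr.
rewrite ![\int[mu]_(_ in `[A, x]) _]int_empty ?(ltW xA)// !subr0.
exact: int_normr.
Qed.

Lemma prim_of_prim A B p v : A <= B -> supp A B p -> bvb p v ->
  prim_of (fun x => \int[mu]_(y in `[A, x]) p y) p.
Proof.
move=> AB sp hp; have bp := bvb_bcc hp; split.
- exact: bvb_bcc (prim_bvb AB sp hp).
- by move=> x; exact: prim_continuous.
- exact: bp.
have [_ cp] := bp; apply: sub_countable (countableU cp (countable1 A)).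
apply: subset_card_le => x /= h; apply: contrapT => /not_orP[/contrapT cx xA]; apply: h.
have [{}xA|Ax|xE] := ltgtP x A; last by case: xA.
- have -> : p x = 0 by apply: sp; rewrite negb_and -ltNge xA.
  apply: (@is_derive_near _ _ (cst 0) x 0 (A - x)); first by rewrite subr_gt0.
  move=> y; rewrite ltr_distl => /andP[_ h]; rewrite int_empty//; lra.
- exact: prim_derive.
Qed.

Lemma prim_ofDcst P p k : prim_of P p -> prim_of (fun x => P x + k) p.
Proof.
move=> [bP cP bp dP]; split.
- exact: (bccD bP (bcc_cst k)).
- by move=> x; exact: (continuousD (cP x) (@cst_continuous _ _ k x)).
- exact: bp.
apply: sub_countable dP; apply: subset_card_le => x /= h h1; apply: h.
by have := is_deriveD h1 (is_derive_cst k x (1 : R)); rewrite addr0.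
Qed.

(** X and rho_r are given with distributional derivatives only; P is the representative whose point
    values enter the boundary terms. *)
Lemma continuous_version A B (F G : R -> R) v (K : R) : A <= B -> measurable_fun setT F ->
  (forall x, `|F x| <= K) -> is_distributional_derivative F G ->
  supp A B G -> bvb G v ->
  exists P, [/\ prim_of P G, bvb P (v * (B - A)) & \forall x \ae mu, F x = P x].
Proof.
move=> AB mF FK dF sG hG; have PG := prim_of_prim AB sG hG.
have [bP cP bG dP] := PG.
have [C FC] := distributional_derivative_inv mF FK dF bP cP bG dP.
exists (fun x => \int[mu]_(y in `[A, x]) G y + C); split; last exact: FC.
- exact: prim_ofDcst.
- by rewrite -[X in bvb _ X]addr0; apply: bvbD; [exact: prim_bvb|exact: bvb_cst].
Qed.

Lemma distr_derive_countable (F G : R -> R) : bcc G -> finite_var (cplx G) ->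
  is_distributional_derivative F G -> countable [set x | distr_derive F x <> G x].
Proof.
move=> bG fG dG; have [fD dD] : (finite_var (cplx (distr_derive F)) /\
    is_distributional_derivative F (distr_derive F)).
  rewrite /distr_derive; apply: (@xgetPex _ _ [set G0 | finite_var (cplx G0) /\ is_distributional_derivative F G0]).
  by exists G.
have [v hv] := finite_var_cplx fD.
exact: distributional_derivative_unique (bvb_bcc hv) bG dD dG.
Qed.

Lemma ae_countable (E : set R) : countable E -> \forall x \ae mu, ~ E x.
Proof.
move=> cE; exists E; split; first exact: countable_measurable.
- exact: countable_lebesgue_measure0.
- by move=> x /= /contrapT.
Qed.

End primitives.

(** * The source term *)

Section susceptibility_source.
Context {R : realType}.
Variables (a b c a0 : R) (f psip psim rho0 X : R -> R).
Hypothesis Hf : unimodal_expanding_mixing a b c f.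
Hypothesis Hpsi : inverse_branches a b c f a0 psip psim.
Hypothesis Hrho : acip_density a b c f rho0.
Hypothesis HX : perturbation_field a b f X.
Hypothesis Hc : not_preperiodic f c.
Implicit Types (x y t u : R).
Notation c1 := (f c).
Notation c2 := (f (f c)).
Notation mu := (@lebesgue_measure R).
Notation orbit := (orbit c f).
Notation s := (jump c f rho0).
Notation rs := (rho_s c f rho0).
Notation rr := (rho_r c f rho0).

Let a0a : a0 < a. Proof. exact: ib_a0_lt_a Hpsi. Qed.
Let c1b : c1 < b. Proof. exact: ib_fc_lt_b Hpsi. Qed.
Let a0c2 : a0 < c2. Proof. exact: a0_lt_c2 Hf Hpsi. Qed.
Let ac2 : a <= c2. Proof. exact: c2_ge_a Hf. Qed.
Let c21 : c2 < c1. Proof. exact: c2_lt_c1 Hf Hpsi. Qed.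
Let ab : a <= b. Proof. exact: le_trans ac2 (ltW (lt_trans c21 c1b)). Qed.

Lemma heaviside_norm u x : `|heaviside u x| <= 1.
Proof.
rewrite /heaviside; case: ifP => _; first by rewrite normrN normr1.
case: ifP => _; last by rewrite normr0.
by rewrite normrN ger0_norm; lra.
Qed.

Lemma heaviside_bvb u : bvb (heaviside u) 1.
Proof.
have -> : heaviside u = (fun x => (heaviside u x + 1) - 1) by apply/funext => x; rewrite addrK.
rewrite -[X in bvb _ X]addr0; apply: bvbB; last exact: bvb_cst.
apply: bvb_homo => [x y xy|x]; last first.
  by rewrite /heaviside; case: ifP => _; [lra|case: ifP => _; lra].
rewrite lerD2r /heaviside; case: (ltgtP x u) => xu.
- by case: (ltgtP y u) => yu; lra.
- by rewrite ltNge (le_trans (ltW xu) xy)/= gt_eqF ?(lt_le_trans xu xy).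
- by rewrite xu in xy; rewrite ltNge xy/=; case: eqP => _; lra.
Qed.

Let term_bound x : exists C k, [/\ 0 <= C, 0 <= k, k < 1 & forall n,
  `|s n.+1 * heaviside (orbit n) x| <= C * k ^+ n].
Proof.
have [C [k [C0 k0 k1 sC]]] := jump_exp Hf Hpsi Hrho Hc; exists C, k; split=> // n.
rewrite normrM -[leRHS]mulr1; apply: ler_pM => //; exact: heaviside_norm.
Qed.

Lemma rho_s_cvg x : (fun N => \sum_(0 <= i < N) s i.+1 * heaviside (orbit i) x) @ \oo --> rs x.
Proof.
have [C [k [C0 k0 k1 H]]] := term_bound x.
have [l [cl _]] := dominated_series k0 k1 H.
suff -> : rs x = l by [].
apply: (cvg_lim (@Rhausdorff R)); apply: cvg_trans cl; apply: near_eq_cvg.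
by apply: nearW => N; rewrite big_add1.
Qed.

Lemma rho_s_bvb : exists v, bvb rs v.
Proof.
have [C [k [C0 k0 k1 sC]]] := jump_exp Hf Hpsi Hrho Hc.
exists (C * k ^+ 0 / (1 - k)).
apply: (@bvb_series _ (fun i x => s i.+1 * heaviside (orbit i) x) (fun i => `|s i.+1| * 1)).
- by move=> n; apply: bvbZ; exact: heaviside_bvb.
- move=> n; under eq_bigr do rewrite mulr1.
  by apply: (dominated_partial_le k0 k1 sC).
- exact: rho_s_cvg.
Qed.

Lemma jump_sum_cvg : exists S, (fun N => \sum_(0 <= i < N) s i.+1) @ \oo --> S /\
  (forall x, x < c2 -> rs x = - S).
Proof.
have [C [k [C0 k0 k1 sC]]] := jump_exp Hf Hpsi Hrho Hc.
have [S [cS _]] := dominated_series k0 k1 sC; exists S; split => // x xc.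
have cr := @rho_s_cvg x; suff H : (fun N => \sum_(0 <= i < N) s i.+1 * heaviside (orbit i) x) @ \oo --> - S.
  exact: cvg_unique cr H.
have -> : (fun N => \sum_(0 <= i < N) s i.+1 * heaviside (orbit i) x) =
    (fun N => - \sum_(0 <= i < N) s i.+1).
  apply/funext => N; rewrite -sumrN; apply: eq_bigr => i _.
  have /andP[ci _] := orbit_core Hf Hpsi i.
  by rewrite /heaviside (lt_le_trans xc ci) mulrN1.
exact: cvgN.
Qed.

Lemma rho_s_gt x : c1 < x -> rs x = 0.
Proof.
move=> cx; have cr := @rho_s_cvg x.
suff H : (fun N => \sum_(0 <= i < N) s i.+1 * heaviside (orbit i) x) @ \oo --> (0 : R).
  exact: cvg_unique cr H.
have -> : (fun N => \sum_(0 <= i < N) s i.+1 * heaviside (orbit i) x) = (fun N => 0).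
  apply/funext => N; apply: big1 => i _.
  have oi := le_lt_trans (orbit_le Hf Hpsi i) cx.
  by rewrite /heaviside ltNge (ltW oi)/= gt_eqF// mulr0.
exact: cvg_cst.
Qed.

Lemma rho_r_bvb : exists v, bvb rr v.
Proof.
have [v hv] := rho_bvb Hrho; have [w hw] := rho_s_bvb.
by exists (v + w); exact: bvbB.
Qed.

(** Equality almost everywhere improves to equality off a countable set, where rho_r is continuous.
    Beyond c_1 both rho_0 and rho_s vanish; to the left of c_2, rho_0 = 0 and rho_s = - S, whence
    the two boundary values. *)
Lemma rho_r_version S : (forall x, x < c2 -> rs x = - S) ->
  exists Rc G2 v w, [/\ prim_of Rc G2, bvb Rc w, supp a b G2 /\ bvb G2 v,
    countable [set x | rr x <> Rc x] & Rc b = 0 /\ Rc a0 = S].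
Proof.
move=> HS; have [G2 [/finite_var_cplx[v hv] sG dG]] := acip_rho_r_derivative Hrho.
have sG2 : supp a b G2 by move=> x; apply: contraNeq => /sG; rewrite in_itv.
have [w hr] := rho_r_bvb; have br := bvb_bcc hr.
have [K K0 rK] := bcc_bound br.
have [Rc [PR vR aeR]] := continuous_version ab (bcc_measurable br) rK dG sG2 hv.
have [_ cR _ _] := PR; have [_ cr] := br.
have cE : countable [set x | rr x <> Rc x].
  apply: sub_countable cr; apply: subset_card_le => x /= h h1; apply: h.
  apply: (@continuous_dense_eq _ rr Rc x (x + 1)) => //; first lra.
    by rewrite lexx; lra.
  move=> s' t _ st _; exact: exists_ae st aeR.
have key k (x u v' : R) : u < v' -> u <= x <= v' -> (forall y, u < y < v' -> rr y = k) -> Rc x = k.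
  move=> uv xuv H; apply: (@continuous_dense_eq _ Rc (cst k) u v') => //; first exact: cst_continuous.
  move=> s' t us st tv; have [y] := exists_notin_countable cE st.
  rewrite in_itv/= => /andP[sy yt] /contrapT E; exists y; first by rewrite sy.
  by rewrite -E H// (le_lt_trans us sy) (lt_le_trans yt tv).
exists Rc, G2, v, (v * (b - a)); split => //; split.
  apply: (key _ _ b (b + 1)); [lra|by rewrite lexx; lra|move=> y /andP[yb _]].
  have cy := lt_trans c1b yb.
  by rewrite /rho_r rho_s_gt// subr0 (rho_supp_core Hrho)// negb_and -!ltNge cy orbT.
apply: (key _ _ (a0 - 1) a0); [lra|by rewrite lexx; lra|move=> y /andP[_ ya]].
have yc := lt_trans ya a0c2.
by rewrite /rho_r HS// opprK (rho_supp_core Hrho) ?add0r// negb_and -!ltNge yc.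
Qed.

Let core_image y : c2 <= y <= c1 -> exists2 x, a <= x <= b & f x = y.
Proof.
move=> yc.
have cab : c <= c1 := ltW (c_lt_c1 Hf Hpsi).
have cf : {within `[c, c1], continuous f}.
  apply: (continuous_subspaceW _ (uem_continuous Hf)) => z /=; rewrite !in_itv/= => /andP[z1 z2].
  by rewrite (le_trans (ltW (uem_a_lt_c Hf)) z1) (le_trans z2 (ltW c1b)).
have [|x] := @IVT R f c c1 y cab cf.
  by rewrite minC maxC min_l ?max_r// ltW.
rewrite in_itv/= => /andP[x1 x2] <-; exists x => //.
by rewrite (le_trans (ltW (uem_a_lt_c Hf)) x1) (le_trans x2 (ltW c1b)).
Qed.

(** On the core, contained in f(I), the C^2 extension makes X equal to its continuous version at
    every point, in particular at all the c_k. *)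
Lemma field_version : exists Xc G v w, [/\ prim_of Xc G, bvb Xc w, supp a b G /\ bvb G v,
  \forall x \ae mu, X x = Xc x &
  (forall x, c2 <= x <= c1 -> X x = Xc x) /\ countable [set x | distr_derive X x <> G x]].
Proof.
have [G [fG sG dG]] := pf_derivative HX; have [v hv] := finite_var_cplx fG.
have sG' : supp a b G by move=> x; apply: contraNeq => /sG; rewrite in_itv.
have [Xc [PX vX aeX]] := continuous_version ab (pf_measurable HX) (pf_bounded HX) dG sG' hv.
have [_ cX bG _] := PX.
exists Xc, G, v, (v * (b - a)); split => //; split; last exact: distr_derive_countable.
have [E [EX [U [oU fU [cd _]]]]] := pf_smooth HX.
have imE y : c2 <= y <= c1 -> (f @` `[a, b]) y.
  by move=> /core_image[x xab <-]; exists x => //=; rewrite in_itv.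
move=> x xc; rewrite -EX; last exact: imE.
apply: (@continuous_dense_eq _ E Xc c2 c1 x) => //.
  apply: (@is_derive_continuous _ E x (derive1 E x)).
  have := cd 0%N x isT (fU _ (imE x xc)); rewrite /= => /derivableP.
  by rewrite derive1E.
move=> s' t us st tv; have [y /andP[sy yt] Xy] := exists_ae st aeX.
exists y; first by rewrite sy.
by rewrite EX//; apply: imE; rewrite (le_trans us (ltW sy)) (le_trans (ltW yt) tv).
Qed.

Lemma int_heaviside P p u : prim_of P p -> a0 <= u <= b ->
  \int[mu]_(x in `[a0, b]) (heaviside u x * p x) = P a0 - P u.
Proof.
move=> PP /andP[a0u ub]; have [_ _ bp _] := PP; have bH := bvb_bcc (heaviside_bvb u).
have bHp := bccM bH bp.
rewrite (int_split a0u ub bHp) [X in _ + X]int_zero ?addr0//; last first.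
  by move=> x /andP[ux _]; rewrite /heaviside ltNge (ltW ux)/= gt_eqF// mul0r.
rewrite -[RHS]opprB -(prim_of_int PP a0u) -mulN1r -(intZ (-1) a0 u bp).
apply: (int_eq_countable bHp (bccZ (-1) bp) (countable1 u)) => x /andP[_ xu] _.
by rewrite /heaviside xu.
Qed.

(** Each step of rho_s contributes s_i (X P)(a_0) - s_i (X P)(c_i); the sum of the first terms, S (X
    P)(a_0), cancels the boundary term at a_0 of the product of X, the continuous version of rho_r,
    and P. *)
Theorem source_identity : exists g v, [/\ supp a b g, bvb g v,
  countable [set x | source c f rho0 X x <> g x],
  (exists w, bvb (fun x => rho0 x * X x) w) & forall P p, prim_of P p ->
  (fun N => \sum_(0 <= i < N) s i.+1 * X (orbit i) * P (orbit i)) @ \oo -->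
    - (\int[mu]_(x in `[a0, b]) (rho0 x * X x * p x)) - \int[mu]_(x in `[a0, b]) (g x * P x)].
Proof.
have [S [cS HS]] := jump_sum_cvg.
have [Rc [G2 [v2 [w2 [PR vR [sG2 hG2] cR [Rb Ra]]]]]] := rho_r_version HS.
have [Xc [G [v1 [w1 [PX vX [sG hG] aeX [XX cG]]]]]] := field_version.
have [vs hs] := rho_s_bvb; have bs := bvb_bcc hs.
have [bR _ bG2 _] := PR; have [bX cX bG _] := PX.
have XRc := prim_ofM PX PR.
pose g1 x := G x * Rc x + Xc x * G2 x.
pose g x := G x * rs x + g1 x.
have prod_bvb p q v' w' : bvb p v' -> bvb q w' -> exists v, bvb (fun x => p x * q x) v.
  move=> hp hq; have [M M0 pM] := bcc_bound (bvb_bcc hp); have [N N0 qN] := bcc_bound (bvb_bcc hq).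
  by eexists; exact: bvbM M0 N0 pM qN hp hq.
have [v3 h3] := prod_bvb _ _ _ _ hG hs; have [v4 h4] := prod_bvb _ _ _ _ hG vR.
have [v5 h5] := prod_bvb _ _ _ _ vX hG2.
have hg1 : bvb g1 (v4 + v5) := bvbD h4 h5.
have hg : bvb g (v3 + (v4 + v5)) := bvbD h3 hg1.
have rhoX x : rho0 x * X x = rho0 x * Xc x.
  have [xc|xc] := boolP (c2 <= x <= c1); first by rewrite XX.
  by rewrite (rho_supp_core Hrho xc) !mul0r.
exists g, (v3 + (v4 + v5)); split => //.
- by move=> x hx; rewrite /g /g1 (sG _ hx) (sG2 _ hx) !mul0r mulr0 !addr0.
- have dXr : is_distributional_derivative (fun x => X x * rr x) g1.
    have [bP cP bp dP] := XRc.
    apply: (distributional_derivative_prim _ _ bP cP bp dP).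
      apply: measurable_funM; first exact: pf_measurable HX.
      have [vr hr] := rho_r_bvb; exact: bcc_measurable (bvb_bcc hr).
    have := ae_countable cR; apply: filterS2 aeX; first exact: (ae_filter_ringOfSetsType mu).
    by move=> x -> /contrapT ->.
  have cD := distr_derive_countable (bvb_bcc hg1) (bvb_cplx hg1) dXr.
  apply: sub_countable (countableU cG cD); apply: subset_card_le => x /= h.
  by apply: contrapT => /not_orP[/contrapT h1 /contrapT h2]; apply: h; rewrite /source h1 h2.
- have [vr hr] := rho_bvb Hrho; have [w hw] := prod_bvb _ _ _ _ hr vX.
  by exists w; apply: bvb_eq hw => x; rewrite rhoX.
move=> P p PP; have [bP _ bp _] := PP.
have XP := prim_ofM PX PP; have XRP := prim_ofM XRc PP.
have [bXP _ bxp _] := XP.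
have a0b : a0 <= b := le_trans (ltW a0a) ab.
have orb i : a0 <= orbit i <= b.
  by rewrite (orbit_ge Hf Hpsi)/= (le_trans (orbit_le Hf Hpsi i) (ltW c1b)).
have [C [k [C0 k0 k1 sC]]] := jump_exp Hf Hpsi Hrho Hc.
have bp_ n : bcc (fun x => s n.+1 * heaviside (orbit n) x).
  exact: bccZ (bvb_bcc (heaviside_bvb _)).
have pC n x : `|s n.+1 * heaviside (orbit n) x| <= C * k ^+ n.
  rewrite normrM -[leRHS]mulr1; apply: ler_pM => //; exact: heaviside_norm.
have H := series_int a0b k0 k1 bp_ pC bs rho_s_cvg bxp.
have E1 i : \int[mu]_(x in `[a0, b]) (s i.+1 * heaviside (orbit i) x * (G x * P x + Xc x * p x)) =
    s i.+1 * (Xc a0 * P a0) - s i.+1 * X (orbit i) * P (orbit i).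
  transitivity (\int[mu]_(x in `[a0, b]) (s i.+1 * (heaviside (orbit i) x * (G x * P x + Xc x * p x)))).
    by apply: int_eq => x _; rewrite mulrA.
  rewrite (intZ (s i.+1) a0 b (bccM (bvb_bcc (heaviside_bvb _)) bxp)) (int_heaviside XP (orb i)).
  by rewrite XX ?(orbit_core Hf Hpsi)//; ring.
pose J := \int[mu]_(x in `[a0, b]) (rs x * (G x * P x + Xc x * p x)).
have H2 : (fun N => \sum_(0 <= i < N) s i.+1 * X (orbit i) * P (orbit i)) @ \oo -->
    S * (Xc a0 * P a0) - J.
  have -> : (fun N => \sum_(0 <= i < N) s i.+1 * X (orbit i) * P (orbit i)) =
    (fun N => (\sum_(0 <= i < N) s i.+1) * (Xc a0 * P a0) -
      \sum_(0 <= i < N) \int[mu]_(x in `[a0, b]) (s i.+1 * heaviside (orbit i) x * (G x * P x + Xc x * p x))).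
    apply/funext => N; rewrite mulr_suml -sumrB; apply: eq_bigr => i _.
    by rewrite E1 opprB addrC subrK.
  by apply: cvgB => //; apply: cvgMl.
suff <- : S * (Xc a0 * P a0) - J = - (\int[mu]_(x in `[a0, b]) (rho0 x * X x * p x))
    - \int[mu]_(x in `[a0, b]) (g x * P x) by [].
have := prim_of_int XRP a0b; rewrite Rb Ra mulr0 mul0r sub0r.
have b1 : bcc (fun x => g1 x * P x) := bccM (bvb_bcc hg1) bP.
have b2 : bcc (fun x => Xc x * Rc x * p x) := bccM (bccM bX bR) bp.
have b3 : bcc (fun x => rs x * (G x * P x)) := bccM bs (bccM bG bP).
have b4 : bcc (fun x => rs x * (Xc x * p x)) := bccM bs (bccM bX bp).
rewrite (intD a0 b b1 b2) => E2.
have E3 : J = \int[mu]_(x in `[a0, b]) (rs x * (G x * P x)) + \int[mu]_(x in `[a0, b]) (rs x * (Xc x * p x)).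
  by rewrite -(intD a0 b b3 b4); apply: int_eq => x _; rewrite mulrDr.
have E4 : \int[mu]_(x in `[a0, b]) (g x * P x) =
    \int[mu]_(x in `[a0, b]) (rs x * (G x * P x)) + \int[mu]_(x in `[a0, b]) (g1 x * P x).
  by rewrite -(intD a0 b b3 b1); apply: int_eq => x _; rewrite /g; ring.
have E5 : \int[mu]_(x in `[a0, b]) (rho0 x * X x * p x) =
    \int[mu]_(x in `[a0, b]) (Xc x * Rc x * p x) + \int[mu]_(x in `[a0, b]) (rs x * (Xc x * p x)).
  rewrite -(intD a0 b b2 b4).
  apply: (int_eq_countable _ (bccD b2 b4) cR).
    have [vr hr] := rho_bvb Hrho; have := bccM (bccM (bvb_bcc hr) bX) bp.
    by congr bcc; apply/funext => x; rewrite rhoX.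
  move=> x _ /contrapT E; rewrite rhoX -E /rho_r; ring.
rewrite E4 E5 E3; lra.
Qed.

End susceptibility_source.

(** * Duality *)

Section duality.
Context {R : realType}.
Variables (a b c a0 : R) (f psip psim : R -> R).
Hypothesis Hf : unimodal_expanding_mixing a b c f.
Hypothesis Hpsi : inverse_branches a b c f a0 psip psim.
Implicit Types (x y t u : R) (p h P : R -> R).
Notation c1 := (f c).
Notation c2 := (f (f c)).
Notation mu := (@lebesgue_measure R).
Notation wm := (fun x => `|derive1 psim x|).
Notation TL := (transfer c1 psip psim (derive1 psip) wm).

Let ac : a < c. Proof. exact: uem_a_lt_c Hf. Qed.
Let cb : c < b. Proof. exact: uem_c_lt_b Hf. Qed.
Let ab : a < b. Proof. exact: lt_trans cb. Qed.
Let a0a : a0 < a. Proof. exact: ib_a0_lt_a Hpsi. Qed.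
Let a0b : a0 <= b. Proof. exact: ltW (lt_trans a0a ab). Qed.

Definition transfer0 p : R -> R := fun x => cut c1 x * p (psip x) - cut c1 x * p (psim x).

(** f prolonged by constants: continuous on the whole line, with derivative 0 off [a, b]. *)
Definition clamped_map x := f (clamp a b x).
Notation F := clamped_map.

Lemma clamped_map_continuous x : {for x, continuous F}.
Proof. exact: clamp_continuous (ltW ab) (uem_continuous Hf). Qed.

Lemma clamped_map_itv x : a <= x <= b -> F x = f x.
Proof. by move=> h; rewrite /F clamp_id. Qed.

Lemma psip_itv x : x <= c1 -> a <= psip x -> F (psip x) = x.
Proof.
have [k HB] := unimodal_branches Hf Hpsi; move=> xc ap.
have pc := psi1_le HB xc; rewrite clamped_map_itv; last by rewrite ap (le_trans pc)// ltW.
apply: (psi1_inj HB); rewrite ?inE/= ?in_itv/= ?(psip_f Hpsi) ?ap//.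
by apply: (f_le_c1 Hf); rewrite ap (le_trans pc)// ltW.
Qed.

Lemma psim_itv x : x <= c1 -> psim x <= b -> F (psim x) = x.
Proof.
have [k HB] := unimodal_branches Hf Hpsi; move=> xc pb.
have cp := psi2_ge HB xc; rewrite clamped_map_itv; last by rewrite pb (le_trans (ltW ac)).
apply: (psi2_inj HB); rewrite ?inE/= ?in_itv/= ?(psim_f Hpsi) ?cp//.
by apply: (f_le_c1 Hf); rewrite pb (le_trans (ltW ac)).
Qed.

Lemma image_itv x : x <= c1 -> a <= psip x \/ psim x <= b -> a <= x <= b.
Proof.
have [k HB] := unimodal_branches Hf Hpsi; move=> xc [h|h].
  rewrite -(psip_itv xc h); apply: (f_stable Hf); exact: clamp_itv (ltW ab).
rewrite -(psim_itv xc h); apply: (f_stable Hf); exact: clamp_itv (ltW ab).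
Qed.

Let supp_pull p x : supp a b p -> x <= c1 -> ~~ (a <= x <= b) ->
  p (psip x) = 0 /\ p (psim x) = 0.
Proof.
move=> sp xc xab; split; apply: sp; apply: contra xab => /andP[h1 h2].
  by apply: (image_itv xc); left.
by apply: (image_itv xc); right.
Qed.

Lemma transfer_supp_itv p : supp a b p -> supp a b (TL p).
Proof.
move=> sp x xab; have [cx|xc] := ltP c1 x; first by rewrite /transfer cut_gt// !mul0r addr0.
by have [h1 h2] := supp_pull sp xc xab; rewrite /transfer h1 h2 !mulr0 addr0.
Qed.

Lemma transfer0_supp_itv p : supp a b p -> supp a b (transfer0 p).
Proof.
move=> sp x xab; have [cx|xc] := ltP c1 x; first by rewrite /transfer0 cut_gt// !mul0r subr0.
by have [h1 h2] := supp_pull sp xc xab; rewrite /transfer0 h1 h2 !mulr0 subr0.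
Qed.

Lemma transfer0_bcc p : bcc p -> bcc (transfer0 p).
Proof.
have [k HB] := unimodal_branches Hf Hpsi; move=> bp.
have pull psi : {in `]-oo, c1]%classic &, injective psi} ->
    (forall x, x <= c1 -> {for x, continuous psi}) -> bcc (fun x => cut c1 x * p (psi x)).
  move=> ipsi cpsi.
  have c1w x : x <= c1 -> {for x, continuous (cst 1 : R -> R)} by move=> _; exact: cst_continuous.
  have n1w x : x <= c1 -> `|(cst 1 : R -> R) x| <= 1 by rewrite /cst normr1.
  have := bcc_pull bp ipsi cpsi c1w ler01 n1w.
  by congr bcc; apply/funext => x; rewrite /cst mulr1.
exact: bccB (pull _ (psi1_inj HB) (psi1_cont HB)) (pull _ (psi2_inj HB) (psi2_cont HB)).
Qed.

Lemma iter_transfer0_bcc n p : bcc p -> bcc (iter n transfer0 p).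
Proof.
move=> bp; elim: n => [|n IH]; first exact: bp.
by rewrite iterS; exact: transfer0_bcc.
Qed.

(** The break points of the clamped map, and the preimages of the exceptional set D under its two
    monotone pieces. *)
Let excep (D : set R) := ([set a] `|` ([set b] `|` [set c])) `|`
  ((`[a, c]%classic `&` f @^-1` D) `|` (`[c, b]%classic `&` f @^-1` D)).

Let excep_countable D : countable D -> countable (excep D).
Proof.
move=> cD; apply: countableU.
  by apply: countableU; [|apply: countableU]; exact: countable1.
have injl : {in `[a, c]%classic &, injective f}.
  move=> x y; rewrite !inE/= !in_itv/= => hx hy E.
  by rewrite -[LHS](psip_f Hpsi hx) E (psip_f Hpsi).
have injr : {in `[c, b]%classic &, injective f}.
  move=> x y; rewrite !inE/= !in_itv/= => hx hy E.
  by rewrite -[LHS](psim_f Hpsi hx) E (psim_f Hpsi).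
apply: countableU; exact: countable_preimage.
Qed.

Let excepP D x : ~ excep D x -> (exists2 r, 0 < r & forall y, `|y - x| < r -> F y = F x /\ ~~ (a < y < b)) \/
  [/\ a < x < b, x != c & ~ D (F x)].
Proof.
move=> /not_orP[/not_orP[/= xa /not_orP[/= xb xc]] /not_orP[/= h1 h2]].
have [{}xa|ax|//] := ltgtP x a.
  left; exists (a - x); first by rewrite subr_gt0.
  move=> y; rewrite ltr_distl => /andP[_ ya].
  have {}ya : y < a by lra.
  split; last by rewrite negb_and -leNgt ltW.
  by rewrite /F /clamp; congr f; rewrite !(@max_l _ _ a)// ltW.
have [{}xb|bx|//] := ltgtP x b; last first.
  left; exists (x - b); first by rewrite subr_gt0.
  move=> y; rewrite ltr_distl => /andP[yb _].
  have {}yb : b < y by lra.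
  split; last by rewrite negb_and -!leNgt (ltW yb) orbT.
  rewrite /F /clamp; congr f.
  have yab := lt_trans ab yb; have xab := lt_trans ab bx.
  by rewrite (max_r (ltW yab)) (max_r (ltW xab)) !min_l// ltW.
right; split => //; first exact/eqP.
rewrite clamped_map_itv; last by rewrite !ltW.
move=> DF; have [xc'|cx] := leP x c.
  by apply: h1; split => //; rewrite in_itv/= ltW.
by apply: h2; split => //; rewrite in_itv/= !ltW.
Qed.

Lemma bcc_comp_map p : bcc p -> bcc (fun x => p (F x)).
Proof.
move=> [[M pM] cp]; apply: (@bcc_intro _ _ M (excep [set y | ~ {for y, continuous p}])).
- by move=> x; exact: pM.
- exact: excep_countable.
move=> x /excepP[[r r0 H]|[_ _ /= /contrapT cpx]].
  apply/continuous_epsP => e e0; exists r => // y /H[-> _].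
  by rewrite subrr normr0.
by apply: (@continuous_comp _ _ _ F p) => //; exact: clamped_map_continuous.
Qed.

(** The two products express that F is inverse to the branches. With the absolute value in the
    weight the second one is -1, and this is the minus sign in L_0. *)
Lemma clamped_map_derivative : exists dF, [/\ bcc dF,
  forall P p, prim_of P p -> prim_of (fun x => P (F x)) (fun x => p (F x) * dF x),
  forall x, x <= c1 -> a < psip x -> psip x < c -> derive1 psip x * dF (psip x) = 1 &
  forall x, x <= c1 -> c < psim x -> psim x < b -> wm x * dF (psim x) = -1].
Proof.
have [k HB] := unimodal_branches Hf Hpsi.
have [gp [Kp [Kp0 Hp]]] := left_extension Hf Hpsi.
have [gm [Km [Km0 Hm]]] := right_extension Hf Hpsi.
pose dF x := if (a < x) && (x < c) then derive1 gp x else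
  if (c < x) && (x < b) then derive1 gm x else 0.
have near_itv x u v : u < x -> x < v -> exists2 r, 0 < r & forall y, `|y - x| < r -> u < y < v.
  move=> ux xv; exists (Num.min (x - u) (v - x)); first by rewrite lt_min !subr_gt0 ux.
  by move=> y; rewrite lt_min !ltr_distl => /andP[/andP[h1 _] /andP[_ h2]]; apply/andP; split; lra.
have dFl x : a < x -> x < c -> dF x = derive1 gp x by move=> h1 h2; rewrite /dF h1 h2.
have dFr x : c < x -> x < b -> dF x = derive1 gm x.
  by move=> h1 h2; rewrite /dF h1 h2 [x < c]ltNge (ltW h1) andbF.
have dF0 x : ~~ (a < x < b) -> dF x = 0.
  rewrite negb_and -!leNgt /dF => /orP[xa|bx].
    by rewrite [a < x]ltNge xa/= [c < x]ltNge (le_trans xa (ltW ac)).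
  by rewrite [x < b]ltNge bx andbF [x < c]ltNge (le_trans (ltW cb) bx) andbF.
have dFb : bcc dF.
  apply: (@bcc_intro _ _ (Kp + Km) (excep set0)).
  - move=> x; rewrite /dF; case: ifP => [/andP[h1 h2]|_].
      by have [|_ _ h _] := Hp x; [rewrite !ltW|move: h; lra].
    case: ifP => [/andP[h1 h2]|_]; last by rewrite normr0 addr_ge0// ltW.
    by have [|_ _ h _] := Hm x; [rewrite !ltW|move: h; lra].
  - by apply: excep_countable; exact: countable0.
  move=> x /excepP[[r r0 H]|[/andP[ax xb] xc _]]; apply/continuous_epsP => e e0.
    exists r => // y yx; rewrite !dF0 ?subrr ?normr0//; first by have [] := H x ltac:(by rewrite subrr normr0).
    by have [] := H y yx.
  have [{}xc|cx|E] := ltgtP x c; last by rewrite E eqxx in xc.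
    have [|_ _ _ cg] := Hp x; first by rewrite !ltW.
    have [r1 r10 H1] := (continuous_epsP _ _).1 cg e e0.
    have [r2 r20 H2] := near_itv _ _ _ ax xc.
    exists (Num.min r1 r2) => [|y]; first by rewrite lt_min r10.
    by rewrite lt_min => /andP[/H1 h1 /H2/andP[h2 h3]]; rewrite !dFl.
  have [|_ _ _ cg] := Hm x; first by rewrite !ltW.
  have [r1 r10 H1] := (continuous_epsP _ _).1 cg e e0.
  have [r2 r20 H2] := near_itv _ _ _ cx xb.
  exists (Num.min r1 r2) => [|y]; first by rewrite lt_min r10.
  by rewrite lt_min => /andP[/H1 h1 /H2/andP[h2 h3]]; rewrite !dFr.
exists dF; split.
- exact: dFb.
- move=> P p [bP cP bp dP]; split.
  + exact: bcc_comp_map.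
  + by move=> x; apply: (@continuous_comp _ _ _ F P); [exact: clamped_map_continuous|exact: cP].
  + exact: bccM (bcc_comp_map bp) dFb.
  apply: sub_countable (excep_countable dP); apply: subset_card_le => x /= nd.
  apply: contrapT => /excepP[[r r0 H]|[/andP[ax xb] xc /= /contrapT dPx]]; apply: nd.
    rewrite dF0; last by have [] := H x ltac:(by rewrite subrr normr0).
    rewrite mulr0; apply: (@is_derive_near _ _ (cst (P (F x))) x 0 r) => //.
    by move=> y /H[-> _].
  have [{}xc|cx|E] := ltgtP x c; last by rewrite E eqxx in xc.
    have [|[gf _] dg _ _] := Hp x; first by rewrite !ltW.
    have FE : F x = gp x by rewrite clamped_map_itv ?gf// !ltW.
    have [r2 r20 H2] := near_itv _ _ _ ax xc.
    rewrite dFl//; apply: (@is_derive_near _ _ (P \o gp) x _ r2) => //.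
      move=> y /H2/andP[h1 h2]; have [|[gy _] _ _ _] := Hp y; first by rewrite !ltW.
      by rewrite /= gy clamped_map_itv// ltW//= (le_trans (ltW h2) (ltW cb)).
    by rewrite FE; apply: is_derive1_comp; rewrite -?FE.
  have [|[gf _] dg _ _] := Hm x; first by rewrite !ltW.
  have FE : F x = gm x by rewrite clamped_map_itv ?gf// !ltW.
  have [r2 r20 H2] := near_itv _ _ _ cx xb.
  rewrite dFr//; apply: (@is_derive_near _ _ (P \o gm) x _ r2) => //.
    move=> y /H2/andP[h1 h2]; have [|[gy _] _ _ _] := Hm y; first by rewrite !ltW.
    by rewrite /= gy clamped_map_itv// (ltW h2) (le_trans (ltW ac) (ltW h1)).
  by rewrite FE; apply: is_derive1_comp; rewrite -?FE.
- move=> x xc h1 h2; have [|[gf E] _ _ _] := Hp (psip x); first by rewrite !ltW.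
  rewrite dFl//; move: E; rewrite -(clamped_map_itv (x := psip x)) ?psip_itv// ?(ltW h1)//.
  by rewrite (le_trans (ltW h2) (ltW cb)).
- move=> x xc h1 h2; have [|[gf E] _ _ _] := Hm (psim x); first by rewrite !ltW.
  rewrite dFr//; move: E; rewrite -(clamped_map_itv (x := psim x)) ?psim_itv// ?(ltW h2)//; last first.
    by rewrite (le_trans (ltW ac) (ltW h1)).
  move=> E; rewrite ler0_norm ?mulNr ?E//; exact: (psim_derive_le0 Hpsi).
Qed.

(** The operator sends p (P o F) to P times the image of p, because F(psi x) = x on the support;
    then mass is conserved. *)
Lemma transfer_dual p P : bcc p -> supp a b p -> bcc P ->
  \int[mu]_(x in `[a0, b]) (TL p x * P x) = \int[mu]_(x in `[a0, b]) (p x * P (F x)).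
Proof.
have [k HB] := unimodal_branches Hf Hpsi; move=> bp sp bP.
pose m x := p x * P (F x); have bm : bcc m := bccM bp (bcc_comp_map bP).
have sm : supp a0 b m.
  by move=> x hx; rewrite /m (suppS (ltW a0a) (lexx b) sp hx) mul0r.
rewrite -(transfer_int HB bm sm); apply: int_eq => x _.
have [cx|xc] := ltP c1 x; first by rewrite /transfer cut_gt// !mul0r addr0 mul0r.
rewrite /transfer /m mulrDl; congr (_ + _).
  have [h|h] := leP a (psip x); first by rewrite psip_itv//; ring.
  by rewrite sp ?mulr0 ?mul0r ?mulr0// negb_and -!ltNge h.
have [h|h] := leP (psim x) b; first by rewrite psim_itv//; ring.
by rewrite sp ?mulr0 ?mul0r ?mulr0// negb_and -!ltNge h orbT.
Qed.

(** Mass conservation for h (P o F)': the weight of each branch cancels against F' up to sign, which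
    leaves L_0. *)
Lemma transfer0_dual : exists dF, (forall P p, prim_of P p ->
    prim_of (fun x => P (F x)) (fun x => p (F x) * dF x)) /\
  forall h p, bcc h -> supp a b h -> bcc p ->
  \int[mu]_(x in `[a0, b]) (transfer0 h x * p x) =
    \int[mu]_(x in `[a0, b]) (h x * (p (F x) * dF x)).
Proof.
have [k HB] := unimodal_branches Hf Hpsi.
have [dF [bdF HP E1 E2]] := clamped_map_derivative; exists dF; split=> // h p bh sh bp.
pose m x := h x * (p (F x) * dF x).
have bm : bcc m := bccM bh (bccM (bcc_comp_map bp) bdF).
have sm : supp a0 b m.
  by move=> x hx; rewrite /m (suppS (ltW a0a) (lexx b) sh hx) mul0r.
rewrite -(transfer_int HB bm sm).
have cE : countable ([set c1] `|` ((`]-oo, c1]%classic `&` psip @^-1` [set a; c]) `|`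
    (`]-oo, c1]%classic `&` psim @^-1` [set c; b]))).
  apply: countableU; first exact: countable1.
  have c2 (s t : R) : countable [set s; t] by apply: countableU; exact: countable1.
  by apply: countableU; [exact: countable_preimage (psi1_inj HB)|exact: countable_preimage (psi2_inj HB)].
apply: (int_eq_countable (bccM (transfer0_bcc bh) bp) (transfer_bcc HB bm) cE) => x _ nE.
have [cx|xc] := ltP c1 x; first by rewrite /transfer /transfer0 cut_gt// !mul0r subr0 addr0 mul0r.
have /not_orP[x1 /not_orP[n1 n2]] := nE.
have xl : (`]-oo, c1]%classic : set R) x by rewrite /= in_itv.
have pa : psip x != a by apply/eqP => e; apply: n1; split => //; left.
have pc : psip x != c by apply/eqP => e; apply: n1; split => //; right.
have mc : psim x != c by apply/eqP => e; apply: n2; split => //; left.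
have mb : psim x != b by apply/eqP => e; apply: n2; split => //; right.
rewrite /transfer0 /transfer /m mulrBl; congr (_ + _).
  have [h1|h1] := ltP (psip x) a.
    by rewrite sh ?mulr0 ?mul0r ?mulr0// negb_and -!ltNge h1.
  have pca : psip x < c by rewrite lt_neqAle pc (psi1_le HB).
  have apx : a < psip x by rewrite lt_neqAle eq_sym pa.
  rewrite psip_itv// -[in LHS](mul1r (h _)) -(E1 x xc apx pca); ring.
have [h1|h1] := ltP b (psim x).
  by rewrite sh ?mulr0 ?mul0r ?mulr0 ?oppr0// negb_and -!ltNge h1 orbT.
have cpx : c < psim x by rewrite lt_neqAle eq_sym mc (psi2_ge HB).
have pxb : psim x < b by rewrite lt_neqAle mb.
rewrite psim_itv// -mulrN -[in LHS](mul1r (h _)) -[X in X * h _]opprK -(E2 x xc cpx pxb); ring.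
Qed.

Lemma iter_transfer_dual n p P : bcc p -> supp a b p -> bcc P ->
  \int[mu]_(x in `[a0, b]) (iter n TL p x * P x) =
    \int[mu]_(x in `[a0, b]) (p x * P (iter n F x)).
Proof.
have [k HB] := unimodal_branches Hf Hpsi.
elim: n P => // n IH P bp sp bP.
have bi : bcc (iter n TL p) by exact: (iter_transfer_bcc HB).
have si : supp a b (iter n TL p) by elim: n {IH bi} => //= n; exact: transfer_supp_itv.
have bPF := bcc_comp_map bP.
by rewrite iterS (transfer_dual bi si bP) (IH (fun x => P (F x)) bp sp bPF).
Qed.

Lemma iter_clamped_map_prim n P p : prim_of P p -> exists q,
  prim_of (fun x => P (iter n F x)) q /\ forall h, bcc h -> supp a b h ->
  \int[mu]_(x in `[a0, b]) (iter n transfer0 h x * p x) = \int[mu]_(x in `[a0, b]) (h x * q x).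
Proof.
have [dF [HP dual]] := transfer0_dual.
elim: n P p => [|n IH] P p PP; first by exists p.
have [q [Pq Hq]] := IH _ _ (HP _ _ PP); exists q; split=> [|h bh sh].
  exact: Pq.
have bi : bcc (iter n transfer0 h) := iter_transfer0_bcc n bh.
have si : supp a b (iter n transfer0 h) by elim: n {IH Pq Hq bi} => //= n; exact: transfer0_supp_itv.
by have [_ _ bp _] := PP; rewrite iterS (dual _ _ bi si bp) (Hq h bh sh).
Qed.

Lemma iter_clamped_orbit n i : iter n F (orbit c f i) = orbit c f (i + n).
Proof.
elim: n => [|n IH]; first by rewrite addn0.
rewrite iterS IH addnS /orbit iterS clamped_map_itv//.
exact: (core_ab Hf (orbit_core Hf Hpsi _)).
Qed.

End duality.

(** * Complex power series *)

Section powers.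
Context {R : realType}.
Implicit Types (q r C : R).

Lemma natmul_exp_le q r : 0 <= q -> q < r -> exists2 C, 0 <= C & forall n, n%:R * q ^+ n <= C * r ^+ n.
Proof.
move=> q0 qr; have r0 : 0 < r by exact: le_lt_trans qr.
(* With this C the inductive step reduces to q <= C (r - q) = r. *)
exists (r / (r - q)); first by rewrite divr_ge0 ?(ltW r0)// subr_ge0 ltW.
have d0 : 0 < r - q by rewrite subr_gt0.
elim=> [|n IH]; first by rewrite mul0r mulr_ge0 ?divr_ge0 ?exprn_ge0// ltW.
have qn : q ^+ n <= r ^+ n by rewrite lerXn2r ?nnegrE// ltW.
rewrite !exprS; apply: (@le_trans _ _ (q * (r / (r - q) * r ^+ n) + q * r ^+ n)).
  rewrite -natr1 mulrDl mul1r mulrCA; apply: lerD; exact: ler_wpM2l.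
rewrite (_ : q * _ + _ = (r / (r - q) * r * r ^+ n) - (r - q) * r ^+ n + (q * r ^+ n - (r - q) * r^+n * (r / (r - q))) + (r - q) * r ^+ n); last by ring.
rewrite (_ : (r - q) * r ^+ n * (r / (r - q)) = r * r ^+ n); last by field; rewrite gt_eqF.
have : 0 <= r ^+ n by rewrite exprn_ge0// ltW.
rewrite mulrA; nra.
Qed.

Lemma natmul2_exp_le q r : 0 <= q -> q < r -> exists2 C, 0 <= C &
  forall n, n%:R ^+ 2 * q ^+ n <= C * r ^+ n.
Proof.
move=> q0 qr; pose m := (q + r) / 2.
have qm : q < m by rewrite /m; lra. have mr : m < r by rewrite /m; lra.
have [C1 C10 H1] := natmul_exp_le q0 qm; have [C2 C20 H2] := natmul_exp_le (le_trans q0 (ltW qm)) mr.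
exists (C1 * C2); first exact: mulr_ge0.
move=> n; rewrite expr2 -mulrA; apply: (@le_trans _ _ (n%:R * (C1 * m ^+ n))).
  by rewrite ler_wpM2l.
by rewrite mulrCA -mulrA ler_wpM2l.
Qed.

End powers.

(** * Geometrically dominated complex series *)

Section complex_series.
Context {R : realType}.
Implicit Types (u v : nat -> R[i]) (z w l h : R[i]) (C k : R).

Lemma complex_ext z w : complex.Re z = complex.Re w -> complex.Im z = complex.Im w -> z = w.
Proof. by case: z w => [x y] [x' y'] /= -> ->. Qed.

Lemma cabs_eq0 z : cabs z = 0 -> z = 0.
Proof.
by move=> h; apply/eqP; rewrite -normr_eq0 normC_cabs h.
Qed.

Lemma cabs_small_eq0 z : (forall e : R, 0 < e -> cabs z <= e) -> z = 0.
Proof.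
move=> H; apply: cabs_eq0; apply/eqP; rewrite eq_le cabs_ge0 andbT.
by apply/ler_addgt0Pr => e e0; rewrite add0r; exact: H.
Qed.

Lemma cabs_gt0 z : z != 0 -> 0 < cabs z.
Proof.
by move=> z0; rewrite lt_neqAle cabs_ge0 andbT eq_sym; apply: contra z0 => /eqP/cabs_eq0->.
Qed.

Lemma cabsV z : cabs z^-1 = (cabs z)^-1.
Proof.
have [->|z0] := eqVneq z 0; first by rewrite invr0 -[0]/(0%:C) cabs_real normr0 invr0.
have c0 : cabs z != 0 by rewrite gt_eqF// cabs_gt0.
apply: (mulfI c0); rewrite -cabsM divff// divff// -[1]/(1%:C).
by rewrite cabs_real normr1.
Qed.

Lemma cabsB_sym z w : cabs (z - w) = cabs (w - z).
Proof. by rewrite -opprB cabsN. Qed.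

Lemma cabs_triangle z w t : cabs (z - t) <= cabs (z - w) + cabs (w - t).
Proof. by rewrite -[z - t](subrKA w) cabsD. Qed.

Definition cdom u C k := [/\ 0 <= k, k < 1 & forall n, cabs (u n) <= C * k ^+ n].

(** Limits are taken on real and imaginary parts, where the real integrals live. *)
Definition csum u : R[i] :=
  limn (series (fun n => complex.Re (u n))) +i* limn (series (fun n => complex.Im (u n))).

Lemma Re_sum u N : complex.Re (\sum_(0 <= i < N) u i) = \sum_(0 <= i < N) complex.Re (u i).
Proof. exact: raddf_sum. Qed.

Lemma Im_sum u N : complex.Im (\sum_(0 <= i < N) u i) = \sum_(0 <= i < N) complex.Im (u i).
Proof. exact: raddf_sum. Qed.

Lemma csumP u C k : cdom u C k ->
  [/\ (fun N => \sum_(0 <= i < N) complex.Re (u i)) @ \oo --> complex.Re (csum u),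
      (fun N => \sum_(0 <= i < N) complex.Im (u i)) @ \oo --> complex.Im (csum u) &
      forall N, cabs (csum u - \sum_(0 <= i < N) u i) <= C / (1 - k) * 2 * k ^+ N].
Proof.
move=> [k0 k1 uC].
have [x [cx Hx]] := dominated_series k0 k1 (fun n => le_trans (Re_le_cabs _) (uC n)).
have [y [cy Hy]] := dominated_series k0 k1 (fun n => le_trans (Im_le_cabs _) (uC n)).
have E : csum u = x +i* y.
  rewrite /csum; congr (_ +i* _); exact: (cvg_lim (@Rhausdorff R)).
rewrite E; split=> //= N; apply: le_trans (cabs_le _) _; rewrite !raddfB/= Re_sum Im_sum.
rewrite (_ : _ * k ^+ N = C * k ^+ N / (1 - k) + C * k ^+ N / (1 - k)); last by ring.
exact: lerD.
Qed.

Lemma csum_unique_shift m u l C k C' k' : cdom u C k -> 0 <= k' -> k' < 1 ->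
  (forall N, cabs (l - \sum_(0 <= i < N + m) u i) <= C' * k' ^+ N) -> csum u = l.
Proof.
move=> du k'0 k'1 H; have [k0 k1 _] := du; have [_ _ H1] := csumP du.
apply/eqP; rewrite -subr_eq0; apply/eqP; apply: cabs_small_eq0 => e e0.
have e2 : 0 < e / 2 by lra.
have [N1 HN1] := geometric_small (C / (1 - k) * 2) k0 k1 e2.
have [N2 HN2] := geometric_small C' k'0 k'1 e2.
pose N := maxn N1 N2.
apply: le_trans (cabs_triangle _ (\sum_(0 <= i < N + m) u i) _) _.
have := HN1 (N + m)%N (leq_trans (leq_maxl _ _) (leq_addr _ _)).
have := HN2 N (leq_maxr _ _); have := H N; have := H1 (N + m)%N.
by rewrite (cabsB_sym l); lra.
Qed.

Lemma csum_unique u l C k C' k' : cdom u C k -> 0 <= k' -> k' < 1 ->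
  (forall N, cabs (l - \sum_(0 <= i < N) u i) <= C' * k' ^+ N) -> csum u = l.
Proof.
move=> du k'0 k'1 H; apply: (csum_unique_shift (m := 0) du k'0 k'1 (C' := C')) => N.
by rewrite addn0.
Qed.

Lemma cdom_le u v C k : cdom v C k -> (forall n, cabs (u n) <= cabs (v n)) -> cdom u C k.
Proof. by move=> [k0 k1 vC] uv; split=> // n; exact: le_trans (uv n) (vC n). Qed.

Lemma cdomD u v C C' k : cdom u C k -> cdom v C' k -> cdom (fun n => u n + v n) (C + C') k.
Proof.
move=> [k0 k1 uC] [_ _ vC]; split=> // n; apply: le_trans (cabsD _ _) _.
by rewrite mulrDl lerD.
Qed.

Lemma cdomZ w u C k : cdom u C k -> cdom (fun n => w * u n) (cabs w * C) k.
Proof.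
move=> [k0 k1 uC]; split=> // n; rewrite cabsM -mulrA ler_wpM2l//.
exact: cabs_ge0.
Qed.

Lemma csumD u v C C' k : cdom u C k -> cdom v C' k ->
  csum (fun n => u n + v n) = csum u + csum v.
Proof.
move=> du dv; have [k0 k1 _] := du; have [_ _ Hu] := csumP du; have [_ _ Hv] := csumP dv.
apply: (csum_unique (cdomD du dv) k0 k1 (C' := C / (1 - k) * 2 + C' / (1 - k) * 2)) => N.
rewrite big_split/= opprD addrACA mulrDl; apply: le_trans (cabsD _ _) _.
exact: lerD.
Qed.

Lemma csumZ w u C k : cdom u C k -> csum (fun n => w * u n) = w * csum u.
Proof.
move=> du; have [k0 k1 _] := du; have [_ _ Hu] := csumP du.
apply: (csum_unique (cdomZ w du) k0 k1 (C' := cabs w * (C / (1 - k) * 2))) => N.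
rewrite -mulr_sumr -mulrBr cabsM -mulrA ler_wpM2l//.
exact: cabs_ge0.
Qed.

Lemma csum_shift u C k : cdom u C k -> csum u = u 0%N + csum (fun n => u n.+1).
Proof.
move=> du; have [k0 k1 uC] := du.
have du' : cdom (fun n => u n.+1) (C * k) k.
  by split=> // n; rewrite -mulrA -exprS.
have [_ _ Hu] := csumP du'.
apply: (csum_unique_shift (m := 1) du k0 k1 (C' := C * k / (1 - k) * 2)) => N.
by rewrite addn1 big_nat_recl//= opprD addrACA subrr add0r.
Qed.

Lemma csum_le u C k : cdom u C k -> cabs (csum u) <= C / (1 - k) * 2.
Proof.
move=> du; have [_ _ /(_ 0%N)] := csumP du.
by rewrite big_geq// subr0 expr0 mulr1.
Qed.

Lemma cvgC_intro (u : nat -> R[i]) l :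
  (forall e : R, 0 < e -> exists N, forall n, (N <= n)%N -> cabs (u n - l) < e) ->
  (u : nat -> R[i]^o) @ \oo --> (l : R[i]^o).
Proof.
move=> H; apply/cvgrPdist_lt => e e0.
have eE : e = (complex.Re e)%:C by apply/esym/RRe_real/gtr0_real.
have e0' : 0 < complex.Re e by move: e0; rewrite eE ltcR.
have [N HN] := H _ e0'; exists N => // n /= /HN; rewrite cabsB_sym => h.
by rewrite normC_cabs eE ltcR.
Qed.

Lemma cvgC_geometric (u : nat -> R[i]) l C k : 0 <= k -> k < 1 ->
  (forall n, cabs (l - u n) <= C * k ^+ n) -> (u : nat -> R[i]^o) @ \oo --> (l : R[i]^o).
Proof.
move=> k0 k1 H; apply: cvgC_intro => e e0; have [N HN] := geometric_small C k0 k1 e0.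
by exists N => n /HN; apply: le_lt_trans; rewrite cabsB_sym.
Qed.

Lemma limnC (u : nat -> R[i]) l :
  (u : nat -> R[i]^o) @ \oo --> (l : R[i]^o) -> limn (u : nat -> R[i]^o) = l.
Proof. by move=> h; apply: (cvg_lim _ h); exact: norm_hausdorff. Qed.

Lemma nearC_intro (Q : R[i] -> Prop) w (d : R) : 0 < d ->
  (forall h, cabs h < d -> Q (w + h)) -> \forall z \near (w : R[i]^o), Q z.
Proof.
move=> d0 H; apply/nbhs_ballP; exists d%:C => /=; first by rewrite ltcR.
move=> z; rewrite /ball/= normC_cabs ltcR => zd.
by rewrite -[z](subrK w) addrC; apply: H; rewrite cabsB_sym.
Qed.

Lemma derivableC_intro (F : R[i] -> R[i]) w D (M d : R) : 0 < d ->
  (forall h, h != 0 -> cabs h < d ->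
    cabs (h^-1 * (F (w + h) - F w) - D) <= M * cabs h) -> holomorphic_at F w.
Proof.
move=> d0 H; apply/cvg_ex; exists (D : R[i]^o); apply/cvgrPdist_lt => e e0.
have eE : e = (complex.Re e)%:C by apply/esym/RRe_real/gtr0_real.
have e0' : 0 < complex.Re e by move: e0; rewrite eE ltcR.
pose N := `|M| + 1; have N0 : 0 < N by have := normr_ge0 M; rewrite /N; lra.
pose r := Num.min d (complex.Re e / N); have r0 : 0 < r by rewrite lt_min d0 divr_gt0.
exists r%:C => /=; first by rewrite ltcR.
move=> h /=; rewrite sub0r normrN normC_cabs ltcR lt_min => /andP[hd he] h0.
rewrite normC_cabs eE ltcR cabsB_sym.
have := H h h0 hd; rewrite /GRing.scale/= mulr1 [h + w]addrC.
move=> /le_lt_trans; apply; apply: (@le_lt_trans _ _ (N * cabs h)).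
  by rewrite ler_wpM2r ?cabs_ge0// /N; have := ler_norm M; lra.
by rewrite mulrC -ltr_pdivlMr.
Qed.

(* The Taylor remainder of order one of the n-th power. *)
Definition pow_rem z h n : R[i] := h^-1 * ((z + h) ^+ n - z ^+ n) - n%:R * z ^+ n.-1.

(** The difference quotients d_n satisfy d_(n+1) = (z + h)^n + z d_n and the remainders r_(n+1) = h
    d_n + z r_n; s >= 1 allows the same power of s in all bounds. *)
Lemma pow_rem_le z h (s : R) n : h != 0 -> 1 <= s -> cabs z <= s -> cabs (z + h) <= s ->
  cabs (pow_rem z h n) <= cabs h * (n%:R ^+ 2 * s ^+ n).
Proof.
move=> h0 s1 zs zhs; pose d n := h^-1 * ((z + h) ^+ n - z ^+ n).
have s0 : 0 <= s by lra.
have sn m : 0 <= s ^+ m by rewrite exprn_ge0.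
have dS m : d m.+1 = (z + h) ^+ m + z * d m.
  by rewrite /d !exprS; field.
have dle m : cabs (d m) <= m%:R * s ^+ m.
  elim: m => [|m IH]; first by rewrite /d !expr0 subrr mulr0 -[0]/(0%:C) cabs_real normr0 mul0r.
  rewrite dS; apply: le_trans (cabsD _ _) _; rewrite cabsM cabsX.
  apply: (@le_trans _ _ (s ^+ m + s * (m%:R * s ^+ m))).
    apply: lerD; first by rewrite lerXn2r ?nnegrE ?cabs_ge0.
    by apply: ler_pM; rewrite ?cabs_ge0.
  rewrite -natr1 exprS mulrDl mul1r (mulrCA s) addrC lerD2l.
  by rewrite ler_peMl.
rewrite /pow_rem -/(d n); elim: n => [|n IH].
  by rewrite /d !expr0 subrr mulr0 mul0r subr0 -[0]/(0%:C) cabs_real normr0 expr0n/= mul0r mulr0.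
have -> : d n.+1 - n.+1%:R * z ^+ n = h * d n + z * (d n - n%:R * z ^+ n.-1).
  rewrite dS mulrBr; have -> : z * (n%:R * z ^+ n.-1) = n%:R * z ^+ n.
    by case: n {IH} => [|n]; [rewrite !mul0r mulr0|rewrite exprS mulrCA].
  have -> : h * d n = (z + h) ^+ n - z ^+ n by rewrite /d mulrA mulfV// mul1r.
  rewrite -natr1; ring.
apply: le_trans (cabsD _ _) _; rewrite (cabsM h) (cabsM z).
apply: (@le_trans _ _ (cabs h * (n%:R * s ^+ n) + s * (cabs h * (n%:R ^+ 2 * s ^+ n)))).
  by apply: lerD; [rewrite ler_wpM2l ?cabs_ge0|apply: ler_pM; rewrite ?cabs_ge0].
have -> : cabs h * (n%:R * s ^+ n) + s * (cabs h * (n%:R ^+ 2 * s ^+ n)) =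
   cabs h * (s ^+ n * (n%:R + s * n%:R ^+ 2)) by ring.
have -> : n.+1%:R ^+ 2 * s ^+ n.+1 = s ^+ n * (n.+1%:R ^+ 2 * s) by rewrite (exprS s); ring.
apply: (ler_wpM2l (cabs_ge0 h)); apply: (ler_wpM2l (sn n)).
rewrite -natr1; have : 0 <= n%:R :> R by []. nra.
Qed.

End complex_series.

(** * Series with values in the functions of bounded variation *)

Section function_valued_series.
Context {R : realType}.
Variables (A B : R) (gs : nat -> R -> R) (gam : nat -> R).
Hypothesis gs_supp : forall n, supp A B (gs n).
Hypothesis gs_bvb : forall n, bvb (gs n) (gam n).
Implicit Types (al be : nat -> R[i]) (C k : R) (z : R[i]) (P : R -> R).
Notation mu := (@lebesgue_measure R).

Definition fseries al (x : R) : R[i] := csum (fun n => al n * (gs n x)%:C).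

(** [gam] bounds the variations and, through the support, the sup norms: the series converges
    pointwise and its variation is summed along with it. *)
Definition fdom al C k := [/\ 0 <= k, k < 1 & forall n, cabs (al n) * gam n <= C * k ^+ n].

Lemma fdom_cdom al C k (x : R) : fdom al C k -> cdom (fun n => al n * (gs n x)%:C) C k.
Proof.
move=> [k0 k1 H]; split=> // n; apply: le_trans (H n); rewrite cabsM cabs_real ler_wpM2l ?cabs_ge0//.
exact: supp_bvb_sup (gs_supp n) (gs_bvb n).
Qed.

Lemma fseries_supp al x : ~~ (A <= x <= B) -> fseries al x = 0.
Proof.
move=> h; rewrite /fseries.
have E : (fun n => al n * (gs n x)%:C) = (fun n => 0).
  by apply/funext => n; rewrite gs_supp// mulr0.
rewrite E; apply: (@csum_unique _ _ 0 0 (1 / 2) 0 (1 / 2)); [split| | |]; try lra.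
  by move=> n; rewrite -[0]/(0%:C) cabs_real normr0 mul0r.
by move=> N; rewrite big1// subrr -[0]/(0%:C) cabs_real normr0 mul0r.
Qed.

Let bvb_part (al : nat -> R[i]) C k (pr : R[i] -> R) (S : R -> R) :
  (forall z (x : R), pr (z * x%:C) = pr z * x) -> (forall z, `|pr z| <= cabs z) -> fdom al C k ->
  (forall x, (fun N => \sum_(0 <= i < N) pr (al i * (gs i x)%:C)) @ \oo --> S x) ->
  bvb S (C / (1 - k)).
Proof.
move=> prM prle [k0 k1 H] cS.
apply: (@bvb_series _ (fun i x => pr (al i) * gs i x) (fun i => `|pr (al i)| * gam i)).
- by move=> n; apply: bvbZ; exact: gs_bvb.
- move=> N; have H' n : `| `|pr (al n)| * gam n| <= C * k ^+ n.
    have g0 := bvb_ge0 (gs_bvb n); rewrite ger0_norm ?mulr_ge0//.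
    by apply: le_trans (H n); rewrite ler_wpM2r.
  have := dominated_partial_le k0 k1 H' (leq0n N); rewrite expr0 mulr1; apply: le_trans.
  by apply: ler_sum => i _; exact: ler_norm.
- by move=> x; have := cS x; under [X in X @ _ --> _ -> _]funext do under eq_bigr do rewrite prM.
Qed.

Let Re_mulr z (x : R) : complex.Re (z * x%:C) = complex.Re z * x.
Proof. by case: z => u v /=; rewrite mulr0 subr0. Qed.

Let Im_mulr z (x : R) : complex.Im (z * x%:C) = complex.Im z * x.
Proof. by case: z => u v /=; rewrite mulr0 add0r. Qed.

Lemma fseries_bvb al C k : fdom al C k ->
  bvb (fun x => complex.Re (fseries al x)) (C / (1 - k)) /\
  bvb (fun x => complex.Im (fseries al x)) (C / (1 - k)).
Proof.
move=> d; split.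
  apply: (bvb_part Re_mulr (@Re_le_cabs R) d) => x.
  by have [h _ _] := csumP (fdom_cdom x d).
apply: (bvb_part Im_mulr (@Im_le_cabs R) d) => x.
by have [_ h _] := csumP (fdom_cdom x d).
Qed.

Lemma fseries_var al C k : fdom al C k -> (var (fseries al) <= (2 * (C / (1 - k)))%:E)%E.
Proof.
move=> d; have [h1 h2] := fseries_bvb d.
by rewrite (_ : 2 * _ = C / (1 - k) + C / (1 - k)); [exact: var_le|ring].
Qed.

Lemma fseries_in_BV al C k : fdom al C k -> in_BV A B (fseries al).
Proof.
move=> d; split; first by apply: le_lt_trans (fseries_var d) _; rewrite ltry.
by move=> x; rewrite in_itv; apply: contraNT => h; rewrite fseries_supp.
Qed.

Lemma fdomD al be C C' k : fdom al C k -> fdom be C' k -> fdom (fun n => al n + be n) (C + C') k.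
Proof.
move=> [k0 k1 H] [_ _ H']; split=> // n; have g0 := bvb_ge0 (gs_bvb n).
rewrite mulrDl; apply: le_trans (lerD (H n) (H' n)); rewrite -mulrDl.
by rewrite ler_wpM2r// cabsD.
Qed.

Lemma fdomZ z al C k : fdom al C k -> fdom (fun n => z * al n) (cabs z * C) k.
Proof.
move=> [k0 k1 H]; split=> // n; rewrite cabsM -!mulrA ler_wpM2l//; exact: cabs_ge0.
Qed.

Lemma fseriesD al be C C' k x : fdom al C k -> fdom be C' k ->
  fseries (fun n => al n + be n) x = fseries al x + fseries be x.
Proof.
move=> d d'; rewrite /fseries -(csumD (fdom_cdom x d) (fdom_cdom x d')).
by congr csum; apply/funext => n; rewrite mulrDl.
Qed.

Lemma fseriesZ z al C k x : fdom al C k -> fseries (fun n => z * al n) x = z * fseries al x.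
Proof.
move=> d; rewrite /fseries -(csumZ z (fdom_cdom x d)).
by congr csum; apply/funext => n; rewrite mulrA.
Qed.

Lemma fseries_int al C k P : A <= B -> fdom al C k -> bcc P ->
  \int[mu]_(x in `[A, B]) (complex.Re (fseries al x) * P x) =
    complex.Re (csum (fun n => al n * (\int[mu]_(x in `[A, B]) (gs n x * P x))%:C)) /\
  \int[mu]_(x in `[A, B]) (complex.Im (fseries al x) * P x) =
    complex.Im (csum (fun n => al n * (\int[mu]_(x in `[A, B]) (gs n x * P x))%:C)).
Proof.
move=> AB d bP; have [k0 k1 H] := d; have [M M0 PM] := bcc_bound bP.
have [bR bI] := fseries_bvb d.
have bgs n : bcc (gs n) := bvb_bcc (gs_bvb n).
have dI : cdom (fun n => al n * (\int[mu]_(x in `[A, B]) (gs n x * P x))%:C) (C * (M * (B - A))) k.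
  split=> // n; rewrite cabsM cabs_real.
  have AB0 : 0 <= M * (B - A) by rewrite mulr_ge0// subr_ge0.
  have h : `|\int[mu]_(x in `[A, B]) (gs n x * P x)| <= gam n * M * (B - A).
    apply: (int_norm_le AB (bccM (bgs n) bP)) => x _; rewrite normrM ler_pM//.
    exact: supp_bvb_sup (gs_supp n) (gs_bvb n).
  apply: (@le_trans _ _ (cabs (al n) * (gam n * M * (B - A)))).
    by rewrite ler_wpM2l ?cabs_ge0.
  rewrite (_ : cabs _ * _ = cabs (al n) * gam n * (M * (B - A))); last by ring.
  rewrite (_ : _ * k ^+ n = C * k ^+ n * (M * (B - A))); last by ring.
  by rewrite ler_wpM2r.
have [cR cI _] := csumP dI.
have part (pr : R[i] -> R) (S : R -> R) l : (forall z (x : R), pr (z * x%:C) = pr z * x) ->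
    (forall z, `|pr z| <= cabs z) ->
    (forall x, (fun N => \sum_(0 <= i < N) pr (al i * (gs i x)%:C)) @ \oo --> S x) -> bcc S ->
    (fun N => \sum_(0 <= i < N) pr (al i * (\int[mu]_(x in `[A, B]) (gs i x * P x))%:C)) @ \oo --> l ->
    \int[mu]_(x in `[A, B]) (S x * P x) = l.
  move=> prM prle cS bS cl.
  have bp_ n : bcc (fun x => pr (al n) * gs n x) := bccZ _ (bgs n).
  have pC n x : `|pr (al n) * gs n x| <= C * k ^+ n.
    rewrite normrM; apply: le_trans (H n); rewrite ler_pM//.
    exact: supp_bvb_sup (gs_supp n) (gs_bvb n).
  have cS' x : (fun N => \sum_(0 <= i < N) pr (al i) * gs i x) @ \oo --> S x.
    by have := cS x; under [X in X @ _ --> _ -> _]funext do under eq_bigr do rewrite prM.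
  have h := series_int AB k0 k1 bp_ pC bS cS' bP.
  suff h2 : (fun N => \sum_(0 <= i < N) pr (al i * (\int[mu]_(x in `[A, B]) (gs i x * P x))%:C)) @ \oo -->
    \int[mu]_(x in `[A, B]) (S x * P x) by exact: cvg_unique h2 cl.
  have -> : (fun N => \sum_(0 <= i < N) pr (al i * (\int[mu]_(x in `[A, B]) (gs i x * P x))%:C)) =
    (fun N => \sum_(0 <= i < N) \int[mu]_(x in `[A, B]) (pr (al i) * gs i x * P x)); last exact: h.
  apply/funext => N; apply: eq_bigr => i _; rewrite prM -(intZ _ A B (bccM (bgs i) bP)).
  by apply: int_eq => x _; rewrite mulrA.
split.
  apply: (part _ _ _ Re_mulr (@Re_le_cabs R) _ (bvb_bcc bR) cR) => x.
  by have [h _ _] := csumP (fdom_cdom x d).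
apply: (part _ _ _ Im_mulr (@Im_le_cabs R) _ (bvb_bcc bI) cI) => x.
by have [_ h _] := csumP (fdom_cdom x d).
Qed.

End function_valued_series.

Section countable_equality.
Context {R : realType}.
Implicit Types (u v w g : R -> R[i]).

Lemma eq_cbl_refl u : eq_cbl u u.
Proof.
by rewrite /eq_cbl (_ : mkset _ = set0) ?countable0//; apply/seteqP; split=> // x /=.
Qed.

Lemma eq_cbl_sym u v : eq_cbl u v -> eq_cbl v u.
Proof.
by apply: sub_countable; apply: subset_card_le => x /= h h1; apply: h.
Qed.

Lemma eq_cbl_trans v u w : eq_cbl u v -> eq_cbl v w -> eq_cbl u w.
Proof.
move=> h1 h2; apply: sub_countable (countableU h1 h2); apply: subset_card_le => x /= h.
by apply: contrapT => /not_orP[/contrapT e1 /contrapT e2]; apply: h; rewrite e1.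
Qed.

Lemma eq_cbl_op2 (op : R[i] -> R[i] -> R[i]) u u' v v' : eq_cbl u u' -> eq_cbl v v' ->
  eq_cbl (fun x => op (u x) (v x)) (fun x => op (u' x) (v' x)).
Proof.
move=> h1 h2; apply: sub_countable (countableU h1 h2); apply: subset_card_le => x /= h.
by apply: contrapT => /not_orP[/contrapT e1 /contrapT e2]; apply: h; rewrite e1 e2.
Qed.

Lemma eq_cbl_op1 (op : R[i] -> R[i]) u u' : eq_cbl u u' ->
  eq_cbl (fun x => op (u x)) (fun x => op (u' x)).
Proof. by move=> h; exact: (@eq_cbl_op2 (fun x _ => op x) _ _ _ _ h h). Qed.

Lemma in_BV_bvb (A B : R) u : in_BV A B u -> exists v w : R,
  [/\ bvb (fun x => complex.Re (u x)) v, bvb (fun x => complex.Im (u x)) w,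
      supp A B (fun x => complex.Re (u x)) & supp A B (fun x => complex.Im (u x))].
Proof.
move=> [/finite_var_bvb[h1 h2] su].
have s0 x : ~~ (A <= x <= B) -> u x = 0.
  by apply: contraNeq => /su; rewrite in_itv.
by exists (fine (var u)), (fine (var u)); split=> // x /s0->.
Qed.

Lemma in_BV_intro (A B v w : R) u : bvb (fun x => complex.Re (u x)) v ->
  bvb (fun x => complex.Im (u x)) w -> (forall x, ~~ (A <= x <= B) -> u x = 0) -> in_BV A B u.
Proof.
move=> h1 h2 su; split; first exact: finite_var_intro h1 h2.
by move=> x; rewrite in_itv; apply: contraNT => /su ->.
Qed.

Lemma BV_norm_le u v : eq_cbl u v -> (BV_norm v <= var u)%E.
Proof. by move=> h; apply: ereal_inf_lbound; exists u. Qed.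

Lemma BV_norm_ge u (m : \bar R) : (forall w, eq_cbl w u -> (m <= var w)%E) -> (m <= BV_norm u)%E.
Proof. by move=> h; apply: le_ereal_inf_tmp => _ [w wu <-]; exact: h. Qed.

End countable_equality.

(** * The resolvent *)

Section resolvent.
Context {R : realType}.
Variables (a b c a0 : R) (f psip psim : R -> R).
Hypothesis Hf : unimodal_expanding_mixing a b c f.
Hypothesis Hpsi : inverse_branches a b c f a0 psip psim.
Implicit Types (x v w C k : R) (p : R -> R) (u g : R -> R[i]) (z : R[i]).
Notation c1 := (f c).
Notation wm := (fun x => `|derive1 psim x|).
Notation TL := (transfer c1 psip psim (derive1 psip) wm).
Notation LC := (L1 c f psip psim).

Let Re_rmul (r : R) z : complex.Re (r%:C * z) = r * complex.Re z.
Proof. by case: z => s t /=; rewrite mul0r subr0. Qed.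

Let Im_rmul (r : R) z : complex.Im (r%:C * z) = r * complex.Im z.
Proof. by case: z => s t /=; rewrite mul0r addr0. Qed.

Lemma Re_L1 u x : complex.Re (LC u x) = TL (fun y => complex.Re (u y)) x.
Proof. by rewrite /L1 raddfD/= !Re_rmul. Qed.

Lemma Im_L1 u x : complex.Im (LC u x) = TL (fun y => complex.Im (u y)) x.
Proof. by rewrite /L1 raddfD/= !Im_rmul. Qed.

(** The operator acts on classes because preimages of countable sets under the injective branches
    are countable. *)
Lemma L1_eq_cbl u u' : eq_cbl u u' -> eq_cbl (LC u) (LC u').
Proof.
have [k HB] := unimodal_branches Hf Hpsi; move=> h.
have h1 := countable_preimage h (psi1_inj HB); have h2 := countable_preimage h (psi2_inj HB).
apply: sub_countable (countableU h1 h2); apply: subset_card_le => x /= nE.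
apply: contrapT => /not_orP[n1 n2]; apply: nE.
have [cx|xc] := ltP c1 x.
  by apply: complex_ext; rewrite ?Re_L1 ?Im_L1 /transfer cut_gt// !mul0r.
have xl : (`]-oo, c1]%classic : set R) x by rewrite /= in_itv.
have E1 : u (psip x) = u' (psip x) by apply: contrapT => e; apply: n1.
have E2 : u (psim x) = u' (psim x) by apply: contrapT => e; apply: n2.
by rewrite /L1 E1 E2.
Qed.

Lemma iter_supp n p : supp a0 b p -> supp a0 b (iter n TL p).
Proof. have [k HB] := unimodal_branches Hf Hpsi; exact: (iter_transfer_supp HB). Qed.

(** Convergence is left to a hypothesis on z, so the same series serves in the unit disc by power
    boundedness and, for functions of integral 0, in a larger disc by the spectral gap. *)
Definition neumann p z : R -> R[i] := fseries (fun n => iter n TL p) (fun n => z ^+ n).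

Lemma neumann_eq p gam z C k x : supp a0 b p -> (forall n, bvb (iter n TL p) (gam n)) ->
  fdom gam (fun n => z ^+ n) C k -> neumann p z x - z * LC (neumann p z) x = (p x)%:C.
Proof.
move=> sp bg d; have gs_supp n := iter_supp n sp.
have dx y := fdom_cdom gs_supp bg y d.
have E : z * LC (neumann p z) x = csum (fun n => z ^+ n.+1 * (iter n.+1 TL p x)%:C).
  rewrite /L1 /neumann /fseries.
  rewrite -(csumZ _ (dx (psip x))) -(csumZ _ (dx (psim x))).
  rewrite -(csumD (cdomZ _ (dx (psip x))) (cdomZ _ (dx (psim x)))).
  rewrite -(csumZ _ (cdomD (cdomZ _ (dx (psip x))) (cdomZ _ (dx (psim x))))).
  congr csum; apply/funext => n; rewrite exprS -mulrA; congr (z * _).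
  rewrite iterS /transfer rmorphD !rmorphM/= mulrDr.
  by congr (_ + _); rewrite mulrCA; congr (_ * (_ * _)); rewrite -rmorphM.
rewrite E /neumann /fseries (csum_shift (dx x)) addrK expr0 mul1r.
by [].
Qed.

Lemma fdom_geometric C v th z : 0 <= C -> 0 <= v -> 0 <= th -> cabs z * th < 1 ->
  fdom (fun n => C * th ^+ n * v) (fun n => z ^+ n) (C * v) (cabs z * th).
Proof.
move=> C0 v0 th0 zth; split=> [||n] //; first by rewrite mulr_ge0// cabs_ge0.
by rewrite cabsX exprMn le_eqVlt; apply/orP; left; apply/eqP; ring.
Qed.

(** Power boundedness in the form of a spectral gap of rate 1, as [fdom_geometric] expects. *)
Lemma power_bounded_gap : exists2 K, 0 <= K & forall n p v, supp a0 b p -> bvb p v ->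
  bvb (iter n TL p) (K * 1 ^+ n * v).
Proof.
have [K K1 HK] := unimodal_power_bounded Hf Hpsi; exists K; first by lra.
by move=> n p v sp hp; rewrite expr1n mulr1; exact: HK.
Qed.

(** The operator is real: the Neumann series of the real and imaginary parts of g are combined
    linearly. *)
Let solve (K : R) z g v w : 0 <= K -> (forall n p v, supp a0 b p -> bvb p v ->
  bvb (iter n TL p) (K * 1 ^+ n * v)) -> cabs z < 1 ->
  bvb (fun x => complex.Re (g x)) v -> bvb (fun x => complex.Im (g x)) w ->
  supp a0 b (fun x => complex.Re (g x)) -> supp a0 b (fun x => complex.Im (g x)) ->
  exists u, [/\ in_BV a0 b u, forall x, u x - z * LC u x = g x &
    (var u <= (2 * (K / (1 - cabs z)) * (v + w))%:E)%E].
Proof.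
move=> K0 HK z1 hv hw sv sw.
pose p := fun x => complex.Re (g x); pose q := fun x => complex.Im (g x).
have z1' : cabs z * 1 < 1 by rewrite mulr1.
have dv := fdom_geometric K0 (bvb_ge0 hv) ler01 z1'.
have dw := fdom_geometric K0 (bvb_ge0 hw) ler01 z1'.
have bp n : bvb (iter n TL p) (K * 1 ^+ n * v) := HK n p v sv hv.
have bq n : bvb (iter n TL q) (K * 1 ^+ n * w) := HK n q w sw hw.
pose I : R[i] := 0 +i* 1.
pose up := neumann p z; pose uq := neumann q z.
pose u x := up x + I * uq x.
have sp n := iter_supp n sv; have sq n := iter_supp n sw.
have [bpr bpi] := fseries_bvb sp bp dv; have [bqr bqi] := fseries_bvb sq bq dw.
have ReI t : complex.Re (I * t) = - complex.Im t by case: t => s t /=; rewrite mul0r mul1r sub0r.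
have ImI t : complex.Im (I * t) = complex.Re t by case: t => s t /=; rewrite mul0r mul1r add0r.
pose V := K * v / (1 - cabs z * 1) + K * w / (1 - cabs z * 1).
have ReD s t : complex.Re (s + t) = complex.Re s + complex.Re t by case: s t => ? ? [].
have ImD s t : complex.Im (s + t) = complex.Im s + complex.Im t by case: s t => ? ? [].
have hre : bvb (fun x => complex.Re (u x)) V.
  by apply: bvb_eq (bvbB bpr bqi) => x; rewrite /u ReD ReI.
have him : bvb (fun x => complex.Im (u x)) V.
  rewrite /V addrC; apply: bvb_eq (bvbD bqr bpi) => x.
  by rewrite /u ImD ImI addrC.
exists u; split.
- apply: (in_BV_intro hre him) => x hx.
  by rewrite /u /up /uq /neumann (fseries_supp sp)// (fseries_supp sq)// mulr0 addr0.
- move=> x; have E : LC u x = LC up x + I * LC uq x by rewrite /L1 /u; ring.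
  rewrite E; have := neumann_eq x sv bp dv; have := neumann_eq x sw bq dw => e1 e2.
  have -> : u x - z * (LC up x + I * LC uq x) = (up x - z * LC up x) + I * (uq x - z * LC uq x).
    by rewrite /u; ring.
  rewrite /up /uq e1 e2; apply: complex_ext; first by rewrite ReD ReI/= oppr0 addr0.
  by rewrite ImD ImI/= add0r.
- apply: le_trans (var_le hre him) _; rewrite lee_fin /V mulr1.
  have := bvb_ge0 hv; have := bvb_ge0 hw => w0 v0.
  rewrite le_eqVlt; apply/orP; left; apply/eqP; field.
  by rewrite subr_eq0 gt_eqF.
Qed.

Lemma iter_L1_eq_cbl z u n : eq_cbl u (fun x => z * LC u x) ->
  eq_cbl u (fun x => z ^+ n * iter n LC u x).
Proof.
move=> h; elim: n => [|n IH].
  have -> : (fun x => z ^+ 0 * iter 0 LC u x) = u by apply/funext => x; rewrite mul1r.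
  exact: eq_cbl_refl.
apply: (eq_cbl_trans h).
have h2 := eq_cbl_op1 (fun t => z * t) (L1_eq_cbl IH).
apply: (eq_cbl_trans h2).
have -> : (fun x => z * LC (fun x => z ^+ n * iter n LC u x) x) =
   (fun x => z ^+ n.+1 * iter n.+1 LC u x).
  by apply/funext => x; rewrite iterS /L1 exprS; ring.
exact: eq_cbl_refl.
Qed.

Lemma iter_L1_parts n u x : complex.Re (iter n LC u x) = iter n TL (fun y => complex.Re (u y)) x /\
  complex.Im (iter n LC u x) = iter n TL (fun y => complex.Im (u y)) x.
Proof.
elim: n x => // n IH x; rewrite !iterS Re_L1 Im_L1.
by split; congr (transfer _ _ _ _ _ _ _); apply/funext => y; have [] := IH y.
Qed.

(** The difference d equals z^n L_1^n d off a countable set for each n, hence off a single one for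
    all n; the right-hand side tends to 0 because the iterates have bounded variation. *)
Let resolvent_unique z g u u' : cabs z < 1 ->
  resolvent_eq a0 b LC z g u -> resolvent_eq a0 b LC z g u' -> eq_cbl u u'.
Proof.
move=> z1 [ubv ue] [u'bv ue'].
have [v1 [w1 [hv1 hw1 sv1 sw1]]] := in_BV_bvb ubv.
have [v2 [w2 [hv2 hw2 sv2 sw2]]] := in_BV_bvb u'bv.
pose d x := u x - u' x.
have hv : bvb (fun x => complex.Re (d x)) (v1 + v2).
  by apply: bvb_eq (bvbB hv1 hv2) => x; rewrite raddfB.
have hw : bvb (fun x => complex.Im (d x)) (w1 + w2).
  by apply: bvb_eq (bvbB hw1 hw2) => x; rewrite raddfB.
have sv : supp a0 b (fun x => complex.Re (d x)).
  by move=> x hx; rewrite raddfB/= sv1// sv2// subr0.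
have sw : supp a0 b (fun x => complex.Im (d x)).
  by move=> x hx; rewrite raddfB/= sw1// sw2// subr0.
have [K K0 HK] := power_bounded_gap.
have dE : eq_cbl d (fun x => z * LC d x).
  have := eq_cbl_op2 (fun s t => s - t) (eq_cbl_trans ue (eq_cbl_sym ue')) (eq_cbl_refl (fun x => 0 : R[i])).
  move=> h; apply: sub_countable h; apply: subset_card_le => x /= nE e; apply: nE.
  have {e} e : u x - z * LC u x = u' x - z * LC u' x by move: e; rewrite !subr0.
  have -> : z * LC d x = z * LC u x - z * LC u' x by rewrite /L1 /d; ring.
  by apply/eqP; rewrite /d -subr_eq0; apply/eqP; rewrite -(subrr (u x - z * LC u x)) {2}e; ring.
have cA : countable (\bigcup_n [set x | d x <> z ^+ n * iter n LC d x]).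
  by apply: bigcup_countable => // n _; exact: iter_L1_eq_cbl.
apply: sub_countable cA; apply: subset_card_le => x /= uu'; apply: contrapT => H; apply: uu'.
apply/eqP; rewrite -subr_eq0; apply/eqP; rewrite -/(d x); apply: cabs_small_eq0 => e e0.
pose M := K * (v1 + v2) + K * (w1 + w2).
have [N HN] := geometric_small M (cabs_ge0 z) z1 e0.
have -> : d x = z ^+ N * iter N LC d x by apply: contrapT => h; apply: H; exists N.
rewrite cabsM cabsX mulrC; apply: le_trans (ltW (HN N (leqnn _))).
rewrite ler_wpM2r ?exprn_ge0 ?cabs_ge0//; apply: le_trans (cabs_le _) _.
have [-> ->] := iter_L1_parts N d x.
have := supp_bvb_sup x (iter_supp N sv) (HK N _ _ sv hv).
have := supp_bvb_sup x (iter_supp N sw) (HK N _ _ sw hw).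
by rewrite expr1n mulr1 => h1 h2; rewrite /M lerD.
Qed.

(** [BV_norm] allows representatives without support condition. Such a psi vanishes at some point
    left of a_0, so its sup is at most its variation; multiplying by an indicator, of variation 2,
    then costs the factor 3. *)
Let restrict_rep g psi : in_BV a0 b g -> eq_cbl psi g -> finite_var psi -> exists psi',
  [/\ eq_cbl psi' g, bvb (fun x => complex.Re (psi' x)) (3 * fine (var psi)),
    bvb (fun x => complex.Im (psi' x)) (3 * fine (var psi)),
    supp a0 b (fun x => complex.Re (psi' x)) & supp a0 b (fun x => complex.Im (psi' x))].
Proof.
have [k HB] := unimodal_branches Hf Hpsi; have a0b := ltW (br_AB HB).
move=> [_ sg] pg fp; have [hr hi] := finite_var_bvb fp.
pose psi' x := (ind a0 b x)%:C * psi x.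
have [y] := exists_notin_countable pg (ltac:(lra) : a0 - 1 < a0).
rewrite in_itv/= => /andP[_ ya] /contrapT py.
have py0 : psi y = 0.
  rewrite py; apply/eqP; apply/negPn/negP => /sg; rewrite in_itv/= => /andP[h _].
  by move: ya; rewrite ltNge h.
have bi := bvb_ind a0b.
have v0 := bvb_ge0 hr.
have prod p : p y = 0 -> bvb p (fine (var psi)) -> bvb (fun x => ind a0 b x * p x) (3 * fine (var psi)).
  move=> p0 hp; have := bvbM ler01 v0 (fun x => ind_norm a0 b x) (fun x => bvb_sup x p0 hp) bi hp.
  by apply: bvb_le; lra.
exists psi'; split.
- apply: sub_countable pg; apply: subset_card_le => x /= h e; apply: h.
  rewrite /psi' /ind; case: ifP => hx; first by rewrite mul1r.
  rewrite mul0r; apply/esym/eqP/negPn/negP => /sg.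
  by rewrite in_itv/= hx.
- have h0 : complex.Re (psi y) = 0 by rewrite py0.
  by apply: bvb_eq (prod (fun x => complex.Re (psi x)) h0 hr) => x; rewrite Re_rmul.
- have h0 : complex.Im (psi y) = 0 by rewrite py0.
  by apply: bvb_eq (prod (fun x => complex.Im (psi x)) h0 hi) => x; rewrite Im_rmul.
- by move=> x /negbTE hx; rewrite Re_rmul /ind hx mul0r.
- by move=> x /negbTE hx; rewrite Im_rmul /ind hx mul0r.
Qed.

Theorem L1_invertible z : cabs z < 1 -> invertible_on_BV a0 b LC z.
Proof.
move=> z1; have [K K0 HK] := power_bounded_gap; split.
- move=> g gbv; have [v [w [hv hw sv sw]]] := in_BV_bvb gbv.
  have [u [ubv ue _]] := solve K0 HK z1 hv hw sv sw.
  exists u; split=> //; have -> : (fun x => u x - z * LC u x) = g by apply/funext.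
  exact: eq_cbl_refl.
- by move=> g u u' _; exact: resolvent_unique.
(* 6 = 3 + 3 for the real and imaginary parts; the + 1 makes M invertible even when K = 0. *)
pose M := 2 * (K / (1 - cabs z)) * 6 + 1.
have M0 : 0 < M.
  have KK : 0 <= K / (1 - cabs z) by rewrite divr_ge0// subr_ge0 ltW.
  rewrite /M; lra.
exists M => g u gbv ue.
rewrite -lee_pdivrMl//; apply: BV_norm_ge => psi pg.
have [fp|] := boolP (var psi < +oo)%E; last first.
  by rewrite -leNgt leye_eq => /eqP ->; rewrite leey.
rewrite lee_pdivrMl//.
have [psi' [pg' hv hw sv sw]] := restrict_rep gbv pg fp.
have [u' [u'bv u'e u'v]] := solve K0 HK z1 hv hw sv sw.
have uu' : eq_cbl u' u.
  apply: (@resolvent_unique z g) => //; split=> //.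
  by have -> : (fun x => u' x - z * LC u' x) = psi' by apply/funext.
apply: le_trans (BV_norm_le uu') _; apply: le_trans u'v _.
have vfin : var psi \is a fin_num by rewrite ge0_fin_numE// var_ge0.
rewrite -[in leRHS](fineK vfin) -EFinM lee_fin.
have v0 : 0 <= fine (var psi) by rewrite fine_ge0// var_ge0.
rewrite (_ : M * _ = 2 * (K / (1 - cabs z)) * (3 * fine (var psi) + 3 * fine (var psi)) + fine (var psi)).
  by rewrite lerDl.
by rewrite /M; ring.
Qed.

Lemma resolvent_eqP z g g' u : cabs z < 1 -> eq_cbl g g' -> in_BV a0 b g ->
  resolvent_eq a0 b LC z g u -> eq_cbl u (resolvent a0 b LC z g').
Proof.
move=> z1 gg' gbv [ubv ue].
have ug' : resolvent_eq a0 b LC z g' u by split=> //; exact: eq_cbl_trans ue gg'.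
apply: (resolvent_unique z1 ug'); rewrite /resolvent.
by apply: (@xgetPex _ _ [set u | resolvent_eq a0 b LC z g' u]); exists u.
Qed.

End resolvent.

(** * Integrals against a complex test function *)

Section complex_pairing.
Context {R : realType}.
Notation mu := (@lebesgue_measure R).
Implicit Types (u v : R) (p q P : R -> R) (phi : R -> R[i]) (w z : R[i]).

Lemma Re_mul z w : complex.Re (z * w) = complex.Re z * complex.Re w - complex.Im z * complex.Im w.
Proof. by case: z w => ? ? []. Qed.

Lemma Im_mul z w : complex.Im (z * w) = complex.Re z * complex.Im w + complex.Im z * complex.Re w.
Proof. by case: z w => ? ? []. Qed.

Lemma Re_add z w : complex.Re (z + w) = complex.Re z + complex.Re w.
Proof. by case: z w => ? ? []. Qed.

Lemma Im_add z w : complex.Im (z + w) = complex.Im z + complex.Im w.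
Proof. by case: z w => ? ? []. Qed.

Lemma C1_prim u v (F : R -> R) : u < v -> (exists G, Ck_extension 1 `[u, v] F G) ->
  exists P p, [/\ prim_of P p, forall x, u <= x <= v -> P x = F x &
    forall x, u <= x <= v -> p x = derive1 F x].
Proof.
move=> uv [G [GF [U [oU AU [dG cG]]]]].
have inU x : u <= x <= v -> U x by move=> h; apply: AU; rewrite /= in_itv.
have GF' x : u <= x <= v -> G x = F x by move=> h; apply: GF; rewrite /= in_itv.
have d x : u <= x <= v -> is_derive x (1 : R) G (derive1 G x).
  by move=> /inU Ux; have := dG 0%N x isT Ux => /= /derivableP; rewrite derive1E.
have near_itv x : u < x -> x < v -> exists2 r, 0 < r & forall y, `|y - x| < r -> u < y < v.
  move=> ux xv; exists (Num.min (x - u) (v - x)); first by rewrite lt_min !subr_gt0 ux.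
  by move=> y; rewrite lt_min !ltr_distl => /andP[/andP[h1 _] /andP[_ h2]]; apply/andP; split; lra.
have FG x : u < x -> x < v -> derive1 F x = derive1 G x.
  move=> ux xv; have [r r0 H] := near_itv x ux xv.
  have dF : is_derive x (1 : R) F (derive1 G x).
    apply: (is_derive_near r0 _ (d x _)); last by rewrite !ltW.
    by move=> y /H/andP[h1 h2]; rewrite GF'// !ltW.
  by rewrite derive1E; case: dF.
have bounded (h : R -> R) : (forall x, u <= x <= v -> {for x, continuous h}) ->
    exists M, forall x, u <= x <= v -> `|h x| <= M.
  move=> ch; have cN : {within `[u, v], continuous (fun x => `|h x|)}.
    apply: continuous_in_subspaceT => x; rewrite inE/= in_itv/= => xuv.
    by apply: (@continuous_comp _ _ _ h); [exact: ch|exact: norm_continuous].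
  have [x0 _ Hx0] := EVT_max (ltW uv) cN; exists `|h x0| => x xuv.
  by apply: Hx0; rewrite in_itv.
have cG0 x : u <= x <= v -> {for x, continuous G} by move=> /d; exact: is_derive_continuous.
have cG1 x : u <= x <= v -> {for x, continuous (derive1 G)} by move=> /inU; exact: cG.
have [M GM] := bounded G cG0; have [N GN] := bounded (derive1 G) cG1.
(* At u and v the value of [derive1 F] depends on F outside [u, v]: it need not be that of G, but
   two points affect neither boundedness nor countability. *)
pose P x := G (clamp u v x); pose p x := if u <= x <= v then derive1 F x else 0.
have cP x : {for x, continuous P}.
  apply: (clamp_continuous (ltW uv)); apply: continuous_in_subspaceT => y.
  by rewrite inE/= in_itv/= => /cG0.
have off x : ~ [set u; v] x -> (u < x < v) \/ exists2 r, 0 < r & forall y, `|y - x| < r ->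
    ~~ (u <= y <= v) /\ P y = P x.
  move=> /not_orP[/= xu xv]; have [{}xu|ux|//] := ltgtP x u.
    right; exists (u - x); first by rewrite subr_gt0.
    move=> y; rewrite ltr_distl => /andP[_ yu].
    have {}yu : y < u by lra.
    split; first by rewrite negb_and -!ltNge yu.
    by rewrite /P /clamp; congr G; rewrite !(@max_l _ _ u)// ltW.
  have [{}xv|vx|//] := ltgtP x v; first by left.
  right; exists (x - v); first by rewrite subr_gt0.
  move=> y; rewrite ltr_distl => /andP[yv _].
  have {}yv : v < y by lra.
  split; first by rewrite negb_and -!ltNge yv orbT.
  rewrite /P /clamp; congr G; have yuv := lt_trans uv yv; have xuv := lt_trans uv vx.
  by rewrite (max_r (ltW yuv)) (max_r (ltW xuv)) !min_l// ltW.
have cE : countable [set u; v] by apply: countableU; exact: countable1.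
exists P, p; split; last by move=> x h; rewrite /p h.
  split => //.
  - apply: (@bcc_intro _ _ M set0) => // x; first exact/GM/clamp_itv/ltW.
  - apply: (@bcc_intro _ _ (Num.max N (Num.max `|derive1 F u| `|derive1 F v|)) [set u; v]) => //.
      move=> x; rewrite /p; case: ifP => [/andP[]|_]; last by rewrite normr0 !le_max normr_ge0 orbT.
      rewrite le_eqVlt => /predU1P[<-|ux]; first by rewrite !le_max lexx orbT.
      rewrite le_eqVlt => /predU1P[->|xv]; first by rewrite !le_max lexx !orbT.
      by rewrite FG// le_max GN// !ltW.
    move=> x /off[/andP[ux xv]|[r r0 H]]; apply/continuous_epsP => e e0.
      have [|r1 r10 H1] := (continuous_epsP _ _).1 (cG1 x _) e e0; first by rewrite !ltW.
      have [r2 r20 H2] := near_itv x ux xv.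
      exists (Num.min r1 r2) => [|y]; first by rewrite lt_min r10.
      rewrite lt_min => /andP[/H1 h1 /H2/andP[h2 h3]].
      by rewrite /p !ltW//= !FG.
    exists r => // y /H[/negbTE h _]; have [|/negbTE h' _] := H x; first by rewrite subrr normr0.
    by rewrite /p h h' subrr normr0.
  - apply: sub_countable cE; apply: subset_card_le => x /= nd; apply: contrapT => /off[/andP[ux xv]|[r r0 H]]; apply: nd.
      have [r2 r20 H2] := near_itv x ux xv.
      rewrite /p !ltW//= FG//; apply: (is_derive_near r20 _ (d x _)); last by rewrite !ltW.
      by move=> y /H2/andP[h1 h2]; rewrite /P clamp_id// !ltW.
    have [|/negbTE h' _] := H x; first by rewrite subrr normr0.
    rewrite /p h'; apply: (@is_derive_near _ _ (cst (P x)) x 0 r) => //.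
    by move=> y /H[_ ->].
by move=> x h; rewrite /P clamp_id// GF'.
Qed.

Variables (A B : R) (phi : R -> R[i]) (P1 P2 : R -> R).
Hypothesis AB : A <= B.
Hypothesis phiE : forall x, A <= x <= B -> phi x = P1 x +i* P2 x.
Hypothesis b1 : bcc P1.
Hypothesis b2 : bcc P2.

(** The integral of p phi for real p, with phi replaced on [A, B] by P1 + i P2, whose parts are
    bounded on the whole line. *)
Definition pairing p : R[i] :=
  (\int[mu]_(x in `[A, B]) (p x * P1 x)) +i* (\int[mu]_(x in `[A, B]) (p x * P2 x)).

Lemma cintegral_pairing w p : bcc p ->
  cintegral A B (fun x => w * (p x)%:C * phi x) = w * pairing p.
Proof.
move=> bp; apply: complex_ext => /=; rewrite ?Re_mul ?Im_mul /=.
  rewrite -(intZ _ _ _ (bccM bp b1)) -(intZ _ _ _ (bccM bp b2)).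
  rewrite -(intB A B (bccZ _ (bccM bp b1)) (bccZ _ (bccM bp b2))).
  by apply: int_eq => x /phiE ->; rewrite Re_mul Re_mul Im_mul/=; ring.
rewrite -(intZ _ _ _ (bccM bp b1)) -(intZ _ _ _ (bccM bp b2)).
rewrite -(intD A B (bccZ _ (bccM bp b2)) (bccZ _ (bccM bp b1))).
by apply: int_eq => x /phiE ->; rewrite Im_mul Re_mul Im_mul/=; ring.
Qed.

Lemma cintegral_parts (u : R -> R[i]) : bcc (fun x => complex.Re (u x)) ->
  bcc (fun x => complex.Im (u x)) ->
  cintegral A B (fun x => u x * phi x) =
    pairing (fun x => complex.Re (u x)) + (0 +i* 1) * pairing (fun x => complex.Im (u x)).
Proof.
move=> br bi; apply: complex_ext => /=.
  rewrite mul0r mul1r add0r -(intB A B (bccM br b1) (bccM bi b2)).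
  by apply: int_eq => x /phiE ->; rewrite Re_mul.
rewrite mul0r mul1r add0r -(intD A B (bccM br b2) (bccM bi b1)).
by apply: int_eq => x /phiE ->; rewrite Im_mul.
Qed.

Lemma cintegral_eq_cbl (u u' : R -> R[i]) : in_BV A B u -> in_BV A B u' -> eq_cbl u u' ->
  cintegral A B (fun x => u x * phi x) = cintegral A B (fun x => u' x * phi x).
Proof.
move=> /in_BV_bvb[v [w [hv hw _ _]]] /in_BV_bvb[v' [w' [hv' hw' _ _]]] E.
have [br bi br' bi'] := And4 (bvb_bcc hv) (bvb_bcc hw) (bvb_bcc hv') (bvb_bcc hw').
have peq p q : bcc p -> bcc q -> (forall x, u x = u' x -> p x = q x) -> pairing p = pairing q.
  move=> bp bq pq; congr (_ +i* _).
    by apply: (int_eq_countable (bccM bp b1) (bccM bq b1) E) => x _ /contrapT /pq ->.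
  by apply: (int_eq_countable (bccM bp b2) (bccM bq b2) E) => x _ /contrapT /pq ->.
rewrite !cintegral_parts//; congr (_ + _ * _).
  by apply: (peq _ _ br br') => x ->.
by apply: (peq _ _ bi bi') => x ->.
Qed.

Lemma pairing_le p v M1 M2 : bcc p -> (forall x, `|p x| <= v) ->
  (forall x, `|P1 x| <= M1) -> (forall x, `|P2 x| <= M2) ->
  cabs (pairing p) <= v * ((M1 + M2) * (B - A)).
Proof.
move=> bp pv m1 m2; apply: le_trans (cabs_le _) _ => /=.
have key P M : bcc P -> (forall x, `|P x| <= M) ->
    `|\int[mu]_(x in `[A, B]) (p x * P x)| <= v * M * (B - A).
  by move=> bP PM; apply: (int_norm_le AB (bccM bp bP)) => x _; rewrite normrM ler_pM.
rewrite (_ : v * _ = v * M1 * (B - A) + v * M2 * (B - A)); last by ring.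
by apply: lerD; exact: key.
Qed.

Lemma pairing_eq p q (E : set R) : bcc p -> bcc q -> countable E ->
  (forall x, ~ E x -> p x = q x) -> pairing p = pairing q.
Proof.
move=> bp bq cE pq; congr (_ +i* _).
  by apply: (int_eq_countable (bccM bp b1) (bccM bq b1) cE) => x _ /pq ->.
by apply: (int_eq_countable (bccM bp b2) (bccM bq b2) cE) => x _ /pq ->.
Qed.

Lemma pairing_lin (k : R) p q : bcc p -> bcc q ->
  pairing (fun x => k * p x + q x) = k%:C * pairing p + pairing q.
Proof.
move=> bp bq; have key P : bcc P -> \int[mu]_(x in `[A, B]) ((k * p x + q x) * P x) =
    k * \int[mu]_(x in `[A, B]) (p x * P x) + \int[mu]_(x in `[A, B]) (q x * P x).
  move=> bP; rewrite -(intZ k A B (bccM bp bP)) -(intD A B (bccZ k (bccM bp bP)) (bccM bq bP)).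
  by apply: int_eq => x _; rewrite mulrDl mulrA.
by apply: complex_ext => /=; rewrite key//; ring.
Qed.

Lemma cintegral_lin w (u u' : R -> R[i]) : bcc (fun x => complex.Re (u x)) ->
  bcc (fun x => complex.Im (u x)) -> bcc (fun x => complex.Re (u' x)) ->
  bcc (fun x => complex.Im (u' x)) ->
  cintegral A B (fun x => (w * u x + u' x) * phi x) =
    w * cintegral A B (fun x => u x * phi x) + cintegral A B (fun x => u' x * phi x).
Proof.
move=> br bi br' bi'.
have E1 : (fun x => complex.Re (w * u x + u' x)) =
    (fun x => complex.Re w * complex.Re (u x) + (- complex.Im w * complex.Im (u x) + complex.Re (u' x))).
  by apply/funext => x; rewrite Re_add Re_mul; ring.
have E2 : (fun x => complex.Im (w * u x + u' x)) =
    (fun x => complex.Im w * complex.Re (u x) + (complex.Re w * complex.Im (u x) + complex.Im (u' x))).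
  by apply/funext => x; rewrite Im_add Im_mul; ring.
have r2 := bccD (bccZ (- complex.Im w) bi) br'; have i2 := bccD (bccZ (complex.Re w) bi) bi'.
have r1 := bccD (bccZ (complex.Re w) br) r2; have i1 := bccD (bccZ (complex.Im w) br) i2.
rewrite (@cintegral_parts (fun x => w * u x + u' x)); [|by rewrite E1|by rewrite E2].
rewrite E1 E2 (cintegral_parts br bi) (cintegral_parts br' bi') (pairing_lin _ br r2).
rewrite (pairing_lin _ bi br') (pairing_lin _ br i2) (pairing_lin _ bi bi').
move: {E1 E2 r1 r2 i1 i2}w => [wr wi]; move: (pairing _) (pairing _) (pairing _) (pairing _).
by move=> [? ?] [? ?] [? ?] [? ?]; apply: complex_ext => /=; ring.
Qed.

Lemma cintegral_fseries gs gam al C k : (forall n, supp A B (gs n)) ->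
  (forall n, bvb (gs n) (gam n)) -> fdom gam al C k ->
  (exists C', cdom (fun n => al n * pairing (gs n)) C' k) /\
  cintegral A B (fun x => fseries gs al x * phi x) = csum (fun n => al n * pairing (gs n)).
Proof.
move=> sg hg d; have [hr hi] := fseries_bvb sg hg d.
rewrite (cintegral_parts (bvb_bcc hr) (bvb_bcc hi)).
have [r1 i1] := fseries_int sg hg AB d b1; have [r2 i2] := fseries_int sg hg AB d b2.
have [k0 k1 H] := d.
have [M1 M10 m1] := bcc_bound b1; have [M2 M20 m2] := bcc_bound b2.
pose D := (M1 + M2) * (B - A).
have D0 : 0 <= D by apply: mulr_ge0; [exact: addr_ge0|rewrite subr_ge0].
have dp : cdom (fun n => al n * pairing (gs n)) (C * D) k.
  split=> // n; rewrite cabsM; apply: (@le_trans _ _ (cabs (al n) * (gam n * D))).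
    rewrite ler_wpM2l ?cabs_ge0//; apply: pairing_le m1 m2; first exact: bvb_bcc (hg n).
    by move=> x; exact: supp_bvb_sup (sg n) (hg n).
  by rewrite mulrA [leRHS]mulrAC ler_wpM2r.
have dle (x : nat -> R) : (forall n, `|x n| <= cabs (pairing (gs n))) ->
    cdom (fun n => al n * (x n)%:C) (C * D) k.
  move=> hx; apply: (cdom_le dp) => n; rewrite !cabsM cabs_real ler_wpM2l//.
  exact: cabs_ge0.
split; first by exists (C * D).
have d1 := dle _ (fun n => Re_le_cabs (pairing (gs n))).
have d2 := dle _ (fun n => Im_le_cabs (pairing (gs n))).
have -> : (fun n => al n * pairing (gs n)) = (fun n => al n * (complex.Re (pairing (gs n)))%:C +
    (0 +i* 1) * (al n * (complex.Im (pairing (gs n)))%:C)).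
  apply/funext => n; case: (al n) => s t; apply: complex_ext => /=; ring.
rewrite (csumD d1 (cdomZ (0 +i* 1) d2)) (csumZ _ d2).
rewrite /pairing r1 r2 i1 i2; move: (csum _) (csum _) => s1 s2.
by apply: complex_ext; case: s1 s2 => ? ? [? ?] /=; ring.
Qed.

End complex_pairing.

(** * Holomorphy of dominated power series *)

Section holomorphy.
Context {R : realType}.
Implicit Types (u : nat -> R[i]) (z w h : R[i]) (C k s q : R).

(** Uniform bounds on the disc of radius s for the coefficients of a power series, of its derivative
    and of its Taylor remainder; the factors n and n^2 are absorbed by some q between s k and 1. *)
Lemma power_coefs k s : 0 <= k -> 1 <= s -> s * k < 1 -> exists C q,
  [/\ 0 <= C, 0 <= q, q < 1, (forall z, cabs z <= s -> forall n,
    cabs (z ^+ n) * k ^+ n <= C * q ^+ n /\ cabs (n%:R * z ^+ n.-1) * k ^+ n <= C * q ^+ n) &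
  forall z h, h != 0 -> cabs z <= s -> cabs (z + h) <= s -> forall n,
    cabs (pow_rem z h n) * k ^+ n <= cabs h * C * q ^+ n].
Proof.
move=> k0 s1 sk; have s0 : 0 <= s by lra.
have p0 : 0 <= s * k by exact: mulr_ge0.
pose q := (s * k + 1) / 2; have pq : s * k < q by rewrite /q; lra.
have q1 : q < 1 by rewrite /q; lra. have q0 : 0 <= q by lra.
have [C1 C10 H1] := natmul_exp_le p0 pq; have [C2 C20 H2] := natmul2_exp_le p0 pq.
pose C := 1 + C1 + C2; have C1C : C1 <= C by rewrite /C; lra.
have C2C : C2 <= C by rewrite /C; lra. have C0C : 1 <= C by rewrite /C; lra.
have qn n : 0 <= q ^+ n by rewrite exprn_ge0.
have kn n : 0 <= k ^+ n by rewrite exprn_ge0.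
have sn n : 0 <= s ^+ n by rewrite exprn_ge0.
exists C, q; split=> //; first lra.
- move=> z zs n; have zn m : cabs z ^+ m <= s ^+ m by rewrite lerXn2r ?nnegrE ?cabs_ge0.
  split.
    rewrite cabsX; apply: (@le_trans _ _ ((s * k) ^+ n)); first by rewrite exprMn ler_wpM2r.
    apply: (@le_trans _ _ (1 * q ^+ n)); last by rewrite ler_wpM2r.
    by rewrite mul1r lerXn2r ?nnegrE// ltW.
  have -> : (n%:R : R[i]) = (n%:R : R)%:C by rewrite rmorph_nat.
  rewrite cabsM cabsX cabs_real ger0_norm//.
  apply: (@le_trans _ _ (n%:R * (s * k) ^+ n)); last first.
    by apply: le_trans (H1 n) _; rewrite ler_wpM2r.
  rewrite exprMn mulrA ler_wpM2r// ler_wpM2l//; case: n => [|n]; first by rewrite !expr0.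
  by apply: le_trans (zn n) _; rewrite exprS ler_peMl.
move=> z h h0 zs zhs n.
apply: (@le_trans _ _ (cabs h * (n%:R ^+ 2 * s ^+ n) * k ^+ n)).
  by rewrite ler_wpM2r//; exact: pow_rem_le.
rewrite (_ : _ * k ^+ n = cabs h * (n%:R ^+ 2 * (s * k) ^+ n)); last by rewrite exprMn; ring.
rewrite -[leRHS]mulrA; apply: (ler_wpM2l (cabs_ge0 h)); apply: le_trans (H2 n) _.
by rewrite ler_wpM2r.
Qed.

Lemma csum_holomorphic u C k s w : cdom u C k -> 1 <= s -> s * k < 1 -> cabs w < s ->
  holomorphic_at (fun z => csum (fun n => z ^+ n * u n)) w.
Proof.
move=> [k0 k1 uC] s1 sk ws.
have C0 : 0 <= C by have := uC 0%N; rewrite expr0 mulr1; apply: le_trans; exact: cabs_ge0.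
have [K [q [K0 q0 q1 Hz Hr]]] := power_coefs k0 s1 sk.
have dom (al : nat -> R[i]) L : (forall n, cabs (al n) * k ^+ n <= L * q ^+ n) ->
    cdom (fun n => al n * u n) (L * C) q.
  move=> H; split=> // n; rewrite cabsM; apply: (@le_trans _ _ (cabs (al n) * (C * k ^+ n))).
    by rewrite ler_wpM2l ?cabs_ge0.
  by rewrite mulrCA [leRHS]mulrAC mulrC ler_wpM2r.
have dz z (zs : cabs z <= s) := dom (fun n => z ^+ n) K (fun n => (Hz z zs n).1).
have dD := dom (fun n => n%:R * w ^+ n.-1) K (fun n => (Hz w (ltW ws) n).2).
apply: (@derivableC_intro _ _ w (csum (fun n => n%:R * w ^+ n.-1 * u n)) (K * C / (1 - q) * 2) (s - cabs w)).
  by rewrite subr_gt0.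
move=> h h0 hd; have whs : cabs (w + h) <= s by have := cabsD w h; lra.
have dR := dom (pow_rem w h) (cabs h * K) (Hr w h h0 (ltW ws) whs).
have -> : h^-1 * (csum (fun n => (w + h) ^+ n * u n) - csum (fun n => w ^+ n * u n)) -
    csum (fun n => n%:R * w ^+ n.-1 * u n) = csum (fun n => pow_rem w h n * u n).
  have -> : (fun n => pow_rem w h n * u n) = (fun n => h^-1 * ((w + h) ^+ n * u n + -1 * (w ^+ n * u n)) +
      -1 * (n%:R * w ^+ n.-1 * u n)).
    by apply/funext => n; rewrite /pow_rem; ring.
  have d1 := cdomD (dz _ whs) (cdomZ (-1) (dz _ (ltW ws))).
  rewrite (csumD (cdomZ h^-1 d1) (cdomZ (-1) dD)) (csumZ _ d1) (csumZ _ dD).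
  by rewrite (csumD (dz _ whs) (cdomZ (-1) (dz _ (ltW ws)))) (csumZ _ (dz _ (ltW ws))) !mulN1r.
apply: le_trans (csum_le dR) _; rewrite le_eqVlt; apply/orP; left; apply/eqP.
field; rewrite subr_eq0 gt_eqF//.
Qed.

Lemma pole_holomorphic w0 z : z != 1 -> holomorphic_at (fun t => w0 / (1 - t)) z.
Proof.
move=> z1; have n1 : 1 - z != 0 by rewrite subr_eq0 eq_sym.
pose d := cabs (1 - z); have d0 : 0 < d by exact: cabs_gt0.
apply: (@derivableC_intro _ _ z (w0 / (1 - z) ^+ 2) (cabs w0 / d ^+ 2 / (d / 2)) (d / 2)); first by rewrite divr_gt0.
move=> h h0 hd; have dh : d / 2 <= cabs (1 - (z + h)).
  have := cabsD (1 - (z + h)) h; rewrite opprD addrA subrK -/d; lra.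
have n2 : 1 - (z + h) != 0.
  by apply/eqP => e; move: dh; rewrite e -[0]/(0%:C) cabs_real normr0; lra.
have -> : h^-1 * (w0 / (1 - (z + h)) - w0 / (1 - z)) - w0 / (1 - z) ^+ 2 =
    w0 * h * (1 - z) ^- 2 * (1 - (z + h))^-1.
  by field; rewrite n1 h0 n2.
rewrite !cabsM !cabsV cabsX -/d.
have i2 : (cabs (1 - (z + h)))^-1 <= (d / 2)^-1 by rewrite lef_pV2 ?posrE ?divr_gt0// (lt_le_trans _ dh) ?divr_gt0.
rewrite [leRHS](_ : _ = cabs w0 * cabs h * (d ^+ 2)^-1 * (d / 2)^-1); last by ring.
by rewrite ler_wpM2l// !mulr_ge0 ?cabs_ge0// invr_ge0 exprn_ge0// ltW.
Qed.

Lemma holomorphicD (F G : R[i] -> R[i]) z : holomorphic_at F z -> holomorphic_at G z ->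
  holomorphic_at (fun t => F t + G t) z.
Proof. exact: derivableD. Qed.

Lemma cvge0_modulus (N : R[i] -> \bar R) (M d : R) : 0 < d ->
  (forall h, h != 0 -> cabs h < d -> (0 <= N h <= (M * cabs h)%:E)%E) ->
  N h @[h --> (0 : R[i]^o)^'] --> 0%E.
Proof.
move=> d0 H; apply/fine_cvgP; split.
  exists d%:C => /=; first by rewrite ltcR.
  move=> h /=; rewrite sub0r normrN normC_cabs ltcR => hd h0.
  have /andP[n1 n2] := H h h0 hd; rewrite ge0_fin_numE//; apply: le_lt_trans n2 _; exact: ltry.
apply/cvgrPdist_lt => e e0; pose L := `|M| + 1; have L0 : 0 < L by rewrite /L; have := normr_ge0 M; lra.
pose r := Num.min d (e / L); have r0 : 0 < r by rewrite lt_min d0 divr_gt0.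
exists r%:C => /=; first by rewrite ltcR.
move=> h /=; rewrite sub0r normrN normC_cabs ltcR lt_min => /andP[hd he] h0.
have /andP[n1 n2] := H h h0 hd.
have fN : N h \is a fin_num.
  by rewrite ge0_fin_numE//; apply: le_lt_trans n2 _; exact: ltry.
rewrite sub0r normrN ger0_norm ?fine_ge0//.
move: n2; rewrite -(fineK fN) lee_fin => /le_lt_trans; apply.
apply: (@le_lt_trans _ _ (L * cabs h)).
  by rewrite ler_wpM2r ?cabs_ge0// /L; have := ler_norm M; lra.
by rewrite mulrC -ltr_pdivlMr.
Qed.

Lemma cvge0_modulus_lt (N : R[i] -> \bar R) (e : R) : N h @[h --> (0 : R[i]^o)^'] --> 0%E ->
  0 < e -> exists2 d, 0 < d & forall h, h != 0 -> cabs h < d -> (N h < e%:E)%E.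
Proof.
move=> cN e0; have nb : nbhs (0%E : \bar R) [set x | (x < e%:E)%E].
  by apply: open_nbhs_nbhs; split; [exact: open_ereal_lt_ereal|rewrite /= lte_fin].
have [d /= d0 H] := cN _ nb.
have dE : d = (complex.Re d)%:C by apply/esym/RRe_real/gtr0_real.
exists (complex.Re d); first by move: d0; rewrite dE ltcR.
move=> h h0 hd; apply: (H h) => //=; rewrite sub0r normrN normC_cabs.
by rewrite dE ltcR.
Qed.

End holomorphy.

(** * The susceptibility function *)

Section triangular_sums.
Context {R : realType}.
Implicit Types (s t : nat -> R[i]) (z : R[i]).

(** The double sum over i <= j < N, taken along the diagonals n = j - i. *)
Lemma triangular_sum s t z N :
  \sum_(0 <= j < N) t j * (\sum_(0 <= i < j.+1) z ^+ (j - i) * s i) =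
  \sum_(0 <= n < N) z ^+ n * (\sum_(0 <= i < N - n) s i * t (i + n)%N).
Proof.
elim: N => [|N IH]; first by rewrite !big_geq.
rewrite big_nat_recr//= IH [RHS]big_nat_recr//= subSn// subnn big_nat1 add0n.
rewrite [in RHS](eq_big_nat _ _ (F2 := fun n => z ^+ n * (\sum_(0 <= i < N - n) s i * t (i + n)%N)
   + t N * (z ^+ n * s (N - n)%N))); last first.
  move=> n /andP[_ nN]; rewrite subSn; last exact: ltnW.
  rewrite big_nat_recr//= mulrDr subnK; last exact: ltnW.
  by congr (_ + _); ring.
rewrite big_split/= -addrA; congr (_ + _).
rewrite -mulr_sumr (_ : z ^+ N * _ = t N * (z ^+ N * s (N - N)%N)); last first.
  by rewrite subnn; ring.
rewrite -mulrDr; congr (_ * _).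
rewrite -(big_nat_recr N 0 (fun n => z ^+ n * s (N - n)%N))//= big_nat_rev/=.
apply: eq_big_nat => i /andP[_ iN]; rewrite add0n subSS subKn//.
Qed.

(** Truncating the n-th inner sum at N - n costs at most |z|^n k^(N - n), up to a constant, hence
    q^N with q the larger of |z| and k; the resulting N q^N is absorbed by r^N, q < r < 1. *)
Lemma triangular_cvg s t z D k : (forall n, cdom (fun i => s i * t (i + n)%N) D k) ->
  cabs z < 1 -> exists C r, [/\ 0 <= r, r < 1 & forall N,
  cabs (csum (fun n => z ^+ n * csum (fun i => s i * t (i + n)%N)) -
    \sum_(0 <= j < N) t j * (\sum_(0 <= i < j.+1) z ^+ (j - i) * s i)) <= C * r ^+ N].
Proof.
move=> H z1; have [k0 k1 _] := H 0%N.
pose E n := csum (fun i => s i * t (i + n)%N); pose M := D / (1 - k) * 2.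
have EM n : cabs (E n) <= M by exact: csum_le (H n).
have M0 : 0 <= M := le_trans (cabs_ge0 _) (EM 0%N).
have dE : cdom (fun n => z ^+ n * E n) M (cabs z).
  split=> [||n] //; first exact: cabs_ge0.
  by rewrite cabsM cabsX mulrC ler_wpM2r ?exprn_ge0 ?cabs_ge0.
have [_ _ HE] := csumP dE.
pose q := Num.max (cabs z) k; have q0 : 0 <= q by rewrite le_max cabs_ge0.
have q1 : q < 1 by rewrite gt_max z1.
pose r := (q + 1) / 2; have qr : q < r by rewrite /r; lra. have r1 : r < 1 by rewrite /r; lra.
have r0 : 0 <= r by lra.
have [C1 C10 HC1] := natmul_exp_le q0 qr.
have zq N : cabs z ^+ N <= q ^+ N.
  by rewrite lerXn2r ?nnegrE ?cabs_ge0// le_max lexx.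
have kq N : k ^+ N <= q ^+ N by rewrite lerXn2r ?nnegrE// le_max lexx orbT.
have qrN N : q ^+ N <= r ^+ N by rewrite lerXn2r ?nnegrE// ltW.
have MM : 0 <= M / (1 - cabs z) * 2 by rewrite mulr_ge0 ?divr_ge0// subr_ge0 ltW.
exists (M / (1 - cabs z) * 2 + M * C1), r; split=> // N; rewrite triangular_sum.
apply: le_trans (cabs_triangle _ (\sum_(0 <= n < N) z ^+ n * E n) _) _.
rewrite mulrDl; apply: lerD.
  apply: le_trans (HE N) _; rewrite ler_wpM2l//; exact: le_trans (zq N) (qrN N).
rewrite -sumrB; apply: le_trans (cabs_sum _ _ _) _.
apply: (@le_trans _ _ (\sum_(0 <= n < N) M * q ^+ N)); last first.
  rewrite sumr_const_nat subn0 -mulr_natl mulrCA -[leRHS]mulrA; exact: (ler_wpM2l M0 (HC1 N)).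
rewrite big_nat [leRHS]big_nat; apply: ler_sum => n /andP[_ nN].
rewrite -mulrBr cabsM cabsX; have [_ _ Hn] := csumP (H n).
apply: (@le_trans _ _ (q ^+ n * (M * q ^+ (N - n)))).
  apply: ler_pM; rewrite ?exprn_ge0 ?cabs_ge0//.
  by apply: le_trans (Hn (N - n)%N) _; rewrite ler_wpM2l.
by rewrite mulrCA -exprD subnKC// ltnW.
Qed.

End triangular_sums.

(** * The susceptibility function, its pole and its value at 1 *)

Section susceptibility.
Context {R : realType}.
Variables (a b c a0 : R) (f psip psim rho0 X : R -> R) (phi : R -> R[i]).
Hypothesis Hf : unimodal_expanding_mixing a b c f.
Hypothesis Hpsi : inverse_branches a b c f a0 psip psim.
Hypothesis Hrho : acip_density a b c f rho0.
Hypothesis HX : perturbation_field a b f X.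
Hypothesis Hc : not_preperiodic f c.
Variables (P1 p1 P2 p2 : R -> R).
Hypothesis PP1 : prim_of P1 p1.
Hypothesis PP2 : prim_of P2 p2.
Hypothesis phiE : forall x, a0 <= x <= b -> phi x = P1 x +i* P2 x.
Hypothesis dphiE : forall x, a0 <= x <= b -> cderive phi x = p1 x +i* p2 x.
Variables (g : R -> R) (v : R).
Hypothesis sg : supp a b g.
Hypothesis hg : bvb g v.
Hypothesis cg : countable [set x | source c f rho0 X x <> g x].
Hypothesis rhoX_bvb : exists w, bvb (fun x => rho0 x * X x) w.
Notation c1 := (f c).
Notation mu := (@lebesgue_measure R).
Notation wm := (fun x => `|derive1 psim x|).
Notation TL := (transfer c1 psip psim (derive1 psip) wm).
Notation T0 := (transfer0 c f psip psim).
Notation LC := (L1 c f psip psim).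
Notation orbit := (orbit c f).
Notation s := (jump c f rho0).
Hypothesis gid : forall P p, prim_of P p ->
  (fun N => \sum_(0 <= i < N) s i.+1 * X (orbit i) * P (orbit i)) @ \oo -->
    - (\int[mu]_(x in `[a0, b]) (rho0 x * X x * p x)) - \int[mu]_(x in `[a0, b]) (g x * P x).
Implicit Types (z : R[i]) (n i j N : nat).

Let a0a : a0 < a. Proof. exact: ib_a0_lt_a Hpsi. Qed.
Let c1b : c1 < b. Proof. exact: ib_fc_lt_b Hpsi. Qed.
Let a0b : a0 <= b.
Proof. exact: le_trans (ltW (a0_lt_c2 Hf Hpsi)) (ltW (lt_trans (c2_lt_c1 Hf Hpsi) c1b)). Qed.
Let sg0 : supp a0 b g. Proof. exact: suppS (ltW a0a) (lexx b) sg. Qed.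

Let h := fun x => rho0 x * X x.
Let bh : bcc h. Proof. by have [w hw] := rhoX_bvb; exact: bvb_bcc hw. Qed.
Let sh : supp a b h.
Proof.
move=> x hx; rewrite /h (suppS (c2_ge_a Hf) (ltW c1b) (rho_supp_core Hrho)) ?mul0r//.
Qed.
Let bP1 : bcc P1. Proof. by have [] := PP1. Qed.
Let bP2 : bcc P2. Proof. by have [] := PP2. Qed.
Let bp1 : bcc p1. Proof. by have [] := PP1. Qed.
Let bp2 : bcc p2. Proof. by have [] := PP2. Qed.

(** The number s_k X(c_k) for k = i + 1. [An] and [Bn] are the power series coefficients of Psi and
    of the integral of the resolvent against phi. *)
Let sig i : R := s i.+1 * X (orbit i).
Let An n := pairing a0 b p1 p2 (iter n T0 h).
Let Bn n := pairing a0 b P1 P2 (iter n TL g).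

Lemma Psi_termE z n : Psi_term b c f a0 psip psim rho0 X phi z n = z ^+ n * An n.
Proof.
have E m : iter m (L0 c f psip psim) (cplx h) = cplx (iter m T0 h).
  elim: m => // m IH; apply/funext => x; rewrite !iterS IH /L0 /cplx /transfer0.
  by rewrite rmorphB !rmorphM.
rewrite /Psi_term E /cplx.
by rewrite (cintegral_pairing dphiE bp1 bp2 (z ^+ n) (iter_transfer0_bcc Hf Hpsi n bh)).
Qed.

Lemma orb_itv i : a0 <= orbit i <= b.
Proof. by rewrite (orbit_ge Hf Hpsi)/= (le_trans (orbit_le Hf Hpsi i) (ltW c1b)). Qed.

Lemma orbit_terms_dom : exists D k, [/\ 0 <= k, k < 1, (forall i, `|sig i| <= D * k ^+ i) &
  exists D', forall n, cdom (fun i => (sig i)%:C * phi (orbit (i + n))) D' k].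
Proof.
have [C [k [C0 k0 k1 sC]]] := jump_exp Hf Hpsi Hrho Hc.
have [M1 M10 m1] := bcc_bound bP1; have [M2 M20 m2] := bcc_bound bP2.
have sigC i : `|sig i| <= C * k ^+ i.
  rewrite /sig normrM -[leRHS]mulr1; apply: ler_pM => //; exact: pf_bounded HX _.
exists C, k; split=> //; exists (C * (M1 + M2)) => n; split=> // i.
rewrite cabsM cabs_real mulrAC; apply: ler_pM; rewrite ?cabs_ge0//.
by rewrite phiE ?orb_itv//; apply: le_trans (cabs_le _) _ => /=; rewrite lerD.
Qed.

Lemma orbit_sum n : csum (fun i => (sig i)%:C * phi (orbit (i + n))) = - An n - Bn n.
Proof.
have [D [k [k0 k1 _ [D' H]]]] := orbit_terms_dom; have [cR cI _] := csumP (H n).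
have key P p (pr : R[i] -> R) l : prim_of P p ->
    (forall (r : R) x, a0 <= x <= b -> pr (r%:C * phi x) = r * P x) ->
    (fun N => \sum_(0 <= i < N) pr ((sig i)%:C * phi (orbit (i + n)))) @ \oo --> l ->
    l = - (\int[mu]_(x in `[a0, b]) (iter n T0 h x * p x)) - \int[mu]_(x in `[a0, b]) (iter n TL g x * P x).
  move=> PP prE cl; have [q [Pq ->//]] := iter_clamped_map_prim Hf Hpsi n PP.
  have [bP _ _ _] := PP.
  rewrite (iter_transfer_dual Hf Hpsi n (bvb_bcc hg) sg bP).
  suff h2 : (fun N => \sum_(0 <= i < N) pr ((sig i)%:C * phi (orbit (i + n)))) @ \oo -->
    - (\int[mu]_(x in `[a0, b]) (h x * q x)) -
    \int[mu]_(x in `[a0, b]) (g x * P (iter n (clamped_map a b f) x)) by exact: cvg_unique cl h2.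
  have -> : (fun N => \sum_(0 <= i < N) pr ((sig i)%:C * phi (orbit (i + n)))) =
      (fun N => \sum_(0 <= i < N) s i.+1 * X (orbit i) * P (iter n (clamped_map a b f) (orbit i))); last exact: gid Pq.
  apply/funext => N; apply: eq_bigr => i _.
  by rewrite prE ?orb_itv// (iter_clamped_orbit Hf Hpsi).
apply: complex_ext; rewrite raddfB raddfN.
  apply: (key P1 p1 _ _ PP1 _ cR) => r x /phiE ->.
  by rewrite Re_mul/= mul0r subr0.
apply: (key P2 p2 _ _ PP2 _ cI) => r x /phiE ->.
by rewrite Im_mul/= mul0r addr0.
Qed.

Lemma jump_partial z N : \sum_(1 <= j < N.+1) jump_term c f rho0 X phi z j =
  \sum_(0 <= j < N) phi (orbit j) * (\sum_(0 <= i < j.+1) z ^+ (j - i) * (sig i)%:C).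
Proof.
rewrite big_add1/=; apply: eq_bigr => j _; rewrite /jump_term; congr (_ * _).
by rewrite big_add1/=; apply: eq_bigr => i _; rewrite subSS.
Qed.

Lemma source_eq_cbl : eq_cbl (cplx g) (cplx (source c f rho0 X)).
Proof.
apply: sub_countable cg; apply: subset_card_le => x /= h1 h2; apply: h1.
by rewrite /cplx h2.
Qed.

Lemma source_in_BV : in_BV a0 b (cplx g).
Proof.
apply: (in_BV_intro (v := v) (w := 0)) => [//||x hx]; first exact: bvb_cst.
by rewrite /cplx sg0.
Qed.

Lemma resolvent_termE z : cabs z < 1 ->
  (exists C, cdom (fun n => z ^+ n * Bn n) C (cabs z)) /\
  resolvent_term b c f a0 psip psim rho0 X phi z = - csum (fun n => z ^+ n * Bn n).
Proof.
move=> z1; have [K K0 HK] := power_bounded_gap Hf Hpsi.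
have bg n : bvb (iter n TL g) (K * 1 ^+ n * v) := HK n g v sg0 hg.
have z1' : cabs z * 1 < 1 by rewrite mulr1.
have d := fdom_geometric K0 (bvb_ge0 hg) ler01 z1'; rewrite [cabs z * 1]mulr1 in d.
have sgn n := iter_supp Hf Hpsi n sg0.
have [dB E] := cintegral_fseries a0b phiE bP1 bP2 sgn bg d; split=> //.
rewrite /resolvent_term; congr (- _); rewrite -E.
have ubv : in_BV a0 b (neumann c f psip psim g z) := fseries_in_BV sgn bg d.
have ue : resolvent_eq a0 b LC z (cplx g) (neumann c f psip psim g z).
  split=> //; have -> : (fun x => neumann c f psip psim g z x - z * LC (neumann c f psip psim g z) x) = cplx g.
    by apply/funext => x; rewrite (neumann_eq Hf Hpsi x sg0 bg d).
  exact: eq_cbl_refl.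
have uE := resolvent_eqP Hf Hpsi z1 source_eq_cbl source_in_BV ue.
apply/esym/(cintegral_eq_cbl phiE bP1 bP2 ubv _ uE).
have [] // : resolvent_eq a0 b LC z (cplx (source c f rho0 X)) (resolvent a0 b LC z (cplx (source c f rho0 X))).
apply: (@xgetPex _ _ [set u | resolvent_eq a0 b LC z (cplx (source c f rho0 X)) u]).
by exists (neumann c f psip psim g z); split=> //; exact: eq_cbl_trans ue.2 source_eq_cbl.
Qed.

Theorem Psi_identity z : cabs z < 1 ->
  [/\ cvg_series0 (Psi_term b c f a0 psip psim rho0 X phi z),
      cvg_series1 (jump_term c f rho0 X phi z) &
      sum_series0 (Psi_term b c f a0 psip psim rho0 X phi z) =
        - sum_series1 (jump_term c f rho0 X phi z)
        + resolvent_term b c f a0 psip psim rho0 X phi z].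
Proof.
move=> z1; have [D [k [k0 k1 _ [D' H]]]] := orbit_terms_dom.
have [C [r [r0 r1 HT]]] := @triangular_cvg _ (fun i => (sig i)%:C) (fun j => phi (orbit j)) z D' k H z1.
have [[CB dB] EB] := resolvent_termE z1.
pose En n := csum (fun i => (sig i)%:C * phi (orbit (i + n))).
pose M := D' / (1 - k) * 2.
have dE : cdom (fun n => z ^+ n * En n) M (cabs z).
  split=> [||n] //; first exact: cabs_ge0.
  by rewrite cabsM cabsX mulrC ler_wpM2r ?exprn_ge0 ?cabs_ge0//; exact: csum_le (H n).
have cJ : (fun N => \sum_(1 <= j < N.+1) jump_term c f rho0 X phi z j : R[i]^o) @ \oo -->
    (csum (fun n => z ^+ n * En n) : R[i]^o).
  by apply: (cvgC_geometric r0 r1 (C := C)) => N; rewrite jump_partial.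
have AE : (fun n => z ^+ n * An n) = (fun n => - 1 * (z ^+ n * En n) + - 1 * (z ^+ n * Bn n)).
  by apply/funext => n; rewrite /En orbit_sum; ring.
have dA : cdom (fun n => z ^+ n * An n) (cabs (- 1) * M + cabs (- 1) * CB) (cabs z).
  by rewrite AE; exact: (cdomD (cdomZ _ dE) (cdomZ _ dB)).
have [_ _ HA] := csumP dA.
have cA : (fun N => \sum_(0 <= n < N) Psi_term b c f a0 psip psim rho0 X phi z n : R[i]^o) @ \oo -->
    (csum (fun n => z ^+ n * An n) : R[i]^o).
  apply: (cvgC_geometric (cabs_ge0 z) z1) => N.
  by under eq_bigr do rewrite Psi_termE; exact: HA.
split; [by apply/cvg_ex; eexists; exact: cA|by apply/cvg_ex; eexists; exact: cJ|].
rewrite /sum_series0 /sum_series1 (limnC cA) (limnC cJ) EB AE.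
by rewrite (csumD (cdomZ _ dE) (cdomZ _ dB)) (csumZ _ dE) (csumZ _ dB) !mulN1r.
Qed.

Lemma total_jumpE : total_jump c f rho0 X = - \int[mu]_(x in `[a0, b]) g x.
Proof.
have h1 := gid (prim_of_cst 1); apply: (cvg_lim (@Rhausdorff R)).
have E : - (\int[mu]_(x in `[a0, b]) (rho0 x * X x * cst 0 x)) - \int[mu]_(x in `[a0, b]) (g x * cst 1 x) =
    - \int[mu]_(x in `[a0, b]) g x.
  rewrite (_ : \int[mu]_(x in `[a0, b]) (rho0 x * X x * cst 0 x) = 0); last first.
    rewrite (int_eq (q := cst 0)) ?int_cst ?mul0r// => x _; exact: mulr0.
  by rewrite oppr0 add0r; congr (- _); apply: int_eq => x _; exact: mulr1.
rewrite -E; have -> : (fun N => \sum_(1 <= n < N.+1) s n * X (iter n f c)) =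
    (fun N => \sum_(0 <= i < N) s i.+1 * X (orbit i) * cst 1 (orbit i)); last exact: h1.
by apply/funext => N; rewrite big_add1/=; apply: eq_bigr => i _; rewrite /cst mulr1.
Qed.

Let J := total_jump c f rho0 X.
Let I := pairing a0 b P1 P2 rho0.
Let g0 x := J * rho0 x + g x.

Let g0_supp : supp a0 b g0.
Proof. exact: suppD (suppZ _ (rho_supp Hf Hpsi Hrho)) sg0. Qed.

Let g0_bvb : exists v0, bvb g0 v0.
Proof.
have [vr hr] := rho_bvb Hrho; exists (`|J| * vr + v).
exact: bvbD (bvbZ _ hr) hg.
Qed.

Let g0_int : \int[mu]_(x in `[a0, b]) g0 x = 0.
Proof.
have br := rho_bcc Hrho; rewrite (intD a0 b (bccZ J br) (bvb_bcc hg)) (intZ J a0 b br).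
by rewrite (rho_int1 Hf Hpsi Hrho) mulr1 /J total_jumpE addNr.
Qed.

Lemma iter_transfer_rho n : countable [set x | iter n TL rho0 x <> rho0 x].
Proof.
have cplxE (p q : R -> R) : eq_cbl (cplx p) (cplx q) -> countable [set x | p x <> q x].
  by apply: sub_countable; apply: subset_card_le => x /= h1 h2; apply: h1; case: h2.
have eqc (p q : R -> R) : countable [set x | p x <> q x] -> eq_cbl (cplx p) (cplx q).
  by apply: sub_countable; apply: subset_card_le => x /= h1 h2; apply: h1; rewrite /cplx h2.
have LE p : LC (cplx p) = cplx (TL p).
  apply/funext => x; apply: complex_ext; rewrite ?Re_L1 ?Im_L1//= /cplx/=.
  by rewrite /transfer !mulr0 addr0.
elim: n => [|n IH]; first by apply: cplxE; exact: eq_cbl_refl.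
apply: cplxE; rewrite iterS -LE.
apply: (eq_cbl_trans (L1_eq_cbl Hf Hpsi (eqc _ _ IH))); rewrite LE.
exact: eqc (transfer_rho Hf Hpsi Hrho).
Qed.

Let bn n := pairing a0 b P1 P2 (iter n TL g0).

Let Bn_split n : Bn n = - J%:C * I + bn n.
Proof.
have [k HB] := unimodal_branches Hf Hpsi; have [v0 hg0] := g0_bvb; have [vr hr] := rho_bvb Hrho.
have br n' : bcc (iter n' TL rho0) := iter_transfer_bcc HB n' (bvb_bcc hr).
have bg n' : bcc (iter n' TL g) := iter_transfer_bcc HB n' (bvb_bcc hg).
have E : iter n TL g0 = (fun x => J * iter n TL rho0 x + iter n TL g x).
  by rewrite /g0 iter_transferD iter_transferZ.
rewrite /bn E (pairing_lin a0 b bP1 bP2 J (br n) (bg n)).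
rewrite (pairing_eq a0 b bP1 bP2 (br n) (br 0%N) (iter_transfer_rho n)); last first.
  by move=> x /contrapT.
by rewrite mulNr addKr.
Qed.

Lemma geometric_csum (w : R[i]) z : cabs z < 1 ->
  cdom (fun n => z ^+ n * w) (cabs w) (cabs z) /\ csum (fun n => z ^+ n * w) = w / (1 - z).
Proof.
move=> z1; have d : cdom (fun n => z ^+ n * w) (cabs w) (cabs z).
  by split=> [||n] //; [exact: cabs_ge0|rewrite cabsM cabsX mulrC].
split=> //; have n1 : 1 - z != 0.
  rewrite subr_eq0; apply/eqP => e; move: z1; rewrite -e -[1]/(1%:C) cabs_real normr1 ltxx//.
apply: (mulIf n1); rewrite divfK// mulrBr mulr1 [csum _ * z]mulrC -(csumZ z d).
rewrite (csum_shift d) expr0 mul1r.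
have -> : (fun n => z ^+ n.+1 * w) = (fun n => z * (z ^+ n * w)).
  by apply/funext => n; rewrite exprS mulrA.
by rewrite addrK.
Qed.

Theorem resolvent_term_extension : exists (r : R) (F : R[i] -> R[i]),
  [/\ 1 < r,
      forall z : R[i], `|z| < 1 -> F z = resolvent_term b c f a0 psip psim rho0 X phi z,
      forall z : R[i], `|z| < r%:C -> z != 1 -> holomorphic_at F z &
      at_most_simple_pole F 1 (J%:C * cintegral a0 b (fun x => phi x * (rho0 x)%:C))].
Proof.
have [C [th [C0 th0 th1 gap]]] := unimodal_spectral_gap Hf Hpsi.
have [v0 hg0] := g0_bvb.
have hn n := gap _ _ n g0_supp hg0 g0_int.
have [M1 M10 m1] := bcc_bound bP1; have [M2 M20 m2] := bcc_bound bP2.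
have sn n := iter_supp Hf Hpsi n g0_supp.
pose D := C * v0 * ((M1 + M2) * (b - a0)).
have db : cdom bn D th.
  split=> //; first exact: ltW; move=> n.
  have := pairing_le a0b bP1 bP2 (bvb_bcc (hn n)) (fun x => supp_bvb_sup x (sn n) (hn n)) m1 m2.
  by move/le_trans; apply; rewrite /D le_eqVlt; apply/orP; left; apply/eqP; ring.
(* The midpoint of 1 and 1 / th, so that r > 1 and r th < 1. *)
pose r := (1 + th^-1) / 2.
have i1 : 1 < th^-1 by rewrite invf_gt1.
have r1 : 1 < r by rewrite /r; lra.
have rth : r * th < 1.
  rewrite (_ : r * th = (th + 1) / 2); first lra.
  by rewrite /r; field; rewrite gt_eqF.
pose H z := csum (fun n => z ^+ n * (- 1 * bn n)).
have holH z : cabs z < r -> holomorphic_at H z.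
  exact: (csum_holomorphic (cdomZ _ db) (ltW r1) rth).
have IE : cintegral a0 b (fun x => phi x * (rho0 x)%:C) = I.
  have := cintegral_pairing phiE bP1 bP2 1 (rho_bcc Hrho); rewrite mul1r -/I => <-.
  by congr cintegral; apply/funext => x; rewrite mul1r mulrC.
(* The constant part - J I of the coefficients sums to - J I / (1 - z); the minus sign in front of
   the integral gives + J I as coefficient of 1 / (1 - z). *)
rewrite IE; exists r, (fun z => J%:C * I / (1 - z) + H z); split => //.
- move=> z; rewrite normC_cabs -[1]/(1%:C) ltcR => z1.
  have [_ ->] := resolvent_termE z1.
  have [t0 _ bD] := db; have D0 : 0 <= D.
    by have := bD 0%N; rewrite expr0 mulr1; apply: le_trans; exact: cabs_ge0.
  have dz : cdom (fun n => z ^+ n * bn n) D (cabs z).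
    split=> [||n] //; first exact: cabs_ge0.
    rewrite cabsM cabsX mulrC ler_wpM2r ?exprn_ge0 ?cabs_ge0//; apply: le_trans (bD n) _.
    by rewrite ler_piMr// exprn_ile1// ltW.
  have [dg gE] := geometric_csum (- J%:C * I) z1.
  have -> : (fun n => z ^+ n * Bn n) = (fun n => z ^+ n * (- J%:C * I) + z ^+ n * bn n).
    by apply/funext => n; rewrite Bn_split mulrDr.
  rewrite (csumD dg dz) gE opprD mulNr mulNr opprK; congr (_ + _).
  transitivity (- 1 * csum (fun n => z ^+ n * bn n)); last exact: mulN1r.
  by rewrite -(csumZ (- 1) dz) /H; congr csum; apply/funext => n; ring.
- move=> z; rewrite normC_cabs ltcR => zs z1.
  by apply: holomorphicD; [exact: pole_holomorphic|exact: holH].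
- exists H; split; last by near=> z.
  apply: (@nearC_intro _ _ 1 (r - 1)); first by rewrite subr_gt0.
  move=> h0 hh; apply: holH; apply: le_lt_trans (cabsD _ _) _.
  by rewrite -[1]/(1%:C) cabs_real normr1; lra.
Unshelve. all: by end_near. Qed.

Notation cint u := (cintegral a0 b (fun x => u x * phi x)).

Lemma in_BV_lin w u u' : in_BV a0 b u -> in_BV a0 b u' -> in_BV a0 b (fun x => w * u x + u' x).
Proof.
move=> ubv u'bv; have [v1 [w1 [hv1 hw1 _ _]]] := in_BV_bvb ubv.
have [v2 [w2 [hv2 hw2 _ _]]] := in_BV_bvb u'bv.
have z0 (u0 : R -> R[i]) x : in_BV a0 b u0 -> ~~ (a0 <= x <= b) -> u0 x = 0.
  by move=> [_ su]; apply: contraNeq => /su; rewrite in_itv.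
have hr := bvbD (bvbB (bvbZ (complex.Re w) hv1) (bvbZ (complex.Im w) hw1)) hv2.
have hi := bvbD (bvbD (bvbZ (complex.Re w) hw1) (bvbZ (complex.Im w) hv1)) hw2.
apply: (in_BV_intro (bvb_eq _ hr) (bvb_eq _ hi)) => x.
- by rewrite Re_add Re_mul.
- by rewrite Im_add Im_mul.
- by move=> hx; rewrite (z0 u)// (z0 u')// mulr0 addr0.
Qed.

Lemma cint_lin w u u' : in_BV a0 b u -> in_BV a0 b u' ->
  cint (fun x => w * u x + u' x) = w * cint u + cint u'.
Proof.
move=> /in_BV_bvb[v1 [w1 [hv1 hw1 _ _]]] /in_BV_bvb[v2 [w2 [hv2 hw2 _ _]]].
exact: (cintegral_lin phiE bP1 bP2 w (bvb_bcc hv1) (bvb_bcc hw1) (bvb_bcc hv2) (bvb_bcc hw2)).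
Qed.

(** A nearly optimal representative may have a larger support, but it vanishes somewhere to the left
    of a_0, so its sup is below its variation. *)
Lemma cint_BV_norm : exists2 M, 0 <= M & forall u (m : R), in_BV a0 b u ->
  (BV_norm u < m%:E)%E -> cabs (cint u) <= m * M.
Proof.
have [M1 M10 m1] := bcc_bound bP1; have [M2 M20 m2] := bcc_bound bP2.
pose D := (M1 + M2) * (b - a0).
have D0 : 0 <= D by apply: mulr_ge0; [exact: addr_ge0|rewrite subr_ge0].
exists (D + D); first exact: addr_ge0.
move=> u m ubv /ereal_inf_lt[_ [psi pu <-] pm].
have [v1 [w1 [hv1 hw1 su1 su2]]] := in_BV_bvb ubv.
have fp : finite_var psi by apply: lt_trans pm _; exact: ltry.
have vfin : var psi \is a fin_num by rewrite ge0_fin_numE// var_ge0.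
have vm : fine (var psi) <= m by rewrite -lee_fin fineK// ltW.
have [hr hi] := finite_var_bvb fp.
have [y] := exists_notin_countable pu (ltac:(lra) : a0 - 1 < a0).
rewrite in_itv/= => /andP[_ ya] /contrapT py.
have hy : ~~ (a0 <= y <= b) by rewrite negb_and -!ltNge ya.
have r0 : complex.Re (psi y) = 0 by rewrite py su1.
have i0 : complex.Im (psi y) = 0 by rewrite py su2.
rewrite (cintegral_parts phiE bP1 bP2 (bvb_bcc hv1) (bvb_bcc hw1)).
rewrite (pairing_eq a0 b bP1 bP2 (bvb_bcc hv1) (bvb_bcc hr) pu); last by move=> x /contrapT ->.
rewrite (pairing_eq a0 b bP1 bP2 (bvb_bcc hw1) (bvb_bcc hi) pu); last by move=> x /contrapT ->.
apply: le_trans (cabsD _ _) _; rewrite cabsM mulrDr.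
have -> : cabs (0 +i* 1 : R[i]) = 1 by rewrite cabsE/= expr0n expr1n add0r sqrtr1.
rewrite mul1r; apply: lerD.
  apply: (pairing_le a0b bP1 bP2 (bvb_bcc hr) _ m1 m2) => x.
  exact: le_trans (bvb_sup x r0 hr) vm.
apply: (pairing_le a0b bP1 bP2 (bvb_bcc hi) _ m1 m2) => x.
exact: le_trans (bvb_sup x i0 hi) vm.
Qed.

(** U(1 + t) = U(1) + t (q + D), where q is the error of the difference quotient and has norm below
    1 for small t. *)
Lemma cint_holomorphic_cvg r U : 1 < r -> BV_holomorphic a0 b r U ->
  forall e : R, 0 < e -> exists2 d, 0 < d & forall h, h != 0 -> cabs h < d ->
    `|1 + h| < r%:C -> cabs (cint (U (1 + h)) - cint (U 1)) <= e.
Proof.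
move=> r1 hU e e0; have h1 : `|1 : R[i]| < r%:C by rewrite normr1 -[1]/(1%:C) ltcR.
have [U1 [D [Dbv cU]]] := hU 1 h1; have [M M0 HM] := cint_BV_norm.
have [d d0 Hd] := cvge0_modulus_lt cU ltr01.
pose L := M + cabs (cint D) + 1; have L0 : 0 < L by have := cabs_ge0 (cint D); rewrite /L; lra.
exists (Num.min d (e / L)); first by rewrite lt_min d0 divr_gt0.
move=> t t0; rewrite lt_min => /andP[td te] tr; have [U1t _] := hU _ tr.
have zbv : in_BV a0 b (fun=> 0) := @in_BV_intro _ a0 b 0 0 (fun=> 0) (bvb_cst 0) (bvb_cst 0) (fun _ _ => erefl).
pose q x := t^-1 * (U (1 + t) x - U 1 x) - D x.
have qbv : in_BV a0 b q.
  have := in_BV_lin (- 1) Dbv (in_BV_lin t^-1 U1t (in_BV_lin (- t^-1) U1 zbv)).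
  by congr (in_BV _ _ _); apply/funext => x; rewrite /q; ring.
have UE : U (1 + t) = (fun x => t * (1 * q x + D x) + U 1 x).
  by apply/funext => x; rewrite /q mul1r subrK mulrA mulfV// mul1r subrK.
rewrite UE (cint_lin t (in_BV_lin 1 qbv Dbv) U1) addrK (cint_lin 1 qbv Dbv) mul1r cabsM.
have qM := HM q 1 qbv (Hd t t0 td); rewrite mul1r in qM.
apply: (@le_trans _ _ (cabs t * L)).
  rewrite ler_wpM2l ?cabs_ge0//; apply: le_trans (cabsD _ _) _.
  by rewrite /L -addrA; apply: lerD => //; rewrite lerDl.
by rewrite -ler_pdivlMr// ltW.
Qed.

(** At z = 1 the inner sums are the partial sums of J = 0, hence opposite to tails, and decay
    geometrically while phi stays bounded along the orbit. *)
Lemma jump_series_cvg : J = 0 -> cvg_series1 (jump_term c f rho0 X phi 1).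
Proof.
move=> J0; have [D [k [k0 k1 sigD _]]] := orbit_terms_dom.
have [M1 M10 m1] := bcc_bound bP1; have [M2 M20 m2] := bcc_bound bP2.
have [l [cl Hl]] := dominated_series k0 k1 sigD.
have l0 : l = 0.
  rewrite -J0 /J; apply/esym/(cvg_lim (@Rhausdorff R)).
  have -> : (fun N => \sum_(1 <= n < N.+1) s n * X (iter n f c)) =
      (fun N => \sum_(0 <= i < N) sig i); last exact: cl.
  by apply/funext => N; rewrite big_add1.
pose tm j := phi (orbit j) * (\sum_(0 <= i < j.+1) 1 ^+ (j - i) * (sig i)%:C).
have dt : cdom tm ((M1 + M2) * (D / (1 - k))) k.
  split=> // j; have D0 : 0 <= D by have := sigD 0%N; rewrite expr0 mulr1; exact: le_trans.
  have D1 : 0 <= D / (1 - k) by rewrite divr_ge0// subr_ge0 ltW.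
  rewrite /tm cabsM -mulrA; apply: ler_pM; rewrite ?cabs_ge0//.
    by rewrite phiE ?orb_itv//; apply: le_trans (cabs_le _) _ => /=; rewrite lerD.
  have -> : \sum_(0 <= i < j.+1) 1 ^+ (j - i) * (sig i)%:C = (\sum_(0 <= i < j.+1) sig i)%:C :> R[i].
    by rewrite rmorph_sum/=; apply: eq_bigr => i _; rewrite expr1n mul1r.
  rewrite cabs_real; have := Hl j.+1; rewrite l0 sub0r normrN => /le_trans; apply.
  rewrite mulrAC ler_wpM2l// exprS ler_piMl ?exprn_ge0// ltW//.
have [_ _ Ht] := csumP dt; apply/cvg_ex; exists (csum tm : R[i]^o).
apply: (cvgC_geometric k0 k1 (C := (M1 + M2) * (D / (1 - k)) / (1 - k) * 2)) => N.
by rewrite jump_partial; exact: Ht.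
Qed.

(* Two extensions of the resolvent agree at real t < 1, hence, being continuous
   in the norm of BV, they have the same pairing with phi at 1. *)
Theorem Psi1_well_defined : J = 0 -> exists! w : R[i], is_Psi1 b c f a0 psip psim rho0 X phi w.
Proof.
move=> J0; have gint : \int[mu]_(x in `[a0, b]) g x = 0.
  by apply/eqP; rewrite -oppr_eq0 -total_jumpE -/J J0.
have [C [th [C0 th0 th1 gap]]] := unimodal_spectral_gap Hf Hpsi.
have gn n : bvb (iter n TL g) (C * th ^+ n * v) := gap _ _ n sg0 hg gint.
have sn n := iter_supp Hf Hpsi n sg0.
have v0 := bvb_ge0 hg.
pose r := (1 + th^-1) / 2.
have i1 : 1 < th^-1 by rewrite invf_gt1.
have r1 : 1 < r by rewrite /r; lra.
have rth : r * th < 1.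
  rewrite (_ : r * th = (th + 1) / 2); first lra.
  by rewrite /r; field; rewrite gt_eqF.
pose U z := neumann c f psip psim g z.
have [K [q [K0 q0 q1 Hz Hr]]] := power_coefs (ltW th0) (ltW r1) rth.
have dom (al : nat -> R[i]) L : (forall n, cabs (al n) * th ^+ n <= L * q ^+ n) ->
    fdom (fun n => C * th ^+ n * v) al (L * (C * v)) q.
  move=> H; split=> // n; rewrite (_ : cabs _ * _ = cabs (al n) * th ^+ n * (C * v)); last by ring.
  by rewrite [leRHS]mulrAC ler_wpM2r// mulr_ge0.
have Ubv z : cabs z <= r -> in_BV a0 b (U z).
  by move=> zr; apply: (fseries_in_BV sn gn (dom _ K _)) => n; have [] := Hz z zr n.
have Uhol : BV_holomorphic a0 b r U.
  move=> z; rewrite normC_cabs ltcR => zr; split; first exact/Ubv/ltW.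
  have dD := dom (fun n => n%:R * z ^+ n.-1) K (fun n => (Hz z (ltW zr) n).2).
  exists (fseries (fun n => iter n TL g) (fun n => n%:R * z ^+ n.-1)); split.
    exact: (fseries_in_BV sn gn dD).
  apply: (@cvge0_modulus _ _ (2 * (K * (C * v) / (1 - q))) (r - cabs z)); first by rewrite subr_gt0.
  move=> t t0 tr; apply/andP; split.
    by apply: BV_norm_ge => w _; exact: var_ge0.
  have ztr : cabs (z + t) <= r by have := cabsD z t; lra.
  have dz := dom (fun n => z ^+ n) K (fun n => (Hz z (ltW zr) n).1).
  have dzt := dom (fun n => (z + t) ^+ n) K (fun n => (Hz (z + t) ztr n).1).
  have dR := dom (pow_rem z t) (cabs t * K) (Hr z t t0 (ltW zr) ztr).
  have RE : fseries (fun n => iter n TL g) (pow_rem z t) = (fun x =>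
      t^-1 * (U (z + t) x - U z x) - fseries (fun n => iter n TL g) (fun n => n%:R * z ^+ n.-1) x).
    apply/funext => x.
    have -> : pow_rem z t = (fun n => t^-1 * ((z + t) ^+ n + - 1 * z ^+ n) + - 1 * (n%:R * z ^+ n.-1)).
      by apply/funext => n; rewrite /pow_rem; ring.
    have d1 := fdomD gn dzt (fdomZ (- 1) dz).
    rewrite (fseriesD sn gn x (fdomZ t^-1 d1) (fdomZ (- 1) dD)) (fseriesZ sn gn _ x d1) (fseriesZ sn gn _ x dD).
    by rewrite (fseriesD sn gn x dzt (fdomZ (- 1) dz)) (fseriesZ sn gn _ x dz) !mulN1r.
  rewrite -RE; apply: le_trans (BV_norm_le (eq_cbl_refl _)) _.
  apply: le_trans (fseries_var sn gn dR) _; rewrite lee_fin le_eqVlt; apply/orP; left; apply/eqP.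
  by field; rewrite subr_eq0 gt_eqF.
have Ures z : `|z| < 1 -> eq_cbl (U z) (resolvent a0 b LC z (cplx (source c f rho0 X))).
  rewrite normC_cabs -[1]/(1%:C) ltcR => z1.
  have zr : cabs z <= r by lra.
  have dz := dom (fun n => z ^+ n) K (fun n => (Hz z zr n).1).
  apply: (resolvent_eqP Hf Hpsi z1 source_eq_cbl source_in_BV); split; first exact: Ubv.
  have -> : (fun x => U z x - z * LC (U z) x) = cplx g.
    by apply/funext => x; rewrite (neumann_eq Hf Hpsi x sg0 gn dz).
  exact: eq_cbl_refl.
have U1bv : in_BV a0 b (U 1) by apply: Ubv; rewrite -[1]/(1%:C) cabs_real normr1 ltW.
have cJ := jump_series_cvg J0.
exists (- sum_series1 (jump_term c f rho0 X phi 1) - cint (U 1)); split.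
  split=> //; exists (U 1); split=> //; exists r, U; split=> //; split=> //; exact: eq_cbl_refl.
move=> w [_ [u' [[r' [U' [r'1 U'hol U'res [u'bv u'E]]]] ->]]].
have h1 : `|1 : R[i]| < r'%:C by rewrite normr1 -[1]/(1%:C) ltcR.
have [U'1bv _] := U'hol 1 h1.
rewrite (cintegral_eq_cbl phiE bP1 bP2 u'bv U'1bv u'E); congr (_ - _).
apply/eqP; rewrite -subr_eq0; apply/eqP; apply: cabs_small_eq0 => e e0.
have e2 : 0 < e / 2 by lra.
have [d d0 Hd] := cint_holomorphic_cvg r1 Uhol e2.
have [d' d'0 Hd'] := cint_holomorphic_cvg r'1 U'hol e2.
(* The two extensions are compared at 1 - m: it is close enough to 1 for both continuity estimates,
   and m <= 1/2 keeps it in the unit disc, where both are the resolvent. *)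
pose m := Num.min (1 / 2) (Num.min (d / 2) (d' / 2)).
have m0 : 0 < m by rewrite !lt_min !divr_gt0.
have md : m < d.
  by apply: (@le_lt_trans _ _ (d / 2)); [rewrite !ge_min lexx orbT|lra].
have md' : m < d'.
  by apply: (@le_lt_trans _ _ (d' / 2)); [rewrite !ge_min lexx !orbT|lra].
have m2 : m <= 1 / 2 by rewrite ge_min lexx.
pose t : R[i] := (- m)%:C.
have t0 : t != 0.
  by apply/eqP => /(congr1 (@complex.Re R))/= /eqP; rewrite oppr_eq0 gt_eqF.
have ct : cabs t = m by rewrite cabs_real normrN gtr0_norm.
have c1t : cabs (1 + t) < 1.
  by rewrite -[1]/(1%:C) /t -rmorphD cabs_real ger0_norm; lra.
have n1t : `|1 + t| < 1 by rewrite normC_cabs -[X in _ < X]/(1%:C) ltcR.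
have ltr (s : R) : 1 < s -> `|1 + t| < s%:C by move=> s1; rewrite normC_cabs ltcR; exact: lt_trans c1t s1.
have E : cint (U (1 + t)) = cint (U' (1 + t)).
  have [U't _] := U'hol _ (ltr _ r'1); have [Ut _] := Uhol _ (ltr _ r1).
  apply: (cintegral_eq_cbl phiE bP1 bP2 Ut U't).
  exact: eq_cbl_trans (Ures _ n1t) (eq_cbl_sym (U'res _ n1t)).
have h2 := Hd t t0 ltac:(by rewrite ct) (ltr _ r1).
have h3 := Hd' t t0 ltac:(by rewrite ct) (ltr _ r'1).
apply: le_trans (cabs_triangle _ (cint (U (1 + t))) _) _.
by rewrite cabsB_sym; move: h2 h3; rewrite -E cabsB_sym; lra.
Qed.

End susceptibility.

Theorem proposition4p4 (R : realType) (a b c a0 : R)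
  (f psip psim rho0 X : R -> R) (phi : R -> R[i])
  (Hf : unimodal_expanding_mixing a b c f)
  (Hpsi : inverse_branches a b c f a0 psip psim)
  (Hrho : acip_density a b c f rho0)
  (HX : perturbation_field a b f X)
  (Hc : not_preperiodic f c)
  (Hphi : C1_on a0 b phi) :
  [/\ forall z : R[i], `|z| < 1 ->
        [/\ invertible_on_BV a0 b (L1 c f psip psim) z,
            exists g, in_BV a0 b g /\ eq_cbl g (cplx (source c f rho0 X)),
            cvg_series0 (Psi_term b c f a0 psip psim rho0 X phi z),
            cvg_series1 (jump_term c f rho0 X phi z) &
            sum_series0 (Psi_term b c f a0 psip psim rho0 X phi z) =
              - sum_series1 (jump_term c f rho0 X phi z)
              + resolvent_term b c f a0 psip psim rho0 X phi z],
      exists (r : R) (F : R[i] -> R[i]),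
        [/\ 1 < r,
            forall z : R[i], `|z| < 1 ->
              F z = resolvent_term b c f a0 psip psim rho0 X phi z,
            forall z : R[i], `|z| < r%:C -> z != 1 -> holomorphic_at F z &
            at_most_simple_pole F 1
              ((total_jump c f rho0 X)%:C *
               cintegral a0 b (fun x => phi x * (rho0 x)%:C))] &
      total_jump c f rho0 X = 0 ->
        exists! w : R[i], is_Psi1 b c f a0 psip psim rho0 X phi w].
Proof.
have [g [v [sg hg cg hbv gid]]] := source_identity Hf Hpsi Hrho HX Hc.
have a0b : a0 < b.
  by apply: lt_trans (ib_a0_lt_a Hpsi) _; apply: lt_trans (uem_a_lt_c Hf) (uem_c_lt_b Hf).
have [hr hi] := Hphi.
have [P1 [p1 [PP1 P1E p1E]]] := C1_prim a0b hr.
have [P2 [p2 [PP2 P2E p2E]]] := C1_prim a0b hi.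
have phiE x : a0 <= x <= b -> phi x = P1 x +i* P2 x.
  by move=> xab; rewrite P1E// P2E//; case: (phi x).
have dphiE x : a0 <= x <= b -> cderive phi x = p1 x +i* p2 x.
  by move=> xab; rewrite p1E// p2E.
split.
- move=> z; rewrite normC_cabs -[1]/(1%:C) ltcR => z1.
  have [h1 h2 h3] := Psi_identity Hf Hpsi Hrho HX Hc PP1 PP2 phiE dphiE sg hg cg hbv gid z1.
  split=> //; first exact: (L1_invertible Hf Hpsi z1).
  exists (cplx g); split; [exact: (source_in_BV Hpsi sg hg)|exact: (source_eq_cbl cg)].
- exact: (resolvent_term_extension Hf Hpsi Hrho PP1 PP2 phiE sg hg cg gid).
- exact: (Psi1_well_defined Hf Hpsi Hrho HX Hc PP1 PP2 phiE sg hg cg gid).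
Qed.
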